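(* Let $T$, $d$, $m$, $\mu$, $\sigma$, $(W^{l,k})$, $(\xi^{l,k})$, the solution process $X$ and the interpolated tamed Euler approximations $\bar Y^{N,l,k}$ be as described in the context. Let $c\in[0,\infty)$ and let $f\colon C([0,T],\mathbb R^d)\to\mathbb R$ be a function satisfying $$|f(v)-f(w)|\le c\,\bigl(1+\|v\|^c_{C([0,T],\mathbb R^d)}+\|w\|^c_{C([0,T],\mathbb R^d)}\bigr)\,\|v-w\|_{C([0,T],\mathbb R^d)}$$ for all $v,w\in C([0,T],\mathbb R^d)$. Then there exists a family $C_p\in[0,\infty)$, $p\in[1,\infty)$, of real numbers such that $$\left(\mathbb E\left[\left|\mathbb E[f(X)]-\frac1N\sum_{k=1}^{N}f(\bar Y^{1,0,k})-\sum_{l=1}^{\log_2(N)}\frac{2^l}{N}\left(\sum_{k=1}^{N/2^l}f(\bar Y^{2^l,l,k})-f(\bar Y^{2^{(l-1)},l,k})\right)\right|^p\right]\right)^{1/p}\le C_p\cdot\frac{(1+\log_2(N))^{3/2}}{\sqrt N}$$ for all $N\in\{2^1,2^2,2^3,\dots\}$ and all $p\in[1,\infty)$. In particular, there are finite $\mathcal F/\mathcal B([0,\infty))$-measurable mappings $\tilde C_\varepsilon\colon\Omega\to[0,\infty)$, $\varepsilon\in(0,\frac12)$, such that $$\left|\mathbb E[f(X)]-\frac1N\sum_{k=1}^{N}f(\bar Y^{1,0,k})-\sum_{l=1}^{\log_2(N)}\frac{2^l}{N}\left(\sum_{k=1}^{N/2^l}f(\bar Y^{2^l,l,k})-f(\bar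 Y^{2^{(l-1)},l,k})\right)\right|\le\frac{\tilde C_\varepsilon}{N^{(\frac12-\varepsilon)}}$$ for all $N\in\{2^1,2^2,2^3,\dots\}$ and all $\varepsilon\in(0,\frac12)$ $\mathbb P$-almost surely.
   Context: $\mathbb N=\{1,2,\dots\}$, $\mathbb N_0=\{0,1,2,\dots\}$; $\|\cdot\|_{\mathbb R^n}$ is the Euclidean norm, $\langle\cdot,\cdot\rangle_{\mathbb R^n}$ the Euclidean scalar product; $\|v\|_{C([0,T],\mathbb R^d)}=\sup_{t\in[0,T]}\|v(t)\|_{\mathbb R^d}$; $L(\mathbb R^m,\mathbb R^d)$ carries the operator norm and $L(\mathbb R^d)=L(\mathbb R^d,\mathbb R^d)$. The inner sums $\sum_{k=1}^{N/2^l}f(\cdot)-f(\cdot)$ sum the differences. Setting. Let $T\in(0,\infty)$, let $(\Omega,\mathcal F,\mathbb P)$ be a probability space with a normal filtration $(\mathcal F_t)_{t\in[0,T]}$, let $d,m\in\mathbb N$, let $W^{l,k}\colon[0,T]\times\Omega\to\mathbb R^m$, $l\in\mathbb N_0$, $k\in\mathbb N$, be a family of independent standard $(\mathcal F_t)_{t\in[0,T]}$-Brownian motions and let $\xi^{l,k}\colon\Omega\to\mathbb R^d$, $l\in\mathbb N_0$, $k\in\mathbb N$, be a family of independent identically distributed $\mathcal F_0/\mathcal B(\mathbb R^d)$-measurable mappings with $\mathbb E[\|\xi^{0,1}\|^p_{\mathbb R^d}]<\infty$ for all $p\in[1,\infty)$. Let $\mu\colon\mathbb R^d\to\mathbb R^d$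 be continuously differentiable and $\sigma\colon\mathbb R^d\to\mathbb R^{d\times m}$ be such that there exists a real number $c_0\in[0,\infty)$ with $\langle x-y,\mu(x)-\mu(y)\rangle_{\mathbb R^d}\le c_0\|x-y\|^2_{\mathbb R^d}$, $\|\mu'(x)\|_{L(\mathbb R^d)}\le c_0(1+\|x\|^{c_0}_{\mathbb R^d})$ and $\|\sigma(x)-\sigma(y)\|_{L(\mathbb R^m,\mathbb R^d)}\le c_0\|x-y\|_{\mathbb R^d}$ for all $x,y\in\mathbb R^d$. Let $X\colon[0,T]\times\Omega\to\mathbb R^d$ be the up to indistinguishability unique adapted stochastic process with continuous sample paths satisfying $X_t=\xi^{0,1}+\int_0^t\mu(X_s)\,ds+\int_0^t\sigma(X_s)\,dW^{0,1}_s$ $\mathbb P$-almost surely for all $t\in[0,T]$. Tamed Euler approximations. $Y^{N,l,k}_n\colon\Omega\to\mathbb R^d$, $n\in\{0,\dots,N\}$, $N\in\mathbb N$, $l\in\mathbb N_0$, $k\in\mathbb N$, are given by $Y^{N,l,k}_0:=\xi^{l,k}$ and $$Y^{N,l,k}_{n+1}:=Y^{N,l,k}_n+\frac{\mu(Y^{N,l,k}_n)\cdot\frac TN}{1+\|\mu(Y^{N,l,k}_n)\cdot\frac TN\|_{\mathbb R^d}}+\sigma(Y^{N,l,k}_n)\bigl(W^{l,k}_{(n+1)T/N}-W^{l,k}_{nT/N}\bigr).$$ Their piecewise linear interpolations $\bar Y^{N,l,k}\colon[0,T]\times\Omega\to\mathbb R^d$ are $\bar Y^{N,l,k}_t:=\bigl(\frac{tN}{T}-n\bigr)Y^{N,l,k}_{n+1}+\bigl(n+1-\frac{tN}{T}\bigr)Y^{N,l,k}_n$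 for $t\in[\frac{nT}{N},\frac{(n+1)T}{N}]$, $n\in\{0,\dots,N-1\}$. *)

(* Defs.v *)
From HB Require Import structures.
From mathcomp Require Import all_boot all_order all_algebra.
From mathcomp Require Import finmap.
From mathcomp Require Import all_classical all_reals all_analysis.

Set Implicit Arguments.
Unset Strict Implicit.
Unset Printing Implicit Defensive.
Import Order.TTheory GRing.Theory Num.Theory.
Import numFieldNormedType.Exports.
Local Open Scope classical_set_scope.
Local Open Scope ring_scope.

(** * Norms *)

(* Vectors of R^n are columns 'cV[R]_n.  The library norm `|.| on matrices is
   the maximum norm; [enorm] is the Euclidean norm on 'cV[R]_n, and the
   Hilbert-Schmidt norm on 'M[R]_(n, k). *)
Definition enorm {R : realType} {n k : nat} (A : 'M[R]_(n, k)) : R :=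
  Num.sqrt (\sum_i \sum_j A i j ^+ 2).

Definition dotp {R : realType} {n : nat} (x y : 'cV[R]_n) : R :=
  \sum_i x i 0 * y i 0.

(* Operator norm with respect to Euclidean norms, meant for linear A. *)
Definition opnorm {R : realType} {n k : nat} (A : 'cV[R]_n -> 'cV[R]_k) : R :=
  sup [set enorm (A v) | v in [set v | enorm v <= 1]].

(* C([0,T], R^n) is represented by the functions v : R -> 'cV[R]_n such that
   {within `[0, T], continuous v}.  A functional on C([0,T], R^n) is a function
   f of such v; a bound on |f v - f w| by a multiple of [supnorm T (v - w)]
   forces f v to depend only on the restriction of v to [0,T]. *)
Definition supnorm {R : realType} {n : nat} (T : R) (v : R -> 'cV[R]_n) : R :=
  sup [set enorm (v t) | t in `[0, T]].

Definition cont_differentiable {R : realType} {n k : nat}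
    (g : 'cV[R]_n -> 'cV[R]_k) : Prop :=
  (forall x, differentiable g x) /\
  (forall x, opnorm (fun v => 'd g y v - 'd g x v) @[y --> x] --> (0 : R)).

(** * Measurability, independence, filtrations *)

Definition borel_sets {V : topologicalType} : set (set V) := <<s open >>.

Definition preimage_sigma {Omega : Type} {V : topologicalType}
    (Y : Omega -> V) : set (set Omega) :=
  [set Y @^-1` B | B in borel_sets].

(* G/Borel-measurability for a sigma-algebra G on Omega. *)
Definition borel_measurable {Omega : Type} {V : topologicalType}
    (G : set (set Omega)) (Y : Omega -> V) : Prop :=
  preimage_sigma Y `<=` G.

Definition process_sigma {R : realType} {Omega : Type} {V : topologicalType}
    (T : R) (Y : R -> Omega -> V) : set (set Omega) :=
  <<s \bigcup_(t in `[0, T]) preimage_sigma (Y t) >>.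

Definition independent_family {R : realType} {disp : measure_display}
    {Omega : measurableType disp} (P : probability Omega R)
    {I : choiceType} (J : set I) (G : I -> set (set Omega)) : Prop :=
  forall (K : {fset I}) (A : I -> set Omega),
    [set` K] `<=` J -> (forall i, i \in K -> G i (A i)) ->
    P (\bigcap_(i in [set` K]) A i) = (\prod_(i <- K) P (A i))%E.

Definition independent_pair {R : realType} {disp : measure_display}
    {Omega : measurableType disp} (P : probability Omega R)
    (G H : set (set Omega)) : Prop :=
  forall A B, G A -> H B -> P (A `&` B) = (P A * P B)%E.

Definition normal_filtration {R : realType} {disp : measure_display}
    {Omega : measurableType disp} (P : probability Omega R)
    (T : R) (F : R -> set (set Omega)) : Prop :=
  [/\ forall t, 0 <= t <= T ->
        sigma_algebra setT (F t) /\ F t `<=` measurable,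
      forall s t, 0 <= s -> s <= t -> t <= T -> F s `<=` F t,
      forall A, measurable A -> P A = 0%E -> F 0 A
    & forall t, 0 <= t < T -> F t = \bigcap_(s in `]t, T]) F s].

Definition adapted {R : realType} {Omega : Type} {V : topologicalType}
    (T : R) (F : R -> set (set Omega)) (Y : R -> Omega -> V) : Prop :=
  forall t, 0 <= t <= T -> borel_measurable (F t) (Y t).

(** * Brownian motion *)

(* [normal_prob] takes the standard deviation as its second argument; the last
   clause says that the increment has law N(0, (t - s) I_m). *)
Definition standard_brownian {R : realType} {disp : measure_display}
    {Omega : measurableType disp} (P : probability Omega R)
    (T : R) (F : R -> set (set Omega)) {m : nat}
    (W : R -> Omega -> 'cV[R]_m) : Prop :=
  [/\ adapted T F W,
      \forall w \ae P, W 0 w = 0,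
      \forall w \ae P, {within `[0, T], continuous (W ^~ w)},
      forall s t, 0 <= s -> s < t -> t <= T ->
        independent_pair P (preimage_sigma (fun w => W t w - W s w)) (F s)
    & forall s t, 0 <= s -> s < t -> t <= T ->
        forall B : 'I_m -> set R, (forall i, measurable (B i)) ->
          P [set w | forall i, B i ((W t w - W s w) i 0)] =
          (\prod_(i < m) normal_prob 0 (Num.sqrt (t - s)) (B i))%E].

(** * Ito integral *)

(* The elementary process
     sum_(j < size) val_j 1_(time_j, time_(j+1)]
   with values in the d x m matrices. *)
Record elementary (R : realType) (Omega : Type) (d m : nat) := Elementary {
  elem_size : nat ;
  elem_time : nat -> R ;
  elem_val : nat -> Omega -> 'M[R]_(d, m) }.

Definition elementary_adapted {R : realType} {Omega : Type} {d m : nat}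
    (T : R) (F : R -> set (set Omega)) (H : elementary R Omega d m) : Prop :=
  [/\ 0 <= elem_time H 0 /\ elem_time H (elem_size H) <= T,
      forall j, (j < elem_size H)%N -> elem_time H j <= elem_time H j.+1,
      forall j, (j < elem_size H)%N ->
        borel_measurable (F (elem_time H j)) (elem_val H j)
    & exists M, forall j w, (j < elem_size H)%N -> enorm (elem_val H j w) <= M].

Definition elementary_process {R : realType} {Omega : Type} {d m : nat}
    (H : elementary R Omega d m) (s : R) (w : Omega) : 'M[R]_(d, m) :=
  \sum_(j < elem_size H)
    \1_(`]elem_time H j, elem_time H j.+1]) s *: elem_val H j w.

Definition elementary_integral {R : realType} {Omega : Type} {d m : nat}
    (W : R -> Omega -> 'cV[R]_m) (H : elementary R Omega d m)
    (t : R) (w : Omega) : 'cV[R]_d :=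
  \sum_(j < elem_size H)
    elem_val H j w *m (W (Num.min (elem_time H j.+1) t) w
                       - W (Num.min (elem_time H j) t) w).

(* [is_ito_integral P T F W H t I] : the random variable I is a version of
   int_0^t H_s dW_s, i.e. a limit in probability of integrals of adapted
   elementary processes H_n with int_0^T |H_n - H|^2 ds -> 0 in probability. *)
Definition is_ito_integral {R : realType} {disp : measure_display}
    {Omega : measurableType disp} (P : probability Omega R)
    (T : R) (F : R -> set (set Omega)) {d m : nat}
    (W : R -> Omega -> 'cV[R]_m) (H : R -> Omega -> 'M[R]_(d, m))
    (t : R) (I : Omega -> 'cV[R]_d) : Prop :=
  borel_measurable measurable I /\
  exists Hn : nat -> elementary R Omega d m,
    [/\ forall n, elementary_adapted T F (Hn n),
        forall e : R, 0 < e ->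
          P [set w | (e%:E <= \int[lebesgue_measure]_(s in `[0%R, T])
             (enorm (elementary_process (Hn n) s w - H s w) ^+ 2)%:E)%E]
          @[n --> \oo] --> 0%E
      & forall e : R, 0 < e ->
          P [set w | e <= enorm (elementary_integral W (Hn n) t w - I w)]
          @[n --> \oo] --> 0%E].

(** * The stochastic differential equation *)

Definition vintegral {R : realType} {n : nat} (t : R) (v : R -> 'cV[R]_n) :
    'cV[R]_n :=
  \col_i \int[lebesgue_measure]_(s in `[0, t]) (v s i 0).

Definition sde_solution {R : realType} {disp : measure_display}
    {Omega : measurableType disp} (P : probability Omega R)
    (T : R) (F : R -> set (set Omega)) {d m : nat}
    (mu : 'cV[R]_d -> 'cV[R]_d) (sigma : 'cV[R]_d -> 'M[R]_(d, m))
    (xi : Omega -> 'cV[R]_d) (W : R -> Omega -> 'cV[R]_m)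
    (X : R -> Omega -> 'cV[R]_d) : Prop :=
  [/\ adapted T F X,
      forall w, {within `[0, T], continuous (X ^~ w)}
    & forall t, 0 <= t <= T -> exists2 I : Omega -> 'cV[R]_d,
        is_ito_integral P T F W (fun s w => sigma (X s w)) t I &
        \forall w \ae P,
          X t w = xi w + vintegral t (fun s => mu (X s w)) + I w].

(** * Tamed Euler approximations *)

(* One trajectory, for the initial value x and the driving path b. *)
Fixpoint tamed_euler {R : realType} {d m : nat} (T : R)
    (mu : 'cV[R]_d -> 'cV[R]_d) (sigma : 'cV[R]_d -> 'M[R]_(d, m))
    (N : nat) (x : 'cV[R]_d) (b : R -> 'cV[R]_m) (n : nat) : 'cV[R]_d :=
  if n is n'.+1 then
    let y := tamed_euler T mu sigma N x b n' in
    let z := (T / N%:R) *: mu y in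
    y + (1 + enorm z)^-1 *: z
      + sigma y *m (b (n'.+1%:R * T / N%:R) - b (n'%:R * T / N%:R))
  else x.

(* The index n is such that t lies in [nT/N, (n+1)T/N], n <= N - 1. *)
Definition tamed_interp {R : realType} {d m : nat} (T : R)
    (mu : 'cV[R]_d -> 'cV[R]_d) (sigma : 'cV[R]_d -> 'M[R]_(d, m))
    (N : nat) (x : 'cV[R]_d) (b : R -> 'cV[R]_m) (t : R) : 'cV[R]_d :=
  let u := t * N%:R / T in
  let n := minn (Num.truncn u) N.-1 in
  (u - n%:R) *: tamed_euler T mu sigma N x b n.+1
  + (n.+1%:R - u) *: tamed_euler T mu sigma N x b n.

(** * Multilevel Monte Carlo estimator *)

(* Ybar N l k w is the path of the k-th copy on level l with N time steps.
   The estimator is used for N a power of 2, where trunc_log 2 N = log_2 N and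
   the divisions N %/ 2 ^ l are exact. *)
Definition mlmc {R : realType} {Omega : Type} {d : nat}
    (f : (R -> 'cV[R]_d) -> R)
    (Ybar : nat -> nat -> nat -> Omega -> R -> 'cV[R]_d)
    (N : nat) (w : Omega) : R :=
  N%:R^-1 * (\sum_(1 <= k < N.+1) f (Ybar 1%N 0%N k w))
  + \sum_(1 <= l < (trunc_log 2 N).+1)
      (2 ^+ l / N%:R) *
      \sum_(1 <= k < (N %/ 2 ^ l).+1)
        (f (Ybar (2 ^ l)%N l k w) - f (Ybar (2 ^ l.-1)%N l k w)).

(* Main.v *)
(** Tamed Euler paths with N and 2N steps driven by the same Brownian motion
    differ in the supremum norm by O(sqrt(log N / N)) in every L^q.  For this the
    coarse path is extended to the fine grid; the one-sided Lipschitz condition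
    and a discrete Gronwall argument bound the difference at the nodes, Doob's
    inequality passes to the maximum, and the logarithm comes from the maximum of
    the Gaussian increments that the linear interpolation leaves out.  Moments of
    the scheme are bounded by comparison with the scheme frozen once the drift
    exceeds sqrt N.

    The error of the estimator is a bias plus, on each level, an average of
    independent centred variables, to which a moment inequality for sums applies.
    That initial values and Brownian paths of all copies are jointly independent
    is not a hypothesis: it follows because products of bounded martingales
    attached to independent Brownian motions are martingales for (F_t).

    The bias is a tail of the telescoping sum of the level differences, once the
    limit of the paths is known to be X.  This limit is only needed in
    probability: X satisfies the Euler recursion up to a residual that tends to 0
    by Lenglart's inequality for elementary integrands, and a stopped mean-square
    estimate compares it with the scheme.  The pathwise bound follows from the
    summability of 2^(n(1/2 - eps)) times the L^1 error for N = 2^n. *)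

From HB Require Import structures.
Require Import Defs.
From mathcomp Require Import all_boot all_order all_algebra.
From mathcomp Require Import finmap.
From mathcomp Require Import all_classical all_reals all_analysis.
From mathcomp Require Import measurable_realfun.
From mathcomp Require Import ring lra.

Set Implicit Arguments.
Unset Strict Implicit.
Unset Printing Implicit Defensive.
Import Order.TTheory GRing.Theory Num.Theory.
Import numFieldNormedType.Exports.
Local Open Scope classical_set_scope.
Local Open Scope ring_scope.

(** No Ito formula is used. All rates are proved for discrete recursions [A + B *m D] with an
    increment independent of the past. No moments are proved for the solution: it enters only as a
    limit in probability, and integrability of f(X) comes out of dominated convergence. Freezing is
    what makes moments uniform in N. Taming alone bounds a drift step by 1 and so gives moments of
    order N^(2q). Moments are taken of even integer order, where expectations are of polynomials and
    the term linear in the noise cancels; real p is reached only at the end. Origin of the exponent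
    3/2: with 2^(l+1) fine steps a level difference has size sqrt((l+2)/2^(l+1)), and N/2^(l+1)
    copies are averaged, which leaves sqrt((l+2)/N). Adding the 1 + log_2 N contributions by the
    triangle inequality yields (1 + log_2 N)^(3/2) / sqrt N. *)

Section Enorm.
Variable R : realType.

(** * Euclidean geometry of vectors and matrices *)

Definition mdot n k (A B : 'M[R]_(n, k)) : R := \sum_i \sum_j A i j * B i j.

Lemma dotpE n (x y : 'cV[R]_n) : dotp x y = mdot x y.
Proof. by apply: eq_bigr => i _; rewrite big_ord1. Qed.

Lemma mdotC n k (A B : 'M[R]_(n, k)) : mdot A B = mdot B A.
Proof. by apply: eq_bigr => i _; apply: eq_bigr => j _; rewrite mulrC. Qed.

Lemma mdotDl n k (A B C : 'M[R]_(n, k)) : mdot (A + B) C = mdot A C + mdot B C.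
Proof.
rewrite /mdot -big_split; apply: eq_bigr => i _ /=; rewrite -big_split.
by apply: eq_bigr => j _; rewrite /= !mxE mulrDl.
Qed.

Lemma mdotZl n k a (A C : 'M[R]_(n, k)) : mdot (a *: A) C = a * mdot A C.
Proof.
rewrite /mdot mulr_sumr; apply: eq_bigr => i _; rewrite mulr_sumr.
by apply: eq_bigr => j _; rewrite !mxE mulrA.
Qed.

Lemma mdotDr n k (A B C : 'M[R]_(n, k)) : mdot C (A + B) = mdot C A + mdot C B.
Proof. by rewrite mdotC mdotDl !(mdotC C). Qed.

Lemma mdotZr n k a (A C : 'M[R]_(n, k)) : mdot C (a *: A) = a * mdot C A.
Proof. by rewrite mdotC mdotZl (mdotC C). Qed.

Lemma mdotNl n k (A C : 'M[R]_(n, k)) : mdot (- A) C = - mdot A C.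
Proof. by rewrite -scaleN1r mdotZl mulN1r. Qed.

Lemma mdotNr n k (A C : 'M[R]_(n, k)) : mdot C (- A) = - mdot C A.
Proof. by rewrite mdotC mdotNl mdotC. Qed.

Lemma mdot0l n k (C : 'M[R]_(n, k)) : mdot 0 C = 0.
Proof. by rewrite -(scale0r 0) mdotZl mul0r. Qed.

Lemma mdotAA_ge0 n k (A : 'M[R]_(n, k)) : 0 <= mdot A A.
Proof. by apply: sumr_ge0 => i _; apply: sumr_ge0 => j _; rewrite -expr2 sqr_ge0. Qed.

Lemma enormE n k (A : 'M[R]_(n, k)) : enorm A = Num.sqrt (mdot A A).
Proof.
by congr Num.sqrt; apply: eq_bigr => i _; apply: eq_bigr => j _; rewrite expr2.
Qed.

Lemma sqr_enorm n k (A : 'M[R]_(n, k)) : enorm A ^+ 2 = mdot A A.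
Proof. by rewrite enormE sqr_sqrtr ?mdotAA_ge0. Qed.

Lemma enorm_ge0 n k (A : 'M[R]_(n, k)) : 0 <= enorm A.
Proof. exact: sqrtr_ge0. Qed.
Hint Resolve enorm_ge0 : core.

Lemma enorm0 n k : enorm (0 : 'M[R]_(n, k)) = 0.
Proof. by rewrite enormE mdot0l sqrtr0. Qed.

Lemma enorm_entry n k (A : 'M[R]_(n, k)) i j : `|A i j| <= enorm A.
Proof.
rewrite -(ler_pXn2r (n:=2))// ?nnegrE// sqr_enorm real_normK ?num_real//.
rewrite /mdot (bigD1 i)//= (bigD1 j)//= -expr2 -addrA lerDl addr_ge0//.
  by apply: sumr_ge0 => l _; rewrite -expr2 sqr_ge0.
by apply: sumr_ge0 => i' _; apply: sumr_ge0 => l _; rewrite -expr2 sqr_ge0.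
Qed.

Lemma enorm0_eq0 n k (A : 'M[R]_(n, k)) : enorm A = 0 -> A = 0.
Proof.
move=> A0; apply/matrixP => i j; rewrite mxE; apply/eqP; rewrite -normr_le0 -A0.
exact: enorm_entry.
Qed.

Lemma enormZ n k a (A : 'M[R]_(n, k)) : enorm (a *: A) = `|a| * enorm A.
Proof.
by rewrite !enormE mdotZl mdotZr mulrA -expr2 sqrtrM ?sqr_ge0// sqrtr_sqr.
Qed.

Lemma enormN n k (A : 'M[R]_(n, k)) : enorm (- A) = enorm A.
Proof. by rewrite -scaleN1r enormZ normrN normr1 mul1r. Qed.

Lemma enormB n k (A B : 'M[R]_(n, k)) : enorm (A - B) = enorm (B - A).
Proof. by rewrite -enormN opprB. Qed.

Lemma sqr_enormD n k (A B : 'M[R]_(n, k)) :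
  enorm (A + B) ^+ 2 = enorm A ^+ 2 + 2 * mdot A B + enorm B ^+ 2.
Proof. rewrite !sqr_enorm !mdotDl !mdotDr (mdotC B A); ring. Qed.

Lemma le_mdot n k (A B : 'M[R]_(n, k)) : mdot A B <= enorm A * enorm B.
Proof.
have [A0|A0] := eqVneq (enorm A) 0; first by rewrite (enorm0_eq0 A0) mdot0l enorm0 mul0r.
have [B0|B0] := eqVneq (enorm B) 0.
  by rewrite (enorm0_eq0 B0) mdotC mdot0l enorm0 mulr0.
(* With a = |A| and b = |B|, the square of |b A - a B| equals 2ab(ab - A.B). *)
have : 0 <= enorm (enorm B *: A + (- enorm A) *: B) ^+ 2 by apply: sqr_ge0.
rewrite sqr_enormD !enormZ mdotZl mdotZr normrN !ger0_norm//.
set a := enorm A; set b := enorm B => H.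
have ab : 0 < a * b by rewrite mulr_gt0 // lt_neqAle eq_sym ?A0 ?B0 enorm_ge0.
rewrite -subr_ge0 -(pmulr_rge0 _ ab); nra.
Qed.

Lemma le_norm_mdot n k (A B : 'M[R]_(n, k)) : `|mdot A B| <= enorm A * enorm B.
Proof.
by rewrite ler_norml le_mdot andbT lerNl -mdotNl (le_trans (le_mdot _ _))// enormN.
Qed.

Lemma ler_enormD n k (A B : 'M[R]_(n, k)) : enorm (A + B) <= enorm A + enorm B.
Proof.
rewrite -(ler_pXn2r (n:=2))// ?nnegrE ?addr_ge0// sqr_enormD sqrrD.
have := le_mdot A B; lra.
Qed.

Lemma ler_enormB n k (A B : 'M[R]_(n, k)) : enorm (A - B) <= enorm A + enorm B.
Proof. by rewrite -(enormN B) ler_enormD. Qed.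

Lemma enorm_sum n k (I : Type) (s : seq I) (p : pred I) (A : I -> 'M[R]_(n, k)) :
  enorm (\sum_(i <- s | p i) A i) <= \sum_(i <- s | p i) enorm (A i).
Proof.
elim/big_ind2 : _ => [|x a y b h1 h2|]; rewrite ?enorm0//.
by rewrite (le_trans (ler_enormD _ _))// lerD.
Qed.

Lemma enorm_le_entries n k (A : 'M[R]_(n, k)) :
  enorm A <= \sum_i \sum_j `|A i j|.
Proof.
rewrite {1}(matrix_sum_delta A) (le_trans (enorm_sum _ _ _))// ler_sum// => i _.
rewrite (le_trans (enorm_sum _ _ _))// ler_sum// => j _.
rewrite enormZ -[leRHS]mulr1 ler_wpM2l// enormE /mdot (bigD1 i)//= (bigD1 j)//=.
rewrite !mxE !eqxx mulr1 big1 ?big1 ?addr0 ?sqrtr1//.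
  move=> i' ni; rewrite big1// => j' _; rewrite !mxE (negPf ni)/= mul0r//.
by move=> j' nj; rewrite !mxE (negPf nj)/= andbF mul0r.
Qed.

Lemma enorm_mulmx n k l (A : 'M[R]_(n, k)) (B : 'M[R]_(k, l)) :
  enorm (A *m B) <= enorm A * enorm B.
Proof.
rewrite -(ler_pXn2r (n:=2))// ?nnegrE ?mulr_ge0// exprMn !sqr_enorm.
suff H i j : (A *m B) i j ^+ 2 <= (\sum_k0 A i k0 ^+ 2) * (\sum_k0 B k0 j ^+ 2).
  rewrite /mdot; apply: (@le_trans _ _
      (\sum_i \sum_j (\sum_k0 A i k0 ^+ 2) * (\sum_k0 B k0 j ^+ 2))).
    by apply: ler_sum => i _; apply: ler_sum => j _; rewrite -expr2 H.
  under eq_bigr do rewrite -mulr_sumr; rewrite -mulr_suml.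
  rewrite le_eqVlt; apply/orP; left; apply/eqP; congr (_ * _).
  by rewrite exchange_big; apply: eq_bigr => i _; apply: eq_bigr => j _; rewrite expr2.
have := le_norm_mdot (row i A)^T (col j B).
rewrite -(ler_pXn2r (n:=2))// ?nnegrE ?mulr_ge0// exprMn !sqr_enorm real_normK ?num_real//.
rewrite /mdot; under [X in X ^+ 2 <= _]eq_bigr do rewrite big_ord1 !mxE.
under [X in _ <= X * _]eq_bigr do rewrite big_ord1 !mxE -expr2.
under [X in _ <= _ * X]eq_bigr do rewrite big_ord1 !mxE -expr2.
by rewrite mxE.
Qed.

(** [sup] of an unbounded set takes the default value 0, so boundedness on the unit ball must be
    known before [opnorm] carries information. *)
Lemma opnorm_bounded n k (A : {linear 'cV[R]_n -> 'cV[R]_k}) :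
  exists K, forall v, enorm (A v) <= K * enorm v.
Proof.
exists (\sum_i enorm (A (delta_mx i 0))) => v.
rewrite {1}(matrix_sum_delta v) linear_sum (le_trans (enorm_sum _ _ _))//.
rewrite mulr_suml ler_sum// => i _; rewrite big_ord1 linearZ enormZ mulrC.
by rewrite ler_wpM2l// enorm_entry.
Qed.

Lemma le_opnorm n k (A : {linear 'cV[R]_n -> 'cV[R]_k}) v :
  enorm (A v) <= opnorm A * enorm v.
Proof.
have [K HK] := opnorm_bounded A.
have [v0|v0] := eqVneq (enorm v) 0.
  by rewrite (enorm0_eq0 v0) linear0 !enorm0 mulr0.
have vp : 0 < enorm v by rewrite lt_neqAle eq_sym v0 enorm_ge0.
rewrite -ler_pdivrMr// mulrC -{1}[(enorm v)^-1]ger0_norm ?invr_ge0//.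
rewrite -enormZ -linearZ; apply: sup_ubound.
  exists `|K| => _ [u /= hu <-]; rewrite (le_trans (HK u))//.
  rewrite -[leRHS]mulr1 (le_trans (ler_norm _))// normrM ler_wpM2l//.
  by rewrite ger0_norm.
by exists ((enorm v)^-1 *: v) => //=; rewrite enormZ ger0_norm ?invr_ge0// mulVf.
Qed.

(** The matrix is the sum of its k columns, each bounded by the operator norm. This turns the
    hypothesis on [sigma] into the Hilbert-Schmidt norm, in which all moment estimates are done. *)
Lemma enorm_opnorm n k (A : 'M[R]_(n, k)) :
  enorm A <= k%:R * opnorm (fun v : 'cV[R]_k => A *m v).
Proof.
have E : A = \sum_j A *m delta_mx j (0 : 'I_1) *m delta_mx 0 j.
  rewrite -[LHS]mulmx1 -[X in _ *m X]trmx1 {1}(matrix_sum_delta 1%:M) linear_sum.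
  rewrite mulmx_sumr; apply: eq_bigr => i _.
  rewrite (bigD1 i)//= big1 ?addr0; last by move=> j ji; rewrite mxE eq_sym (negPf ji) scale0r.
  by rewrite mxE eqxx scale1r trmx_delta -mulmxA mul_delta_mx.
have D1 (p q : nat) (i : 'I_p) (j : 'I_q) : enorm (delta_mx i j : 'M[R]_(p, q)) <= 1.
  rewrite (le_trans (enorm_le_entries _))// (bigD1 i)//= (bigD1 j)//= !mxE !eqxx normr1.
  rewrite big1 ?big1 ?addr0//.
    by move=> i' ni; rewrite big1// => j' _; rewrite !mxE (negPf ni)/= normr0.
  by move=> j' nj; rewrite !mxE (negPf nj)/= andbF normr0.
rewrite {1}E (le_trans (enorm_sum _ _ _))//.
have -> : k%:R * opnorm (fun v : 'cV[R]_k => A *m v) =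
    \sum_(j < k) opnorm (fun v : 'cV[R]_k => A *m v).
  by rewrite sumr_const card_ord mulr_natl.
apply: ler_sum => j _; rewrite (le_trans (enorm_mulmx _ _))//.
apply: (@le_trans _ _ (enorm (A *m delta_mx j (0 : 'I_1)) * 1)).
  by rewrite ler_wpM2l.
have := @le_opnorm k n (mulmx A : {linear 'cV[R]_k -> 'cV[R]_n}) (delta_mx j 0).
rewrite mulr1 => /le_trans; apply.
rewrite -[leRHS]mulr1 ler_wpM2l//; apply: le_trans.
  exact: (@enorm_ge0 _ _ (A *m (0 : 'cV[R]_k))).
apply: sup_ubound; last by exists 0 => //=; rewrite enorm0.
exists (enorm A) => _ [u /= hu <-]; rewrite (le_trans (enorm_mulmx _ _))//.
by rewrite -[leRHS]mulr1 ler_wpM2l.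
Qed.

Lemma enorm_le_norm n k (A : 'M[R]_(n, k)) : enorm A <= (n * k)%:R * `|A|.
Proof.
rewrite (le_trans (enorm_le_entries _))//.
have -> : (n * k)%:R * `|A| = \sum_(i < n) \sum_(j < k) `|A|.
  by rewrite !sumr_const !card_ord -mulrnA mulnC mulr_natl.
apply: ler_sum => i _; apply: ler_sum => j _.
rewrite -[leRHS]/(mx_norm A) mx_normrE.
exact: (le_bigmax _ (fun ij : 'I_n * 'I_k => `|A ij.1 ij.2|) (i, j)).
Qed.

Lemma mdot_linear n k (u : 'M[R]_(n, k)) : linear (mdot u).
Proof. by move=> a v w; rewrite mdotDr mdotZr. Qed.

HB.instance Definition _ n k (u : 'M[R]_(n, k)) :=
  GRing.isLinear.Build _ _ _ _ (mdot u) (@mdot_linear n k u).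

Lemma mdot_continuous n k (u : 'M[R]_(n, k)) : continuous (mdot u).
Proof.
apply: bounded_linear_continuous; apply/ex_bound; exists (enorm u * ((n * k)%:R * 1)).
have : \forall z \near nbhs (0 : 'M[R]_(n, k)), `|z| <= 1.
  apply/nbhs_ballP; exists 1 => //= z; rewrite -ball_normE /= sub0r normrN; exact: ltW.
apply: filterS => z z1; rewrite /= (le_trans (le_norm_mdot _ _))// ler_wpM2l//.
by rewrite (le_trans (enorm_le_norm _))// ler_wpM2l.
Qed.

End Enorm.
#[global] Hint Extern 0 (is_true (0 <= enorm _)) => exact: enorm_ge0 : core.

(** * Polynomial bounds for the coefficients *)

Section Coefficients.
Variables (R : realType) (d m : nat).

(** Real exponents are traded for integer ones, at the price of a larger power of 1 + x. *)
Lemma powR_le_expn (c x : R) : 0 <= c -> 0 <= x -> x `^ c <= (1 + x) ^+ (Num.truncn c).+1.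
Proof.
move=> c0 x0; rewrite -powR_mulrn ?addr_ge0//.
apply: (@le_trans _ _ ((1 + x) `^ c)).
  by apply: ge0_ler_powR; rewrite ?nnegrE ?addr_ge0// lerDr.
by apply: ler_powR; rewrite ?lerDl// ltW// truncnS_gt.
Qed.

(* The difference is a directional derivative of [mu] at a point of the
   segment, tested against the difference itself. *)
Lemma mean_value_bound (mu : 'cV[R]_d -> 'cV[R]_d) (K : R) (x y : 'cV[R]_d) :
  (forall z, differentiable mu z) -> 0 <= K ->
  (forall z, enorm z <= enorm x + enorm y -> opnorm ('d mu z) <= K) ->
  enorm (mu x - mu y) <= K * enorm (x - y).
Proof.
move=> dmu K0 HK; set u := mu x - mu y.
have Lcont := @mdot_continuous R d 1 u.
pose p (s : R) : 'cV[R]_d := y + s *: (x - y).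
have dp s : is_diff s p (fun h => h *: (x - y)).
  have -> : p = cst y + ( *:%R ^~ (x - y)) by [].
  apply: (is_diff_eq (is_diffD (is_diff_cst y s) (is_diff_scalel s (x - y)))).
  by apply/funext => h; rewrite /= add0r.
have cd (s : R) : is_derive s 1 (mdot u \o mu \o p) (mdot u ('d mu (p s) (x - y))).
  have dL z : differentiable (mdot u : 'cV[R]_d -> R) z.
    exact: (@linear_differentiable _ _ _ (mdot u)).
  have dps : differentiable p s by [].
  have dmp : differentiable (mu \o p) s by apply: differentiable_comp.
  have dall : differentiable (mdot u \o mu \o p) s.
    by rewrite -compA; apply: differentiable_comp => //.
  apply: DeriveDef; first by apply/derivable1_diffP.
  rewrite deriveE// -compA diff_comp// diff_lin//.
  by rewrite diff_comp//= /comp diff_val scale1r.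
have [c cin] := @MVT_segment R (mdot u \o mu \o p) (fun s => mdot u ('d mu (p s) (x - y))) 0 1
  ler01 (fun s _ => cd s)
  (continuous_subspaceT (fun s => differentiable_continuous (proj1 (derivable1_diffP _ _) (@ex_derive _ _ _ _ _ _ _ (cd s))))).
rewrite /p /= scale1r scale0r addr0 subr0 mulr1 (addrC y) subrK.
rewrite -[- mdot u (mu y)]mdotNr -mdotDr -/u -sqr_enorm.
set dmc := 'd mu _ => E.
have [u0|u0] := eqVneq (enorm u) 0; first by rewrite u0 mulr_ge0.
have up : 0 < enorm u by rewrite lt_neqAle eq_sym u0 enorm_ge0.
rewrite -(ler_pM2l up) -expr2 E (le_trans (le_mdot _ _))// ler_wpM2l//.
rewrite (le_trans (le_opnorm _ _))// ler_wpM2r// HK//.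
move: cin; rewrite in_itv/= => /andP[c0 c1].
have -> : y + c *: (x - y) = (1 - c) *: y + c *: x.
  by rewrite scalerBr scalerBl scale1r addrCA addrA [RHS]addrC addrA.
rewrite (le_trans (ler_enormD _ _))// !enormZ !ger0_norm ?subr_ge0// addrC.
by rewrite lerD// ler_piMl// lerBlDr lerDl.
Qed.

Definition drift_bounds (K : R) (k : nat) (mu : 'cV[R]_d -> 'cV[R]_d) :=
  forall x y, dotp (x - y) (mu x - mu y) <= K * enorm (x - y) ^+ 2 /\
    enorm (mu x - mu y) <= K * (1 + enorm x + enorm y) ^+ k * enorm (x - y).

Lemma coefficient_bounds (mu : 'cV[R]_d -> 'cV[R]_d) (sigma : 'cV[R]_d -> 'M[R]_(d, m))
    (c0 : R) : cont_differentiable mu -> 0 <= c0 ->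
  (forall x y,
    [/\ dotp (x - y) (mu x - mu y) <= c0 * enorm (x - y) ^+ 2,
        opnorm ('d mu x) <= c0 * (1 + enorm x `^ c0)
      & opnorm (fun v => (sigma x - sigma y) *m v) <= c0 * enorm (x - y)]) ->
  exists K k, [/\ 0 <= K, drift_bounds K k mu,
    forall x y, enorm (sigma x - sigma y) <= K * enorm (x - y),
    forall x, enorm (mu x) <= K * (1 + enorm x) ^+ k &
    forall x, enorm (sigma x) <= K * (1 + enorm x)].
Proof.
move=> [dmu _] c00 H.
set k := (Num.truncn c0).+1.
have k1 (x y : 'cV[R]_d) : 1 <= (1 + enorm x + enorm y) ^+ k.
  by rewrite exprn_ege1// -addrA lerDl addr_ge0.
(* The factor 2 comes from 1 + |z|^c0, where both summands are at most (1 + |x| + |y|)^k for z on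
   the segment. *)
have L x y : enorm (mu x - mu y) <= 2 * c0 * (1 + enorm x + enorm y) ^+ k * enorm (x - y).
  apply: mean_value_bound => //; first by rewrite !mulr_ge0// exprn_ge0// !addr_ge0.
  move=> z hz; have [_ + _] := H z 0; move/le_trans; apply.
  rewrite mulrAC -[2 * _ * c0]mulrC ler_wpM2l//.
  have : enorm z `^ c0 <= (1 + enorm x + enorm y) ^+ k.
    apply: le_trans (powR_le_expn c00 (enorm_ge0 z)) _.
    by rewrite lerXn2r// ?nnegrE ?addr_ge0// -addrA lerD2l.
  have := k1 x y; lra.
have S x y : enorm (sigma x - sigma y) <= m%:R * c0 * enorm (x - y).
  apply: le_trans (enorm_opnorm _) _; rewrite -mulrA ler_wpM2l//.
  by have [] := H x y.
(* The sum of all constants that occur, so that each of them lies below K. *)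
pose K := c0 + 2 * c0 + m%:R * c0 + (enorm (mu 0) + 2 * c0) + enorm (sigma 0).
have Kc : [/\ c0 <= K, 2 * c0 <= K, m%:R * c0 <= K & (enorm (mu 0) + 2 * c0) <= K].
  have h1 := enorm_ge0 (mu 0); have h2 := enorm_ge0 (sigma 0).
  have h3 : 0 <= m%:R * c0 by rewrite mulr_ge0.
  by rewrite /K; split; lra.
have [K1 K2 K3 K4] := Kc.
(* One power more than the Lipschitz bound needs: mu x is reached through mu x - mu 0, which brings
   another factor |x|. *)
exists K, k.+1; split.
- by apply: le_trans K1.
- move=> x y; split; first by have [/le_trans + _ _] := H x y; apply; rewrite ler_wpM2r// sqr_ge0.
  apply: le_trans (L x y) _; rewrite ler_wpM2r// ler_pM// ?mulr_ge0 ?exprn_ge0 ?addr_ge0//.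
  by rewrite exprS ler_peMl ?exprn_ge0 ?addr_ge0// -addrA lerDl addr_ge0.
- by move=> x y; apply: le_trans (S x y) _; rewrite ler_wpM2r.
- move=> x; have := L x 0; rewrite enorm0 addr0 subr0 => h.
  have -> : mu x = mu 0 + (mu x - mu 0) by rewrite addrC subrK.
  rewrite (le_trans (ler_enormD _ _))//.
  apply: (@le_trans _ _ ((enorm (mu 0) + 2 * c0) * (1 + enorm x) ^+ k.+1)); last first.
    by rewrite ler_wpM2r// exprn_ge0// addr_ge0.
  rewrite mulrDl lerD//; first by rewrite ler_peMr// exprn_ege1// lerDl.
  rewrite (le_trans h)// -mulrA ler_wpM2l ?mulr_ge0// exprSr ler_wpM2l ?exprn_ge0 ?addr_ge0//.
  by rewrite lerDr.
- move=> x; have := S x 0; rewrite subr0 => h.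
  have -> : sigma x = sigma 0 + (sigma x - sigma 0) by rewrite addrC subrK.
  rewrite (le_trans (ler_enormD _ _))//.
  have h1 := enorm_ge0 (mu 0); have h2 := enorm_ge0 (sigma 0).
  have h3 : 0 <= m%:R * c0 by rewrite mulr_ge0.
  rewrite mulrDr mulr1 lerD//; first by rewrite /K; lra.
  by rewrite (le_trans h)// ler_wpM2r.
Qed.

End Coefficients.

(** * Measurability with respect to a sub-sigma-algebra *)

Section Measurability.
Variable R : realType.

Lemma borel_setsR : borel_sets = measurable :> set (set R).
Proof.
rewrite eqEsubset; split.
  apply: smallest_sub; first exact: sigma_algebra_measurable.
  by move=> U oU; exact: open_measurable.
have -> : @measurable _ R = <<s @RGenOpens.G R >>.
  by refine (RGenOpens.measurableE R).
apply: smallest_sub; first exact: smallest_sigma_algebra.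
by move=> _ [x [y ->]]; apply: sub_gen_smallest; exact: interval_open.
Qed.

(** The type generated by G is a measurable space of its own, so closure under sums, products and
    limits applies verbatim; if G is a sigma-algebra, its measurable sets are exactly G. *)
Definition msr (Omega : pointedType) (G : set (set Omega)) (f : Omega -> R) :=
  @measurable_fun _ _ (g_sigma_algebraType G) R setT f.

Lemma msrP (Omega : pointedType) (G : set (set Omega)) (f : Omega -> R) :
  sigma_algebra setT G -> msr G f <-> borel_measurable G f.
Proof.
move=> sG; rewrite /borel_measurable /preimage_sigma borel_setsR; split.
  move=> mf _ [B mB <-]; have := mf measurableT _ mB.
  by rewrite setTI /measurable /= sigma_algebra_id.
move=> h _ B mB; rewrite setTI /measurable /= sigma_algebra_id//.
by apply: h; exists B.
Qed.

Lemma borel_measurable_comp (Omega : Type) (V V' : topologicalType) (G : set (set Omega))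
    (Y : Omega -> V) (g : V -> V') : continuous g ->
  borel_measurable G Y -> borel_measurable G (g \o Y).
Proof.
move=> cg mY _ [B bB <-]; rewrite comp_preimage; apply: mY; exists (g @^-1` B) => //.
move: B bB; apply: (@smallest_sub _ _ _ [set B | borel_sets (g @^-1` B)]).
  split => /=.
  - by rewrite preimage_set0; have [] := smallest_sigma_algebra setT (@open V).
  - move=> A bA; rewrite setTD preimage_setC -setTD.
    by have [_ + _] := smallest_sigma_algebra setT (@open V); apply.
  - move=> A bA; rewrite preimage_bigcup.
    by have [_ _] := smallest_sigma_algebra setT (@open V); apply.
by move=> U oU; apply: sub_gen_smallest; move/continuousP : cg; apply.
Qed.

Lemma preimage_generated (Omega T : Type) (G : set (set Omega)) (C : set (set T))
    (Y : Omega -> T) : sigma_algebra setT G ->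
  (forall B, C B -> G (Y @^-1` B)) -> forall B, <<s C >> B -> G (Y @^-1` B).
Proof.
move=> sG CG B; move: B; apply: (@smallest_sub _ _ _ [set B | G (Y @^-1` B)]) => //.
split => /=; first by rewrite preimage_set0; case: sG.
  by move=> A bA; rewrite setTD preimage_setC -setTD; case: sG => _ + _; apply.
by move=> A bA; rewrite preimage_bigcup; case: sG => _ _; apply.
Qed.

(** Every open set of matrices is a countable union of boxes with rational centre and radius, and a
    box is a finite intersection of conditions on single entries. *)
Lemma borel_measurable_entries (Omega : pointedType) (n k : nat) (G : set (set Omega))
    (Y : Omega -> 'M[R]_(n, k)) : sigma_algebra setT G ->
  borel_measurable G Y <-> forall i j, msr G (fun w => Y w i j).
Proof.
move=> sG; split.
  move=> mY i j; apply/msrP => //.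
  apply: (@borel_measurable_comp _ _ _ _ _ (fun A : 'M[R]_(n, k) => A i j)) => //.
  exact: coord_continuous.
move=> H _ [B bB <-]; move: B bB; apply: preimage_generated => // U oU.
pose box (q : 'M[rat]_(n, k) * rat) : set 'M[R]_(n, k) :=
  [set A | forall i j, `|A i j - ratr (q.1 i j)| < ratr q.2].
pose I := [set q | box q `<=` U].
(* The boxes inside U are enumerated through [pickle]; numbers that code nothing, and boxes not
   contained in U, contribute the empty set. *)
have -> : Y @^-1` U = \bigcup_k (oapp (fun q => if `[< I q >] then Y @^-1` box q else set0) set0 (choice.unpickle k)).
  have -> : \bigcup_k (oapp (fun q => if `[< I q >] then Y @^-1` box q else set0) set0 (choice.unpickle k))
      = \bigcup_(q in I) (Y @^-1` box q).
    rewrite eqEsubset; split => w [].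
      by move=> k' _; case: choice.unpickle => //= q; case: asboolP => // Iq; exists q.
    by move=> q Iq bq; exists (choice.pickle q) => //; rewrite choice.pickleK /=; case: asboolP.
  rewrite -preimage_bigcup; congr (_ @^-1` _); rewrite eqEsubset; split; last first.
    by move=> A [q Iq]; exact: Iq.
  move=> A UA; have /nbhs_ballP[e /= e0 eU] : nbhs A U by apply: open_nbhs_nbhs.
  have [r] := @rat_in_itvoo R 0 (e / 2) ltac:(by rewrite divr_gt0).
  rewrite in_itv /= => /andP[r0 re].
  have /choice[q Hq] : forall ij : 'I_n * 'I_k, exists q : rat, `|A ij.1 ij.2 - ratr q| < ratr r.
    move=> ij; have [q] := @rat_in_itvoo R (A ij.1 ij.2 - ratr r) (A ij.1 ij.2 + ratr r) ltac:(lra).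
    by rewrite in_itv /= => /andP[q0 q1]; exists q; rewrite ltr_distl; lra.
  exists (\matrix_(i, j) q (i, j), r); last by move=> i j /=; rewrite mxE; exact: (Hq (i, j)).
  move=> B /= HB; apply: eU; rewrite /ball /= /mx_ball; split => // i j; rewrite -ball_normE /=.
  have := HB i j; have := Hq (i, j); rewrite /= mxE => h1 h2.
  by rewrite ltr_distl; move: h1 h2; rewrite !ltr_distl; lra.
have bq q : G (Y @^-1` box q).
  have -> : Y @^-1` box q = \bigcap_(ij in [set: 'I_n * 'I_k])
      ((fun w => Y w ij.1 ij.2) @^-1` [set x : R | `|x - ratr (q.1 ij.1 ij.2)| < ratr q.2]).
    rewrite eqEsubset; split => w /=; first by move=> h [i j] _; exact: h.
    by move=> h i j; exact: (h (i, j) Logic.I).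
  have mm (ij : 'I_n * 'I_k) :
     @measurable _ (g_sigma_algebraType G) ((fun w => Y w ij.1 ij.2) @^-1` [set x : R | `|x - ratr (q.1 ij.1 ij.2)| < ratr q.2]).
    rewrite -[X in measurable X]setTI; apply: H => //.
    have -> : [set x : R | `|x - ratr (q.1 ij.1 ij.2)| < ratr q.2] = ball (ratr (q.1 ij.1 ij.2) : R) (ratr q.2).
      by rewrite -ball_normE; apply/seteqP; split => x /=; rewrite distrC.
    exact: measurable_ball.
  suff : @measurable _ (g_sigma_algebraType G) (\bigcap_(ij in [set: 'I_n * 'I_k])
      ((fun w => Y w ij.1 ij.2) @^-1` [set x : R | `|x - ratr (q.1 ij.1 ij.2)| < ratr q.2])).
    by rewrite /measurable /= sigma_algebra_id.
  by apply: fin_bigcap_measurable => //; exact: finite_finset.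
suff : @measurable _ (g_sigma_algebraType G) (\bigcup_k
    (oapp (fun q => if `[< I q >] then Y @^-1` box q else set0) set0 (choice.unpickle k))).
  by rewrite /measurable /= sigma_algebra_id.
apply: bigcupT_measurable => k'; case: choice.unpickle => [q|] /=; last exact: measurable0.
case: asboolP => _; last exact: measurable0.
by rewrite /measurable /= sigma_algebra_id.
Qed.

Lemma msr_cont (Omega : pointedType) (n k : nat) (G : set (set Omega))
    (Y : Omega -> 'M[R]_(n, k)) (g : 'M[R]_(n, k) -> R) : sigma_algebra setT G ->
  continuous g -> (forall i j, msr G (fun w => Y w i j)) -> msr G (fun w => g (Y w)).
Proof.
move=> sG cg /(borel_measurable_entries _ sG) mY; apply/msrP => //.
exact: (@borel_measurable_comp _ _ _ _ _ g).
Qed.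

Lemma msr_sub (Omega : pointedType) (G H : set (set Omega)) (f : Omega -> R) :
  G `<=` H -> msr G f -> msr H f.
Proof.
move=> GH mf mT B mB; have := mf measurableT B mB.
by apply: sub_smallest2r => //; exact: smallest_sigma_algebra.
Qed.

End Measurability.

(** * Random variables with moments of all orders *)

Section LG.
Context (R : realType) (disp : measure_display) (Omega : measurableType disp)
  (P : probability Omega R).
Implicit Types (G H : set (set Omega)) (f g : Omega -> R).

Definition subalg G := sigma_algebra setT G /\ G `<=` (@measurable _ Omega).

Lemma subalg_measurable : subalg measurable.
Proof. by split => //; exact: sigma_algebra_measurable. Qed.

Lemma msr_measurable_fun G f : subalg G -> msr G f -> measurable_fun setT f.
Proof.
move=> [sG GM] mf mT B mB; have := mf measurableT B mB.
by rewrite /measurable /= sigma_algebra_id// => /GM.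
Qed.

(** Finiteness of all moments is stable under sums, products and polynomially bounded maps, so
    integrability never has to be tracked order by order. *)
Definition LG G f :=
  msr G f /\ forall n, P.-integrable setT (fun w => (`|f w| ^+ n)%:E).

Definition Ex f : R := (\int[P]_w f w)%R.

Lemma LG_msr G f : LG G f -> msr G f. Proof. by case. Qed.

Section fixed.
Variable G : set (set Omega).
Hypothesis sG : subalg G.

Lemma LG_integrable f : LG G f -> P.-integrable setT (EFin \o f).
Proof.
move=> [mf /(_ 1%N) fi]; apply: le_integrable fi => //.
  by apply/measurable_EFinP; exact: msr_measurable_fun mf.
by move=> x _ /=; rewrite expr1 normr_id.
Qed.

Lemma LG_dom f g : msr G g -> (forall w, `|g w| <= f w) -> LG G f -> LG G g.
Proof.
move=> mg gf [mf fi]; split => // n; apply: le_integrable (fi n) => //.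
  apply/measurable_EFinP; apply: measurable_funX; apply: measurableT_comp => //.
  exact: msr_measurable_fun mg.
move=> x _ /=; rewrite lee_fin !normrX !normr_id lerXn2r ?nnegrE//.
by rewrite (le_trans (gf x)) ?ler_norm.
Qed.

Lemma LG_cst (c : R) : LG G (cst c).
Proof.
split => [|n]; first exact: measurable_cst.
have := @finite_measure_integrable_cst _ _ _ P setT (`|c| ^+ n) measurableT.
exact: eq_integrable.
Qed.

Lemma LG_norm f : LG G f -> LG G (fun w => `|f w|).
Proof.
move=> [mf fi]; split; first exact: measurableT_comp.
by move=> n; apply: eq_integrable (fi n) => // x _; rewrite normr_id.
Qed.

Lemma LG_pow f n : LG G f -> LG G (fun w => f w ^+ n).
Proof.
move=> [mf fi]; split; first exact: measurable_funX.
move=> k; apply: eq_integrable (fi (n * k)%N) => // x _.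
by rewrite normrX -exprM.
Qed.

Lemma pow2D (a b : R) n : 0 <= a -> 0 <= b -> (a + b) ^+ n <= 2 ^+ n * (a ^+ n + b ^+ n).
Proof.
move=> a0 b0; wlog ab : a b a0 b0 / a <= b.
  move=> h; have [/h|/ltW /h] := leP a b; first exact.
  by rewrite (addrC b) (addrC (b ^+ n)); apply.
apply: (@le_trans _ _ ((2 * b) ^+ n)).
  by rewrite lerXn2r// ?nnegrE ?addr_ge0 ?mulr_ge0//; lra.
by rewrite exprMn ler_wpM2l ?exprn_ge0// lerDr exprn_ge0.
Qed.

Lemma LGD f g : LG G f -> LG G g -> LG G (fun w => f w + g w).
Proof.
move=> [mf fi] [mg gi].
have mfg : msr G (fun w => f w + g w) by exact: measurable_funD.
split => // n.
have : P.-integrable setT (fun w => (2 ^+ n)%:E * ((`|f w| ^+ n)%:E + (`|g w| ^+ n)%:E))%E.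
  by apply: integrableZl => //; exact: integrableD.
apply: le_integrable => //.
  apply/measurable_EFinP; apply: measurable_funX; apply: measurableT_comp => //.
  exact: msr_measurable_fun mfg.
move=> x _ /=; rewrite lee_fin [leRHS]ger0_norm ?mulr_ge0 ?addr_ge0 ?exprn_ge0//.
rewrite normrX normr_id.
apply: le_trans (pow2D n (normr_ge0 (f x)) (normr_ge0 (g x))).
by rewrite lerXn2r// ?nnegrE ?addr_ge0// ler_normD.
Qed.

Lemma LGM f g : LG G f -> LG G g -> LG G (fun w => f w * g w).
Proof.
move=> [mf fi] [mg gi].
have mfg : msr G (fun w => f w * g w) by exact: measurable_funM.
split => // n.
have : P.-integrable setT (fun w => (`|f w| ^+ (2 * n))%:E + (`|g w| ^+ (2 * n))%:E)%E.
  exact: integrableD.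
apply: le_integrable => //.
  apply/measurable_EFinP; apply: measurable_funX; apply: measurableT_comp => //.
  exact: msr_measurable_fun mfg.
move=> x _ /=; rewrite lee_fin [leRHS]ger0_norm ?addr_ge0 ?exprn_ge0//.
rewrite normrX normr_id normrM exprMn !(mulnC 2) !exprM.
set a := `|f x| ^+ n; set b := `|g x| ^+ n.
have := sqr_ge0 (a - b); have := sqr_ge0 a; have := sqr_ge0 b; nra.
Qed.

Lemma LGZ c f : LG G f -> LG G (fun w => c * f w).
Proof. by move=> hf; apply: LGM => //; exact: LG_cst. Qed.

Lemma LGN f : LG G f -> LG G (fun w => - f w).
Proof. by move=> /(LGZ (-1)); under eq_fun do rewrite mulN1r. Qed.

Lemma LGB f g : LG G f -> LG G g -> LG G (fun w => f w - g w).
Proof. by move=> hf hg; apply: LGD => //; exact: LGN. Qed.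

Lemma LG_sum (I : Type) (s : seq I) (p : pred I) (F : I -> Omega -> R) :
  (forall i, p i -> LG G (F i)) -> LG G (fun w => \sum_(i <- s | p i) F i w).
Proof.
move=> hF; elim: s => [|i s IH].
  by under eq_fun do rewrite big_nil; exact: LG_cst.
under eq_fun do rewrite big_cons.
by case: (p i) (hF i) => // h; apply: LGD => //; exact: h.
Qed.

Lemma LG_indic (A : set Omega) : G A -> LG G (\1_A).
Proof.
move=> GA.
have mA : @measurable _ (g_sigma_algebraType G) A by rewrite /measurable /= sigma_algebra_id//; case: sG.
apply: (@LG_dom (cst 1)); last exact: LG_cst; first exact: measurable_indic.
by move=> w /=; rewrite ger0_norm// indicE; case: (_ \in _).
Qed.

Lemma ExD f g : LG G f -> LG G g -> Ex (fun w => f w + g w) = Ex f + Ex g.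
Proof. by move=> hf hg; apply: RintegralD => //; exact: LG_integrable. Qed.

Lemma ExZ c f : LG G f -> Ex (fun w => c * f w) = c * Ex f.
Proof. by move=> hf; apply: RintegralZl => //; exact: LG_integrable. Qed.

Lemma ExB f g : LG G f -> LG G g -> Ex (fun w => f w - g w) = Ex f - Ex g.
Proof. by move=> hf hg; apply: RintegralB => //; exact: LG_integrable. Qed.

Lemma Ex_cst (c : R) : Ex (cst c) = c.
Proof. by rewrite /Ex Rintegral_cst//= probability_setT mulr1. Qed.

Lemma Ex_le f g : LG G f -> LG G g -> (forall w, f w <= g w) -> Ex f <= Ex g.
Proof. by move=> hf hg fg; apply: le_Rintegral => //; exact: LG_integrable. Qed.

Lemma Ex_sum (I : Type) (s : seq I) (p : pred I) (F : I -> Omega -> R) :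
  (forall i, p i -> LG G (F i)) ->
  Ex (fun w => \sum_(i <- s | p i) F i w) = \sum_(i <- s | p i) Ex (F i).
Proof.
move=> hF; elim: s => [|i s IH].
  by under eq_fun do rewrite big_nil; rewrite big_nil Ex_cst.
rewrite big_cons; under eq_fun do rewrite big_cons.
have hs : LG G (fun w => \sum_(i <- s | p i) F i w) by exact: LG_sum.
by case: (p i) (hF i) => // h; rewrite -IH ExD//; exact: h.
Qed.

Lemma Ex_indic (A : set Omega) : G A -> Ex (\1_A) = fine (P A).
Proof.
move=> GA; rewrite /Ex /Rintegral integral_indic ?setIT//.
by case: sG => _; apply.
Qed.

Lemma Ex_EFin f : LG G f -> (\int[P]_w (f w)%:E)%E = (Ex f)%:E.
Proof. by move=> hf; rewrite fineK// integrable_fin_num//; exact: LG_integrable. Qed.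

Ltac lgs := solve [repeat first [assumption | exact: LG_cst | apply: LG_pow
  | apply: LG_norm | apply: LGZ | apply: LGN | apply: LGM | apply: LGB | apply: LGD]].

(* [|ab| <= (s a^2 + b^2/s)/2] with the optimal [s] *)
Lemma Ex_CS f g : LG G f -> LG G g ->
  Ex (fun w => f w * g w) ^+ 2 <= Ex (fun w => f w ^+ 2) * Ex (fun w => g w ^+ 2).
Proof.
move=> hf hg; set a := Ex (fun w => f w ^+ 2); set b := Ex (fun w => g w ^+ 2).
set c := Ex _.
have H s : 0 <= s ^+ 2 * a + 2 * s * c + b.
  have -> : s ^+ 2 * a + 2 * s * c + b = Ex (fun w => (s * f w + g w) ^+ 2).
    rewrite (_ : (fun w => (s * f w + g w) ^+ 2) =
        (fun w => (s ^+ 2 * f w ^+ 2 + (2 * s) * (f w * g w)) + g w ^+ 2)).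
      rewrite ExD ?ExD ?ExZ//; lgs.
    by apply/funext => w; ring.
  rewrite -(Ex_cst 0); apply: Ex_le => [||w]; first exact: LG_cst.
    by apply: LG_pow; apply: LGD => //; apply: LGZ.
  exact: sqr_ge0.
have a0 : 0 <= a by rewrite -(Ex_cst 0); apply: Ex_le => [||w]; [exact: LG_cst|exact: LG_pow|exact: sqr_ge0].
have [a00|an0] := eqVneq a 0; last first.
  have := H (- c / a).
  have ap : 0 < a by rewrite lt_neqAle eq_sym an0.
  rewrite (_ : _ + b = (a * b - c ^+ 2) / a); last by field.
  by rewrite pmulr_lge0 ?invr_gt0// subr_ge0.
(* Here the coefficient of s^2 vanishes and [H] is affine in s; with a nonzero slope it would take
   the value -1 at s = -(b + 1)/(2c). *)
have [-> | cn0] := eqVneq c 0; first by rewrite expr0n/= a00 mul0r.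
have := H (- (b + 1) / (2 * c)).
rewrite a00 mulr0 add0r (_ : 2 * _ * c = - (b + 1)); last by field.
by rewrite opprD -addrA addrCA [X in _ + X]addrC; lra.
Qed.

End fixed.

Lemma LG_sub G H f : G `<=` H -> LG G f -> LG H f.
Proof. by move=> GH [mf fi]; split => //; exact: msr_sub mf. Qed.

Lemma Ex_ge0 f : (forall w, 0 <= f w) -> 0 <= Ex f.
Proof. by move=> f0; apply: Rintegral_ge0. Qed.

Lemma eq_Ex f g : f =1 g -> Ex f = Ex g.
Proof. by move=> /funext ->. Qed.

End LG.

Ltac lgs := solve [repeat first [assumption | exact: LG_cst | apply: LG_pow
  | apply: LG_norm | apply: LGZ | apply: LGN | apply: LGM | apply: LGB | apply: LGD]].

(** * Independence: pi-systems, freezing and transport of laws *)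

Section Independence.
Context (R : realType) (disp : measure_display) (Omega : measurableType disp)
  (P : probability Omega R).
Implicit Types (G H C D : set (set Omega)) (f g : Omega -> R).

(** As functions of B, both sides are finite measures: P restricted to A, and P scaled by P A. They
    agree on a pi-system containing the whole space. *)
Lemma indep_pi C (A : set Omega) : measurable A -> setI_closed C ->
  C `<=` measurable -> C setT ->
  (forall B, C B -> P (A `&` B) = (P A * P B)%E) ->
  forall B, <<s C >> B -> P (A `&` B) = (P A * P B)%E.
Proof.
move=> mA IC CM CT H B sB.
have PA0 : 0 <= fine (P A) by apply: fine_ge0; exact: measure_ge0.
have PA : (fine (P A))%:E = P A by rewrite fineK// fin_num_measure.
have cov : \bigcup_(k in [set: nat]) [set: Omega] = setT.
  by rewrite bigcup_const//; exists 0%N.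
have := @g_sigma_algebra_measure_unique _ R Omega C CM (fun _ => setT) (fun _ => CT)
  cov (mrestr P mA) (mscale (NngNum PA0) P) IC _ _ B sB.
have E1 A0 : C A0 -> mrestr P mA A0 = mscale (NngNum PA0) P A0.
  by move=> CA; rewrite /mrestr /mscale /= PA setIC H.
have E2 (n : nat) : (mrestr P mA setT < +oo)%E by rewrite /mrestr setTI -PA ltry.
move=> /(_ E1 E2) E3; rewrite setIC; transitivity (mscale (NngNum PA0) P B); first exact: E3.
by rewrite /mscale /= PA.
Qed.

Lemma independent_pair_sym G H : independent_pair P G H -> independent_pair P H G.
Proof. by move=> GH A B HA GB; rewrite setIC muleC GH. Qed.

Lemma independent_pair_gen C D : C `<=` measurable -> D `<=` measurable ->
  setI_closed C -> setI_closed D -> C setT -> D setT ->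
  independent_pair P C D -> independent_pair P <<s C >> <<s D >>.
Proof.
move=> CM DM IC ID CT DT h A B sA sB.
have sM E : E `<=` measurable -> <<s E >> `<=` @measurable _ Omega.
  by move=> EM; apply: smallest_sub => //; exact: sigma_algebra_measurable.
apply: (@indep_pi D) => //; first exact: sM sA.
move=> B' DB'; rewrite setIC muleC; apply: (@indep_pi C) => //; first exact: DM.
by move=> A' CA'; rewrite setIC muleC; exact: h.
Qed.

Section fubini.
Variables G H : set (set Omega).
Hypotheses (sG : subalg G) (sH : subalg H) (GH : independent_pair P G H).

Let measurable_id K : subalg K ->
  @measurable_fun _ _ Omega (g_sigma_algebraType K) setT id.
Proof.
move=> [sK KM] _ B; rewrite setTI preimage_id /measurable /= sigma_algebra_id//.
exact: KM.
Qed.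

Let diag := fun w : Omega => (w, w) : g_sigma_algebraType G * g_sigma_algebraType H.

Let measurable_diag : measurable_fun setT diag.
Proof. by apply/measurable_fun_pairP; split; exact: measurable_id. Qed.

Let idG : {mfun Omega >-> g_sigma_algebraType G} :=
  MeasurableFun.Pack (MeasurableFun.Class (isMeasurableFun.Build _ _ _ _ _ (measurable_id sG))).
Let idH : {mfun Omega >-> g_sigma_algebraType H} :=
  MeasurableFun.Pack (MeasurableFun.Class (isMeasurableFun.Build _ _ _ _ _ (measurable_id sH))).
Let dg : {mfun Omega >-> (g_sigma_algebraType G * g_sigma_algebraType H)%type} :=
  MeasurableFun.Pack (MeasurableFun.Class (isMeasurableFun.Build _ _ _ _ _ measurable_diag)).

Let PG : probability (g_sigma_algebraType G) R := distribution P idG.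
Let PH : probability (g_sigma_algebraType H) R := distribution P idH.

Variable h : Omega * Omega -> R.
Hypothesis mh : @measurable_fun _ _ (g_sigma_algebraType G * g_sigma_algebraType H)%type R setT h.
Hypothesis ih : P.-integrable setT (fun w => (h (w, w))%:E).
Hypothesis ihw : forall w, P.-integrable setT (fun w' => (h (w, w'))%:E).

Let eq_diag : forall X, measurable X -> (PG \x PH)%E X = distribution P dg X.
Proof.
apply: product_measure_unique => A B mA mB.
rewrite /PG /PH /distribution /pushforward /=.
by apply: GH; [have := mA|have := mB]; rewrite /measurable /= sigma_algebra_id//; [case: sG|case: sH].
Qed.

Let ihd : (distribution P dg).-integrable setT (EFin \o h).
Proof. by apply: (@integrable_pushforward _ _ _ _ _ dg) => //; exact/measurable_EFinP. Qed.

Let ihp : (PG \x PH)%E.-integrable setT (EFin \o h).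
Proof.
move/integrableP : ihd => [mh' hfin]; apply/integrableP; split => //.
rewrite (eq_measure_integral (distribution P dg))// => A mA _.
exact: eq_diag.
Qed.

Let inner w : (\int[PH]_w' (h (w, w'))%:E)%E = (Ex P (fun w' => h (w, w')))%:E.
Proof.
have mhw : measurable_fun setT (EFin \o (fun w' : g_sigma_algebraType H => h (w, w'))).
  by apply/measurable_EFinP; exact: (measurableT_comp mh (pair1_measurable (w : g_sigma_algebraType G))).
rewrite /PH (integral_pushforward (measurable_id sH) mhw)//=; last exact: ihw.
by rewrite fineK//; apply: integrable_fin_num.
Qed.

Lemma msr_inner : msr G (fun w => Ex P (fun w' => h (w, w'))).
Proof.
have := measurable_fubini_F ihp; rewrite /fubini_F /=.
by under eq_fun do rewrite inner; move/measurable_EFinP.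
Qed.

(** Independence of G and H says that the law of w -> (w, w) on the product of (Omega, G) and
    (Omega, H) is the product of the two restrictions of P. Fubini for this product is the freezing
    lemma: the G-measurable argument is held fixed while the other is averaged, without conditional
    expectations. *)
Lemma indep_fubini : Ex P (fun w => h (w, w)) = Ex P (fun w => Ex P (fun w' => h (w, w'))).
Proof.
apply: EFin_inj.
have E1 : (Ex P (fun w => h (w, w)))%:E = (\int[(PG \x PH)%E]_z (h z)%:E)%E.
  rewrite (eq_measure_integral (distribution P dg)); last first.
    by move=> A mA _; exact: eq_diag.
  have mE : measurable_fun setT (EFin \o (h : g_sigma_algebraType G * g_sigma_algebraType H -> R)).
    exact/measurable_EFinP.
  by rewrite (integral_pushforward measurable_diag mE)//= fineK//; apply: integrable_fin_num.
have := integrable_fubini_F ihp; have := integral12_prod_meas1 ihp.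
rewrite /fubini_F /=; under eq_integral do rewrite inner.
rewrite E1 => <-; under [X in integrable _ _ X -> _]eq_fun do rewrite inner.
move=> ii.
have mi : measurable_fun setT (EFin \o (fun w : g_sigma_algebraType G => Ex P (fun w' => h (w, w')))).
  by apply/measurable_EFinP; exact: msr_inner.
have iP : P.-integrable setT (EFin \o (fun w => Ex P (fun w' => h (w, w')))).
  apply/integrableP; split; first by apply/measurable_EFinP; apply: (msr_measurable_fun sG msr_inner).
  move/integrableP : ii => [_].
  rewrite /PG (ge0_integral_pushforward (measurable_id sG) P)//=.
  by apply/measurable_EFinP; apply: measurableT_comp => //; exact: msr_inner.
rewrite (integral_pushforward (measurable_id sG) mi)//=.
by rewrite fineK//; apply: integrable_fin_num.
Qed.

End fubini.

Lemma indep_mul G H f g : subalg G -> subalg H -> independent_pair P G H ->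
  LG P G f -> LG P H g -> Ex P (fun w => f w * g w) = Ex P f * Ex P g.
Proof.
move=> sG sH GH hf hg.
have mf : LG P measurable f by apply: LG_sub hf; case: sG.
have mg : LG P measurable g by apply: LG_sub hg; case: sH.
have sM := @subalg_measurable disp Omega.
have sf := LG_integrable sM mf.
rewrite (@indep_fubini G H sG sH GH (fun z => f z.1 * g z.2)) /=.
- under eq_fun do rewrite (ExZ sM)//.
  under eq_fun do rewrite mulrC.
  by rewrite (ExZ sM)// mulrC.
- apply: measurable_funM.
  + have hf' : measurable_fun setT (f : g_sigma_algebraType G -> R) := LG_msr hf.
    exact: (measurableT_comp hf' measurable_fst).
  + have hg' : measurable_fun setT (g : g_sigma_algebraType H -> R) := LG_msr hg.
    exact: (measurableT_comp hg' measurable_snd).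
- by apply: (LG_integrable sM); apply: LGM.
- by move=> w; apply: (LG_integrable sM); apply: LGZ.
Qed.

(** Positive and negative parts are compared separately, so the equality of expectations requires no
    integrability; integrability is transported as well. *)
Lemma law_unique (E : pointedType) (C : set (set E)) (V1 V2 : Omega -> E) :
  setI_closed C -> C setT ->
  (forall B, C B -> measurable (V1 @^-1` B)) -> (forall B, C B -> measurable (V2 @^-1` B)) ->
  (forall B, C B -> P (V1 @^-1` B) = P (V2 @^-1` B)) ->
  forall f : E -> R, msr C f -> Ex P (f \o V1) = Ex P (f \o V2) /\
    (P.-integrable setT (EFin \o (f \o V1)) -> P.-integrable setT (EFin \o (f \o V2))).
Proof.
move=> IC CT m1 m2 H f mf.
have mV V : (forall B, C B -> measurable (V @^-1` B)) ->
    @measurable_fun _ _ Omega (g_sigma_algebraType C) setT V.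
  move=> hV _ B mB; rewrite setTI.
  by apply: (@preimage_generated Omega E) mB => //; exact: sigma_algebra_measurable.
pose W V hV : {mfun Omega >-> g_sigma_algebraType C} :=
  MeasurableFun.Pack (MeasurableFun.Class (isMeasurableFun.Build _ _ _ _ _ (mV V hV))).
have eqd A : measurable A -> distribution P (W V1 m1) A = distribution P (W V2 m2) A.
  move=> mA; apply: (@measure_unique _ R (g_sigma_algebraType C) C (fun _ => setT)) => //.
  - by rewrite bigcup_const//; exists 0%N.
  - by move=> k; rewrite -ge0_fin_numE//; exact: fin_num_measure.
have key (g : g_sigma_algebraType C -> \bar R) : measurable_fun setT g -> (forall x, (0 <= g x)%E) ->
   (\int[P]_w g (V1 w) = \int[P]_w g (V2 w))%E.
  move=> mg g0.
  rewrite -(@ge0_integral_pushforward _ _ _ _ _ _ (mV _ m1) P setT g)//=.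
  rewrite -(@ge0_integral_pushforward _ _ _ _ _ _ (mV _ m2) P setT g)//=.
  exact: (@eq_measure_integral _ _ _ setT (distribution P (W _ m2)) (distribution P (W _ m1)) g (fun A mA _ => eqd A mA)).
have mf' : measurable_fun setT (f : g_sigma_algebraType C -> R) := mf.
split; last first.
  move=> /integrableP[_ fin]; apply/integrableP; split.
    by apply/measurable_EFinP; exact: (measurableT_comp mf' (mV _ m2)).
  move: fin; rewrite (key (fun x => `|(f x)%:E|%E))//.
  by apply: measurableT_comp => //; exact/measurable_EFinP.
rewrite /Ex /Rintegral; congr fine; rewrite [LHS]integralE [RHS]integralE.
have mfe : measurable_fun setT (EFin \o f : g_sigma_algebraType C -> \bar R) by exact/measurable_EFinP.
have pE (V : Omega -> E) : (fun x => ((f \o V) x)%:E)^\+%E = (EFin \o f)^\+%E \o V.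
  by apply/funext => x; rewrite /= !funeposE.
have nE (V : Omega -> E) : (fun x => ((f \o V) x)%:E)^\-%E = (EFin \o f)^\-%E \o V.
  by apply/funext => x; rewrite /= !funenegE.
rewrite !pE !nE; congr (_ - _)%E.
  exact: (key ((EFin \o f)^\+)%E (measurable_funepos mfe) (funepos_ge0 _)).
exact: (key ((EFin \o f)^\-)%E (measurable_funeneg mfe) (funeneg_ge0 _)).
Qed.

End Independence.

(** * Elementary inequalities and discrete Gronwall *)

Section RealInequalities.
Variable R : realType.
Implicit Types a b s x y : R.

(** Binomial expansion to first order: every later term contains s at least twice, and s <= 1. With
    s the square root of a time step the remainder is of the order of the step. *)
Lemma pow_expand a y s q : 0 <= s <= 1 ->
  (a + s * y) ^+ q <= a ^+ q + q%:R * a ^+ q.-1 * (s * y) + s ^+ 2 * (`|a| + `|y|) ^+ q.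
Proof.
move=> /andP[s0 s1]; case: q => [|[|q]] /=.
- by rewrite !expr0 !mul0r addr0 mulr1 lerDl sqr_ge0.
- by rewrite !expr1 expr0 !mul1r lerDl mulr_ge0 ?sqr_ge0// addr_ge0.
set B := (_ + `|y|) ^+ _.
have HB : \sum_(i < q.+1) (`|a| ^+ (q.+2 - (1 + (1 + i))) *
   `|y| ^+ (1 + (1 + i))) *+ 'C(q.+2, 1 + (1 + i)) <= B.
  rewrite /B exprDn [leRHS]big_ord_recl [X in _ <= _ + X]big_ord_recl /= addrA lerDr addr_ge0// mulrn_wge0// mulr_ge0// exprn_ge0//.
rewrite [leLHS]exprDn [leLHS]big_ord_recl [X in _ + X <= _]big_ord_recl /= /bump /= !subn0 bin0 bin1 !expr0 !expr1 !mulr1 mulr1n.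
rewrite subn1 /= addrA lerD//; first by rewrite lerD2l mulr_natl mulrnAl.
apply: le_trans (ler_wpM2l (sqr_ge0 s) HB).
rewrite mulr_sumr; apply: ler_sum => i _; rewrite mulrnAr lerMn2r; apply/orP; right.
rewrite (le_trans (ler_norm _))// normrM normrX exprMn normrM [leRHS]mulrCA ler_wpM2l ?exprn_ge0//.
rewrite !normrX ler_wpM2r ?exprn_ge0// ger0_norm// addnA exprD.
by rewrite ler_piMr ?exprn_ge0// exprn_ile1.
Qed.

(** Convexity of the q-th power on the half-line: the graph lies above its tangent at a. With a = 1
    it is the classical Bernoulli inequality. *)
Lemma bernoulli a x q : 0 <= a -> 0 <= a + x -> a ^+ q + q%:R * a ^+ q.-1 * x <= (a + x) ^+ q.
Proof.
move=> a0 ax; elim: q => [|q IH]; first by rewrite !expr0 !mul0r addr0.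
rewrite [leRHS]exprS; apply: le_trans (ler_wpM2l ax IH).
rewrite /=; case: q {IH} => [|q] /=; first by rewrite !expr0 expr1; lra.
have : 0 <= q.+1%:R * a ^+ q * x ^+ 2 by rewrite mulr_ge0 ?sqr_ge0// mulr_ge0// exprn_ge0.
rewrite -(natr1 q.+1) !exprS expr0 mulr1; set c := a ^+ q; set k := q.+1%:R => h.
rewrite -subr_ge0; apply: le_trans h _; rewrite le_eqVlt; apply/orP; left; apply/eqP; ring.
Qed.

Lemma pow_sum_le (n : nat) (q : nat) (x : nat -> R) : (forall i, 0 <= x i) ->
  (\sum_(i < n) x i) ^+ q.+1 <= n%:R ^+ q * \sum_(i < n) x i ^+ q.+1.
Proof.
move=> x0; case: n => [|n]; first by rewrite !big_ord0 mulr0 expr0n.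
set S := \sum_(i < n.+1) x i; pose N : R := n.+1%:R.
have N0 : 0 < N by rewrite ltr0n.
have S0 : 0 <= S by apply: sumr_ge0 => i _.
(* the tangent of t^(q+1) at the mean S/N, summed over i *)
have H i : (S / N) ^+ q.+1 + q.+1%:R * (S / N) ^+ q * (x i - S / N) <= x i ^+ q.+1.
  have := @bernoulli (S / N) (x i - S / N) q.+1 _ _; rewrite addrC subrK; apply => //.
  by rewrite divr_ge0// ltW.
have := @ler_sum _ _ (index_enum 'I_n.+1) xpredT _ _ (fun i _ => H i).
rewrite big_split /= -mulr_sumr big_split /= -/S !sumr_const card_ord.
rewrite -[X in _ * (_ + X)]mulr_natl mulrN mulrCA divff ?gt_eqF// mulr1 subrr mulr0 addr0.
move=> h; rewrite -(ler_pM2l (_ : 0 < N^-1 ^+ q)) ?exprn_gt0 ?invr_gt0//.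
rewrite mulrA -exprMn mulVf ?gt_eqF// expr1n mul1r; apply: le_trans h.
rewrite -mulr_natl expr_div_n -/N !exprS exprVn.
have Nn : N != 0 by rewrite gt_eqF.
have Nq : N ^+ q != 0 by rewrite expf_neq0.
clearbody N; rewrite le_eqVlt; apply/orP; left; apply/eqP; field.
by rewrite ?Nn ?Nq.
Qed.

Lemma pow3_le a b c q : 0 <= a -> 0 <= b -> 0 <= c ->
  (a + b + c) ^+ q.+1 <= 3 ^+ q * (a ^+ q.+1 + b ^+ q.+1 + c ^+ q.+1).
Proof.
move=> a0 b0 c0; have := @pow_sum_le 3 q (fun i => nth 0 [:: a; b; c] i).
rewrite !big_ord_recl !big_ord0 /= !addr0 !addrA; apply.
by case=> [|[|[|i]]] //=; rewrite nth_default.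
Qed.

(** The induction carries exp(K times the elapsed time), since 1 + K eta <= exp(K eta); only at the
    end is the elapsed time bounded by 1. *)
Lemma discrete_gronwall (a b eta : nat -> R) (K : R) (N : nat) : 0 <= K ->
  (forall n, 0 <= eta n) -> (forall n, 0 <= b n) -> \sum_(i < N) eta i <= 1 ->
  (forall n, (n < N)%N -> a n.+1 <= (1 + K * eta n) * a n + eta n * b n) ->
  0 <= a 0%N ->
  forall n, (n <= N)%N -> a n <= expR K * (a 0%N + \sum_(i < n) eta i * b i).
Proof.
move=> K0 e0 b0 Ne H a00.
have S0 n : 0 <= a 0%N + \sum_(i < n) eta i * b i.
  by rewrite addr_ge0// sumr_ge0// => i _; rewrite mulr_ge0.
have step n : (n <= N)%N ->
    a n <= expR (K * \sum_(i < n) eta i) * (a 0%N + \sum_(i < n) eta i * b i).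
  elim: n => [|n IH] nN; first by rewrite !big_ord0 mulr0 expR0 mul1r addr0.
  apply: le_trans (H _ nN) _.
  rewrite !big_ord_recr /= addrA [leRHS]mulrDr lerD//.
    rewrite [X in expR X]mulrDr expRD [X in _ <= X * _]mulrC -mulrA.
    apply: (@le_trans _ _ ((1 + K * eta n) *
        (expR (K * \sum_(i < n) eta i) * (a 0%N + \sum_(i < n) eta i * b i)))).
      by rewrite ler_wpM2l ?addr_ge0 ?mulr_ge0//; exact/IH/ltnW.
    by rewrite ler_wpM2r ?expR_ge1Dx// mulr_ge0 ?expR_ge0.
  rewrite ler_peMl ?mulr_ge0//; apply: le_trans (expR_ge1Dx _).
  by rewrite lerDl mulr_ge0// addr_ge0// sumr_ge0.
move=> n nN; apply: le_trans (step n nN) _; rewrite ler_wpM2r// ler_expR ler_piMr//.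
apply: le_trans Ne; rewrite -(subnKC nN) big_split_ord /= lerDl sumr_ge0//.
Qed.

End RealInequalities.

(** * Vector-valued variables and locally Lipschitz maps *)

Lemma lipschitz_continuous (R : realType) n k (h : 'M[R]_(n, k) -> R) K q : 0 <= K ->
  (forall x y, `|h x - h y| <= K * (1 + enorm x + enorm y) ^+ q * enorm (x - y)) ->
  continuous h.
Proof.
move=> K0 Kh x; apply/(@cvgrPdist_lt _ _ _ _ (@nbhs_filter _ x)) => e e0.
pose M := K * (2 + 2 * enorm x) ^+ q + 1.
have M1 : 0 < M by rewrite ltr_wpDl// mulr_ge0// exprn_ge0// addr_ge0// mulr_ge0.
pose r := Num.min 1 (e / M).
have r0 : 0 < r by rewrite lt_min ltr01 divr_gt0.
have e1 : 0 < r / ((n * k)%:R + 1) by rewrite divr_gt0// ltr_wpDl.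
have : \forall y \near x, `|x - y| < r / ((n * k)%:R + 1).
  by apply/nbhs_ballP; exists (r / ((n * k)%:R + 1)) => //= y; rewrite -ball_normE.
apply: filterS => y xy.
have xyr : enorm (x - y) < r.
  apply: le_lt_trans (enorm_le_norm _) _.
  apply: (@le_lt_trans _ _ (((n * k)%:R + 1) * `|x - y|)); first by rewrite ler_wpM2r// lerDl.
  by rewrite mulrC -ltr_pdivlMr// ltr_wpDl.
have xy1 : enorm (x - y) < 1 by rewrite (lt_le_trans xyr)// /r ge_min lexx.
have xye : enorm (x - y) < e / M by rewrite (lt_le_trans xyr)// /r ge_min lexx orbT.
have yx : enorm y <= 1 + enorm x.
  by have := ler_enormD (y - x) x; rewrite subrK (enormB y x); lra.
apply: le_lt_trans (Kh x y) _.
apply: (@le_lt_trans _ _ (M * enorm (x - y))); last by rewrite mulrC -ltr_pdivlMr.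
rewrite ler_wpM2r// /M ler_wpDr// ler_wpM2l// lerXn2r// ?nnegrE ?addr_ge0 ?mulr_ge0//.
by lra.
Qed.

Lemma enorm_continuous (R : realType) n k : continuous (@enorm R n k).
Proof.
apply: (@lipschitz_continuous _ _ _ _ 1 0) => // x y; rewrite expr0 mulr1 mul1r ler_distl.
have := ler_enormD (x - y) y; have := ler_enormD (y - x) x.
by rewrite !subrK (enormB y x); lra.
Qed.

Section VectorLG.
Context (R : realType) (disp : measure_display) (Omega : measurableType disp)
  (P : probability Omega R) (G : set (set Omega)).
Hypothesis sG : subalg G.

Definition VLG n k (Y : Omega -> 'M[R]_(n, k)) := forall i j, LG P G (fun w => Y w i j).

Lemma msr_enorm n k (Y : Omega -> 'M[R]_(n, k)) :
  (forall i j, msr G (fun w => Y w i j)) -> msr G (fun w => enorm (Y w)).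
Proof.
by move=> mY; apply: (msr_cont (g := enorm)) => //; [case: sG|exact: enorm_continuous].
Qed.

Lemma LG_enorm n k (Y : Omega -> 'M[R]_(n, k)) : VLG Y -> LG P G (fun w => enorm (Y w)).
Proof.
move=> hY; apply: (@LG_dom _ _ _ _ _ sG (fun w => \sum_i \sum_j `|Y w i j|)).
- by apply: msr_enorm => i j; exact: LG_msr (hY i j).
- by move=> w; rewrite ger0_norm//; exact: enorm_le_entries.
- by apply: LG_sum => // i _; apply: LG_sum => // j _; apply: LG_norm => //; exact: hY.
Qed.

Lemma VLG_dom n k (Y : Omega -> 'M[R]_(n, k)) f : (forall i j, msr G (fun w => Y w i j)) ->
  LG P G f -> (forall w, enorm (Y w) <= f w) -> VLG Y.
Proof.
move=> mY hf Yf i j; apply: (@LG_dom _ _ _ _ _ sG f) => // w.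
by apply: le_trans (Yf w); exact: enorm_entry.
Qed.

Lemma VLGD n k (Y Z : Omega -> 'M[R]_(n, k)) : VLG Y -> VLG Z -> VLG (fun w => Y w + Z w).
Proof. by move=> hY hZ i j; under eq_fun do rewrite mxE; exact: LGD. Qed.

Lemma VLGZ n k a (Y : Omega -> 'M[R]_(n, k)) : LG P G a -> VLG Y -> VLG (fun w => a w *: Y w).
Proof. by move=> ha hY i j; under eq_fun do rewrite mxE; exact: LGM. Qed.

Lemma VLGZc n k (a : R) (Y : Omega -> 'M[R]_(n, k)) : VLG Y -> VLG (fun w => a *: Y w).
Proof. by apply: (@VLGZ _ _ (cst a)); exact: LG_cst. Qed.

Lemma VLGN n k (Y : Omega -> 'M[R]_(n, k)) : VLG Y -> VLG (fun w => - Y w).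
Proof. by move=> hY i j; under eq_fun do rewrite mxE; exact: LGN. Qed.

Lemma VLGB n k (Y Z : Omega -> 'M[R]_(n, k)) : VLG Y -> VLG Z -> VLG (fun w => Y w - Z w).
Proof. by move=> hY hZ; apply: VLGD => //; exact: VLGN. Qed.

Lemma VLG_cst n k (A : 'M[R]_(n, k)) : VLG (cst A).
Proof. by move=> i j; exact: LG_cst. Qed.

Lemma VLG_mulmx n k l (Y : Omega -> 'M[R]_(n, k)) (Z : Omega -> 'M[R]_(k, l)) :
  VLG Y -> VLG Z -> VLG (fun w => Y w *m Z w).
Proof.
move=> hY hZ i j; under eq_fun do rewrite mxE.
by apply: LG_sum => // c _; exact: LGM.
Qed.

Lemma VLG_tr n k (Y : Omega -> 'M[R]_(n, k)) : VLG Y -> VLG (fun w => (Y w)^T).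
Proof. by move=> hY i j; under eq_fun do rewrite mxE. Qed.

Lemma LG_mdot n k (Y Z : Omega -> 'M[R]_(n, k)) : VLG Y -> VLG Z ->
  LG P G (fun w => mdot (Y w) (Z w)).
Proof. by move=> hY hZ; apply: LG_sum => // i _; apply: LG_sum => // j _; exact: LGM. Qed.

(** Polynomial growth of the Lipschitz constant is what keeps compositions within the variables with
    all moments. *)
Definition locally_lipschitz (n k n' k' : nat) (g : 'M[R]_(n, k) -> 'M[R]_(n', k')) :=
  exists K q, 0 <= K /\
   forall x y, enorm (g x - g y) <= K * (1 + enorm x + enorm y) ^+ q * enorm (x - y).

Lemma VLG_comp n k n' k' (g : 'M[R]_(n, k) -> 'M[R]_(n', k')) (Y : Omega -> 'M[R]_(n, k)) :
  locally_lipschitz g -> VLG Y -> VLG (fun w => g (Y w)).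
Proof.
move=> [K [q [K0 Kg]]] hY.
have cg i j : continuous (fun x => g x i j).
  apply: (lipschitz_continuous K0) => x y; apply: le_trans (Kg x y).
  by have := enorm_entry (g x - g y) i j; rewrite !mxE.
apply: (@VLG_dom _ _ _ (fun w => enorm (g 0) + K * (1 + enorm (Y w)) ^+ q * enorm (Y w))).
- move=> i j; apply: (msr_cont (g := fun x => g x i j)) => //; first by case: sG.
  by move=> i' j'; exact: LG_msr (hY i' j').
- have hE := LG_enorm hY.
  apply: LGD => //; first exact: LG_cst.
  by apply: LGM => //; apply: LGZ => //; apply: LG_pow => //; apply: LGD => //; exact: LG_cst.
- move=> w; have := Kg (Y w) 0; rewrite enorm0 addr0 subr0 => h.
  have := ler_enormD (g (Y w) - g 0) (g 0); rewrite subrK => h'.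
  by apply: le_trans h' _; rewrite addrC lerD2l.
Qed.

End VectorLG.

Lemma VLG_sub (R : realType) (disp : measure_display) (Omega : measurableType disp)
  (P : probability Omega R) (G H : set (set Omega)) n k (Y : Omega -> 'M[R]_(n, k)) :
  G `<=` H -> VLG P G Y -> VLG P H Y.
Proof. by move=> GH hY i j; apply: LG_sub (hY i j). Qed.

(** * One step with an independent increment *)

Section Increments.
Context (R : realType) (disp : measure_display) (Omega : measurableType disp)
  (P : probability Omega R).
Variables (d m : nat).

(* The abstract properties of a Brownian increment over a time step of
   relative length [eta]: [G] is the past and [H] the future sigma-algebra. *)
Record incr (C : nat -> R) (eta : R) (G H : set (set Omega)) (D : Omega -> 'cV[R]_m) := {
  incr_past : subalg G;
  incr_future : subalg H;
  incr_sub : G `<=` H;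
  incr_VLG : VLG P H D;
  incr_indep : independent_pair P G (preimage_sigma D);
  incr_mean : forall i, Ex P (fun w => D w i 0) = 0;
  incr_moment : forall n, Ex P (fun w => enorm (D w) ^+ (2 * n)) <= C n * eta ^+ n }.

Variables (C : nat -> R) (eta : R) (G H : set (set Omega)) (D : Omega -> 'cV[R]_m).
Hypothesis hD : incr C eta G H D.

Let sG := incr_past hD.
Let sH := incr_future hD.

Lemma subalg_preimage_sigma : subalg (preimage_sigma D).
Proof.
have mD : borel_measurable H D.
  apply/borel_measurable_entries; first by case: sH.
  by move=> i j; exact: LG_msr (incr_VLG hD i j).
split; last by move=> A /mD; case: sH => _; apply.
have sB := smallest_sigma_algebra setT (@open 'cV[R]_m).
split.
- by exists set0; rewrite ?preimage_set0//; case: sB.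
- move=> _ [B bB <-]; exists (~` B); last by rewrite preimage_setC setTD.
  by rewrite -setTD; case: sB => _ + _; apply.
- move=> A hA.
  have /choice[B HB] : forall k, exists B, borel_sets B /\ D @^-1` B = A k.
    by move=> k; have [B bB BA] := hA k; exists B.
  exists (\bigcup_k B k); last by rewrite preimage_bigcup; apply: eq_bigcupr => k _; case: (HB k).
  by case: sB => _ _; apply => k; case: (HB k).
Qed.

Let sS := subalg_preimage_sigma.

Lemma VLG_preimage_sigma : VLG P (preimage_sigma D) D.
Proof.
move=> i j; split; last by case: (incr_VLG hD i j).
by move: i j; apply/borel_measurable_entries => //; case: sS.
Qed.

Lemma Ex_incr0 (U : Omega -> 'cV[R]_m) : VLG P G U ->
  Ex P (fun w => mdot (U w) (D w)) = 0.
Proof.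
move=> hU; rewrite /mdot.
have hS i j : LG P H (fun w => U w i j * D w i j).
  by apply: LGM => //; [apply: LG_sub (hU i j); exact: incr_sub hD|exact: incr_VLG hD i j].
rewrite (Ex_sum sH) => [|i _]; last by apply: LG_sum.
rewrite big1// => i _; rewrite (Ex_sum sH)// big1// => j _.
rewrite (indep_mul sG sS (incr_indep hD) (hU i j) (VLG_preimage_sigma i j)).
by rewrite ord1 (incr_mean hD) mulr0.
Qed.

Lemma Ex_incr_mul (f : Omega -> R) n : LG P G f ->
  Ex P (fun w => f w * enorm (D w) ^+ n) = Ex P f * Ex P (fun w => enorm (D w) ^+ n).
Proof.
move=> hf; apply: (indep_mul sG sS (incr_indep hD)) => //.
by apply: LG_pow => //; apply: LG_enorm => //; exact: VLG_preimage_sigma.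
Qed.

Section step.
Variables (A : Omega -> 'cV[R]_d) (B : Omega -> 'M[R]_(d, m)).
Hypotheses (hA : VLG P G A) (hB : VLG P G B).

Let hA' := VLG_sub (incr_sub hD) hA.
Let hB' := VLG_sub (incr_sub hD) hB.

Lemma VLG_step : VLG P H (fun w => A w + B w *m D w).
Proof. by apply: VLGD => //; apply: VLG_mulmx => //; exact: incr_VLG hD. Qed.

Lemma mdot_mulmx (a : 'cV[R]_d) (b : 'M[R]_(d, m)) (x : 'cV[R]_m) :
  mdot a (b *m x) = mdot (b^T *m a) x.
Proof.
rewrite /mdot; under eq_bigr do rewrite big_ord1 mxE mulr_sumr.
under [RHS]eq_bigr do rewrite big_ord1 mxE mulr_suml.
rewrite exchange_big; apply: eq_bigr => i _; apply: eq_bigr => j _.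
by rewrite !mxE; ring.
Qed.

Lemma Ex_cross0 (f : Omega -> R) : LG P G f ->
  Ex P (fun w => f w * mdot (A w) (B w *m D w)) = 0.
Proof.
move=> hf; rewrite -[RHS](@Ex_incr0 (fun w => f w *: ((B w)^T *m A w))).
  by apply: eq_Ex => w; rewrite mdotZl mdot_mulmx.
by apply: VLGZ => //; apply: VLG_mulmx => //; exact: VLG_tr.
Qed.

Lemma pow_young (x y : R) k l : 0 <= x -> 0 <= y ->
  x ^+ k * y ^+ l <= x ^+ (k + l) + y ^+ (k + l).
Proof.
move=> x0 y0; rewrite !exprD; have [xy|/ltW yx] := leP x y.
  rewrite (@le_trans _ _ (y ^+ k * y ^+ l))//; last by rewrite lerDr mulr_ge0// exprn_ge0.
  by rewrite ler_wpM2r ?exprn_ge0// lerXn2r.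
rewrite (@le_trans _ _ (x ^+ k * x ^+ l))//; last by rewrite lerDl mulr_ge0// exprn_ge0.
by rewrite ler_wpM2l ?exprn_ge0// lerXn2r.
Qed.

(** q C_1 comes from the second-order term of the expansion below, 4^q (1 + C_q) from its
    remainder. *)
Definition step_cst q := q%:R * C 1%N + 4 ^+ q * (1 + C q).

(** The q-th power of |A + B D|^2 is expanded around |A|^2: the term linear in D is centred given
    the past, and everything else is of the order of eta. *)
Lemma one_step_moment q : 0 < eta <= 1 -> 0 <= C q -> 0 <= C 1%N ->
  Ex P (fun w => enorm (A w + B w *m D w) ^+ (2 * q)) <=
  (1 + step_cst q * eta) * Ex P (fun w => enorm (A w) ^+ (2 * q))
   + step_cst q * eta * Ex P (fun w => enorm (B w) ^+ (2 * q)).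
Proof.
move=> /andP[e0 e1] Cq C1.
pose s := Num.sqrt eta.
have s0 : 0 < s by rewrite sqrtr_gt0.
have s2 : s ^+ 2 = eta by rewrite sqr_sqrtr// ltW.
have s1 : 0 <= s <= 1 by rewrite ltW//= -[leRHS]sqrtr1 ler_sqrt.
pose a w := enorm (A w) ^+ 2; pose b w := enorm (B w) ^+ 2.
pose z w := enorm (D w) ^+ 2 / eta.
(* The increment of the squared norm in units of sqrt eta. It is of order 1, since |D|^2 / eta = [z]
   has bounded moments, so [pow_expand] with s = sqrt eta leaves a remainder of order eta. *)
pose y w := (2 * mdot (A w) (B w *m D w) + enorm (B w *m D w) ^+ 2) / s.
have yb w : `|y w| <= a w + 2 * b w * z w.
  rewrite /y normrM [X in _ * X]gtr0_norm ?invr_gt0// ler_pdivrMr//.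
  apply: (@le_trans _ _ (2 * (enorm (A w) * (enorm (B w) * enorm (D w)))
      + (enorm (B w) * enorm (D w)) ^+ 2)).
    rewrite (le_trans (ler_normD _ _))// lerD//.
      rewrite normrM ger0_norm// ler_wpM2l// (le_trans (le_norm_mdot _ _))//.
      by rewrite ler_wpM2l// enorm_mulmx.
    by rewrite ger0_norm ?sqr_ge0// lerXn2r ?nnegrE ?mulr_ge0// enorm_mulmx.
  pose t := enorm (D w) / s.
  have tz : z w = t ^+ 2 by rewrite /z /t expr_div_n s2.
  have -> : enorm (D w) = s * t by rewrite /t mulrC divfK ?gt_eqF.
  have t0 : 0 <= t by rewrite divr_ge0// ltW.
  rewrite tz /a /b; set x := enorm (A w); set v := enorm (B w).
  have s1' : s <= 1 by case/andP: s1.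
  have h1 : 0 <= (x - v * t) ^+ 2 by exact: sqr_ge0.
  have h2 : 0 <= (v * t) ^+ 2 by exact: sqr_ge0.
  have : 0 <= s * (1 - s) * (v * t) ^+ 2 by rewrite mulr_ge0 ?sqr_ge0// mulr_ge0 ?subr_ge0// ltW.
  have : 0 <= s * (x - v * t) ^+ 2 by rewrite mulr_ge0 ?sqr_ge0// ltW.
  by rewrite !expr2; nra.
have a0 w : 0 <= a w by exact: sqr_ge0.
have b0 w : 0 <= b w by exact: sqr_ge0.
have z0 w : 0 <= z w by rewrite /z divr_ge0 ?sqr_ge0// ltW.
have hea : LG P G (fun w => enorm (A w)) by exact: LG_enorm.
have heb : LG P G (fun w => enorm (B w)) by exact: LG_enorm.
have hea' := LG_sub (incr_sub hD) hea; have heb' := LG_sub (incr_sub hD) heb.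
have hed : LG P H (fun w => enorm (D w)) by apply: LG_enorm => //; exact: incr_VLG hD.
have hAq : LG P G (fun w => enorm (A w) ^+ (2 * q)) by exact: LG_pow.
have hBq : LG P G (fun w => enorm (B w) ^+ (2 * q)) by exact: LG_pow.
have hAq' := LG_sub (incr_sub hD) hAq; have hBq' := LG_sub (incr_sub hD) hBq.
have hBDq : LG P H (fun w => enorm (B w) ^+ (2 * q) * enorm (D w) ^+ (2 * q)).
  by apply: LGM => //; exact: LG_pow.
have hcross : LG P H (fun w => enorm (A w) ^+ (2 * q.-1) * mdot (A w) (B w *m D w)).
  apply: LGM => //; first exact: LG_pow.
  by apply: LG_mdot => //; apply: VLG_mulmx => //; exact: incr_VLG hD.
have hsq : LG P H (fun w => (enorm (A w) ^+ (2 * q.-1) * enorm (B w) ^+ 2) * enorm (D w) ^+ 2).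
  by apply: LGM => //; [apply: LGM => //|]; exact: LG_pow.
have pointwise w : enorm (A w + B w *m D w) ^+ (2 * q) <=
    (enorm (A w) ^+ (2 * q) + (2 * q%:R) * (enorm (A w) ^+ (2 * q.-1) * mdot (A w) (B w *m D w)))
    + (q%:R * ((enorm (A w) ^+ (2 * q.-1) * enorm (B w) ^+ 2) * enorm (D w) ^+ 2)
    + (eta * 4 ^+ q * enorm (A w) ^+ (2 * q)
    + (eta * 4 ^+ q / eta ^+ q) * (enorm (B w) ^+ (2 * q) * enorm (D w) ^+ (2 * q)))).
  rewrite exprM sqr_enormD -addrA.
  have -> : enorm (A w) ^+ 2 + (2 * mdot (A w) (B w *m D w) + enorm (B w *m D w) ^+ 2)
     = a w + s * y w by rewrite /y mulrCA divff ?gt_eqF// mulr1.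
  apply: le_trans (pow_expand _ _ _ s1) _; rewrite s2 (ger0_norm (a0 w)).
  have -> : s * y w = 2 * mdot (A w) (B w *m D w) + enorm (B w *m D w) ^+ 2.
    by rewrite /y mulrCA divff ?gt_eqF// mulr1.
  have E1 : (a w + `|y w|) ^+ q <= 4 ^+ q * (enorm (A w) ^+ (2 * q)
      + enorm (B w) ^+ (2 * q) * enorm (D w) ^+ (2 * q) / eta ^+ q).
    apply: (@le_trans _ _ ((2 * (a w + b w * z w)) ^+ q)).
      have bz : 0 <= b w * z w by rewrite mulr_ge0.
      have hh : a w + `|y w| <= 2 * (a w + b w * z w) by have := yb w; have := a0 w; lra.
      have l0 : 0 <= a w + `|y w| by rewrite addr_ge0.
      by rewrite lerXn2r ?nnegrE//; apply: le_trans hh.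
    have four : (4 : R) ^+ q = 2 ^+ q * 2 ^+ q by rewrite -exprMn; congr (_ ^+ _); ring.
    rewrite exprMn four -mulrA ler_wpM2l ?exprn_ge0//.
    apply: le_trans (pow2D q (a0 w) (mulr_ge0 (b0 w) (z0 w))) _.
    have zq : z w ^+ q = enorm (D w) ^+ (2 * q) / eta ^+ q by rewrite /z expr_div_n -exprM.
    by rewrite [(b w * z w) ^+ q]exprMn zq /a /b -!exprM mulrA.
  have E2 : enorm (B w *m D w) ^+ 2 <= enorm (B w) ^+ 2 * enorm (D w) ^+ 2.
    by rewrite -exprMn lerXn2r ?nnegrE ?mulr_ge0// enorm_mulmx.
  have EAw : enorm (A w) ^+ (2 * q) = a w ^+ q by rewrite exprM.
  rewrite EAw in E1 *.
  have -> : enorm (A w) ^+ (2 * q.-1) = a w ^+ q.-1 by rewrite exprM.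
  have aq : 0 <= a w ^+ q.-1 by rewrite exprn_ge0.
  have := ler_wpM2l (mulr_ge0 (ler0n R q) aq) E2; have := ler_wpM2l (ltW e0) E1.
  move: (enorm (B w *m D w) ^+ 2) (mdot _ _) => X1 X2 h1 h2.
  set Y := _ * (a w + _) ^+ q in h1 *.
  move: h1 h2; set Z1 := enorm (B w) ^+ (2 * q); set Z2 := enorm (D w) ^+ (2 * q).
  set Z3 := a w ^+ q; set Z4 := a w ^+ q.-1; set Z5 := enorm (B w) ^+ 2; set Z6 := enorm (D w) ^+ 2.
  move=> h1 h2; nra.
have lgY : LG P H (fun w => (enorm (A w) ^+ (2 * q) + (2 * q%:R) * (enorm (A w) ^+ (2 * q.-1) * mdot (A w) (B w *m D w)))
    + (q%:R * ((enorm (A w) ^+ (2 * q.-1) * enorm (B w) ^+ 2) * enorm (D w) ^+ 2)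
    + (eta * 4 ^+ q * enorm (A w) ^+ (2 * q)
    + (eta * 4 ^+ q / eta ^+ q) * (enorm (B w) ^+ (2 * q) * enorm (D w) ^+ (2 * q))))).
  by do ?[apply: LGD => //]; apply: LGZ.
have hX : LG P H (fun w => enorm (A w + B w *m D w) ^+ (2 * q)).
  by apply: LG_pow => //; apply: LG_enorm => //; exact: VLG_step.
apply: le_trans (Ex_le sH hX lgY pointwise) _.
have hZ1 := LGZ sH (2 * q%:R) hcross; have hZ2 := LGZ sH q%:R hsq.
have hZ3 := LGZ sH (eta * 4 ^+ q) hAq'; have hZ4 := LGZ sH (eta * 4 ^+ q / eta ^+ q) hBDq.
rewrite (ExD sH (LGD sH hAq' hZ1) (LGD sH hZ2 (LGD sH hZ3 hZ4))).
rewrite (ExD sH hAq' hZ1) (ExD sH hZ2 (LGD sH hZ3 hZ4)) (ExD sH hZ3 hZ4).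
rewrite !(ExZ sH)// (Ex_cross0 (LG_pow _ hea)) mulr0 addr0.
rewrite (Ex_incr_mul _ (LGM sG (LG_pow _ hea) (LG_pow 2 heb))) (Ex_incr_mul _ hBq).
set EA := Ex P (fun w => enorm (A w) ^+ (2 * q)); set EB := Ex P (fun w => enorm (B w) ^+ (2 * q)).
set EC := Ex P (fun w => _ * _).
have EA0 : 0 <= EA by apply: Ex_ge0 => w; rewrite exprn_ge0.
have EB0 : 0 <= EB by apply: Ex_ge0 => w; rewrite exprn_ge0.
have EC0 : 0 <= EC by apply: Ex_ge0 => w; rewrite mulr_ge0// exprn_ge0.
have EC1 : q%:R * EC <= q%:R * (EA + EB).
  case: (q) @EA @EB @EC {EA0 EB0 EC0} hAq hBq => [|q'] EA EB EC hAq1 hBq1; first by rewrite !mul0r.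
  rewrite ler_wpM2l// -(ExD sG)//; apply: (Ex_le sG).
  - by apply: LGM => //; exact: LG_pow.
  - exact: LGD.
  - move=> w /=; have := @pow_young (a w) (b w) q' 1 (a0 w) (b0 w).
    by rewrite addn1 expr1 /a /b -!exprM.
have M1 := incr_moment hD 1; have Mq := incr_moment hD q; rewrite muln1 expr1 in M1.
have h1 : q%:R * (EC * Ex P (fun w => enorm (D w) ^+ 2)) <= q%:R * C 1%N * eta * (EA + EB).
  apply: (@le_trans _ _ (q%:R * EC * (C 1%N * eta))).
    by rewrite -mulrA ler_wpM2l// ler_wpM2l.
  rewrite (_ : q%:R * C 1%N * eta * (EA + EB) = q%:R * (EA + EB) * (C 1%N * eta)); last by ring.
  by rewrite ler_wpM2r// mulr_ge0// ltW.
have h2 : eta * 4 ^+ q / eta ^+ q * (EB * Ex P (fun w => enorm (D w) ^+ (2 * q)))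
    <= eta * 4 ^+ q * C q * EB.
  apply: (@le_trans _ _ (eta * 4 ^+ q / eta ^+ q * (EB * (C q * eta ^+ q)))).
    apply: ler_wpM2l; last exact: ler_wpM2l.
    by rewrite divr_ge0 ?mulr_ge0 ?exprn_ge0 ?ltW.
  have eq0 : eta ^+ q != 0 by rewrite expf_neq0// gt_eqF.
  by rewrite le_eqVlt; apply/orP; left; apply/eqP; field.
have p4 : 0 <= (4 ^+ q : R) by rewrite exprn_ge0.
have h3 : 0 <= eta * 4 ^+ q * C q * EA by rewrite !mulr_ge0// ltW.
have h4 : 0 <= eta * 4 ^+ q * EB by rewrite !mulr_ge0// ltW.
by rewrite /step_cst; lra.
Qed.

End step.
End Increments.

(** * Moments and maxima of discrete martingale transforms *)

Lemma measurable_fun_inv (R : realType) : measurable_fun setT (fun x : R => x^-1).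
Proof.
have -> : [set: R] = [set x | x != 0] `|` [set 0].
  by apply/seteqP; split => // x _ /=; have [->|] := eqVneq x 0; [right|left].
have o0 : open [set x : R | x != 0] by exact: open_neq.
apply/measurable_funU => //; first exact: open_measurable.
split; last exact: measurable_fun_set1.
apply: open_continuous_measurable_fun => // x; rewrite inE /= => x0.
exact: inv_continuous.
Qed.

Section Doob.
Context (R : realType) (disp : measure_display) (Omega : measurableType disp)
  (P : probability Omega R).
Variables (d m : nat).

Definition chain (C : nat -> R) (N : nat) (eta : nat -> R) (Gs : nat -> set (set Omega))
    (D : nat -> Omega -> 'cV[R]_m) :=
  forall n, (n < N)%N -> incr P C (eta n) (Gs n) (Gs n.+1) (D n).

Definition mart (B : nat -> Omega -> 'M[R]_(d, m)) (D : nat -> Omega -> 'cV[R]_m) n w :=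
  \sum_(i < n) B i w *m D i w.

Variables (C : nat -> R) (N : nat) (eta : nat -> R) (Gs : nat -> set (set Omega))
  (D : nat -> Omega -> 'cV[R]_m) (B : nat -> Omega -> 'M[R]_(d, m)).
Hypothesis hD : chain C N eta Gs D.
Hypothesis sG0 : subalg (Gs 0%N).

Lemma chain_subalg n : (n <= N)%N -> subalg (Gs n).
Proof. by case: n => // n nN; exact: incr_future (hD nN). Qed.

Lemma chain_sub i n : (i <= n <= N)%N -> Gs i `<=` Gs n.
Proof.
move=> /andP[]; elim: n => [|n IH]; first by rewrite leqn0 => /eqP -> _; exact: subset_refl.
rewrite leq_eqVlt => /orP[/eqP -> _|]; first exact: subset_refl.
rewrite ltnS => /IH h nN.
by apply: subset_trans (h (ltnW nN)) _; exact: incr_sub (hD nN).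
Qed.

Hypothesis hB : forall n, (n < N)%N -> VLG P (Gs n) (B n).

Lemma VLG_mart n : (n <= N)%N -> VLG P (Gs n) (mart B D n).
Proof.
elim: n => [|n IH] nN.
  by rewrite /mart; under eq_fun do rewrite big_ord0; exact: VLG_cst.
rewrite /mart; under eq_fun do rewrite big_ord_recr /=.
exact: (VLG_step (hD nN) (IH (ltnW nN)) (hB nN)).
Qed.

Let a n q := Ex P (fun w => enorm (mart B D n w) ^+ (2 * q)).

Lemma mart_moment q n : (n <= N)%N -> (forall n, (n < N)%N -> 0 < eta n <= 1) ->
  (forall n, 0 <= eta n) -> \sum_(i < N) eta i <= 1 -> (forall q, 0 <= C q) ->
  Ex P (fun w => enorm (mart B D n w) ^+ (2 * q.+1)) <= expR (step_cst C q.+1) *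
   \sum_(i < n) eta i * (step_cst C q.+1 * Ex P (fun w => enorm (B i w) ^+ (2 * q.+1))).
Proof.
move=> nN e01 e0 Se C0.
have K0 : 0 <= step_cst C q.+1.
  by rewrite /step_cst addr_ge0 ?mulr_ge0 ?exprn_ge0 ?addr_ge0.
have := @discrete_gronwall R (fun n => a n q.+1)
  (fun i => step_cst C q.+1 * Ex P (fun w => enorm (B i w) ^+ (2 * q.+1))) eta
  (step_cst C q.+1) N K0 e0.
have -> : a 0%N q.+1 = 0.
  rewrite /a /mart; under eq_Ex do rewrite big_ord0 enorm0 expr0n/=.
  exact: Ex_cst.
move=> H; have := H _ Se _ (lexx 0) n nN; under eq_bigr do rewrite /=; rewrite add0r.
apply.
  by move=> i; rewrite mulr_ge0// Ex_ge0// => w; rewrite exprn_ge0.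
move=> i iN; have := one_step_moment (hD iN) (VLG_mart (ltnW iN)) (hB iN) (e01 i iN) (C0 q.+1) (C0 1%N).
rewrite /a /mart; under [X in _ -> X <= _]eq_Ex do rewrite big_ord_recr /=.
by rewrite [X in _ -> _ <= _ + X]mulrA [X in _ -> _ <= _ + X * _]mulrC; apply.
Qed.

Fixpoint runmax (s : nat -> Omega -> R) n w : R :=
  if n is n'.+1 then Num.max (runmax s n' w) (s n w) else s 0%N w.

Lemma le_runmax (s : nat -> Omega -> R) n k w : (k <= n)%N -> s k w <= runmax s n w.
Proof.
elim: n => [|n IH]; first by rewrite leqn0 => /eqP ->.
rewrite leq_eqVlt => /orP[/eqP -> /=|]; first by rewrite le_max lexx orbT.
by rewrite ltnS => /IH h; rewrite /= le_max h.
Qed.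

Lemma LG_max G (f g : Omega -> R) : subalg G -> LG P G f -> LG P G g ->
  LG P G (fun w => Num.max (f w) (g w)).
Proof.
move=> sG hf hg; apply: (@LG_dom _ _ _ _ _ sG (fun w => `|f w| + `|g w|)).
- have mf : measurable_fun setT (f : g_sigma_algebraType G -> R) := LG_msr hf.
  have mg : measurable_fun setT (g : g_sigma_algebraType G -> R) := LG_msr hg.
  exact: measurable_maxr.
- by move=> w; have [_|_] := leP (f w) (g w); rewrite ?lerDl ?lerDr.
- by apply: LGD => //; exact: LG_norm.
Qed.

Lemma LG_runmax (s : nat -> Omega -> R) : (forall n, (n <= N)%N -> LG P (Gs n) (s n)) ->
  forall n, (n <= N)%N -> LG P (Gs n) (runmax s n).
Proof.
move=> hs; elim=> [|n IH] nN; first exact: hs.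
apply: LG_max; [exact: chain_subalg| |exact: hs].
by apply: LG_sub (IH (ltnW nN)); apply: chain_sub; rewrite leqnSn.
Qed.

(* Summation by parts: the running maximum increases only where it is attained. *)
Lemma doob_pathwise (s : nat -> Omega -> R) n w :
  \sum_(k < n) runmax s k w * (s k.+1 w - s k w) <=
  runmax s n w * s n w - runmax s n w ^+ 2 / 2.
Proof.
elim: n => [|n IH]; first by rewrite big_ord0 /=; have := sqr_ge0 (s 0%N w); rewrite expr2; lra.
rewrite big_ord_recr /=; apply: le_trans (lerD IH (lexx _)) _.
set S := runmax s n w; set x := s n w; set y := s n.+1 w.
have := sqr_ge0 (S - y); have [Sy|yS] := leP S y; nra.
Qed.

Let s q n w : R := enorm (mart B D n w) ^+ q.

(** By the tangent inequality the increment of |M|^q is at least q |M|^(q-1) U.(B D), where U is a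
    subgradient of the norm at M; multiplied by the running maximum, which belongs to the past, this
    lower bound has mean zero. *)
Let submart q k : (k < N)%N ->
  0 <= Ex P (fun w => runmax (s q) k w * (s q k.+1 w - s q k w)).
Proof.
move=> kN; have sGk := chain_subalg (ltnW kN); have sGk1 := chain_subalg kN.
have hMk := VLG_mart (ltnW kN); have hMk1 := VLG_mart kN.
have hs n : (n <= N)%N -> LG P (Gs n) (s q n).
  by move=> nN; apply: LG_pow; apply: LG_enorm; [exact: chain_subalg|exact: VLG_mart].
have hr : LG P (Gs k) (runmax (s q) k) by apply: LG_runmax => //; exact: ltnW.
have r0 w : 0 <= runmax (s q) k w.
  by apply: le_trans (le_runmax (s q) w (leq0n k)); rewrite /s exprn_ge0.
(* The convention 0^-1 = 0 gives U = 0 where the martingale vanishes, which is also a subgradient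
   there. *)
pose U w := (enorm (mart B D k w))^-1 *: mart B D k w.
have hU : VLG P (Gs k) U.
  apply: (@VLG_dom _ _ _ _ _ sGk _ _ _ (cst 1)); last 2 first.
  - exact: LG_cst.
  - move=> w /=; rewrite enormZ ger0_norm ?invr_ge0//.
    by have [->|n0] := eqVneq (enorm (mart B D k w)) 0; rewrite ?mulr0 ?ler01// mulVf.
  move=> i j; rewrite /U; under eq_fun do rewrite mxE.
  have m1 : measurable_fun setT ((fun w => enorm (mart B D k w)) : g_sigma_algebraType (Gs k) -> R).
    exact: LG_msr (LG_enorm sGk hMk).
  have m2 : measurable_fun setT ((fun w => mart B D k w i j) : g_sigma_algebraType (Gs k) -> R).
    exact: LG_msr (hMk i j).
  by apply: measurable_funM => //; exact: (measurableT_comp (@measurable_fun_inv R)).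
have hf : LG P (Gs k) (fun w => runmax (s q) k w * (q%:R * enorm (mart B D k w) ^+ q.-1)).
  by apply: LGM => //; apply: LGZ => //; apply: LG_pow; exact: LG_enorm.
rewrite -(Ex_cross0 (hD kN) hU (hB kN) hf).
have hf1 := LG_sub (incr_sub (hD kN)) hf; have hU1 := VLG_sub (incr_sub (hD kN)) hU.
have hr1 := LG_sub (incr_sub (hD kN)) hr; have hs1 := LG_sub (incr_sub (hD kN)) (hs k (ltnW kN)).
apply: (Ex_le sGk1).
- apply: LGM => //; apply: LG_mdot => //; apply: VLG_mulmx => //; last exact: incr_VLG (hD kN).
  exact: VLG_sub (incr_sub (hD kN)) (hB kN).
- by apply: LGM => //; apply: LGB => //; exact: hs.
move=> w; rewrite -mulrA ler_wpM2l// /s.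
have -> : mart B D k.+1 w = mart B D k w + B k w *m D k w by rewrite /mart big_ord_recr.
rewrite /U mdotZl; set M := mart B D k w; set V := B k w *m D k w.
have h : mdot M V / enorm M <= enorm (M + V) - enorm M.
  have [M0|n0] := eqVneq (enorm M) 0; first by rewrite M0 invr0 mulr0 subr0.
  have Mp : 0 < enorm M by rewrite lt_neqAle eq_sym n0 enorm_ge0.
  rewrite ler_pdivrMr//; have := le_mdot M (M + V).
  by rewrite mdotDr -sqr_enorm expr2; lra.
have := @bernoulli R (enorm M) (enorm (M + V) - enorm M) q (enorm_ge0 M).
rewrite addrC subrK => /(_ (enorm_ge0 _)) h2.
have h3 : q%:R * enorm M ^+ q.-1 * (mdot M V / enorm M) <=
    q%:R * enorm M ^+ q.-1 * (enorm (M + V) - enorm M).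
  by rewrite ler_wpM2l// mulr_ge0// exprn_ge0.
by move: h2 h3; rewrite [_^-1 * _]mulrC; lra.
Qed.

(** With S the running maximum and s the final value of |M|^q, [doob_pathwise] and [submart] give E
    S^2 <= 2 E(S s); then S s <= S^2/4 + s^2 yields the constant 4 of Doob's L^2 inequality. *)
Lemma doob_mart q : Ex P (fun w => runmax (s q) N w ^+ 2) <=
  4 * Ex P (fun w => enorm (mart B D N w) ^+ (2 * q)).
Proof.
have sGN := chain_subalg (leqnn N).
have hs n : (n <= N)%N -> LG P (Gs n) (s q n).
  by move=> nN; apply: LG_pow; apply: LG_enorm; [exact: chain_subalg|exact: VLG_mart].
have hr := LG_runmax hs.
have hrN := hr _ (leqnn N); have hsN := hs _ (leqnn N).
have up n f : (n <= N)%N -> LG P (Gs n) f -> LG P (Gs N) f.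
  by move=> nN; apply: LG_sub; apply: chain_sub; rewrite nN leqnn.
have hterm k : (k < N)%N -> LG P (Gs N) (fun w => runmax (s q) k w * (s q k.+1 w - s q k w)).
  move=> kN; apply: LGM => //; first by apply: (up k); [exact: ltnW|exact/hr/ltnW].
  by apply: LGB => //; [apply: (up k.+1) => //; exact: hs|apply: (up k); [exact: ltnW|exact/hs/ltnW]].
have h1 : 0 <= Ex P (fun w => \sum_(k < N) runmax (s q) k w * (s q k.+1 w - s q k w)).
  rewrite (Ex_sum sGN) => [|k _]; last exact: hterm.
  by apply: sumr_ge0 => k _; exact: submart.
have hrs : LG P (Gs N) (fun w => 4 * s q N w ^+ 2 - runmax (s q) N w ^+ 2).
  by apply: LGB => //; [apply: LGZ => //|]; exact: LG_pow.
have h2 : Ex P (fun w => \sum_(k < N) runmax (s q) k w * (s q k.+1 w - s q k w)) <=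
    Ex P (fun w => 4^-1 * (4 * s q N w ^+ 2 - runmax (s q) N w ^+ 2)).
  apply: (Ex_le sGN) => [||w].
  - by apply: LG_sum => // k _; exact: hterm.
  - exact: LGZ.
  - apply: le_trans (doob_pathwise _ _ _) _.
    by have := sqr_ge0 (runmax (s q) N w - 2 * s q N w); nra.
have := le_trans h1 h2; rewrite (ExZ sGN)// (ExB sGN); [|by apply: LGZ => //; exact: LG_pow|exact: LG_pow].
rewrite (ExZ sGN); last exact: LG_pow.
rewrite (_ : Ex P (fun w => s q N w ^+ 2) = Ex P (fun w => enorm (mart B D N w) ^+ (2 * q))); first lra.
by apply: eq_Ex => w; rewrite /s -exprM mulnC.
Qed.

Lemma mart_max q : (forall n, (n < N)%N -> 0 < eta n <= 1) ->
  (forall n, 0 <= eta n) -> \sum_(i < N) eta i <= 1 -> (forall q, 0 <= C q) ->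
  exists S, [/\ LG P (Gs N) S, forall w, 0 <= S w,
    forall n w, (n <= N)%N -> enorm (mart B D n w) ^+ q.+1 <= S w &
    Ex P (fun w => S w ^+ 2) <= 4 * expR (step_cst C q.+1) * step_cst C q.+1 *
       \sum_(i < N) eta i * Ex P (fun w => enorm (B i w) ^+ (2 * q.+1))].
Proof.
move=> e01 e0 Se C0; exists (runmax (s q.+1) N); split.
- apply: LG_runmax => // n nN; apply: LG_pow; apply: LG_enorm; [exact: chain_subalg|exact: VLG_mart].
- by move=> w; apply: le_trans (le_runmax _ w (leq0n N)); rewrite /s exprn_ge0.
- by move=> n w nN; exact: (le_runmax (s q.+1)).
- apply: le_trans (doob_mart _) _; rewrite -2!mulrA ler_wpM2l//.
  apply: le_trans (mart_moment _ (leqnn N) e01 e0 Se C0) _.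
  rewrite ler_wpM2l ?expR_ge0// mulr_sumr le_eqVlt; apply/orP; left; apply/eqP.
  by apply: eq_bigr => i _; rewrite mulrCA.
Qed.

End Doob.

(** * Moments and maxima of perturbed recursions *)

Section PowPerturb.
Variable R : realType.
Implicit Types x y c rho eta : R.

Definition perturb_cst c q : R := (q%:R + 2 ^+ q) * (1 + 2 ^+ q * (c ^+ q + 1)).

Lemma perturb_cst_ge0 c q : 0 <= c -> 0 <= perturb_cst c q.
Proof. by move=> c0; rewrite /perturb_cst mulr_ge0 ?addr_ge0 ?mulr_ge0 ?addr_ge0 ?exprn_ge0. Qed.

(** The q-th power of a Gronwall step is again a Gronwall step, so a pathwise bound on squared norms
    becomes a recursion for moments of order 2q. *)
Lemma pow_perturb x c rho eta q : 0 <= x -> 0 <= c -> 0 <= rho -> 0 <= eta <= 1 ->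
  ((1 + c * eta) * x + eta * rho) ^+ q <=
  (1 + perturb_cst c q * eta) * x ^+ q + eta * (perturb_cst c q * rho ^+ q).
Proof.
move=> x0 c0 r0 e01; have /andP[e0 e1] := e01.
have y0 : 0 <= c * x + rho by rewrite addr_ge0// mulr_ge0.
have -> : (1 + c * eta) * x + eta * rho = x + eta * (c * x + rho) by ring.
apply: le_trans (pow_expand _ _ _ e01) _; rewrite !ger0_norm//.
have h1 : q%:R * x ^+ q.-1 * (c * x + rho) <= q%:R * (x ^+ q + (c * x + rho) ^+ q).
  case: q => [|q] /=; first by rewrite !mul0r.
  rewrite -mulrA ler_wpM2l//; have := @pow_young _ x (c * x + rho) q 1 x0 y0.
  by rewrite addn1 expr1.
have h2 := pow2D q x0 y0.
have h3 : (c * x + rho) ^+ q <= 2 ^+ q * (c ^+ q * x ^+ q + rho ^+ q).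
  by have := pow2D q (mulr_ge0 c0 x0) r0; rewrite exprMn.
have xq : 0 <= x ^+ q by rewrite exprn_ge0.
have rq : 0 <= rho ^+ q by rewrite exprn_ge0.
have cq : 0 <= c ^+ q by rewrite exprn_ge0.
have twoq : 0 <= (2 ^+ q : R) by rewrite exprn_ge0.
have nq : 0 <= (q%:R : R) by [].
set Y := (c * x + rho) ^+ q in h1 h3 *; set X := x ^+ q in h1 h2 h3 xq *.
set Z := (x + (c * x + rho)) ^+ q in h2 *; set Rr := rho ^+ q in h3 rq *.
have Y0 : 0 <= Y by rewrite exprn_ge0.
have Z0 : 0 <= Z by rewrite exprn_ge0// addr_ge0.
have h4 : q%:R * x ^+ q.-1 * (c * x + rho) + Z <= perturb_cst c q * X + perturb_cst c q * Rr.
  apply: (@le_trans _ _ ((q%:R + 2 ^+ q) * (X + Y))); first by rewrite mulrDl lerD.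
  rewrite -mulrDr /perturb_cst -mulrA ler_wpM2l ?addr_ge0//.
  apply: le_trans (lerD (lexx X) h3) _.
  have : 0 <= 2 ^+ q * X + Rr + 2 ^+ q * c ^+ q * Rr by rewrite !addr_ge0// !mulr_ge0.
  by lra.
have h5 : eta ^+ 2 * Z <= eta * Z.
  by rewrite expr2 -mulrA ler_piMl// mulr_ge0.
have h6 := ler_wpM2l e0 h4.
by rewrite [_ * (eta * _)]mulrCA; lra.
Qed.

End PowPerturb.

Section Recursion.
Context (R : realType) (disp : measure_display) (Omega : measurableType disp)
  (P : probability Omega R).
Variables (d m : nat).

Lemma LG_le G (f : Omega -> R) (c : R) : subalg G -> msr G f ->
  LG P G (fun w => (f w <= c)%R%:R).
Proof.
move=> sG hf.
have -> : (fun w => (f w <= c)%R%:R) = \1_[set w | f w <= c] :> (Omega -> R).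
  apply/funext => w; rewrite indicE; congr (_%:R); congr nat_of_bool.
  by apply/idP/idP => [h|]; rewrite ?inE.
apply: LG_indic => //.
have := hf measurableT _ (measurable_itv `]-oo, c]).
rewrite setTI /measurable /= sigma_algebra_id; last by case: sG.
by congr (G _); apply/seteqP; split => w /=; rewrite in_itv.
Qed.

Variables (C : nat -> R) (N : nat) (Gs : nat -> set (set Omega))
  (D : nat -> Omega -> 'cV[R]_m).
Hypothesis N0 : (0 < N)%N.
Hypothesis C0 : forall q, 0 <= C q.
Let eta : R := N%:R^-1.
Hypothesis hD : chain P C N (fun=> eta) Gs D.
Hypothesis sG0 : subalg (Gs 0%N).

Lemma eta01 : 0 < eta <= 1.
Proof. by rewrite /eta invr_gt0 ltr0n N0 invf_le1 ?ltr0n// ler1n. Qed.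

Lemma eta_ge0 : 0 <= eta. Proof. by have /andP[/ltW] := eta01. Qed.

Lemma sum_eta : \sum_(i < N) eta <= 1.
Proof. by rewrite sumr_const card_ord -mulr_natl /eta divff// pnatr_eq0 -lt0n. Qed.

Variables (Y A : nat -> Omega -> 'cV[R]_d) (B : nat -> Omega -> 'M[R]_(d, m)).
Hypothesis hY0 : VLG P (Gs 0%N) (Y 0%N).
Hypothesis YS : forall n w, (n < N)%N -> Y n.+1 w = A n w + B n w *m D n w.
Hypothesis hA : forall n, (n < N)%N -> VLG P (Gs n) (Y n) -> VLG P (Gs n) (A n).
Hypothesis hB : forall n, (n < N)%N -> VLG P (Gs n) (Y n) -> VLG P (Gs n) (B n).

Lemma VLG_rec n : (n <= N)%N -> VLG P (Gs n) (Y n).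
Proof.
elim: n => [//|n IH] nN.
have -> : Y n.+1 = (fun w => A n w + B n w *m D n w) by apply/funext => w; exact: YS.
have h := IH (ltnW nN); exact: (VLG_step (hD nN) (hA nN h) (hB nN h)).
Qed.

(** A majorant, for eta <= 1, of the coefficients that arise when the bounds on A and B are inserted
    into [one_step_moment]. *)
Definition rec_cst (C' : nat -> R) (c : R) q : R := 1 + 2 * step_cst C' q + perturb_cst c q
  + step_cst C' q * perturb_cst c q + step_cst C' q * perturb_cst c q.

Lemma rec_moment (c : R) (rho : nat -> Omega -> R) q : 0 <= c ->
  (forall n, (n < N)%N -> LG P (Gs n) (rho n)) ->
  (forall n w, 0 <= rho n w) ->
  (forall n w, (n < N)%N -> enorm (A n w) ^+ 2 <= (1 + c * eta) * enorm (Y n w) ^+ 2 + eta * rho n w) ->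
  (forall n w, (n < N)%N -> enorm (B n w) ^+ 2 <= c * enorm (Y n w) ^+ 2 + rho n w) ->
  forall n, (n <= N)%N -> Ex P (fun w => enorm (Y n w) ^+ (2 * q)) <=
   expR (rec_cst C c q) * (Ex P (fun w => enorm (Y 0%N w) ^+ (2 * q)) +
     \sum_(i < n) eta * (rec_cst C c q * Ex P (fun w => rho i w ^+ q))).
Proof.
move=> c0 hrho rho0 bA bB.
have e0 := eta_ge0; have e01 := eta01; have /andP[e0' e1] := e01.
have s0 : 0 <= step_cst C q by rewrite /step_cst addr_ge0 ?mulr_ge0 ?exprn_ge0 ?addr_ge0.
have p0 := perturb_cst_ge0 q c0.
have K0 : 0 <= rec_cst C c q by rewrite /rec_cst; have := mulr_ge0 s0 p0; lra.
apply: (@discrete_gronwall R (fun n => Ex P (fun w => enorm (Y n w) ^+ (2 * q)))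
  (fun i => rec_cst C c q * Ex P (fun w => rho i w ^+ q)) (fun=> eta) _ N) => //; last 2 first.
- move=> n nN; have sG := chain_subalg hD sG0 (ltnW nN).
  have hYn := VLG_rec (ltnW nN); have hAn := hA nN hYn; have hBn := hB nN hYn.
  have sp : (fun w => enorm (Y n.+1 w) ^+ (2 * q)) = (fun w => enorm (A n w + B n w *m D n w) ^+ (2 * q)).
    by apply/funext => w; rewrite YS.
  rewrite sp; apply: le_trans (one_step_moment (hD nN) hAn hBn e01 (C0 q) (C0 1%N)) _.
  have hyq : LG P (Gs n) (fun w => enorm (Y n w) ^+ (2 * q)) by apply: LG_pow; exact: LG_enorm.
  have hrq : LG P (Gs n) (fun w => rho n w ^+ q) by apply: LG_pow; exact: hrho.
  set a := Ex P (fun w => enorm (Y n w) ^+ (2 * q)); set r := Ex P (fun w => rho n w ^+ q).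
  have a0 : 0 <= a by apply: Ex_ge0 => w; rewrite exprn_ge0.
  have r0 : 0 <= r by apply: Ex_ge0 => w; rewrite exprn_ge0.
  have EA : Ex P (fun w => enorm (A n w) ^+ (2 * q)) <=
      (1 + perturb_cst c q * eta) * a + eta * perturb_cst c q * r.
    rewrite -(ExZ sG)// -(ExZ sG)// -(ExD sG); [|exact: LGZ|exact: LGZ].
    apply: (Ex_le sG).
    + by apply: LG_pow; exact: LG_enorm.
    + by apply: LGD => //; exact: LGZ.
    + move=> w; rewrite !exprM -mulrA.
      apply: le_trans _ (pow_perturb q (sqr_ge0 _) c0 (rho0 n w) _); last by rewrite e0.
      rewrite lerXn2r ?nnegrE ?sqr_ge0//; last exact: bA.
      by rewrite addr_ge0// mulr_ge0// ?sqr_ge0// addr_ge0// mulr_ge0.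
  have EB : Ex P (fun w => enorm (B n w) ^+ (2 * q)) <=
      perturb_cst c q * a + perturb_cst c q * r.
    rewrite -(ExZ sG)// -(ExZ sG)// -(ExD sG); [|exact: LGZ|exact: LGZ].
    apply: (Ex_le sG).
    + by apply: LG_pow; exact: LG_enorm.
    + by apply: LGD => //; exact: LGZ.
    + move=> w; rewrite !exprM; set x := enorm (Y n w) ^+ 2.
      have x0 : 0 <= x by exact: sqr_ge0.
      apply: (@le_trans _ _ ((c * x + rho n w) ^+ q)).
        by rewrite lerXn2r ?nnegrE ?sqr_ge0 ?addr_ge0 ?mulr_ge0//; exact: bB.
      apply: le_trans (pow2D q (mulr_ge0 c0 x0) (rho0 n w)) _.
      have xq : 0 <= x ^+ q by rewrite exprn_ge0.
      have rq : 0 <= rho n w ^+ q by rewrite exprn_ge0.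
      have cq : 0 <= c ^+ q by rewrite exprn_ge0.
      have t1 : 1 <= (q%:R + 2 ^+ q : R).
        by rewrite (le_trans (_ : 1 <= 2 ^+ q))// ?lerDr// exprn_ege1// ler1n.
      have t2 : 0 <= (2 ^+ q : R) by rewrite exprn_ge0.
      rewrite exprMn /perturb_cst -mulrDr -mulrA.
      apply: (@le_trans _ _ ((1 + 2 ^+ q * (c ^+ q + 1)) * (x ^+ q + rho n w ^+ q))); last first.
        by rewrite ler_peMl// mulr_ge0 ?addr_ge0 ?mulr_ge0 ?addr_ge0.
      have : 0 <= (1 + 2 ^+ q) * x ^+ q + (1 + 2 ^+ q * c ^+ q) * rho n w ^+ q.
        by rewrite addr_ge0// mulr_ge0// addr_ge0// mulr_ge0.
      by lra.
  have EA' := ler_wpM2l (_ : 0 <= 1 + step_cst C q * eta) EA.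
  have {}EA' := EA' (addr_ge0 ler01 (mulr_ge0 s0 e0)).
  have EB' := ler_wpM2l (mulr_ge0 s0 e0) EB.
  apply: le_trans (lerD EA' EB') _; rewrite /rec_cst.
  set s := step_cst C q in s0 *; set p := perturb_cst c q in p0 *.
  have e1' : 0 <= 1 - eta by rewrite subr_ge0.
  have H1 := mulr_ge0 (mulr_ge0 (mulr_ge0 (mulr_ge0 s0 p0) a0) e0) e1'.
  have H2 := mulr_ge0 (mulr_ge0 (mulr_ge0 (mulr_ge0 s0 p0) r0) e0) e1'.
  have H3 : 0 <= eta * r by rewrite mulr_ge0.
  have H4 := mulr_ge0 (mulr_ge0 e0 s0) r0.
  have H5 := mulr_ge0 (mulr_ge0 e0 s0) a0.
  have H6 := mulr_ge0 e0 a0.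
  by lra.
- by apply: Ex_ge0 => w; rewrite exprn_ge0.
- by move=> n; rewrite mulr_ge0// Ex_ge0// => w; rewrite exprn_ge0.
- exact: sum_eta.
Qed.

(* Sup bounds come from the martingale maximal inequality and from the
   triangle inequality for the drift. *)
Definition max_cst (C' : nat -> R) q : R :=
  3 * 9 ^+ q * (1 + 4 * expR (step_cst C' q.+1) * step_cst C' q.+1).

Lemma rec_max (a : nat -> Omega -> 'cV[R]_d) (gam : nat -> Omega -> R) q :
  (forall n w, (n < N)%N -> A n w = Y n w + a n w) ->
  (forall n, (n < N)%N -> LG P (Gs n) (gam n)) ->
  (forall n w, 0 <= gam n w) ->
  (forall n w, (n < N)%N -> enorm (a n w) <= eta * gam n w) ->
  exists S, [/\ LG P (Gs N) S, forall w, 0 <= S w,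
   forall n w, (n <= N)%N -> enorm (Y n w) ^+ q.+1 <= S w &
   Ex P (fun w => S w ^+ 2) <= max_cst C q *
    (Ex P (fun w => enorm (Y 0%N w) ^+ (2 * q.+1)) +
     \sum_(i < N) eta * (Ex P (fun w => gam i w ^+ (2 * q.+1)) +
        Ex P (fun w => enorm (B i w) ^+ (2 * q.+1))))].
Proof.
move=> Aa hgam gam0 bgam; have e0 := eta_ge0.
have hB' n : (n < N)%N -> VLG P (Gs n) (B n) by move=> nN; apply: hB => //; exact/VLG_rec/ltnW.
have [S [hS S0 bS ES]] := mart_max hD sG0 hB' q (fun _ _ => eta01) (fun _ => e0) sum_eta C0.
have sGN := chain_subalg hD sG0 (leqnn N).
have up n f : (n <= N)%N -> LG P (Gs n) f -> LG P (Gs N) f.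
  by move=> nN; apply: LG_sub; apply: (chain_sub hD); rewrite nN leqnn.
pose Z w := \sum_(i < N) eta * gam i w.
have hZ : LG P (Gs N) Z.
  by apply: LG_sum => // i _; apply: LGZ => //; apply: (up i); [exact: ltnW|exact: hgam].
have Z0 w : 0 <= Z w by apply: sumr_ge0 => i _; rewrite mulr_ge0.
have hy0 : LG P (Gs N) (fun w => enorm (Y 0%N w)) by apply: (up 0%N) => //; exact: LG_enorm.
have hy0q := LG_pow q.+1 hy0; have hZq := LG_pow q.+1 hZ.
exists (fun w => 3 ^+ q * (enorm (Y 0%N w) ^+ q.+1 + Z w ^+ q.+1 + S w)); split.
- by apply: LGZ => //; apply: LGD => //; exact: LGD.
- by move=> w; rewrite mulr_ge0 ?exprn_ge0// !addr_ge0// exprn_ge0.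
- move=> n w nN.
  have bY : enorm (Y n w) <= enorm (Y 0%N w) + Z w + enorm (mart B D n w).
    have E : Y n w = Y 0%N w + \sum_(i < n) a i w + mart B D n w.
      elim: n nN => [|n IH] nN; first by rewrite /mart !big_ord0 !addr0.
      rewrite YS// Aa// IH; last exact: ltnW.
      by rewrite /mart !big_ord_recr /=; rewrite -!addrA; do 2!congr (_ + _); rewrite addrCA.
    rewrite E; apply: le_trans (ler_enormD _ _) _; rewrite lerD2r.
    apply: le_trans (ler_enormD _ _) _; rewrite lerD2l.
    apply: le_trans (enorm_sum _ _ _) _.
    apply: (@le_trans _ _ (\sum_(i < n) eta * gam i w)).
      by apply: ler_sum => i _; apply: bgam; exact: leq_trans nN.
    rewrite /Z -(subnKC nN) big_split_ord /= lerDl sumr_ge0// => i _.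
    by rewrite mulr_ge0.
  apply: (@le_trans _ _ ((enorm (Y 0%N w) + Z w + enorm (mart B D n w)) ^+ q.+1)).
    by rewrite lerXn2r ?nnegrE// !addr_ge0.
  apply: le_trans (pow3_le q (enorm_ge0 _) (Z0 w) (enorm_ge0 _)) _.
  by rewrite ler_wpM2l ?exprn_ge0// lerD2l; exact: bS.
- have hy2 : LG P (Gs N) (fun w => enorm (Y 0%N w) ^+ (2 * q.+1)) by exact: LG_pow.
  have hg2 i : (i < N)%N -> LG P (Gs N) (fun w => gam i w ^+ (2 * q.+1)).
    by move=> iN; apply: LG_pow; apply: (up i); [exact: ltnW|exact: hgam].
  have hgs : LG P (Gs N) (fun w => \sum_(i < N) eta * gam i w ^+ (2 * q.+1)).
    by apply: LG_sum => // i _; apply: LGZ => //; exact: hg2.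
  have hS2 := LG_pow 2 hS.
  have e1 : N%:R * eta = 1 by rewrite /eta divff// pnatr_eq0 -lt0n.
  have H w : (3 ^+ q * (enorm (Y 0%N w) ^+ q.+1 + Z w ^+ q.+1 + S w)) ^+ 2 <=
     (3 * 9 ^+ q) * ((enorm (Y 0%N w) ^+ (2 * q.+1) + \sum_(i < N) eta * gam i w ^+ (2 * q.+1)) + S w ^+ 2).
    (* Convexity of the power, for N equal weights eta of total mass 1. *)
    have Zq : Z w ^+ (2 * q.+1) <= \sum_(i < N) eta * gam i w ^+ (2 * q.+1).
      have p0 i : 0 <= eta * gam i w by rewrite mulr_ge0.
      have := @pow_sum_le R N (2 * q.+1).-1 (fun i => eta * gam i w) p0.
      rewrite prednK ?muln_gt0// -/(Z w) => /le_trans; apply.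
      rewrite mulr_sumr ler_sum// => i _; rewrite exprMn mulrA.
      rewrite ler_wpM2r ?exprn_ge0//.
      rewrite -[X in eta ^+ X](@prednK (2 * q.+1)) ?muln_gt0// exprSr mulrA -exprMn e1 expr1n mul1r//.
    rewrite exprMn -exprM mulnC (exprM 3 2) (_ : 3 ^+ 2 = 9); last by ring.
    rewrite -[X in _ <= X * _]mulrC -[leRHS]mulrA ler_wpM2l ?exprn_ge0//.
    have := @pow3_le R (enorm (Y 0%N w) ^+ q.+1) (Z w ^+ q.+1) (S w) 1.
    rewrite !exprn_ge0// => /(_ isT isT (S0 w)); rewrite expr1 -!exprM ![(q.+1 * 2)%N]mulnC.
    by lra.
  apply: le_trans (Ex_le sGN _ _ H) _.
  + by apply: LG_pow; apply: LGZ => //; apply: LGD => //; exact: LGD.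
  + by apply: LGZ => //; apply: LGD => //; exact: LGD.
  rewrite (ExZ sGN); last by apply: LGD => //; exact: LGD.
  rewrite (ExD sGN) ?(ExD sGN)//; last exact: LGD.
  rewrite (Ex_sum sGN) => [|i _]; last by apply: LGZ => //; exact: hg2.
  have -> : \sum_(i < N) Ex P (fun w => eta * gam i w ^+ (2 * q.+1)) =
      \sum_(i < N) eta * Ex P (fun w => gam i w ^+ (2 * q.+1)).
    by apply: eq_bigr => i _; rewrite (ExZ sGN)//; exact: hg2.
  rewrite /max_cst -[leRHS]mulrA ler_wpM2l ?mulr_ge0 ?exprn_ge0//.
  under [in leRHS]eq_bigr do rewrite mulrDr; rewrite big_split /=.
  set E0 := Ex P (fun w => enorm (Y 0%N w) ^+ _); set E1 := \sum_(i < N) eta * Ex P (fun w => gam i w ^+ _).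
  move: ES; set E2 := \sum_(i < N) _; set k := 4 * _ * _ => ES.
  have s0 : 0 <= step_cst C q.+1 by rewrite /step_cst addr_ge0 ?mulr_ge0 ?exprn_ge0 ?addr_ge0.
  have k0 : 0 <= k by rewrite /k !mulr_ge0// expR_ge0.
  have E00 : 0 <= E0 by apply: Ex_ge0 => w; rewrite exprn_ge0.
  have E10 : 0 <= E1 by apply: sumr_ge0 => i _; rewrite mulr_ge0// Ex_ge0// => w; rewrite exprn_ge0.
  have E20 : 0 <= E2 by apply: sumr_ge0 => i _; rewrite mulr_ge0// Ex_ge0// => w; rewrite exprn_ge0.
  have : 0 <= k * (E0 + E1) by rewrite mulr_ge0// addr_ge0.
  by lra.
Qed.

End Recursion.

(** * Uniform moments of the tamed scheme *)

Section Tamed.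
Context (R : realType) (disp : measure_display) (Omega : measurableType disp)
  (P : probability Omega R).
Variables (d m : nat) (T K : R) (k : nat) (mu : 'cV[R]_d -> 'cV[R]_d)
  (sigma : 'cV[R]_d -> 'M[R]_(d, m)).
Hypotheses (T0 : 0 < T) (K0 : 0 <= K) (hmu : drift_bounds K k mu)
  (hsig : forall x y, enorm (sigma x - sigma y) <= K * enorm (x - y))
  (gmu : forall x, enorm (mu x) <= K * (1 + enorm x) ^+ k)
  (gsig : forall x, enorm (sigma x) <= K * (1 + enorm x)).

Let T0' : 0 <= T := ltW T0.

Definition tame (h : R) y := (1 + enorm (h *: mu y))^-1 *: (h *: mu y).

Fixpoint tamed (h : R) (x : Omega -> 'cV[R]_d) (D : nat -> Omega -> 'cV[R]_m) n w :=
  if n is n'.+1 then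
    let y := tamed h x D n' w in y + tame h y + sigma y *m D n' w
  else x w.

Lemma tame_le1 h y : enorm (tame h y) <= 1.
Proof.
rewrite enormZ ger0_norm ?invr_ge0 ?addr_ge0//.
by rewrite mulrC ler_pdivrMr ?mul1r ?lerDr// ltr_pwDl.
Qed.

Lemma tame_le h y : 0 <= h -> enorm (tame h y) <= h * enorm (mu y).
Proof.
move=> h0; rewrite enormZ ger0_norm ?invr_ge0 ?addr_ge0// enormZ (ger0_norm h0).
by rewrite ler_piMl ?mulr_ge0// invf_le1 ?lerDl ?mulr_ge0// ltr_pwDl// mulr_ge0.
Qed.

(** The difference is z times -|z|/(1 + |z|) with z = h mu(y): taming is a perturbation of second
    order in h, harmless for the strong rate 1/2. *)
Lemma tame_err h y : 0 <= h -> enorm (tame h y - h *: mu y) <= h ^+ 2 * enorm (mu y) ^+ 2.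
Proof.
move=> h0; rewrite /tame; set z := h *: mu y.
have z1 : 0 < 1 + enorm z by rewrite ltr_pwDl.
rewrite -[X in _ - X]scale1r -scalerBl enormZ.
have -> : (1 + enorm z)^-1 - 1 = - (enorm z / (1 + enorm z)) by field; rewrite gt_eqF.
rewrite normrN ger0_norm ?divr_ge0 ?(ltW z1)//.
have -> : h ^+ 2 * enorm (mu y) ^+ 2 = enorm z * enorm z.
  by rewrite /z enormZ ger0_norm//; ring.
rewrite ler_wpM2r// ler_pdivrMr// ler_peMr// lerDl//.
Qed.

Lemma lip_mu : locally_lipschitz mu.
Proof. by exists K, k; split => // x y; have [_] := hmu x y. Qed.

Lemma lip_sigma : locally_lipschitz sigma.
Proof. by exists K, 0%N; split => // x y; rewrite expr0 mulr1. Qed.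

Lemma lip_tame h : 0 <= h -> locally_lipschitz (tame h).
Proof.
move=> h0; exists (2 * (h * K)), k; split; first by rewrite !mulr_ge0.
move=> x y; rewrite /tame; set z := h *: mu x; set z' := h *: mu y.
have H : enorm (z - z') <= h * K * (1 + enorm x + enorm y) ^+ k * enorm (x - y).
  rewrite -scalerBr enormZ ger0_norm// -!mulrA ler_wpM2l// mulrA.
  by have [_] := hmu x y.
apply: (@le_trans _ _ (2 * enorm (z - z'))); last by rewrite -!mulrA ler_wpM2l// !mulrA.
have z1 : 0 < 1 + enorm z by rewrite ltr_pwDl.
have z1' : 0 < 1 + enorm z' by rewrite ltr_pwDl.
have -> : (1 + enorm z)^-1 *: z - (1 + enorm z')^-1 *: z' =
    (1 + enorm z)^-1 *: (z - z') + ((1 + enorm z)^-1 - (1 + enorm z')^-1) *: z'.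
  by rewrite scalerBr scalerBl addrA subrK.
apply: le_trans (ler_enormD _ _) _; rewrite [leRHS](_ : _ = enorm (z - z') + enorm (z - z')); last by ring.
apply: lerD.
  rewrite enormZ ger0_norm ?invr_ge0 ?(ltW z1)// ler_piMl// invf_le1// lerDl//.
rewrite enormZ.
have -> : (1 + enorm z)^-1 - (1 + enorm z')^-1 = (enorm z' - enorm z) / ((1 + enorm z) * (1 + enorm z')).
  by field; rewrite !gt_eqF.
rewrite normrM [X in _ * X * _]ger0_norm ?invr_ge0 ?mulr_ge0 ?(ltW z1) ?(ltW z1')//.
have : `|enorm z' - enorm z| <= enorm (z - z').
  rewrite ler_distl; have := ler_enormD (z - z') z'; have := ler_enormD (z' - z) z.
  by rewrite !subrK (enormB z' z); lra.
move=> h1; rewrite -mulrA; apply: (@le_trans _ _ (`|enorm z' - enorm z| * 1)); last by rewrite mulr1.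
rewrite ler_wpM2l// mulrC ler_pdivrMr ?mulr_gt0// mul1r.
have := enorm_ge0 z; have := enorm_ge0 z'; nra.
Qed.

Lemma moment_poly (p q : nat) (c : R) (f : 'cV[R]_d -> R) (Z : Omega -> 'cV[R]_d) G :
  subalg G -> VLG P G Z -> (forall w, 0 <= f (Z w)) -> LG P G (fun w => f (Z w)) ->
  (forall y, f y <= K * (1 + enorm y) ^+ p) ->
  Ex P (fun w => enorm (Z w) ^+ (2 * (p * q))) <= c ->
  Ex P (fun w => f (Z w) ^+ (2 * q)) <= K ^+ (2 * q) * (2 ^+ (2 * (p * q)) * (1 + c)).
Proof.
move=> sG hZ f0 hf bf Ec; have hz := LG_enorm sG hZ.
have hz2 : LG P G (fun w => enorm (Z w) ^+ (2 * (p * q))) by exact: LG_pow.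
have h1 : LG P G (cst (1 : R)) by exact: LG_cst.
apply: (@le_trans _ _ (Ex P (fun w => K ^+ (2 * q) * (2 ^+ (2 * (p * q)) * (1 + enorm (Z w) ^+ (2 * (p * q))))))).
  apply: (Ex_le sG); first exact: LG_pow.
    by apply: LGZ => //; apply: LGZ => //; exact: LGD.
  move=> w; apply: (@le_trans _ _ ((K * (1 + enorm (Z w)) ^+ p) ^+ (2 * q))).
    by rewrite lerXn2r ?nnegrE ?mulr_ge0 ?exprn_ge0 ?addr_ge0//.
  rewrite exprMn ler_wpM2l ?exprn_ge0// -exprM mulnCA.
  by have := pow2D (2 * (p * q)) ler01 (enorm_ge0 (Z w)); rewrite expr1n.
rewrite !(ExZ sG) ?(ExD sG) ?Ex_cst//; [|exact: LGD|by apply: LGZ => //; exact: LGD].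
by rewrite !ler_wpM2l ?exprn_ge0// lerD2l.
Qed.

Variables (C Cx : nat -> R).
Hypotheses (C0 : forall q, 0 <= C q) (Cx0 : forall q, 0 <= Cx q).

(** What constants may depend on, [C] and [Cx], is fixed outside. N, the filtration, the increments
    and the initial value vary inside, so a constant chosen before them is uniform in the copy and
    in the grid. *)
Definition tsetup N Gs (D : nat -> Omega -> 'cV[R]_m) (xi : Omega -> 'cV[R]_d) :=
  [/\ (0 < N)%N, chain P C N (fun=> N%:R^-1) Gs D, subalg (Gs 0%N), VLG P (Gs 0%N) xi &
    forall r, Ex P (fun w => enorm (xi w) ^+ (2 * r)) <= Cx r].

Lemma sum_eta_le N n (b : nat -> R) c : (n <= N)%N -> 0 <= c ->
  (forall i, (i < N)%N -> b i <= c) -> \sum_(i < n) N%:R^-1 * b i <= c.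
Proof.
move=> nN c0 bc; case: N nN bc => [|N] nN bc; first by move: nN; rewrite leqn0 => /eqP ->; rewrite big_ord0.
apply: (@le_trans _ _ (\sum_(i < n) N.+1%:R^-1 * c)).
  apply: ler_sum => i _; rewrite ler_wpM2l ?invr_ge0// bc//.
  exact: leq_trans nN.
rewrite sumr_const card_ord -[_ *+ n]mulr_natl mulrA ler_piMl// ler_pdivrMr ?ltr0n//.
by rewrite mul1r ler_nat.
Qed.

Lemma sigma_sq y : enorm (sigma y) ^+ 2 <= 2 * K ^+ 2 * enorm y ^+ 2 + 2 * K ^+ 2.
Proof.
apply: (@le_trans _ _ ((K * (1 + enorm y)) ^+ 2)).
  by rewrite lerXn2r ?nnegrE ?mulr_ge0 ?addr_ge0.
rewrite exprMn; have := mulr_ge0 (sqr_ge0 K) (sqr_ge0 (1 - enorm y)); nra.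
Qed.

Section setup.
Variables (N : nat) (Gs : nat -> set (set Omega)) (D : nat -> Omega -> 'cV[R]_m)
  (xi : Omega -> 'cV[R]_d).
Hypothesis hs : tsetup N Gs D xi.
Let h := T / N%:R.
Let h0 : 0 <= h. Proof. by rewrite divr_ge0// ltW. Qed.
Let Y := tamed h xi D.

Lemma VLG_tamed n : (n <= N)%N -> VLG P (Gs n) (Y n).
Proof.
case: hs => N0 hD sG0 hxi _.
apply: (VLG_rec hD (A := fun n w => Y n w + tame h (Y n w)) (B := fun n w => sigma (Y n w))) => //.
- move=> i iN hY; have sG := chain_subalg hD sG0 (ltnW iN).
  by apply: VLGD => //; apply: (VLG_comp sG) => //; exact: lip_tame.
- move=> i iN hY; have sG := chain_subalg hD sG0 (ltnW iN).
  by apply: (VLG_comp sG) => //; exact: lip_sigma.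
Qed.

Lemma tamed_rough q n : (n <= N)%N -> Ex P (fun w => enorm (Y n w) ^+ (2 * q)) <=
  expR (rec_cst C (1 + 2 * K ^+ 2) q) * (Cx q + rec_cst C (1 + 2 * K ^+ 2) q * (2 + 2 * K ^+ 2) ^+ q)
  * N%:R ^+ (2 * q).
Proof.
case: hs => N0 hD sG0 hxi bxi nN.
have N1 : 1 <= N%:R :> R by rewrite ler1n.
(* The cross term of (|y| + 1)^2 is split as 2|y| <= |y|^2/N + N, and N + 1 <= 2N is 1/N times the
   first summand of [rho]. *)
set c := 1 + 2 * K ^+ 2; pose rho := 2 * N%:R ^+ 2 + 2 * K ^+ 2 : R.
have K2 : 0 <= 2 * K ^+ 2 by rewrite mulr_ge0 ?sqr_ge0.
have c0 : 0 <= c by rewrite addr_ge0.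
have rho0 : 0 <= rho by rewrite addr_ge0// mulr_ge0 ?sqr_ge0.
have s0 : 0 <= rec_cst C c q.
  have sc : 0 <= step_cst C q by rewrite /step_cst addr_ge0 ?mulr_ge0 ?exprn_ge0 ?addr_ge0.
  have pc := perturb_cst_ge0 q c0; have := mulr_ge0 sc pc.
  by rewrite /rec_cst; lra.
have eN : N%:R^-1 * N%:R = 1 :> R by rewrite mulVf// pnatr_eq0 -lt0n.
have e0 : 0 <= N%:R^-1 :> R by rewrite invr_ge0.
have H := @rec_moment R disp Omega P d m C N Gs D N0 C0 hD sG0 Y
  (fun n w => Y n w + tame h (Y n w)) (fun n w => sigma (Y n w)) hxi (fun _ _ _ => erefl)
  _ _ c (fun _ _ => rho) q c0 (fun _ _ => LG_cst P _ _) (fun _ _ => rho0) _ _ n nN.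
apply: le_trans (H _ _ _ _) _ => {H}.
- move=> i iN hY; have sG := chain_subalg hD sG0 (ltnW iN).
  by apply: VLGD => //; apply: (VLG_comp sG) => //; exact: lip_tame.
- move=> i iN hY; have sG := chain_subalg hD sG0 (ltnW iN).
  by apply: (VLG_comp sG) => //; exact: lip_sigma.
- move=> i w iN; set y := Y i w.
  have t1 : enorm (y + tame h y) <= enorm y + 1.
    by apply: le_trans (ler_enormD _ _) _; rewrite lerD2l tame_le1.
  apply: (@le_trans _ _ ((enorm y + 1) ^+ 2)).
    by rewrite lerXn2r ?nnegrE ?addr_ge0.
  set e := N%:R^-1 in eN e0 *; rewrite /c /rho; set M : R := N%:R in N1 eN *.
  have h1 : 0 <= e * (enorm y - M) ^+ 2 by rewrite mulr_ge0 ?sqr_ge0.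
  have h2 : 0 <= 2 * K ^+ 2 * e * enorm y ^+ 2 by rewrite mulr_ge0 ?sqr_ge0// mulr_ge0.
  have h3 : 0 <= e * (2 * K ^+ 2) by rewrite mulr_ge0.
  have h4 : e * M ^+ 2 = M by rewrite expr2 mulrA eN mul1r.
  have h5 : e * enorm y * M = enorm y by rewrite mulrAC eN mul1r.
  rewrite (_ : e * (enorm y - M) ^+ 2 = e * enorm y ^+ 2 - 2 * (e * enorm y * M) + e * M ^+ 2) in h1; last by ring.
  rewrite h4 h5 in h1.
  rewrite (_ : e * (2 * M ^+ 2 + _) = 2 * (e * M ^+ 2) + e * (2 * K ^+ 2)); last by ring.
  by rewrite h4; lra.
- move=> i w iN; apply: le_trans (sigma_sq _) _; rewrite /c /rho.
  have := sqr_ge0 (enorm (Y i w)); have : 0 <= (N%:R : R) ^+ 2 by exact: sqr_ge0.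
  by lra.
have NNq : 1 <= N%:R ^+ (2 * q) :> R by rewrite exprn_ege1.
rewrite -[leRHS]mulrA ler_wpM2l ?expR_ge0// [leRHS]mulrDl lerD//.
  by apply: le_trans (bxi q) _; rewrite ler_peMr.
have rq : rho ^+ q <= (2 + 2 * K ^+ 2) ^+ q * N%:R ^+ (2 * q).
  rewrite exprM -exprMn lerXn2r ?nnegrE ?mulr_ge0 ?sqr_ge0// ?addr_ge0//.
  by rewrite /rho [leRHS]mulrDl lerD2l ler_peMr// exprn_ege1.
apply: (@sum_eta_le N n (fun=> _)) => //.
  by rewrite !mulr_ge0 ?exprn_ge0// addr_ge0.
by move=> _ _; rewrite (Ex_cst P (rho ^+ q)) -mulrA ler_wpM2l.
Qed.

(* The scheme frozen as soon as the drift is larger than [sqrt N]: before that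
   time the taming is harmless, and freezing keeps track of the bad event. *)
Fixpoint frozen n w : 'cV[R]_d :=
  if n is n'.+1 then
    let y := frozen n' w in
    let chi : R := (enorm (mu y) ^+ 2 <= N%:R)%R%:R in
    (y + chi *: tame h y) + (chi *: sigma y) *m D n' w
  else xi w.

Lemma frozen_or n w : tamed h xi D n w = frozen n w \/ N%:R < enorm (mu (frozen n w)) ^+ 2.
Proof.
elim: n => [|n IH]; first by left.
rewrite /=; have [le|lt] := leP (enorm (mu (frozen n w)) ^+ 2) N%:R.
  left; case: IH => [->|]; last by rewrite ltNge le.
  by rewrite !scale1r.
by right; rewrite !scale0r addr0 mul0mx addr0.
Qed.

Let chi_VLG n Z : subalg (Gs n) -> VLG P (Gs n) Z ->
  LG P (Gs n) (fun w => (enorm (mu (Z w)) ^+ 2 <= N%:R)%R%:R).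
Proof.
move=> sG hZ; apply: LG_le => //; apply: (@LG_msr _ _ _ P); apply: LG_pow; apply: LG_enorm => //.
by apply: (VLG_comp sG) => //; exact: lip_mu.
Qed.

Let A n w := frozen n w + ((enorm (mu (frozen n w)) ^+ 2 <= N%:R)%R%:R : R) *: tame h (frozen n w).
Let B n w := ((enorm (mu (frozen n w)) ^+ 2 <= N%:R)%R%:R : R) *: sigma (frozen n w).

Let hA n : (n < N)%N -> VLG P (Gs n) (frozen n) -> VLG P (Gs n) (A n).
Proof.
case: hs => N0 hD sG0 _ _ iN hY; have sG := chain_subalg hD sG0 (ltnW iN).
exact: (VLGD sG hY (VLGZ sG (chi_VLG sG hY) (VLG_comp sG (lip_tame h0) hY))).
Qed.

Let hB n : (n < N)%N -> VLG P (Gs n) (frozen n) -> VLG P (Gs n) (B n).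
Proof.
case: hs => N0 hD sG0 _ _ iN hY; have sG := chain_subalg hD sG0 (ltnW iN).
exact: (VLGZ sG (chi_VLG sG hY) (VLG_comp sG lip_sigma hY)).
Qed.

Lemma VLG_frozen n : (n <= N)%N -> VLG P (Gs n) (frozen n).
Proof. by case: hs => N0 hD sG0 hxi _; apply: (VLG_rec hD (A := A) (B := B)). Qed.

Definition frozen_cst : R := 2 * T * (K + 1) + 2 * K ^+ 2.
Definition frozen_rho : R := 2 * T * enorm (mu 0) ^+ 2 + T ^+ 2 + 2 * K ^+ 2.

Lemma dotp_mu y : mdot y (mu y) <= (K + 1) * enorm y ^+ 2 + enorm (mu 0) ^+ 2.
Proof.
have [h1 _] := hmu y 0; rewrite dotpE !subr0 mdotDr mdotNr in h1.
have h2 := le_mdot y (mu 0); have := sqr_ge0 (enorm y - enorm (mu 0)).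
have := sqr_ge0 (enorm y); have := sqr_ge0 (enorm (mu 0)); nra.
Qed.

(** While |mu|^2 <= N, the square of a tamed drift step is at most h^2 N = T^2/N, of the order of
    one step; the cross term is controlled by the one-sided condition. The superlinear growth of mu
    therefore never enters. *)
Lemma frozen_moment q n : (n <= N)%N -> Ex P (fun w => enorm (frozen n w) ^+ (2 * q)) <=
  expR (rec_cst C frozen_cst q) * (Cx q + rec_cst C frozen_cst q * frozen_rho ^+ q).
Proof.
case: hs => N0 hD sG0 hxi bxi nN.
have N1 : 0 < N%:R :> R by rewrite ltr0n.
have K2 : 0 <= 2 * K ^+ 2 by rewrite mulr_ge0 ?sqr_ge0.
have TK : 0 <= 2 * T * (K + 1) by rewrite !mulr_ge0 ?addr_ge0.
have Tm : 0 <= 2 * T * enorm (mu 0) ^+ 2 by rewrite !mulr_ge0 ?sqr_ge0.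
have c0 : 0 <= frozen_cst by rewrite addr_ge0.
have T2 := sqr_ge0 T.
have rho0 : 0 <= frozen_rho by rewrite !addr_ge0.
have s0 : 0 <= rec_cst C frozen_cst q.
  have sc : 0 <= step_cst C q by rewrite /step_cst addr_ge0 ?mulr_ge0 ?exprn_ge0 ?addr_ge0.
  have pc := perturb_cst_ge0 q c0; have := mulr_ge0 sc pc.
  by rewrite /rec_cst; lra.
have e0 : 0 <= N%:R^-1 :> R by rewrite invr_ge0.
have H := @rec_moment R disp Omega P d m C N Gs D N0 C0 hD sG0 frozen A B hxi (fun _ _ _ => erefl)
  hA hB frozen_cst (fun _ _ => frozen_rho) q c0 (fun _ _ => LG_cst P _ _) (fun _ _ => rho0) _ _ n nN.
apply: le_trans (H _ _) _ => {H}.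
- move=> i w iN; rewrite /A; set y := frozen i w.
  have y2 := sqr_ge0 (enorm y).
  have [le|_] := leP (enorm (mu y) ^+ 2) N%:R; last first.
    rewrite scale0r addr0.
    have := mulr_ge0 e0 rho0; have := mulr_ge0 (mulr_ge0 c0 e0) y2; lra.
  rewrite scale1r /tame scalerA; set a := _ * h.
  have a0 : 0 <= a by rewrite mulr_ge0 ?invr_ge0 ?addr_ge0.
  have ah : a <= h.
    by rewrite ler_piMl// invf_le1 ?lerDl// ltr_pwDl.
  rewrite sqr_enormD enormZ ger0_norm// exprMn mdotZr.
  have E0 : 0 <= (K + 1) * enorm y ^+ 2 + enorm (mu 0) ^+ 2.
    by rewrite addr_ge0 ?sqr_ge0// mulr_ge0// addr_ge0.
  have h1 : a * mdot y (mu y) <= h * ((K + 1) * enorm y ^+ 2 + enorm (mu 0) ^+ 2).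
    apply: le_trans (ler_wpM2l a0 (dotp_mu y)) _; exact: ler_wpM2r.
  have h2 : a ^+ 2 * enorm (mu y) ^+ 2 <= N%:R^-1 * T ^+ 2.
    apply: (@le_trans _ _ (h ^+ 2 * N%:R)).
      by apply: ler_pM; rewrite ?sqr_ge0// lerXn2r ?nnegrE.
    rewrite /h le_eqVlt; apply/orP; left; apply/eqP; field.
    by rewrite gt_eqF.
  rewrite /h mulrC in h1.
  have h3 := mulr_ge0 (mulr_ge0 e0 K2) y2; have h4 := mulr_ge0 e0 K2.
  by rewrite /frozen_cst /frozen_rho; lra.
- move=> i w iN; rewrite /B; set y := frozen i w.
  have y2 := sqr_ge0 (enorm y).
  have [le|_] := leP (enorm (mu y) ^+ 2) N%:R; last first.
    rewrite scale0r enorm0 expr0n/=; have := mulr_ge0 c0 y2; lra.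
  rewrite scale1r; apply: le_trans (sigma_sq y) _; rewrite /frozen_cst /frozen_rho.
  by have := mulr_ge0 TK y2; lra.
rewrite ler_wpM2l ?expR_ge0// lerD//.
apply: (@sum_eta_le N n (fun=> _)) => //; first by rewrite mulr_ge0 ?exprn_ge0.
by move=> _ _; rewrite (Ex_cst P (frozen_rho ^+ q)).
Qed.

End setup.

(** On the bad event the factor N^(-2q) |mu(Z)|^(4q) >= 1 may be inserted. Cauchy-Schwarz pairs the
    bounded moments of mu(Z) with the rough bound N^(4q) on E|Y|^(4q), and the powers of N
    cancel. *)
Lemma tamed_moment q : exists2 c, 0 <= c & forall N Gs D xi, tsetup N Gs D xi ->
  forall n, (n <= N)%N -> Ex P (fun w => enorm (tamed (T / N%:R) xi D n w) ^+ (2 * q)) <= c.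
Proof.
pose c1 r : R := expR (rec_cst C frozen_cst r) * (Cx r + rec_cst C frozen_cst r * frozen_rho ^+ r).
pose c2 r : R := expR (rec_cst C (1 + 2 * K ^+ 2) r) *
  (Cx r + rec_cst C (1 + 2 * K ^+ 2) r * (2 + 2 * K ^+ 2) ^+ r).
pose M : R := K ^+ (2 * (4 * q)) * (2 ^+ (2 * (k * (4 * q))) * (1 + c1 (k * (4 * q))%N)).
exists (`|c1 q| + (1 + `|M * c2 (2 * q)%N|)); first by rewrite !addr_ge0.
move=> N Gs D xi hs n nN; have [N0 hD sG0 hxi bxi] := hs.
have sG := chain_subalg hD sG0 nN.
set Y := tamed _ xi D; set Z := frozen N D xi.
have hY := VLG_tamed hs nN; have hZ := VLG_frozen hs nN.
have heY : LG P (Gs n) (fun w => enorm (Y n w)) by exact: LG_enorm.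
have heZ : LG P (Gs n) (fun w => enorm (Z n w)) by exact: LG_enorm.
have hmZ : LG P (Gs n) (fun w => enorm (mu (Z n w))).
  by apply: LG_enorm => //; apply: (VLG_comp sG) => //; exact: lip_mu.
have hYq : LG P (Gs n) (fun w => enorm (Y n w) ^+ (2 * q)) by exact: LG_pow.
have hZq : LG P (Gs n) (fun w => enorm (Z n w) ^+ (2 * q)) by exact: LG_pow.
have hmq : LG P (Gs n) (fun w => enorm (mu (Z n w)) ^+ (4 * q)) by exact: LG_pow.
have hfg : LG P (Gs n) (fun w => enorm (mu (Z n w)) ^+ (4 * q) * enorm (Y n w) ^+ (2 * q)) by exact: LGM.
have N1 : 0 < N%:R :> R by rewrite ltr0n.
pose x := N%:R ^- (2 * q) * Ex P (fun w => enorm (mu (Z n w)) ^+ (4 * q) * enorm (Y n w) ^+ (2 * q)) : R.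
have x0 : 0 <= x.
  by rewrite mulr_ge0 ?invr_ge0 ?exprn_ge0// Ex_ge0// => w; rewrite mulr_ge0 ?exprn_ge0.
have x2 : x ^+ 2 <= M * c2 (2 * q)%N.
  have := Ex_CS sG hmq hYq.
  have -> : (fun w => (enorm (mu (Z n w)) ^+ (4 * q)) ^+ 2) = (fun w => enorm (mu (Z n w)) ^+ (2 * (4 * q))).
    by apply/funext => w; rewrite -exprM mulnC.
  have -> : (fun w => (enorm (Y n w) ^+ (2 * q)) ^+ 2) = (fun w => enorm (Y n w) ^+ (2 * (2 * q))).
    by apply/funext => w; rewrite -exprM mulnC.
  have b1 := @moment_poly k (4 * q) (c1 (k * (4 * q))%N) (fun y => enorm (mu y)) (Z n) (Gs n) sG hZ
    (fun _ => enorm_ge0 _) hmZ gmu (frozen_moment hs _ nN).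
  have b2 := tamed_rough hs (2 * q) nN.
  move=> /le_trans H; rewrite /x exprMn.
  apply: (@le_trans _ _ ((N%:R ^- (2 * q)) ^+ 2 * (M * (c2 (2 * q)%N * N%:R ^+ (2 * (2 * q)))))).
    rewrite ler_wpM2l ?sqr_ge0//; apply: H; apply: ler_pM => //.
    - by apply: Ex_ge0 => w; rewrite exprn_ge0.
    - by apply: Ex_ge0 => w; rewrite exprn_ge0.
  rewrite -exprVn -exprM [(2 * q * 2)%N]mulnC.
  rewrite (_ : _ * (M * _) = M * c2 (2 * q)%N * (N%:R^-1 ^+ (2 * (2 * q)) * N%:R ^+ (2 * (2 * q)))); last by ring.
  by rewrite -exprMn mulVf ?gt_eqF// expr1n mulr1.
have xb : x <= 1 + `|M * c2 (2 * q)%N|.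
  have := ler_norm (M * c2 (2 * q)%N); have := sqr_ge0 (x - 1); rewrite !expr2 in x2 *.
  by set u := `|_|; nra.
apply: (@le_trans _ _ (Ex P (fun w => enorm (Z n w) ^+ (2 * q) +
    N%:R ^- (2 * q) * (enorm (mu (Z n w)) ^+ (4 * q) * enorm (Y n w) ^+ (2 * q))))).
  apply: (Ex_le sG) => //; first by apply: LGD => //; exact: LGZ.
  move=> w; have [->|bad] : Y n w = Z n w \/ N%:R < enorm (mu (Z n w)) ^+ 2 := frozen_or N D xi n w.
    by rewrite lerDl mulr_ge0 ?invr_ge0 ?exprn_ge0// mulr_ge0 ?exprn_ge0.
  rewrite mulrA; apply: (@le_trans _ _ (1 * enorm (Y n w) ^+ (2 * q))); first by rewrite mul1r.
  apply: (@le_trans _ _ (N%:R ^- (2 * q) * enorm (mu (Z n w)) ^+ (4 * q) * enorm (Y n w) ^+ (2 * q))).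
    rewrite ler_wpM2r ?exprn_ge0// mulrC ler_pdivlMr ?exprn_gt0// mul1r.
    rewrite (_ : 4 * q = 2 * (2 * q))%N; last by rewrite mulnA.
    by rewrite [leRHS]exprM lerXn2r ?nnegrE ?sqr_ge0 ?ler0n// ltW.
  by rewrite lerDr exprn_ge0.
rewrite (ExD sG)//; last exact: LGZ.
rewrite (ExZ sG)//; apply: lerD; last exact: xb.
by apply: le_trans (frozen_moment hs q nN) (ler_norm _).
Qed.

Lemma tamed_max q : exists2 c, 0 <= c & forall N Gs D xi, tsetup N Gs D xi ->
  exists S, [/\ LG P (Gs N) S, forall w, 0 <= S w,
   forall n w, (n <= N)%N -> enorm (tamed (T / N%:R) xi D n w) ^+ q.+1 <= S w &
   Ex P (fun w => S w ^+ 2) <= c].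
Proof.
have [c1 c10 H1] := tamed_moment (k * q.+1).
have [c2 c20 H2] := tamed_moment q.+1.
pose b1 := T ^+ (2 * q.+1) * (K ^+ (2 * q.+1) * (2 ^+ (2 * (k * q.+1)) * (1 + c1))).
pose b2 := K ^+ (2 * q.+1) * (2 ^+ (2 * (1 * q.+1)) * (1 + c2)).
have b10 : 0 <= b1 by rewrite !mulr_ge0 ?exprn_ge0 ?addr_ge0.
have b20 : 0 <= b2 by rewrite !mulr_ge0 ?exprn_ge0 ?addr_ge0.
have s0 : 0 <= step_cst C q.+1 by rewrite /step_cst addr_ge0 ?mulr_ge0 ?exprn_ge0 ?addr_ge0.
have m0 : 0 <= max_cst C q.
  by rewrite /max_cst !mulr_ge0 ?exprn_ge0// addr_ge0// !mulr_ge0// expR_ge0.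
exists (max_cst C q * (Cx q.+1 + (b1 + b2))); first by rewrite mulr_ge0 ?addr_ge0.
move=> N Gs D xi hs; have [N0 hD sG0 hxi bxi] := hs.
set h := T / N%:R; have h0 : 0 <= h by rewrite divr_ge0// ltW.
pose Y := tamed h xi D.
have := @rec_max R disp Omega P d m C N Gs D N0 C0 hD sG0 Y
  (fun n w => Y n w + tame h (Y n w)) (fun n w => sigma (Y n w)) hxi (fun _ _ _ => erefl)
  _ _ (fun n w => tame h (Y n w)) (fun n w => T * enorm (mu (Y n w))) q.
have hmu' n : (n <= N)%N -> LG P (Gs n) (fun w => enorm (mu (Y n w))).
  move=> nN; have sG := chain_subalg hD sG0 nN; apply: LG_enorm => //.
  exact: (VLG_comp sG lip_mu (VLG_tamed hs nN)).
case.
- move=> i iN hY; have sG := chain_subalg hD sG0 (ltnW iN).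
  by apply: VLGD => //; apply: (VLG_comp sG) => //; exact: lip_tame.
- move=> i iN hY; have sG := chain_subalg hD sG0 (ltnW iN).
  by apply: (VLG_comp sG) => //; exact: lip_sigma.
- by [].
- move=> n nN; have sG := chain_subalg hD sG0 (ltnW nN).
  by apply: LGZ => //; exact/hmu'/ltnW.
- by move=> n w; rewrite mulr_ge0// ltW.
- move=> n w nN; apply: le_trans (tame_le _ h0) _.
  by rewrite /h mulrA [_^-1 * T]mulrC.
move=> S [hS S0 bS ES]; exists S; split => //.
apply: le_trans ES _; apply: ler_wpM2l => //; apply: lerD; first exact: bxi.
apply: (@sum_eta_le N N (fun i => Ex P (fun w => (T * enorm (mu (Y i w))) ^+ (2 * q.+1)) +
  Ex P (fun w => enorm (sigma (Y i w)) ^+ (2 * q.+1)))) => //; first by rewrite addr_ge0.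
move=> i iN; have sG := chain_subalg hD sG0 (ltnW iN).
have hYi := VLG_tamed hs (ltnW iN).
apply: lerD.
- have -> : (fun w => (T * enorm (mu (Y i w))) ^+ (2 * q.+1)) =
      (fun w => T ^+ (2 * q.+1) * enorm (mu (Y i w)) ^+ (2 * q.+1)).
    by apply/funext => w; rewrite exprMn.
  rewrite (ExZ sG); last by apply: LG_pow; exact/hmu'/ltnW.
  apply: ler_wpM2l; first by rewrite exprn_ge0.
  apply: (@moment_poly k q.+1 c1 (fun y => enorm (mu y)) (Y i) (Gs i)) => //; first exact/hmu'/ltnW.
  exact: H1 hs i (ltnW iN).
- apply: (@moment_poly 1 q.+1 c2 (fun y => enorm (sigma y)) (Y i) (Gs i)) => //.
  + by apply: LG_enorm => //; apply: (VLG_comp sG) => //; exact: lip_sigma.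
  + by rewrite mul1n; exact: H2 hs i (ltnW iN).
Qed.

End Tamed.

(** * Calculus of orders of magnitude in all L^q *)

Section MomentOrder.
Context (R : realType) (disp : measure_display) (Omega : measurableType disp)
  (P : probability Omega R).
Variables (I : Type) (eta : I -> R).
Hypothesis eta01 : forall x, 0 <= eta x <= 1.

Let eta0 x : 0 <= eta x. Proof. by have /andP[] := eta01 x. Qed.
Let sM := @subalg_measurable disp Omega.

(* [OL a f] : f = O(eta^(a/2)) in L^q for every q, uniformly in the index. *)
Definition OL (a : nat) (f : I -> Omega -> R) :=
  (forall x, LG P measurable (f x)) /\
  forall q, exists2 c, 0 <= c & forall x, Ex P (fun w => f x w ^+ (2 * q)) <= c * eta x ^+ (a * q).

Lemma even_pow_norm (y : R) q : y ^+ (2 * q) = `|y| ^+ (2 * q).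
Proof. by rewrite !exprM real_normK ?num_real. Qed.

Lemma OL_dom a (f g : I -> Omega -> R) : (forall x, LG P measurable (g x)) ->
  (forall x w, `|g x w| <= f x w) -> OL a f -> OL a g.
Proof.
move=> hg gf [hf H]; split => // q; have [c c0 Hc] := H q; exists c => // x.
apply: le_trans (Hc x); apply: (Ex_le sM); [exact: LG_pow|exact: LG_pow|move=> w].
by rewrite even_pow_norm lerXn2r ?nnegrE// (le_trans (normr_ge0 _) (gf x w)).
Qed.

Lemma OL_weak a b f : (b <= a)%N -> OL a f -> OL b f.
Proof.
move=> ba [hf H]; split => // q; have [c c0 Hc] := H q; exists c => // x.
apply: le_trans (Hc x) _; rewrite ler_wpM2l//.
by apply: ler_wiXn2l; [exact: eta0|by have /andP[] := eta01 x|rewrite leq_mul2r ba orbT].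
Qed.

Lemma OL_D a f g : OL a f -> OL a g -> OL a (fun x w => f x w + g x w).
Proof.
move=> [hf Hf] [hg Hg]; split; first by move=> x; exact: LGD.
move=> q; have [c1 c10 H1] := Hf q; have [c2 c20 H2] := Hg q.
exists (2 ^+ (2 * q) * (c1 + c2)); first by rewrite mulr_ge0 ?exprn_ge0 ?addr_ge0.
move=> x; apply: (@le_trans _ _ (Ex P (fun w => 2 ^+ (2 * q) * (f x w ^+ (2 * q) + g x w ^+ (2 * q))))).
  apply: (Ex_le sM).
  - by apply: LG_pow; exact: LGD.
  - by apply: LGZ => //; apply: LGD => //; exact: LG_pow.
  - move=> w; rewrite even_pow_norm (even_pow_norm (f x w)) (even_pow_norm (g x w)).
    apply: le_trans (pow2D (2 * q) (normr_ge0 (f x w)) (normr_ge0 (g x w))).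
    by rewrite lerXn2r ?nnegrE ?addr_ge0// ler_normD.
rewrite (ExZ sM) ?(ExD sM); [|exact: LG_pow|exact: LG_pow|by apply: LGD => //; exact: LG_pow].
by rewrite -mulrA ler_wpM2l ?exprn_ge0// mulrDl lerD.
Qed.

(** Cauchy-Schwarz doubles the order of the moments; quantifying over all q makes this harmless. *)
Lemma OL_M a b f g : OL a f -> OL b g -> OL (a + b) (fun x w => f x w * g x w).
Proof.
move=> [hf Hf] [hg Hg]; split; first by move=> x; exact: LGM.
move=> q; have [c1 c10 H1] := Hf (2 * q)%N; have [c2 c20 H2] := Hg (2 * q)%N.
exists (Num.sqrt (c1 * c2)); first exact: sqrtr_ge0.
move=> x; have hfq := LG_pow (2 * q) (hf x); have hgq := LG_pow (2 * q) (hg x).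
have -> : Ex P (fun w => (f x w * g x w) ^+ (2 * q)) = Ex P (fun w => f x w ^+ (2 * q) * g x w ^+ (2 * q)).
  by apply: eq_Ex => w; rewrite exprMn.
rewrite -(ler_pXn2r (n:=2))// ?nnegrE ?mulr_ge0 ?sqrtr_ge0 ?exprn_ge0//; last first.
  by apply: Ex_ge0 => w; rewrite mulr_ge0// even_pow_norm exprn_ge0.
apply: le_trans (Ex_CS sM hfq hgq) _.
rewrite exprMn sqr_sqrtr ?mulr_ge0//.
have -> : c1 * c2 * (eta x ^+ ((a + b) * q)) ^+ 2 =
    (c1 * eta x ^+ (a * (2 * q))) * (c2 * eta x ^+ (b * (2 * q))).
  rewrite -exprM mulrACA -exprD; congr (_ * eta x ^+ _).
  by rewrite -mulnDl -mulnA [(q * 2)%N]mulnC.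
apply: ler_pM.
- by apply: Ex_ge0 => w; rewrite -exprM mulnAC exprM even_pow_norm exprn_ge0.
- by apply: Ex_ge0 => w; rewrite -exprM mulnAC exprM even_pow_norm exprn_ge0.
- by under eq_Ex do rewrite -exprM [(_ * 2)%N]mulnC; exact: H1.
- by under eq_Ex do rewrite -exprM [(_ * 2)%N]mulnC; exact: H2.
Qed.

Lemma OL_cst (c : R) : OL 0 (fun _ _ => c).
Proof.
split => [x|q]; first exact: LG_cst.
exists (c ^+ (2 * q)); first by rewrite even_pow_norm exprn_ge0.
by move=> x; rewrite (Ex_cst P (c ^+ (2 * q))) mul0n expr0 mulr1.
Qed.

Lemma OL_Z a c f : OL a f -> OL a (fun x w => c * f x w).
Proof. by move=> hf; have := OL_M (OL_cst c) hf. Qed.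

Lemma OL_pow a f n : OL a f -> OL (a * n) (fun x w => f x w ^+ n).
Proof.
move=> hf; elim: n => [|n IH]; first by rewrite muln0; exact: OL_cst.
by rewrite mulnS; under eq_fun do (under eq_fun do rewrite exprS); exact: OL_M.
Qed.

Lemma OL_eta : OL 2 (fun x _ => eta x).
Proof.
split => [x|q]; first exact: LG_cst.
by exists 1 => // x; rewrite (Ex_cst P (eta x ^+ (2 * q))) mul1r.
Qed.

Lemma OL_poly (K : R) (k : nat) f : OL 0 f -> OL 0 (fun x w => K * (1 + f x w) ^+ k).
Proof. by move=> hf; apply: OL_Z; apply: (@OL_pow 0); apply: OL_D => //; exact: OL_cst. Qed.

Lemma OL_intro a f : (forall x, LG P measurable (f x)) ->
  (forall q, exists2 c, 0 <= c &
    forall x, Ex P (fun w => f x w ^+ (2 * q.+1)) <= c * eta x ^+ (a * q.+1)) -> OL a f.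
Proof.
move=> hf H; split => // -[|q]; last exact: H.
exists 1 => // x; rewrite muln0; under eq_Ex do rewrite expr0.
by rewrite (Ex_cst P 1) muln0 expr0 mulr1.
Qed.

(** Cauchy-Schwarz against the constant 1 reaches odd powers as well, which is needed because the
    source of a recursion enters with an arbitrary power. *)
Lemma OL2_Ex f q : OL 2 f -> exists2 c, 0 <= c &
  forall x, Ex P (fun w => f x w ^+ q) <= c * eta x ^+ q.
Proof.
move=> [hf H]; have [c c0 Hc] := H q; exists (Num.sqrt c); first exact: sqrtr_ge0.
move=> x; have h1 : LG P measurable (cst (1 : R)) by exact: LG_cst.
have := Ex_CS sM h1 (LG_pow q (hf x)).
under eq_Ex do rewrite /= mul1r; under [X in _ <= X * _]eq_Ex do rewrite /= expr1n.
rewrite (Ex_cst P 1) mul1r; under [X in _ <= X]eq_Ex do rewrite -exprM [(q * 2)%N]mulnC.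
move=> /le_trans /(_ (Hc x)) h2.
have [neg|pos] := lerP (Ex P (fun w => f x w ^+ q)) 0.
  by apply: le_trans neg _; rewrite mulr_ge0 ?sqrtr_ge0 ?exprn_ge0.
rewrite -(ler_pXn2r (n:=2))// ?nnegrE ?mulr_ge0 ?sqrtr_ge0 ?exprn_ge0 ?(ltW pos)//.
by rewrite exprMn sqr_sqrtr// -exprM [(q * 2)%N]mulnC.
Qed.

End MomentOrder.

Section RunMax.
Context (R : realType) (disp : measure_display) (Omega : measurableType disp)
  (P : probability Omega R).
Implicit Type s : nat -> Omega -> R.

Lemma runmax_ex s n w : exists2 k, (k <= n)%N & runmax s n w = s k w.
Proof.
elim: n => [|n [k kn E]]; first by exists 0%N.
rewrite /=; have [_|_] := leP (runmax s n w) (s n.+1 w); first by exists n.+1.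
by exists k => //; rewrite leqW.
Qed.

Lemma LG_runmaxT s N : (forall n, (n <= N)%N -> LG P measurable (s n)) ->
  LG P measurable (runmax s N).
Proof.
elim: N => [|N IH] hs; first exact: hs.
apply: LG_max => //; [exact: subalg_measurable| |exact: hs].
by apply: IH => n nN; apply: hs; exact: leqW.
Qed.

Lemma Ex_runmax_le s N q (S : Omega -> R) c :
  (forall n, (n <= N)%N -> LG P measurable (s n)) -> LG P measurable S ->
  (forall n w, (n <= N)%N -> 0 <= s n w) ->
  (forall n w, (n <= N)%N -> s n w ^+ q <= S w) -> Ex P (fun w => S w ^+ 2) <= c ->
  Ex P (fun w => runmax s N w ^+ (2 * q)) <= c.
Proof.
move=> hs hS s0 sS Ec; apply: le_trans Ec; apply: (Ex_le (@subalg_measurable disp Omega)).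
- by apply: LG_pow; exact: LG_runmaxT.
- exact: LG_pow.
- move=> w; have [k kN ->] := runmax_ex s N w; rewrite mulnC exprM.
  have h := sS k w kN; have h0 : 0 <= s k w ^+ q by rewrite exprn_ge0 ?s0.
  by rewrite lerXn2r ?nnegrE// (le_trans h0).
Qed.

End RunMax.

(** * Distance between the schemes with N and 2N steps *)

Section Level.
Context (R : realType) (disp : measure_display) (Omega : measurableType disp)
  (P : probability Omega R).
Variables (d m : nat) (T K : R) (k : nat) (mu : 'cV[R]_d -> 'cV[R]_d)
  (sigma : 'cV[R]_d -> 'M[R]_(d, m)).
Hypotheses (T0 : 0 < T) (K0 : 0 <= K) (hmu : drift_bounds K k mu)
  (hsig : forall x y, enorm (sigma x - sigma y) <= K * enorm (x - y))
  (gmu : forall x, enorm (mu x) <= K * (1 + enorm x) ^+ k)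
  (gsig : forall x, enorm (sigma x) <= K * (1 + enorm x)).
Variables (C Cx : nat -> R).
Hypotheses (C0 : forall q, 0 <= C q) (Cx0 : forall q, 0 <= Cx q).

Definition pairsum (D : nat -> Omega -> 'cV[R]_m) n w := D n.*2 w + D n.*2.+1 w.

(** An index type: an [OL] statement over it is uniform in the grid, the filtration, the noise and
    the initial value. [lcoarse] is a field because moment bounds with the same [C] for sums of two
    increments do not follow from [lfine]. *)
Record lev := Lev { lN : nat; lG : nat -> set (set Omega);
  lD : nat -> Omega -> 'cV[R]_m; lxi : Omega -> 'cV[R]_d;
  lfine : tsetup P C Cx lN.*2 lG lD lxi;
  lcoarse : tsetup P C Cx lN (fun n => lG n.*2) (pairsum lD) lxi }.

Let T0' : 0 <= T := ltW T0.
Let sM := @subalg_measurable disp Omega.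

Definition leta (l : lev) : R := (lN l).*2%:R^-1.

Lemma leta01 l : 0 <= leta l <= 1.
Proof.
have [N0 _ _ _ _] := lfine l.
by rewrite /leta invr_ge0 ler0n /= invf_le1 ?ltr0n// ler1n.
Qed.

Let hf (l : lev) := T / (lN l).*2%:R.
Let hc (l : lev) := T / (lN l)%:R.

Let hfE l : hf l = leta l * T. Proof. by rewrite /hf mulrC. Qed.

Let hcE l : 2^-1 * hc l = leta l * T.
Proof.
have [N0 _ _ _ _] := lcoarse l.
rewrite /hc /leta -muln2 natrM; field.
by rewrite pnatr_eq0 -lt0n.
Qed.

Let hf0 l : 0 <= hf l. Proof. by rewrite /hf divr_ge0. Qed.
Let hc0 l : 0 <= hc l. Proof. by rewrite /hc divr_ge0. Qed.

Definition fineY (l : lev) := tamed mu sigma (T / (lN l).*2%:R) (lxi l) (lD l).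
Definition coarseY (l : lev) := tamed mu sigma (T / (lN l)%:R) (lxi l) (pairsum (lD l)).

(* The coarse approximation extended to the fine grid: half of the drift, but
   all of the noise available so far, is added at odd indices. *)
Fixpoint midY (l : lev) i w : 'cV[R]_d :=
  if i is i'.+1 then
    midY l i' w + 2^-1 *: tame mu (T / (lN l)%:R) (coarseY l i'./2 w)
      + sigma (coarseY l i'./2 w) *m lD l i' w
  else lxi l w.

Lemma midY_even l n w : midY l n.*2 w = coarseY l n w.
Proof.
have alg (y a b b' : 'cV[R]_d) : y + 2^-1 *: a + b + 2^-1 *: a + b' = y + a + (b + b').
  by apply/matrixP => i j; rewrite !mxE; field.
elim: n => // n IH; rewrite doubleS /= IH /= uphalf_double doubleK.
by rewrite /coarseY /= -/(coarseY l n w) /pairsum mulmxDr; exact: alg.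
Qed.

Lemma midY_odd l n w : midY l n.*2.+1 w = coarseY l n w +
   2^-1 *: tame mu (T / (lN l)%:R) (coarseY l n w) + sigma (coarseY l n w) *m lD l n.*2 w.
Proof. by rewrite /= midY_even doubleK. Qed.

Lemma half_le l i : (i <= (lN l).*2)%N -> (i./2 <= lN l)%N.
Proof. by move=> iN; rewrite -(doubleK (lN l)) half_leq. Qed.

Lemma lev_subalg l n : (n <= (lN l).*2)%N -> subalg (lG l n).
Proof. by have [_ hD sG0 _ _] := lfine l; exact: chain_subalg hD sG0 n. Qed.

Lemma lev_sub l i n : (i <= n <= (lN l).*2)%N -> lG l i `<=` lG l n.
Proof. by have [_ hD _ _ _] := lfine l; exact: chain_sub hD i n. Qed.

Lemma VLG_fineY l n : (n <= (lN l).*2)%N -> VLG P (lG l n) (fineY l n).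
Proof. exact: (VLG_tamed T0 K0 hmu hsig (lfine l)). Qed.

Lemma VLG_coarseY l n : (n <= (lN l).*2)%N -> VLG P (lG l n) (coarseY l n./2).
Proof.
move=> nN; have h := VLG_tamed T0 K0 hmu hsig (lcoarse l) (half_le nN).
apply: VLG_sub h; apply: lev_sub; rewrite nN andbT.
by rewrite -[leqRHS](odd_double_half n) leq_addl.
Qed.

Lemma VLG_midY l n : (n <= (lN l).*2)%N -> VLG P (lG l n) (midY l n).
Proof.
have [_ hD _ hxi _] := lfine l; elim: n => [//|n IH] nN.
have sG := lev_subalg (ltnW nN); have hQ := VLG_coarseY (ltnW nN).
apply: (VLG_step (hD n nN) (A := fun w => midY l n w + 2^-1 *: tame mu (T / (lN l)%:R) (coarseY l n./2 w))
  (B := fun w => sigma (coarseY l n./2 w))).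
  apply: VLGD => //; first exact/IH/ltnW.
  by apply: VLGZc => //; apply: (VLG_comp sG (lip_tame K0 hmu (hc0 l)) hQ).
exact: (VLG_comp sG (lip_sigma K0 hsig) hQ).
Qed.

Definition err l i w := fineY l i w - midY l i w.

Let gap l i w := midY l i w - coarseY l i./2 w.
(** In units of [leta]: what the drift difference contains besides mu(fine) - mu(mid), namely the
    passage from the extended scheme to the last coarse node and the two taming errors. *)
Let drift_rest l i w : R := T * enorm (mu (midY l i w) - mu (coarseY l i./2 w))
   + leta l * (T ^+ 2 * enorm (mu (fineY l i w)) ^+ 2)
   + leta l * (2 * T ^+ 2 * enorm (mu (coarseY l i./2 w)) ^+ 2).
Let drift_gam l i w : R := T * enorm (mu (fineY l i w) - mu (midY l i w)) + drift_rest l i w.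
Let rho l i w : R := 3 * drift_rest l i w ^+ 2
   + leta l * (2 * T ^+ 2 * (enorm (mu (fineY l i w)) + enorm (mu (midY l i w))) ^+ 2)
   + 2 * K ^+ 2 * enorm (gap l i w) ^+ 2.
Let incA l i w := tame mu (hf l) (fineY l i w) - 2^-1 *: tame mu (hc l) (coarseY l i./2 w).
Let incB l i w := sigma (fineY l i w) - sigma (coarseY l i./2 w).

Let drift_rest_ge0 l i w : 0 <= drift_rest l i w.
Proof.
have /andP[e0 _] := leta01 l.
by rewrite /drift_rest !addr_ge0// ?mulr_ge0 ?sqr_ge0.
Qed.

Let err_rec l n w : err l n.+1 w = (err l n w + incA l n w) + incB l n w *m lD l n w.
Proof.
have alg (u t s v t' s' : 'cV[R]_d) : (u + t + s) - (v + t' + s') = (u - v + (t - t')) + (s - s').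
  by apply/matrixP => i j; rewrite !mxE; ring.
by rewrite /err /incA /incB mulmxBl; exact: alg.
Qed.

(** The one-sided condition helps only for mu evaluated at the two points whose difference is [err].
    Hence mu at [midY] is inserted, although the coarse drift is evaluated at the coarse node. *)
Let incA_split l i w : exists r, incA l i w =
   (leta l * T) *: (mu (fineY l i w) - mu (midY l i w)) + r /\ enorm r <= leta l * drift_rest l i w.
Proof.
set h := leta l * T; set u := fineY l i w; set v := midY l i w; set q := coarseY l i./2 w.
exists (h *: (mu v - mu q) + ((tame mu (hf l) u - hf l *: mu u)
   - 2^-1 *: (tame mu (hc l) q - hc l *: mu q))); split.
  have -> : 2^-1 *: (tame mu (hc l) q - hc l *: mu q) = 2^-1 *: tame mu (hc l) q - h *: mu q.
    by rewrite scalerBr [2^-1 *: (hc l *: _)]scalerA hcE.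
  have alg (a b x y z : 'cV[R]_d) (t : R) :
      a - b = t *: (x - y) + (t *: (y - z) + (a - t *: x - (b - t *: z))).
    by apply/matrixP => i' j'; rewrite !mxE; ring.
  by rewrite /incA -/u -/q [X in _ - X *: mu u]hfE; exact: alg.
have /andP[e0 e1] := leta01 l.
have h0 : 0 <= h by rewrite mulr_ge0.
apply: le_trans (ler_enormD _ _) _; rewrite /drift_rest -/u -/v -/q.
rewrite -[X in leta l * X]addrA [leRHS]mulrDr; apply: lerD.
  by rewrite enormZ ger0_norm// mulrA.
apply: le_trans (ler_enormB _ _) _; rewrite mulrDr; apply: lerD.
  apply: le_trans (tame_err mu u (hf0 l)) _; rewrite hfE le_eqVlt; apply/orP; left; apply/eqP; ring.
rewrite enormZ ger0_norm ?invr_ge0//.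
apply: le_trans (ler_wpM2l _ (tame_err mu q (hc0 l))) _; first by rewrite invr_ge0.
have hcE2 : hc l = 2 * (leta l * T) by rewrite -hcE mulrA divff// mul1r.
by rewrite hcE2 le_eqVlt; apply/orP; left; apply/eqP; field.
Qed.

Let err_cst : R := 2 * T * K + 1 + 2 * K ^+ 2.

(** The one-sided condition controls the cross term. The square of the drift step, for which mu has
    no global Lipschitz bound, is estimated by the sizes of mu; it carries h^2 and fits into the
    source. *)
Let incA_sq l i w : enorm (err l i w + incA l i w) ^+ 2 <=
   (1 + err_cst * leta l) * enorm (err l i w) ^+ 2 + leta l * rho l i w.
Proof.
have /andP[e0 e1] := leta01 l.
have [r [-> br]] := incA_split l i w.
rewrite /rho; have := drift_rest_ge0 l i w.
move: (drift_rest l i w) br => g br g0.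
set e := err l i w; set u := fineY l i w; set v := midY l i w.
set h := leta l * T; have h0 : 0 <= h by rewrite mulr_ge0.
rewrite sqr_enormD mdotDr mdotZr.
have h1 : h * mdot e (mu u - mu v) <= h * (K * enorm e ^+ 2).
  by rewrite ler_wpM2l//; have [+ _] := hmu u v; rewrite dotpE.
have h2 : mdot e r <= enorm e * (leta l * g).
  by apply: le_trans (le_mdot _ _) _; rewrite ler_wpM2l.
have h3 : enorm (h *: (mu u - mu v) + r) ^+ 2 <=
    2 * (h ^+ 2 * (enorm (mu u) + enorm (mu v)) ^+ 2) + 2 * (leta l * g) ^+ 2.
  apply: (@le_trans _ _ ((h * (enorm (mu u) + enorm (mu v)) + leta l * g) ^+ 2)).
    rewrite lerXn2r ?nnegrE ?addr_ge0 ?mulr_ge0 ?addr_ge0//.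
    apply: le_trans (ler_enormD _ _) _; rewrite enormZ (ger0_norm h0) lerD//.
    by rewrite ler_wpM2l// ler_enormB.
  rewrite -exprMn; have := sqr_ge0 (h * (enorm (mu u) + enorm (mu v)) - leta l * g); nra.
have h4 : h ^+ 2 * (enorm (mu u) + enorm (mu v)) ^+ 2 <=
    leta l * (T ^+ 2 * (enorm (mu u) + enorm (mu v)) ^+ 2).
  rewrite /h exprMn -mulrA expr2 -[leLHS]mulrA.
  by rewrite ler_wpM2l// ler_piMl// mulr_ge0 ?sqr_ge0.
have h5 : (leta l * g) ^+ 2 <= leta l * g ^+ 2.
  by rewrite exprMn ler_wpM2r ?sqr_ge0// expr2 ler_piMl.
have h6 : 2 * (enorm e * (leta l * g)) <= leta l * (enorm e ^+ 2 + g ^+ 2).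
  by have := mulr_ge0 e0 (sqr_ge0 (enorm e - g)); nra.
have h7 : 0 <= leta l * (2 * K ^+ 2 * enorm (gap l i w) ^+ 2).
  by rewrite !mulr_ge0 ?sqr_ge0.
have h8 : 0 <= 2 * K ^+ 2 * leta l * enorm e ^+ 2 by rewrite !mulr_ge0 ?sqr_ge0.
have h9 : leta l * (leta l * (2 * T ^+ 2 * (enorm (mu u) + enorm (mu v)) ^+ 2)) =
   2 * (h ^+ 2 * (enorm (mu u) + enorm (mu v)) ^+ 2) by rewrite /h; ring.
rewrite (mulrDr (leta l)) (mulrDr (leta l)) h9 /err_cst.
rewrite (_ : h * (K * enorm e ^+ 2) = leta l * (T * K * enorm e ^+ 2)) in h1; last by rewrite /h; ring.
by lra.
Qed.

Let incB_bound l i w : enorm (incB l i w) <= K * (enorm (err l i w) + enorm (gap l i w)).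
Proof.
apply: le_trans (hsig _ _) _; rewrite ler_wpM2l//.
have -> : fineY l i w - coarseY l i./2 w = err l i w + gap l i w by rewrite /err /gap addrA subrK.
exact: ler_enormD.
Qed.

Let incB_sq l i w : enorm (incB l i w) ^+ 2 <= err_cst * enorm (err l i w) ^+ 2 + rho l i w.
Proof.
have /andP[e0 _] := leta01 l.
apply: (@le_trans _ _ ((K * (enorm (err l i w) + enorm (gap l i w))) ^+ 2)).
  by rewrite lerXn2r ?nnegrE ?mulr_ge0 ?addr_ge0//; exact: incB_bound.
rewrite exprMn /err_cst /rho.
have h1 := mulr_ge0 (sqr_ge0 K) (sqr_ge0 (enorm (err l i w) - enorm (gap l i w))).
have h2 : 0 <= (2 * T * K + 1) * enorm (err l i w) ^+ 2.
  by rewrite mulr_ge0 ?sqr_ge0// addr_ge0// !mulr_ge0.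
have h3 : 0 <= 3 * drift_rest l i w ^+ 2 by rewrite mulr_ge0 ?sqr_ge0.
have h4 : 0 <= leta l * (2 * T ^+ 2 * (enorm (mu (fineY l i w)) + enorm (mu (midY l i w))) ^+ 2).
  by rewrite mulr_ge0// mulr_ge0 ?sqr_ge0// mulr_ge0 ?sqr_ge0.
by nra.
Qed.

(** Pairs of a level and one of its nodes, to state orders uniformly over all nodes of all grids. *)
Record levi := Levi { li_lev :> lev; li_i : nat; li_le : (li_i < (lN li_lev).*2)%N }.

Let ieta (x : levi) := leta x.
Let ieta01 x : 0 <= ieta x <= 1 := leta01 x.

Let up x f : LG P (lG (li_lev x) (li_i x)) f -> LG P measurable f.
Proof. by apply: LG_sub; case: (lev_subalg (ltnW (li_le x))). Qed.

Let oU : OL P ieta 0 (fun x w => enorm (fineY x (li_i x) w)).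
Proof.
split => [x|q].
  by apply: (@up x); apply: LG_enorm; [exact: lev_subalg (ltnW (li_le x))|exact: VLG_fineY (ltnW (li_le x))].
have [c c0 Hc] := tamed_moment P T0 K0 hmu hsig gmu gsig C0 Cx0 q.
by exists c => // x; rewrite mul0n expr0 mulr1; exact: Hc (lfine x) _ (ltnW (li_le x)).
Qed.

Let oQ : OL P ieta 0 (fun x w => enorm (coarseY x (li_i x)./2 w)).
Proof.
split => [x|q].
  by apply: (@up x); apply: LG_enorm; [exact: lev_subalg (ltnW (li_le x))|exact: VLG_coarseY (ltnW (li_le x))].
have [c c0 Hc] := tamed_moment P T0 K0 hmu hsig gmu gsig C0 Cx0 q.
exists c => // x; rewrite mul0n expr0 mulr1.
exact: Hc (lcoarse x) _ (half_le (ltnW (li_le x))).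
Qed.

(** The index [(li_i x).-1] is that of the increment by which an odd node of [midY] is ahead of the
    coarse scheme; at even nodes there is no such increment to account for. *)
Let oD : OL P ieta 1 (fun x w => enorm (lD x (li_i x).-1 w)).
Proof.
have lt (x : levi) : ((li_i x).-1 < (lN x).*2)%N by apply: leq_ltn_trans (li_le x); exact: leq_pred.
have hi (x : levi) := (let: And5 _ hD _ _ _ := lfine x in hD) _ (lt x).
split => [x|q].
  apply: (LG_sub _ (LG_enorm (incr_future (hi x)) (incr_VLG (hi x)))).
  by case: (incr_future (hi x)).
exists (C q) => // x; rewrite mul1n; exact: incr_moment (hi x) q.
Qed.

Let omu (Z : levi -> Omega -> 'cV[R]_d) : OL P ieta 0 (fun x w => enorm (Z x w)) ->
  (forall x : levi, VLG P (lG x (li_i x)) (Z x)) -> OL P ieta 0 (fun x w => enorm (mu (Z x w))).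
Proof.
move=> oZ hZ; apply: (OL_dom _ _ (OL_poly ieta01 K k oZ)) => x.
  have sG := lev_subalg (ltnW (li_le x)); apply: (@up x); apply: LG_enorm => //.
  exact: (VLG_comp sG (lip_mu K0 hmu)).
by move=> w; rewrite ger0_norm.
Qed.

Let osig (Z : levi -> Omega -> 'cV[R]_d) : OL P ieta 0 (fun x w => enorm (Z x w)) ->
  (forall x : levi, VLG P (lG x (li_i x)) (Z x)) -> OL P ieta 0 (fun x w => enorm (sigma (Z x w))).
Proof.
move=> oZ hZ; apply: (OL_dom _ _ (OL_poly ieta01 K 1 oZ)) => x.
  have sG := lev_subalg (ltnW (li_le x)); apply: (@up x); apply: LG_enorm => //.
  exact: (VLG_comp sG (lip_sigma K0 hsig)).
by move=> w; rewrite ger0_norm.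
Qed.

Let hU x : VLG P (lG (li_lev x) (li_i x)) (fineY x (li_i x)) := VLG_fineY (ltnW (li_le x)).
Let hQ x : VLG P (lG (li_lev x) (li_i x)) (coarseY x (li_i x)./2) := VLG_coarseY (ltnW (li_le x)).
Let hV x : VLG P (lG (li_lev x) (li_i x)) (midY x (li_i x)) := VLG_midY (ltnW (li_le x)).
Let sGx x : subalg (lG (li_lev x) (li_i x)) := lev_subalg (ltnW (li_le x)).
Let he x : VLG P (lG (li_lev x) (li_i x)) (err x (li_i x)) := VLGB (sGx x) (hU x) (hV x).
Let hgap x : VLG P (lG (li_lev x) (li_i x)) (gap x (li_i x)) := VLGB (sGx x) (hV x) (hQ x).

Let gap_bound l i w : enorm (gap l i w) <=
  leta l * (T * enorm (mu (coarseY l i./2 w))) + enorm (sigma (coarseY l i./2 w)) * enorm (lD l i.-1 w).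
Proof.
have /andP[e0 _] := leta01 l.
rewrite /gap -[i]odd_double_half; move: (i./2) (odd i) => n [] /=; last first.
  by rewrite add0n doubleK midY_even subrr enorm0 addr_ge0 ?mulr_ge0.
rewrite /= uphalf_double -/(midY l n.*2.+1 w) midY_odd; set q := coarseY l n w.
have -> : q + 2^-1 *: tame mu (T / (lN l)%:R) q + sigma q *m lD l n.*2 w - q =
    2^-1 *: tame mu (T / (lN l)%:R) q + sigma q *m lD l n.*2 w.
  by rewrite addrC -addrA addKr.
apply: le_trans (ler_enormD _ _) _; apply: lerD; last exact: enorm_mulmx.
rewrite enormZ ger0_norm ?invr_ge0//.
apply: le_trans (ler_wpM2l _ (tame_le mu q (hc0 l))) _; first by rewrite invr_ge0.
by rewrite [leLHS]mulrA [leRHS]mulrA ler_wpM2r// hcE.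
Qed.

Let ogap : OL P ieta 1 (fun x w => enorm (gap x (li_i x) w)).
Proof.
have o1 : OL P ieta 1 (fun x w => ieta x * (T * enorm (mu (coarseY x (li_i x)./2 w)))).
  apply: (OL_weak ieta01 (_ : 1 <= 2 + 0)%N) => //.
  by apply: (OL_M ieta01); [exact: OL_eta|apply: OL_Z => //; exact: omu].
have o2 := OL_D o1 (OL_M ieta01 (osig oQ hQ) oD).
apply: (OL_dom _ _ o2) => [x|x w].
  by apply: (@up x); exact: LG_enorm.
rewrite ger0_norm//; exact: gap_bound.
Qed.

Let omU := omu oU hU.
Let omQ := omu oQ hQ.

Let oV : OL P ieta 0 (fun x w => enorm (midY x (li_i x) w)).
Proof.
have o := OL_D (OL_weak ieta01 (leq0n 1) ogap) oQ.
apply: (OL_dom _ _ o) => [x|x w].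
  by apply: (@up x); exact: (LG_enorm (sGx x) (hV x)).
rewrite ger0_norm//; have -> : midY x (li_i x) w = gap x (li_i x) w + coarseY x (li_i x)./2 w by rewrite /gap subrK.
exact: ler_enormD.
Qed.

Let omV := omu oV hV.

Let olip (Z Z' : levi -> Omega -> 'cV[R]_d) : OL P ieta 0 (fun x w => enorm (Z x w)) ->
  OL P ieta 0 (fun x w => enorm (Z' x w)) ->
  (forall x : levi, VLG P (lG x (li_i x)) (Z x)) -> (forall x : levi, VLG P (lG x (li_i x)) (Z' x)) ->
  OL P ieta 1 (fun x w => enorm (Z x w - Z' x w)) ->
  OL P ieta 1 (fun x w => enorm (mu (Z x w) - mu (Z' x w))).
Proof.
move=> oZ oZ' hZ hZ' od.
have o := OL_M ieta01 (OL_poly ieta01 K k (OL_D oZ oZ')) od.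
apply: (OL_dom _ _ o) => [x|x w].
  have sG := sGx x; apply: (@up x); apply: LG_enorm => //.
  by apply: VLGB => //; exact: (VLG_comp sG (lip_mu K0 hmu)).
by rewrite ger0_norm// addrA; have [_] := hmu (Z x w) (Z' x w).
Qed.

Let orest : OL P ieta 1 (fun x w => drift_rest x (li_i x) w).
Proof.
rewrite /drift_rest; apply: (OL_D); first apply: (OL_D).
- exact: (OL_Z ieta01 T (olip oV oQ hV hQ ogap)).
- apply: (OL_weak ieta01 (_ : 1 <= 2 + 0)%N) => //; apply: (OL_M ieta01); first exact: OL_eta.
  by apply: (OL_Z ieta01); exact: (OL_pow ieta01 2 omU).
- apply: (OL_weak ieta01 (_ : 1 <= 2 + 0)%N) => //; apply: (OL_M ieta01); first exact: OL_eta.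
  by apply: (OL_Z ieta01); exact: (OL_pow ieta01 2 omQ).
Qed.

Let orho : OL P ieta 2 (fun x w => rho x (li_i x) w).
Proof.
rewrite /rho; apply: (OL_D); first apply: (OL_D).
- by apply: (OL_Z ieta01); exact: (OL_pow ieta01 2 orest).
- rewrite -[2%N]addn0; apply: (OL_M ieta01); first exact: OL_eta.
  by apply: (OL_Z ieta01); exact: (OL_pow ieta01 2 (OL_D omU omV)).
- by apply: (OL_Z ieta01); exact: (OL_pow ieta01 2 ogap).
Qed.

Let VLGmu l n (Z : Omega -> 'cV[R]_d) : (n <= (lN l).*2)%N -> VLG P (lG l n) Z ->
  VLG P (lG l n) (fun w => mu (Z w)).
Proof. by move=> nN hZ; exact: (VLG_comp (lev_subalg nN) (lip_mu K0 hmu) hZ). Qed.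

Let LG_rest l n : (n <= (lN l).*2)%N -> LG P (lG l n) (drift_rest l n).
Proof.
move=> nN; have sG := lev_subalg nN.
have h1 := VLGmu nN (VLG_fineY nN); have h2 := VLGmu nN (VLG_midY nN); have h3 := VLGmu nN (VLG_coarseY nN).
have [e1 e3] := (LG_enorm sG h1, LG_enorm sG h3); have e2 := LG_enorm sG (VLGB sG h2 h3).
apply: (LGD sG); first apply: (LGD sG).
- exact: LGZ.
- by apply: (LGZ sG); apply: (LGZ sG); exact: LG_pow.
- by apply: (LGZ sG); apply: (LGZ sG); exact: LG_pow.
Qed.

Let LG_rho l n : (n <= (lN l).*2)%N -> LG P (lG l n) (rho l n).
Proof.
move=> nN; have sG := lev_subalg nN.
have h1 := VLGmu nN (VLG_fineY nN); have h2 := VLGmu nN (VLG_midY nN).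
have e1 := LG_enorm sG h1; have e2 := LG_enorm sG h2.
have e3 := LG_enorm sG (VLGB sG (VLG_midY nN) (VLG_coarseY nN)).
apply: (LGD sG); first apply: (LGD sG).
- by apply: (LGZ sG); apply: LG_pow; exact: LG_rest.
- by apply: (LGZ sG); apply: (LGZ sG); apply: LG_pow; exact: LGD.
- by apply: (LGZ sG); exact: LG_pow.
Qed.

Let rho_ge0 l n w : 0 <= rho l n w.
Proof.
have /andP[e0 _] := leta01 l; rewrite /rho !addr_ge0//.
- by rewrite mulr_ge0// sqr_ge0.
- by rewrite mulr_ge0// mulr_ge0 ?sqr_ge0// mulr_ge0 ?sqr_ge0.
- by rewrite mulr_ge0 ?sqr_ge0// mulr_ge0 ?sqr_ge0.
Qed.

Let VLG_err l n : (n <= (lN l).*2)%N -> VLG P (lG l n) (err l n).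
Proof. by move=> nN; exact: (VLGB (lev_subalg nN) (VLG_fineY nN) (VLG_midY nN)). Qed.

Let VLG_incA l n : (n < (lN l).*2)%N -> VLG P (lG l n) (incA l n).
Proof.
move=> /ltnW nN; have sG := lev_subalg nN; apply: (VLGB sG).
  exact: (VLG_comp sG (lip_tame K0 hmu (hf0 l)) (VLG_fineY nN)).
by apply: (VLGZc sG); exact: (VLG_comp sG (lip_tame K0 hmu (hc0 l)) (VLG_coarseY nN)).
Qed.

Let VLG_incB l n : (n < (lN l).*2)%N -> VLG P (lG l n) (incB l n).
Proof.
move=> /ltnW nN; have sG := lev_subalg nN; apply: (VLGB sG).
  exact: (VLG_comp sG (lip_sigma K0 hsig) (VLG_fineY nN)).
exact: (VLG_comp sG (lip_sigma K0 hsig) (VLG_coarseY nN)).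
Qed.

Let err0 l w : err l 0%N w = 0. Proof. by rewrite /err subrr. Qed.

Let err_cst_ge0 : 0 <= err_cst.
Proof. by rewrite /err_cst !addr_ge0// !mulr_ge0// sqr_ge0. Qed.

Let oerr : OL P ieta 1 (fun x w => enorm (err x (li_i x) w)).
Proof.
apply: (OL_intro) => [x|q]; first by apply: (@up x); exact: (LG_enorm (sGx x) (he x)).
have [c c0 Hc] := OL2_Ex ieta01 q.+1 orho.
set r := rec_cst C err_cst q.+1.
exists (`|expR r * (r * c)|) => // x; rewrite mul1n.
have [N0 hD sG0 hxi _] := lfine x.
have r0 : 0 <= r.
  have sc : 0 <= step_cst C q.+1 by rewrite /step_cst addr_ge0 ?mulr_ge0 ?exprn_ge0 ?addr_ge0.
  have pc := perturb_cst_ge0 q.+1 err_cst_ge0; have := mulr_ge0 sc pc.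
  by rewrite /r /rec_cst; lra.
have e00 : VLG P (lG x 0%N) (err x 0%N) by exact: VLG_err.
have H := @rec_moment R disp Omega P d m C (lN x).*2 (lG x) (lD x) N0 C0 hD sG0 (err x)
  (fun n w => err x n w + incA x n w) (incB x) e00 (fun n w _ => err_rec x n w)
  _ _ err_cst (rho x) q.+1 err_cst_ge0 (fun n nN => LG_rho (ltnW nN)) (rho_ge0 x)
  (fun n w _ => incA_sq x n w) (fun n w _ => incB_sq x n w) _ (ltnW (li_le x)).
apply: le_trans (H _ _) _ => {H}.
- by move=> n nN hY; apply: (VLGD (lev_subalg (ltnW nN))) => //; exact: VLG_incA.
- by move=> n nN _; exact: VLG_incB.
under [X in _ * (X + _)]eq_Ex do rewrite err0 enorm0 expr0n/=.
rewrite (Ex_cst P 0) add0r -/r.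
apply: (@le_trans _ _ (expR r * (r * c * ieta x ^+ q.+1))); last first.
  by rewrite mulrA ler_wpM2r ?exprn_ge0 ?ler_norm//; have /andP[] := ieta01 x.
rewrite ler_wpM2l ?expR_ge0//.
have e0 : 0 <= ieta x by have /andP[] := ieta01 x.
apply: (@sum_eta_le R (lN x).*2 (li_i x) (fun i => r * Ex P (fun w => rho x i w ^+ q.+1))) => //.
- exact: (ltnW (li_le x)).
- by rewrite !mulr_ge0 ?exprn_ge0.
- by move=> i iN; rewrite -mulrA ler_wpM2l//; exact: (Hc (Levi iN)).
Qed.

Definition max_err l w := runmax (fun i w => enorm (err l i w)) (lN l).*2 w.

(** The bound [oerr] at single nodes makes both the drift and the diffusion coefficient of the error
    recursion of order sqrt eta; [rec_max] then puts the maximum inside the expectation without loss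
    of rate. *)
Lemma OL_max_err : OL P leta 1 max_err.
Proof.
have LGe l n : (n <= (lN l).*2)%N -> LG P measurable (fun w => enorm (err l n w)).
  move=> nN; have sG := lev_subalg nN; apply: LG_sub (LG_enorm sG (VLG_err nN)).
  by case: sG.
apply: (OL_intro) => [l|q]; first by apply: LG_runmaxT => n nN; exact: LGe.
have ogam : OL P ieta 1 (fun x w => drift_gam x (li_i x) w).
  exact: (OL_D (OL_Z ieta01 T (olip oU oV hU hV oerr)) orest).
have oB : OL P ieta 1 (fun x w => enorm (incB x (li_i x) w)).
  have o := OL_Z ieta01 K (OL_D oerr ogap).
  apply: (OL_dom _ _ o) => [x|x w].
    by apply: (@up x); apply: (LG_enorm (sGx x)); apply: VLG_incB; exact: li_le.
  by rewrite ger0_norm//; exact: incB_bound.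
have [c1 c10 H1] := ogam.2 q.+1; have [c2 c20 H2] := oB.2 q.+1.
have s0 : 0 <= step_cst C q.+1 by rewrite /step_cst addr_ge0 ?mulr_ge0 ?exprn_ge0 ?addr_ge0.
have m0 : 0 <= max_cst C q.
  by rewrite /max_cst !mulr_ge0 ?exprn_ge0// addr_ge0// !mulr_ge0// expR_ge0.
exists (max_cst C q * (c1 + c2)); first by rewrite mulr_ge0// addr_ge0.
move=> l; rewrite mul1n; have [N0 hD sG0 hxi _] := lfine l; have /andP[e0 _] := leta01 l.
have e00 : VLG P (lG l 0%N) (err l 0%N) by exact: VLG_err.
have [] := @rec_max R disp Omega P d m C (lN l).*2 (lG l) (lD l) N0 C0 hD sG0 (err l)
  (fun n w => err l n w + incA l n w) (incB l) e00 (fun n w _ => err_rec l n w)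
  _ _ (incA l) (drift_gam l) q.
- by move=> n nN hY; apply: (VLGD (lev_subalg (ltnW nN))) => //; exact: VLG_incA.
- by move=> n nN _; exact: VLG_incB.
- by [].
- move=> n /ltnW nN; have sG := lev_subalg nN; apply: (LGD sG); last exact: LG_rest.
  apply: (LGZ sG); apply: (LG_enorm sG).
  by apply: (VLGB sG); [exact: VLGmu nN (VLG_fineY nN)|exact: VLGmu nN (VLG_midY nN)].
- by move=> n w; rewrite /drift_gam addr_ge0// mulr_ge0.
- move=> n w _; have [r [-> br]] := incA_split l n w.
  apply: le_trans (ler_enormD _ _) _; rewrite /drift_gam [leRHS]mulrDr lerD//.
  by rewrite enormZ ger0_norm ?mulr_ge0// mulrA.
move=> S [hS S0 bS ES].
apply: (@Ex_runmax_le _ _ _ P (fun i w => enorm (err l i w)) (lN l).*2 q.+1 S _ (LGe l) _ _ bS) => //.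
  by apply: LG_sub hS; case: (lev_subalg (leqnn (lN l).*2)).
apply: le_trans ES _; rewrite -[leRHS]mulrA; apply: ler_wpM2l => //.
under [X in X + _]eq_Ex do rewrite err0 enorm0 expr0n/=.
rewrite (Ex_cst P 0) add0r.
apply: (@sum_eta_le R (lN l).*2 (lN l).*2 (fun i => Ex P (fun w => drift_gam l i w ^+ (2 * q.+1))
   + Ex P (fun w => enorm (incB l i w) ^+ (2 * q.+1)))) => //.
  by rewrite mulr_ge0 ?addr_ge0 ?exprn_ge0.
move=> i iN; rewrite [leRHS]mulrDl; apply: lerD.
  by have := H1 (Levi iN); rewrite mul1n.
by have := H2 (Levi iN); rewrite mul1n.
Qed.

Definition max_coarse l w := runmax (fun n w => enorm (coarseY l n w)) (lN l) w.
Definition max_fine l w := runmax (fun n w => enorm (fineY l n w)) (lN l).*2 w.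

Let tamed_LG N Gs D xi n : tsetup P C Cx N Gs D xi -> (n <= N)%N ->
  LG P measurable (fun w => enorm (tamed mu sigma (T / N%:R) xi D n w)).
Proof.
move=> hs nN; have [N0 hD sG0 _ _] := hs; have sG := chain_subalg hD sG0 nN.
by apply: LG_sub (LG_enorm sG (VLG_tamed T0 K0 hmu hsig hs nN)); case: sG.
Qed.

Let tamed_LG_max N Gs D xi : tsetup P C Cx N Gs D xi ->
  LG P measurable (fun w => runmax (fun n w => enorm (tamed mu sigma (T / N%:R) xi D n w)) N w).
Proof. by move=> hs; apply: LG_runmaxT => n nN; exact: tamed_LG hs nN. Qed.

Lemma OL_max_fine : OL P leta 0 max_fine.
Proof.
apply: (OL_intro) => [l|q]; first exact: tamed_LG_max (lfine l).
have [c c0 H] := tamed_max P T0 K0 hmu hsig gmu gsig C0 Cx0 q.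
exists c => // l; rewrite mul0n expr0 mulr1; have [S [hS S0 bS ES]] := H _ _ _ _ (lfine l).
apply: (Ex_runmax_le (fun n nN => tamed_LG (lfine l) nN) _ _ bS) => //.
by apply: LG_sub hS; case: (lev_subalg (leqnn (lN l).*2)).
Qed.

Lemma OL_max_coarse : OL P leta 0 max_coarse.
Proof.
apply: (OL_intro) => [l|q]; first exact: tamed_LG_max (lcoarse l).
have [c c0 H] := tamed_max P T0 K0 hmu hsig gmu gsig C0 Cx0 q.
exists c => // l; rewrite mul0n expr0 mulr1; have [S [hS S0 bS ES]] := H _ _ _ _ (lcoarse l).
apply: (Ex_runmax_le (fun n nN => tamed_LG (lcoarse l) nN) _ _ bS) => //.
by apply: LG_sub hS; case: (lev_subalg (leqnn (lN l).*2)).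
Qed.

End Level.

(** * Maxima of Gaussian vectors *)

Section Gaussian.
Variable R : realType.
Local Notation mu := (@lebesgue_measure R).

(** The Radon-Nikodym derivative of the normal law and [normal_pdf] have the same integrals over all
    measurable sets, hence agree almost everywhere. *)
Lemma integral_normal_prob (m s : R) (f : R -> \bar R) : s != 0 ->
  measurable_fun setT f -> (forall x, (0 <= f x)%E) ->
  (\int[normal_prob m s]_x f x = \int[mu]_x (f x * (normal_pdf m s x)%:E))%E.
Proof.
move=> s0 mf f0.
have dom : normal_prob m s `<< mu by exact: normal_prob_dominates.
rewrite -(Radon_Nikodym_SigmaFinite.change_of_variables dom)//.
have mpdf : measurable_fun setT (fun x => (normal_pdf m s x)%:E).
  by apply/measurable_EFinP; exact: measurable_normal_pdf.
have mRN := measurable_int _ (Radon_Nikodym_SigmaFinite.f_integrable dom).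
apply: ae_eq_integral => //; [exact: emeasurable_funM|exact: emeasurable_funM|].
apply: ae_eqe_mul2l; apply: integral_ae_eq => //.
  exact: Radon_Nikodym_SigmaFinite.f_integrable.
by move=> E _ mE; rewrite -Radon_Nikodym_SigmaFinite.f_integral.
Qed.

Lemma normal_pdfN (s x : R) : s != 0 -> normal_pdf 0 s (- x) = normal_pdf 0 s x.
Proof. by move=> s0; rewrite normal_pdfE// /normal_fun !subr0 sqrrN. Qed.

Lemma normal_probN (s : R) (B : set R) : s != 0 -> measurable B ->
  normal_prob 0 s (-%R @^-1` B) = normal_prob 0 s B.
Proof.
move=> s0 mB; rewrite /normal_prob.
under eq_integral do rewrite -normal_pdfN//.
have mpdf : measurable_fun setT (fun x => (normal_pdf 0 s x)%:E).
  by apply/measurable_EFinP; exact: measurable_normal_pdf.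
have mN : measurable_fun setT (-%R : measurableTypeR R -> measurableTypeR R) by exact: oppr_measurable.
have := @ge0_integral_pushforward _ _ _ _ _ _ mN mu B (fun x => (normal_pdf 0 s x)%:E) mB.
move=> <-; last 2 first.
- exact: measurable_funS mpdf.
- by move=> x _; rewrite lee_fin normal_pdf_ge0.
by apply: eq_measure_integral => A mA _; exact: lebesgue_measureN.
Qed.

(** x^2/(4s^2) - x^2/(2s^2) = -x^2/(4s^2) is the exponent of the normal density with variance 2s^2,
    and sqrt 2 is the ratio of the normalisations. Integration gives E exp(Z^2/(4s^2)) = sqrt 2. *)
Lemma normal_pdf_exp (s x : R) : 0 < s ->
  expR (x ^+ 2 / (4 * s ^+ 2)) * normal_pdf 0 s x =
  Num.sqrt 2 * normal_pdf 0 (Num.sqrt 2 * s) x.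
Proof.
move=> s0; have r0 : 0 < Num.sqrt 2 :> R by rewrite sqrtr_gt0.
have rs0 : 0 < Num.sqrt 2 * s by rewrite mulr_gt0.
rewrite !normal_pdfE ?gt_eqF// /normal_peak /normal_fun subr0.
have -> : (Num.sqrt 2 * s) ^+ 2 * pi *+ 2 = 2 * (s ^+ 2 * pi *+ 2).
  by rewrite exprMn sqr_sqrtr//; ring.
rewrite sqrtrM// mulrCA -expRD (invfM (Num.sqrt 2)) -[X in _ = _ * X]mulrA mulVKf ?gt_eqF//.
congr (_ * expR _); rewrite exprMn sqr_sqrtr//; field.
by rewrite gt_eqF.
Qed.

Lemma pow_le_expR (x : R) n : 0 <= x -> x ^+ n <= n%:R ^+ n * expR x.
Proof.
move=> x0; case: n => [|n]; first by rewrite !expr0 mul1r -expR0 ler_expR.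
have -> : expR x = expR (x / n.+1%:R) ^+ n.+1 by rewrite -expRM_natl mulrC divfK.
rewrite -exprMn lerXn2r ?nnegrE ?mulr_ge0 ?expR_ge0//.
rewrite mulrC -ler_pdivrMr//; apply: le_trans (expR_ge1Dx _).
by rewrite lerDr.
Qed.

(** Above the level a, one half of the exponential pays for the power and the other half leaves the
    factor exp(-a/2), which will beat the number of Gaussians. *)
Lemma pow_le_tail (x a : R) n : 0 <= x -> 0 <= a ->
  x ^+ n <= a ^+ n + (2 ^+ n * n%:R ^+ n * expR (- (a / 2))) * expR x.
Proof.
move=> x0 a0; have [xa|ax] := leP x a.
  rewrite (@le_trans _ _ (a ^+ n)) ?lerXn2r//.
  by rewrite lerDl !mulr_ge0 ?expR_ge0 ?exprn_ge0.
rewrite (@le_trans _ _ (2 ^+ n * n%:R ^+ n * expR (- (a / 2)) * expR x))//; last first.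
  by rewrite lerDr exprn_ge0.
have {1}-> : x = 2 * (x / 2) by rewrite mulrC divfK.
rewrite exprMn -!mulrA ler_wpM2l ?exprn_ge0//.
apply: le_trans (@pow_le_expR (x / 2) n _) _; first by rewrite divr_ge0.
by rewrite ler_wpM2l ?exprn_ge0// -expRD ler_expR; lra.
Qed.

Lemma sum_ord_pow_le m q (x : 'I_m -> R) U : (forall i, 0 <= x i) -> 0 <= U ->
  (forall i, x i ^+ q.+1 <= U) -> (\sum_i x i) ^+ q.+1 <= m%:R ^+ q.+1 * U.
Proof.
case: m x => [|m] x x0 U0 xU; first by rewrite big_ord0 expr0n mulr_ge0 ?exprn_ge0.
have := @pow_sum_le R m.+1 q (fun n => x (inord n)) (fun n => x0 (inord n)).
have -> : \sum_(i < m.+1) x (inord i) = \sum_i x i by apply: eq_bigr => i _; rewrite inord_val.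
move=> /le_trans; apply; rewrite exprSr -mulrA ler_wpM2l ?exprn_ge0//.
apply: (@le_trans _ _ (\sum_(i < m.+1) U)); first by apply: ler_sum => i _; exact: xU.
by rewrite sumr_const card_ord mulr_natl.
Qed.

Context (disp : measure_display) (Omega : measurableType disp) (P : probability Omega R).
Let sM := @subalg_measurable disp Omega.

Definition gauss (s : R) (Z : Omega -> R) := measurable_fun setT Z /\
  forall B, measurable B -> P (Z @^-1` B) = normal_prob 0 s B.

Section gauss.
Variables (s : R) (Z : Omega -> R).
Hypotheses (s0 : 0 < s) (gZ : gauss s Z).

Let mZ := gZ.1.
Let mE : measurable_fun setT (fun w => (expR (Z w ^+ 2 / (4 * s ^+ 2)))%:E).
Proof.
apply/measurable_EFinP; apply: measurableT_comp => //.
by apply: measurable_funM => //; exact: measurable_funX.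
Qed.

Lemma gauss_exp : (\int[P]_w (expR (Z w ^+ 2 / (4 * s ^+ 2)))%:E = (Num.sqrt 2)%:E)%E.
Proof.
have mf : measurable_fun setT (fun x : R => (expR (x ^+ 2 / (4 * s ^+ 2)))%:E).
  apply/measurable_EFinP; apply: measurableT_comp => //.
  by apply: measurable_funM => //; exact: measurable_funX.
have mZ' : measurable_fun setT (Z : Omega -> measurableTypeR R) by exact: mZ.
pose Zf : {mfun Omega >-> measurableTypeR R} :=
  MeasurableFun.Pack (MeasurableFun.Class (isMeasurableFun.Build _ _ _ _ _ mZ')).
transitivity (\int[distribution P Zf]_x (expR (x ^+ 2 / (4 * s ^+ 2)))%:E)%E.
  by rewrite ge0_integral_distribution// => x; rewrite lee_fin expR_ge0.
transitivity (\int[normal_prob 0 s]_x (expR (x ^+ 2 / (4 * s ^+ 2)))%:E)%E.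
  by apply: eq_measure_integral => A mA _; exact: gZ.2.
rewrite integral_normal_prob ?gt_eqF//.
under eq_integral do rewrite -EFinM normal_pdf_exp//.
under eq_integral do rewrite EFinM.
rewrite ge0_integralZl//.
- by rewrite integral_normal_pdf ?mule1.
- by apply/measurable_EFinP; exact: measurable_normal_pdf.
- by move=> x _; rewrite lee_fin normal_pdf_ge0.
Qed.

Lemma gauss_LG : LG P measurable Z.
Proof.
have mZ' : msr measurable Z.
  move=> _ B mB; have := mZ measurableT mB.
  by rewrite /measurable /= sigma_algebra_id//; exact: sigma_algebra_measurable.
split => // n.
have ie : P.-integrable setT (fun w => (1 + (4 * s ^+ 2) ^+ n * n%:R ^+ n * expR (Z w ^+ 2 / (4 * s ^+ 2)))%:E).
  under eq_fun do rewrite EFinD EFinM.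
  apply: integrableD => //; first exact: finite_measure_integrable_cst.
  apply: integrableZl => //; apply/integrableP; split => //.
  under eq_integral do rewrite gee0_abs ?lee_fin ?expR_ge0//.
  by rewrite gauss_exp ltry.
apply: le_integrable ie => //.
  by apply/measurable_EFinP; apply: measurable_funX; exact: measurableT_comp.
move=> w _ /=; rewrite lee_fin.
have h0 : 0 <= (4 * s ^+ 2) ^+ n * n%:R ^+ n * expR (Z w ^+ 2 / (4 * s ^+ 2)).
  by rewrite !mulr_ge0 ?expR_ge0 ?exprn_ge0// mulr_ge0// sqr_ge0.
rewrite [leRHS]ger0_norm ?addr_ge0// ger0_norm ?exprn_ge0//.
have s4 : 0 < 4 * s ^+ 2 by rewrite mulr_gt0// exprn_gt0.
apply: (@le_trans _ _ (1 + `|Z w| ^+ (2 * n))).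
  have := @pow_young R 1 `|Z w| n n ler01 (normr_ge0 _).
  by rewrite !expr1n mul1r addnn mul2n.
rewrite lerD2l -mulrA exprM real_normK ?num_real//.
have {1}-> : Z w ^+ 2 = (4 * s ^+ 2) * (Z w ^+ 2 / (4 * s ^+ 2)).
  by rewrite mulrCA divff ?mulr1// gt_eqF.
rewrite exprMn ler_wpM2l ?exprn_ge0 ?(ltW s4)//.
by apply: pow_le_expR; rewrite divr_ge0 ?sqr_ge0// ltW.
Qed.

Lemma gauss_mean : Ex P Z = 0.
Proof.
have mN : measurable_fun setT (fun w => - Z w) by exact: measurableT_comp.
have [] := @law_unique R disp Omega P R measurable Z (fun w => - Z w) _ _ _ _ _ id.
- by move=> A B mA mB; exact: measurableI.
- exact: measurableT.
- by move=> B mB; rewrite -[X in measurable X]setTI; exact: mZ.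
- by move=> B mB; rewrite -[X in measurable X]setTI; exact: mN.
- move=> B mB; have -> : (fun w => - Z w) @^-1` B = Z @^-1` (-%R @^-1` B) by [].
  rewrite !gZ.2 ?normal_probN ?gt_eqF//.
  by rewrite -[X in measurable X]setTI; exact: oppr_measurable.
- move=> _ B mB; rewrite setTI preimage_id /measurable /= sigma_algebra_id//.
  exact: sigma_algebra_measurable.
move=> E _; have := E; rewrite /comp /=.
have -> : (fun w => - Z w) = (fun w => -1 * Z w) by apply/funext => w; rewrite mulN1r.
by rewrite (ExZ sM)//; [rewrite /= => h; have : Ex P Z = -1 * Ex P Z by [] ; lra|exact: gauss_LG].
Qed.

End gauss.

Definition gauss_cst m q : R := 4 ^+ q * m%:R ^+ q *
  (2 ^+ q + 2 ^+ q * q%:R ^+ q * m%:R * Num.sqrt 2).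

(** Bounding the maximum by a sum costs N + 1 <= 2^l exponential moments. The level a = 2l gives
    exp(-a/2) = exp(-l), which absorbs them; what remains is a power of l from a, the logarithm in
    the final rate. *)
Lemma gauss_max m l N q (s : R) (D : nat -> Omega -> 'cV[R]_m) : 0 < s ->
  (N < 2 ^ l)%N -> (forall n i, (n <= N)%N -> gauss s (fun w => D n w i 0)) ->
  Ex P (fun w => runmax (fun n w => enorm (D n w)) N w ^+ (2 * q.+1)) <=
    gauss_cst m q.+1 * (s ^+ 2 * l.+1%:R) ^+ q.+1.
Proof.
move=> s0 Nl gD.
have hLG n : (n <= N)%N -> LG P measurable (fun w => enorm (D n w)).
  move=> nN; apply: (LG_enorm sM) => i j; rewrite ord1; exact: (gauss_LG s0 (gD n i nN)).
have s4 : 0 < 4 * s ^+ 2 by rewrite mulr_gt0// exprn_gt0.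
set k := q.+1; set a : R := 2 * l%:R; pose c := 2 ^+ k * k%:R ^+ k * expR (- (a / 2)).
have a0 : 0 <= a by rewrite mulr_ge0.
have c0 : 0 <= c by rewrite !mulr_ge0 ?expR_ge0 ?exprn_ge0.
pose y n i w := D n w i 0 ^+ 2 / (4 * s ^+ 2).
have y0 n i w : 0 <= y n i w by rewrite divr_ge0 ?sqr_ge0// ltW.
pose U w := a ^+ k + c * \sum_(n < N.+1) \sum_(i < m) expR (y n i w).
have V0 : 0 <= (4 * s ^+ 2) ^+ k * m%:R ^+ k by rewrite mulr_ge0 ?exprn_ge0// ltW.
have es0 w : 0 <= \sum_(n < N.+1) \sum_(i < m) expR (y n i w).
  by apply: sumr_ge0 => n _; apply: sumr_ge0 => i _; exact: expR_ge0.
have pw w : runmax (fun n w => enorm (D n w)) N w ^+ (2 * k) <= (4 * s ^+ 2) ^+ k * m%:R ^+ k * U w.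
  have [n nN ->] := runmax_ex (fun n w => enorm (D n w)) N w.
  rewrite exprM sqr_enorm /mdot.
  have -> : \sum_i \sum_j D n w i j * D n w i j = (4 * s ^+ 2) * \sum_i y n i w.
    rewrite mulr_sumr; apply: eq_bigr => i _; rewrite big_ord1 -expr2 /y mulrCA divff ?mulr1// gt_eqF//.
  rewrite exprMn -mulrA ler_wpM2l ?exprn_ge0 ?(ltW s4)//.
  apply: sum_ord_pow_le => // [|i]; first by rewrite addr_ge0 ?mulr_ge0 ?exprn_ge0.
  apply: le_trans (pow_le_tail k (y0 n i w) a0) _.
  rewrite lerD2l -/c ler_wpM2l//.
  rewrite -ltnS in nN; rewrite (bigD1 (Ordinal nN))//= (bigD1 i)//= -addrA lerDl.
  by rewrite addr_ge0// sumr_ge0// => ? _; rewrite ?expR_ge0// sumr_ge0// => ? _; exact: expR_ge0.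
have mrun : LG P measurable (fun w => runmax (fun n w => enorm (D n w)) N w ^+ (2 * k)).
  by apply: LG_pow; exact: LG_runmaxT.
have mexp n i : (n <= N)%N -> measurable_fun setT (fun w => (expR (y n i w))%:E).
  move=> nN; apply/measurable_EFinP; apply: measurableT_comp => //.
  by apply: measurable_funM => //; apply: measurable_funX; exact: (gD n i nN).1.
have mU : measurable_fun setT (fun w => (\sum_(n < N.+1) \sum_(i < m) (expR (y n i w))%:E)%E).
  apply: emeasurable_sum => n; apply: emeasurable_sum => i.
  by apply: mexp; rewrite -ltnS; exact: ltn_ord.
have IU : (\int[P]_w ((4 * s ^+ 2) ^+ k * m%:R ^+ k * U w)%:E =
    ((4 * s ^+ 2) ^+ k * m%:R ^+ k * (a ^+ k + c * (N.+1%:R * (m%:R * Num.sqrt 2))))%:E)%E.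
  have -> : (fun w => ((4 * s ^+ 2) ^+ k * m%:R ^+ k * U w)%:E) = (fun w =>
     ((4 * s ^+ 2) ^+ k * m%:R ^+ k)%:E * ((a ^+ k)%:E + c%:E * \sum_(n < N.+1) \sum_(i < m) (expR (y n i w))%:E))%E.
    apply/funext => w; rewrite EFinM; congr (_ * _)%E; rewrite /U EFinD EFinM; congr (_ + _ * _)%E.
    by rewrite -sumEFin; apply: eq_bigr => n _; rewrite -sumEFin.
  have S0 w : (0 <= \sum_(n < N.+1) \sum_(i < m) (expR (y n i w))%:E)%E.
    by apply: sume_ge0 => n _; apply: sume_ge0 => i _; rewrite lee_fin expR_ge0.
  rewrite ge0_integralZl//; last 2 first.
  - apply: emeasurable_funD => //; apply: emeasurable_funM => //.
  - by move=> w _; rewrite adde_ge0 ?lee_fin ?exprn_ge0// mule_ge0.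
  rewrite ge0_integralD//; last 3 first.
  - by move=> w _; rewrite lee_fin exprn_ge0.
  - by move=> w _; rewrite mule_ge0.
  - by apply: emeasurable_funM.
  have -> : (\int[P]__ (a ^+ k)%:E = (a ^+ k)%:E)%E by rewrite integral_cst//= probability_setT mule1.
  rewrite ge0_integralZl//.
  rewrite ge0_integral_sum//; last 2 first.
  - move=> n; apply: emeasurable_sum => i; apply: mexp; rewrite -ltnS; exact: ltn_ord.
  - by move=> n w _; apply: sume_ge0 => i _; rewrite lee_fin expR_ge0.
  have -> : (\sum_(n < N.+1) \int[P]_w (\sum_(i < m) (expR (y n i w))%:E) =
      \sum_(n < N.+1) \sum_(i < m) (Num.sqrt 2)%:E)%E.
    apply: eq_bigr => n _; rewrite ge0_integral_sum//.
    - apply: eq_bigr => i _; apply: gauss_exp => //; apply: gD; rewrite -ltnS; exact: ltn_ord.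
    - by move=> i; apply: mexp; rewrite -ltnS; exact: ltn_ord.
  under eq_bigr do rewrite sumEFin; rewrite sumEFin -(EFinM c) -(EFinD (a ^+ k)) -EFinM.
  by rewrite !sumr_const !card_ord !mulr_natl.
rewrite -lee_fin -(Ex_EFin sM mrun).
apply: (@le_trans _ _ (\int[P]_w ((4 * s ^+ 2) ^+ k * m%:R ^+ k * U w)%:E)%E).
  apply: ge0_le_integral => //.
  - by move=> w _; rewrite lee_fin exprM exprn_ge0// sqr_ge0.
  - by apply/measurable_EFinP; exact: (msr_measurable_fun sM (LG_msr mrun)).
  - apply/measurable_EFinP; apply: measurable_funM => //; apply: measurable_funD => //.
    apply: measurable_funM => //; apply: measurable_sum => n; apply: measurable_sum => i.
    by apply/measurable_EFinP; apply: mexp; rewrite -ltnS; exact: ltn_ord.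
  - by move=> w _; rewrite lee_fin; exact: pw.
rewrite IU lee_fin /gauss_cst -/k.
have L1 : 1 <= l.+1%:R :> R by rewrite ler1n.
have Lk : 1 <= l.+1%:R ^+ k :> R by rewrite exprn_ege1.
have -> : 4 ^+ k * m%:R ^+ k * (2 ^+ k + 2 ^+ k * k%:R ^+ k * m%:R * Num.sqrt 2) * (s ^+ 2 * l.+1%:R) ^+ k
  = (4 * s ^+ 2) ^+ k * m%:R ^+ k * ((2 ^+ k + 2 ^+ k * k%:R ^+ k * m%:R * Num.sqrt 2) * l.+1%:R ^+ k).
  by rewrite !exprMn; ring.
apply: ler_wpM2l => //; rewrite mulrDl lerD//.
  rewrite -exprMn lerXn2r ?nnegrE// ?mulr_ge0//.
  by rewrite /a ler_wpM2l// ler_nat.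
apply: (@le_trans _ _ (2 ^+ k * k%:R ^+ k * m%:R * Num.sqrt 2)); last first.
  by rewrite ler_peMr// !mulr_ge0 ?exprn_ge0// sqrtr_ge0.
have -> : c * (N.+1%:R * (m%:R * Num.sqrt 2)) =
   2 ^+ k * k%:R ^+ k * m%:R * Num.sqrt 2 * (expR (- (a / 2)) * N.+1%:R) by rewrite /c; ring.
rewrite ler_piMr// ?mulr_ge0 ?exprn_ge0 ?sqrtr_ge0//.
have -> : a / 2 = l%:R by rewrite /a mulrC mulrA mulVf ?mul1r.
rewrite expRN mulrC ler_pdivrMr ?expR_gt0// mul1r.
apply: (@le_trans _ _ (2 ^+ l)); first by rewrite -natrX ler_nat.
have -> : expR l%:R = expR 1 ^+ l :> R by rewrite -expRM_natl mulr1.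
by rewrite lerXn2r ?nnegrE ?expR_ge0//; have := expR_ge1Dx (1 : R); lra.
Qed.

End Gaussian.

(** * Brownian increments as abstract increments *)

Section BrownianIncrements.
Context (R : realType) (disp : measure_display) (Omega : measurableType disp)
  (P : probability Omega R).
Variables (T : R) (F : R -> set (set Omega)).

Definition filtration := (forall t, 0 <= t <= T -> subalg (F t)) /\
  forall s t, 0 <= s -> s <= t -> t <= T -> F s `<=` F t.

Hypothesis hF : filtration.

Lemma msr_measurable d' (X : measurableType d') (f : X -> R) :
  measurable_fun setT f <-> msr (@measurable _ X) f.
Proof.
by split => mf _ B mB; have := mf measurableT _ mB; rewrite /measurable /= sigma_algebra_id//;
  exact: sigma_algebra_measurable.
Qed.

Variables (m : nat) (W : R -> Omega -> 'cV[R]_m).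
Hypothesis bW : standard_brownian P T F W.

Lemma adapted_msr n (X : R -> Omega -> 'cV[R]_n) t i : adapted T F X ->
  0 <= t <= T -> msr (F t) (fun w => X t w i 0).
Proof.
move=> aX tT; have [sF _] := hF.
have [sFt _] := sF t tT.
by move: i (0 : 'I_1); apply/(borel_measurable_entries _ sFt); exact: aX.
Qed.

Lemma incr_msr s t i : 0 <= s -> s <= t -> t <= T -> msr (F t) (fun w => (W t w - W s w) i 0).
Proof.
move=> s0 st tT; have [aW _ _ _ _] := bW; have [sF mF] := hF.
under eq_fun do rewrite 2!mxE; apply: measurable_funB.
  by apply: adapted_msr => //; rewrite (le_trans s0).
by apply: (msr_sub (mF s t s0 st tT)); apply: adapted_msr => //; rewrite s0 (le_trans st).
Qed.

Lemma incr_gauss s t i : 0 <= s -> s < t -> t <= T ->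
  gauss P (Num.sqrt (t - s)) (fun w => (W t w - W s w) i 0).
Proof.
move=> s0 st tT; have [sF mF] := hF; have [aW _ _ _ law] := bW.
split.
  apply: (msr_measurable_fun _ (incr_msr i s0 (ltW st) tT)).
  by apply: sF; rewrite tT (le_trans s0 (ltW st)).
move=> B mB; have := law s t s0 st tT (fun j => if j == i then B else setT).
have mB' (j : 'I_m) : measurable (if j == i then B else setT) by case: ifP.
move=> /(_ mB'); rewrite (bigD1 i)//= eqxx big1 ?mule1; last first.
  by move=> j /negbTE ->; rewrite probability_setT.
move=> <-; congr (P _); apply/seteqP; split => w /=; last by move=> /(_ i); rewrite eqxx.
by move=> h j; case: eqP => // ->.
Qed.

Definition bm_cst n : R := if n is q.+1 then gauss_cst R m q.+1 * T ^+ q.+1 else 1.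

Lemma gauss_cst_ge0 q : 0 <= gauss_cst R m q.
Proof. by rewrite /gauss_cst !(mulr_ge0, addr_ge0) ?exprn_ge0 ?sqrtr_ge0. Qed.

Lemma bm_cst_ge0 n : 0 <= T -> 0 <= bm_cst n.
Proof. by move=> T0; case: n => [|q] //=; rewrite mulr_ge0 ?gauss_cst_ge0 ?exprn_ge0. Qed.

Lemma VLG_incr s t : 0 <= s -> s < t -> t <= T -> VLG P (F t) (fun w => W t w - W s w).
Proof.
move=> s0 st tT i j; rewrite ord1; split; first by apply: incr_msr => //; exact: ltW.
have r0 : 0 < Num.sqrt (t - s) by rewrite sqrtr_gt0 subr_gt0.
by have [] := gauss_LG r0 (incr_gauss i s0 st tT).
Qed.

Lemma bm_incr eta s t : 0 <= s -> s < t -> t <= T -> t - s = T * eta ->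
  incr P bm_cst eta (F s) (F t) (fun w => W t w - W s w).
Proof.
move=> s0 st tT E; have [sF mF] := hF; have [aW _ _ ind law] := bW.
have r0 : 0 < Num.sqrt (t - s) by rewrite sqrtr_gt0 subr_gt0.
split.
- by apply: sF; rewrite s0 (le_trans (ltW st)).
- by apply: sF; rewrite tT (le_trans s0 (ltW st)).
- by apply: mF => //; exact: ltW.
- exact: VLG_incr.
- by apply: independent_pair_sym; exact: ind.
- move=> i; exact: (gauss_mean r0 (incr_gauss i s0 st tT)).
- case=> [|q] /=; first by rewrite mul1r; under eq_Ex do rewrite expr0; rewrite (Ex_cst P 1).
(* The maximum over a single vector, N = 0 and l = 0, gives the plain moments. *)
have := @gauss_max R _ _ P m 0 0 q _ (fun _ w => W t w - W s w) r0 isT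
  (fun n i _ => incr_gauss i s0 st tT).
by rewrite /= mulr1 sqr_sqrtr ?subr_ge0 ?(ltW st)// E exprMn mulrA.
Qed.

End BrownianIncrements.

(** * Products of independent bounded martingales *)

Section BoundedMartingale.
Context (R : realType) (disp : measure_display) (Omega : measurableType disp)
  (P : probability Omega R).
Variables (T : R) (F : R -> set (set Omega)).
Hypothesis hF : filtration T F.
Let sM := @subalg_measurable disp Omega.

(** The martingale property is stated by testing against variables of F_r, without conditional
    expectations. The sigma-algebra G carries the independence, and the last clause bounds the
    variance of increments by the elapsed time, which makes covariations over a fine mesh vanish. *)
Record bmart (s t : R) (G : set (set Omega)) (M : R -> Omega -> R) := {
  bmart_adapted : forall r, s <= r <= t -> msr (F r) (M r);
  bmart_msr : forall r, s <= r <= t -> msr G (M r);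
  bmart_bounded : exists2 K, 0 <= K & forall r w, s <= r <= t -> `|M r w| <= K;
  bmart_mart : forall r r' f, s <= r -> r <= r' -> r' <= t -> LG P (F r) f ->
    Ex P (fun w => f w * M r' w) = Ex P (fun w => f w * M r w);
  bmart_holder : exists2 C, 0 <= C & forall r r', s <= r -> r <= r' -> r' <= t ->
    Ex P (fun w => (M r' w - M r w) ^+ 2) <= C * (r' - r) }.

Lemma LG_bounded G f (K : R) : subalg G -> msr G f -> (forall w, `|f w| <= K) -> LG P G f.
Proof. by move=> sG mf fK; apply: (LG_dom sG mf (f := cst K)) => //; exact: LG_cst. Qed.

Variables (s t : R).
Hypotheses (s0 : 0 <= s) (tT : t <= T).

Let sub r : s <= r <= t -> subalg (F r).
Proof.
move=> /andP[sr rt]; have [sF _] := hF; apply: sF.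
by rewrite (le_trans s0 sr) (le_trans rt tT).
Qed.

Let mono r r' : s <= r -> r <= r' -> r' <= t -> F r `<=` F r'.
Proof. by move=> sr rr rt; have [_] := hF; apply => //; [exact: le_trans sr|exact: le_trans tT]. Qed.

Lemma bmart_cst G (c : R) : subalg G -> bmart s t G (fun _ _ => c).
Proof.
move=> sG; split => //.
- by move=> r rt; exact: measurable_cst.
- by move=> r rt; exact: measurable_cst.
- by exists `|c|.
- exists 0 => // r r' _ rr _; rewrite mul0r; under eq_Ex do rewrite subrr expr0n/=.
  by rewrite (Ex_cst P 0).
Qed.

Section product.
Variables (G H K : set (set Omega)) (M L : R -> Omega -> R).
Hypotheses (sG : subalg G) (sH : subalg H) (sK : subalg K).
Hypotheses (GK : G `<=` K) (HK : H `<=` K) (GH : independent_pair P G H).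
Hypotheses (bM : bmart s t G M) (bL : bmart s t H L).

Let LGF E N r : bmart s t E N -> s <= r <= t -> LG P (F r) (N r).
Proof.
move=> bN sr; have [C _ hC] := bmart_bounded bN; apply: (@LG_bounded _ _ C) => //.
- exact: sub.
- exact: bmart_adapted bN _ sr.
- by move=> w; exact: hC.
Qed.

Let LGG E N r : subalg E -> bmart s t E N -> s <= r <= t -> LG P E (N r).
Proof.
move=> sE bN sr; have [C _ hC] := bmart_bounded bN; apply: (@LG_bounded _ _ C) => //.
- exact: bmart_msr bN _ sr.
- by move=> w; exact: hC.
Qed.

Let up E N r : bmart s t E N -> s <= r <= t -> LG P measurable (N r).
Proof. by move=> bN sr; apply: LG_sub (LGF bN sr); case: (sub sr). Qed.

Section mesh.
Variables (r r' : R) (n : nat).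
Hypotheses (sr : s <= r) (rr : r <= r') (rt : r' <= t).
Let p (i : nat) : R := r + i%:R * ((r' - r) / n.+1%:R).
Let d0 : 0 <= (r' - r) / n.+1%:R. Proof. by rewrite divr_ge0// subr_ge0. Qed.
Let pp i j : (i <= j)%N -> p i <= p j.
Proof. by move=> ij; rewrite lerD2l ler_wpM2r// ler_nat. Qed.
Let p0 : p 0 = r. Proof. by rewrite /p mul0r addr0. Qed.
Let pn : p n.+1 = r'. Proof. by rewrite /p mulrC divfK ?pnatr_eq0// addrC subrK. Qed.
Let pb i : (i <= n.+1)%N -> s <= p i <= t.
Proof. by move=> ni; rewrite (le_trans sr) -?p0 ?pp//= (le_trans _ rt)// -pn pp. Qed.
Let dM i w := M (p i.+1) w - M (p i) w.
Let dL i w := L (p i.+1) w - L (p i) w.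

Let dE E N i : subalg E -> bmart s t E N -> (i <= n)%N ->
  LG P E (fun w => N (p i.+1) w - N (p i) w).
Proof. by move=> sE bN ni; apply: (LGB sE); apply: (LGG sE bN); apply: pb => //; exact: leqW. Qed.

Let orth E N i j : bmart s t E N -> (i <= n)%N -> (j <= n)%N -> i != j ->
  Ex P (fun w => (N (p i.+1) w - N (p i) w) * (N (p j.+1) w - N (p j) w)) = 0.
Proof.
move=> bN; wlog ij : i j / (i < j)%N.
  move=> h ni nj; rewrite neq_ltn => /orP[ij|ji]; first by apply: h => //; rewrite neq_ltn ij.
  by under eq_Ex do rewrite mulrC; apply: h => //; rewrite neq_ltn ji.
move=> ni nj _; have pj := pb (leqW nj); have /andP[sj jt] := pj.
have hi k : (k <= j)%N -> LG P (F (p j)) (N (p k)).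
  move=> kj; have pk := pb (leq_trans kj (leqW nj)); have /andP[sk kt] := pk.
  by apply: LG_sub (LGF bN pk); apply: mono => //; exact: pp.
have hf : LG P (F (p j)) (fun w => N (p i.+1) w - N (p i) w).
  by apply: (LGB (sub pj)); apply: hi => //; exact: ltnW.
have /andP[sj1 j1t] := pb (nj : j.+1 <= n.+1)%N.
have hfM := LG_sub (sub pj).2 hf.
under eq_Ex do rewrite mulrBr.
rewrite (ExB sM); [|by apply: (LGM sM) => //; exact: up bN (pb _)|by apply: (LGM sM) => //; exact: up bN pj].
by rewrite (bmart_mart bN sj (pp (leqnSn j)) j1t hf) subrr.
Qed.

Let S w := \sum_(i < n.+1) dM i w * dL i w.

(** By independence the mixed moments factor, and by orthogonality of martingale increments only the
    diagonal survives: n + 1 terms of size ((r' - r)/(n + 1))^2 up to constants. *)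
Let Ex_S2 (CM CL : R) : 0 <= CM -> 0 <= CL ->
  (forall r r', s <= r -> r <= r' -> r' <= t -> Ex P (fun w => (M r' w - M r w) ^+ 2) <= CM * (r' - r)) ->
  (forall r r', s <= r -> r <= r' -> r' <= t -> Ex P (fun w => (L r' w - L r w) ^+ 2) <= CL * (r' - r)) ->
  Ex P (fun w => S w ^+ 2) <= CM * CL * (r' - r) ^+ 2 / n.+1%:R.
Proof.
move=> CM0 CL0 hM hL.
have up' E f : subalg E -> LG P E f -> LG P measurable f by case=> _ EM; exact: LG_sub EM.
have dMm i : (i <= n)%N -> LG P measurable (dM i) by move=> ni; apply: (up' _ _ sG); exact: dE.
have dLm i : (i <= n)%N -> LG P measurable (dL i) by move=> ni; apply: (up' _ _ sH); exact: dE.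
have -> : Ex P (fun w => S w ^+ 2) = \sum_(i < n.+1) \sum_(j < n.+1)
    Ex P (fun w => dM i w * dM j w) * Ex P (fun w => dL i w * dL j w).
  transitivity (Ex P (fun w => \sum_(i < n.+1) \sum_(j < n.+1) (dM i w * dM j w) * (dL i w * dL j w))).
    apply: eq_Ex => w; rewrite expr2 /S big_distrlr; apply: eq_bigr => i _.
    by apply: eq_bigr => j _; rewrite mulrACA.
  have ht (i j : 'I_n.+1) : LG P measurable (fun w => (dM i w * dM j w) * (dL i w * dL j w)).
    have ni := ltn_ord i; have nj := ltn_ord j.
    by apply: (LGM sM); apply: (LGM sM); [exact: dMm|exact: dMm|exact: dLm|exact: dLm].
  rewrite (Ex_sum sM) => [|i _]; last by apply: (LG_sum sM).
  apply: eq_bigr => i _; rewrite (Ex_sum sM)//; apply: eq_bigr => j _.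
  have ni := ltn_ord i; have nj := ltn_ord j.
  apply: (indep_mul sG sH GH); first by apply: (LGM sG); exact: dE.
  by apply: (LGM sH); exact: dE.
apply: (@le_trans _ _ (\sum_(i < n.+1) (CM * ((r' - r) / n.+1%:R)) * (CL * ((r' - r) / n.+1%:R)))).
  apply: ler_sum => i _; have ni := ltn_ord i.
  rewrite (bigD1 i)//= big1 ?addr0 => [|j ji]; last first.
    have nj : (j <= n)%N by rewrite -ltnS ltn_ord.
    have ij : (i : nat) != j by rewrite eq_sym.
    by rewrite (orth bM ni nj ij) mul0r.
  have dp : p i.+1 - p i = (r' - r) / n.+1%:R.
    by rewrite /p opprD addrACA subrr add0r -mulrBl -natrB// subSnn mul1r.
  have /andP[h1 _] := pb (ltnW ni : i <= n.+1)%N; have /andP[_ h2] := pb ni.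
  have sq0 (f : Omega -> R) : 0 <= Ex P (fun w => f w * f w).
    by apply: Ex_ge0 => w; rewrite -expr2 sqr_ge0.
  apply: ler_pM => //; rewrite -dp.
    by have := hM (p i) (p i.+1) h1 (pp (leqnSn i)) h2.
  by have := hL (p i) (p i.+1) h1 (pp (leqnSn i)) h2.
rewrite sumr_const card_ord -mulr_natr le_eqVlt; apply/orP; left; apply/eqP; field.
by rewrite nat1r pnatr_eq0.
Qed.

(** The increment of M L is dM dL + M dL + L dM; the last two terms are centred against the past,
    since both factors are martingales for the common filtration. *)
Let telescope f : LG P (F r) f ->
  Ex P (fun w => f w * (M r' w * L r' w)) - Ex P (fun w => f w * (M r w * L r w)) =
  Ex P (fun w => f w * S w).
Proof.
move=> hf; have rr0 : s <= r <= t by rewrite sr (le_trans rr).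
have hfM := LG_sub (sub rr0).2 hf.
pose a i := Ex P (fun w => f w * (M (p i) w * L (p i) w)).
have -> : Ex P (fun w => f w * (M r' w * L r' w)) = a n.+1 by rewrite /a pn.
have -> : Ex P (fun w => f w * (M r w * L r w)) = a 0%N by rewrite /a p0.
rewrite -(telescope_sumr a (leq0n n.+1)) big_mkord.
have hMi i : (i <= n.+1)%N -> LG P measurable (M (p i)) by move=> ni; exact: up bM (pb ni).
have hLi i : (i <= n.+1)%N -> LG P measurable (L (p i)) by move=> ni; exact: up bL (pb ni).
have -> : Ex P (fun w => f w * S w) = \sum_(i < n.+1) Ex P (fun w => f w * (dM i w * dL i w)).
  transitivity (Ex P (fun w => \sum_(i < n.+1) f w * (dM i w * dL i w))).
    by apply: eq_Ex => w; rewrite mulr_sumr.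
  rewrite (Ex_sum sM)// => i _; apply: (LGM sM) => //; apply: (LGM sM); apply: (LGB sM);
    [apply: hMi|apply: hMi|apply: hLi|apply: hLi] => //; exact: ltnW.
apply: eq_bigr => i _; have ni := ltn_ord i; have ni' : (i <= n.+1)%N by exact: ltnW.
have pi := pb ni'; have /andP[h1 h1'] := pi; have /andP[_ h2] := pb ni.
have hfi : LG P (F (p i)) f by apply: LG_sub hf; apply: mono => //; rewrite -p0 pp.
have hfM1 : LG P (F (p i)) (fun w => f w * M (p i) w) by apply: (LGM (sub pi)) => //; exact: LGF bM pi.
have hfL1 : LG P (F (p i)) (fun w => f w * L (p i) w) by apply: (LGM (sub pi)) => //; exact: LGF bL pi.
have E1 := bmart_mart bL h1 (pp (leqnSn i)) h2 hfM1.
have E2 := bmart_mart bM h1 (pp (leqnSn i)) h2 hfL1.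
have l1 := hMi _ ni; have l2 := hMi _ ni'; have l3 := hLi _ ni; have l4 := hLi _ ni'.
have q1 : LG P measurable (fun w => f w * (M (p i.+1) w * L (p i.+1) w)) by apply: (LGM sM) => //; exact: LGM.
have q2 : LG P measurable (fun w => f w * M (p i) w * L (p i.+1) w) by apply: (LGM sM) => //; exact: LGM.
have q3 : LG P measurable (fun w => f w * L (p i) w * M (p i.+1) w) by apply: (LGM sM) => //; exact: LGM.
have q4 : LG P measurable (fun w => f w * (M (p i) w * L (p i) w)) by apply: (LGM sM) => //; exact: LGM.
transitivity (Ex P (fun w => (f w * (M (p i.+1) w * L (p i.+1) w) + f w * (M (p i) w * L (p i) w))
    - (f w * M (p i) w * L (p i.+1) w + f w * L (p i) w * M (p i.+1) w))); last first.
  by apply: eq_Ex => w; rewrite /dM /dL; ring.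
rewrite (ExB sM) ?(ExD sM)//; [|exact: LGD|exact: LGD].
rewrite E1 E2 /a.
have -> : Ex P (fun w => f w * L (p i) w * M (p i) w) = Ex P (fun w => f w * (M (p i) w * L (p i) w)).
  by apply: eq_Ex => w; ring.
have -> : Ex P (fun w => f w * M (p i) w * L (p i) w) = Ex P (fun w => f w * (M (p i) w * L (p i) w)).
  by apply: eq_Ex => w; ring.
by ring.
Qed.

Lemma bmart_mesh (CM CL : R) f : 0 <= CM -> 0 <= CL ->
  (forall r r', s <= r -> r <= r' -> r' <= t -> Ex P (fun w => (M r' w - M r w) ^+ 2) <= CM * (r' - r)) ->
  (forall r r', s <= r -> r <= r' -> r' <= t -> Ex P (fun w => (L r' w - L r w) ^+ 2) <= CL * (r' - r)) ->
  LG P (F r) f ->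
  (Ex P (fun w => f w * (M r' w * L r' w)) - Ex P (fun w => f w * (M r w * L r w))) ^+ 2 <=
  (Ex P (fun w => f w ^+ 2) * (CM * CL * (r' - r) ^+ 2)) / n.+1%:R.
Proof.
move=> CM0 CL0 hM hL hf; rewrite (telescope hf).
have rr0 : s <= r <= t by rewrite sr (le_trans rr).
have hfM := LG_sub (sub rr0).2 hf.
have hS : LG P measurable S.
  apply: (LG_sum sM) => i _; have ni := ltn_ord i.
  by apply: (LGM sM); apply: (LGB sM); [apply: up bM _|apply: up bM _|apply: up bL _|apply: up bL _];
    apply: pb => //; exact: ltnW.
apply: le_trans (Ex_CS sM hfM hS) _; rewrite -mulrA ler_wpM2l//.
  by apply: Ex_ge0 => w; rewrite sqr_ge0.
exact: Ex_S2.
Qed.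

End mesh.

(* The covariation vanishes: over a mesh, the sum of products of increments is
   small in L^2 because the two martingales are independent. *)
Lemma bmart_mul : bmart s t K (fun r w => M r w * L r w).
Proof.
have [KM KM0 hKM] := bmart_bounded bM; have [KL KL0 hKL] := bmart_bounded bL.
have [CM CM0 hCM] := bmart_holder bM; have [CL CL0 hCL] := bmart_holder bL.
split.
- by move=> r rt; apply: measurable_funM; [exact: bmart_adapted bM _ rt|exact: bmart_adapted bL _ rt].
- move=> r rt; apply: measurable_funM; first exact: (msr_sub GK (bmart_msr bM rt)).
  exact: (msr_sub HK (bmart_msr bL rt)).
- by exists (KM * KL); [exact: mulr_ge0|move=> r w rt; rewrite normrM ler_pM ?hKM ?hKL].
- move=> r r' f sr rr rt hf; apply/eqP; rewrite -subr_eq0; apply/eqP.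
  set x := _ - _.
  have hx n : x ^+ 2 <= (Ex P (fun w => f w ^+ 2) * (CM * CL * (r' - r) ^+ 2)) / n.+1%:R.
    exact: bmart_mesh.
  set A := _ * _ in hx.
  apply/eqP; rewrite -sqrf_eq0 eq_le sqr_ge0 andbT leNgt; apply/negP => x0.
  have A0 : 0 <= A by have := hx 0%N; rewrite divr1; apply: le_trans; exact: ltW.
  have := hx (Num.truncn (A / x ^+ 2)); rewrite leNgt => /negP; apply.
  by rewrite ltr_pdivrMr// mulrC -ltr_pdivrMr// truncnS_gt.
- exists (2 * KM ^+ 2 * CL + 2 * KL ^+ 2 * CM).
    by rewrite addr_ge0// !mulr_ge0 ?sqr_ge0.
  move=> r r' sr rr rt.
  have br : s <= r <= t by rewrite sr (le_trans rr).
  have br' : s <= r' <= t by rewrite rt (le_trans sr).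
  have l1 := up bM br; have l2 := up bM br'; have l3 := up bL br; have l4 := up bL br'.
  have lM : LG P measurable (fun w => (M r' w - M r w) ^+ 2) by apply: LG_pow; exact: LGB.
  have lL : LG P measurable (fun w => (L r' w - L r w) ^+ 2) by apply: LG_pow; exact: LGB.
  apply: (@le_trans _ _ (Ex P (fun w => (2 * KM ^+ 2) * (L r' w - L r w) ^+ 2 + (2 * KL ^+ 2) * (M r' w - M r w) ^+ 2))).
    apply: (Ex_le sM).
    + by apply: LG_pow; apply: (LGB sM); exact: LGM.
    + by apply: (LGD sM); exact: LGZ.
    + move=> w; have -> : M r' w * L r' w - M r w * L r w = M r' w * (L r' w - L r w) + L r w * (M r' w - M r w) by ring.
      have h1 : M r' w ^+ 2 <= KM ^+ 2 by rewrite -real_normK ?num_real// lerXn2r ?nnegrE ?hKM.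
      have h2 : L r w ^+ 2 <= KL ^+ 2 by rewrite -real_normK ?num_real// lerXn2r ?nnegrE ?hKL.
      set a := M r' w in h1 *; set b := L r w in h2 *; set x := _ - b; set y := a - _.
      have := sqr_ge0 (a * x - b * y).
      have := ler_wpM2r (sqr_ge0 x) h1; have := ler_wpM2r (sqr_ge0 y) h2.
      by rewrite !expr2; lra.
  rewrite (ExD sM) ?(ExZ sM)//; [|exact: LGZ|exact: LGZ].
  have := ler_wpM2l (mulr_ge0 (ler0n R 2) (sqr_ge0 KM)) (hCL _ _ sr rr rt).
  have := ler_wpM2l (mulr_ge0 (ler0n R 2) (sqr_ge0 KL)) (hCM _ _ sr rr rt).
  by lra.
Qed.

End product.
End BoundedMartingale.

(** * The sigma-algebra generated by the first n members of a family *)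

Section Past.
Context (R : realType) (disp : measure_display) (Omega : measurableType disp)
  (P : probability Omega R).
Variables (K : nat) (C : nat -> set (set Omega)).
Hypotheses (CM : forall k, C k `<=` measurable) (CI : forall k, setI_closed (C k))
  (CT : forall k, C k setT).

(** Intersections form a pi-system, on which independence from the next member of the family reduces
    to a product formula. *)
Definition past_sets n : set (set Omega) :=
  [set B | exists2 A : nat -> set Omega, forall k, C k (A k) & B = \bigcap_(k in `I_n) A k].

Definition past n := <<s past_sets n >>.

Lemma past_sets_measurable n : past_sets n `<=` measurable.
Proof. by move=> _ [A hA ->]; apply: bigcap_measurableType => k _; exact: CM. Qed.

Lemma gen_subalg (E : set (set Omega)) : E `<=` measurable -> subalg <<s E >>.
Proof.
move=> EM; split; first exact: smallest_sigma_algebra.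
by apply: smallest_sub => //; exact: sigma_algebra_measurable.
Qed.

Lemma past_subalg n : subalg (past n).
Proof. by apply: gen_subalg; exact: past_sets_measurable. Qed.

Lemma past_setsI n : setI_closed (past_sets n).
Proof.
move=> _ _ [A hA ->] [B hB ->]; exists (fun k => A k `&` B k); last by rewrite bigcapI.
by move=> k; exact: CI.
Qed.

Lemma past_setsT n : past_sets n setT.
Proof. by exists (fun _ => setT) => //; rewrite bigcapT. Qed.

Lemma sub_past k n : (k < n)%N -> <<s C k >> `<=` past n.
Proof.
move=> kn; apply: smallest_sub; first exact: smallest_sigma_algebra.
move=> B CB; apply: sub_gen_smallest; exists (fun j => if j == k then B else setT).
  by move=> j; case: eqP => [->|].
rewrite eqEsubset; split => w; first by move=> Bw j _ /=; case: eqP.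
by move=> /(_ k kn); rewrite /= eqxx.
Qed.

Lemma past_sub n : past n `<=` past n.+1.
Proof.
apply: smallest_sub; first exact: smallest_sigma_algebra.
move=> _ [A hA ->]; apply: sub_gen_smallest; exists (fun k => if (k < n)%N then A k else setT).
  by move=> k; case: ifP.
rewrite eqEsubset; split => w Aw k kn /=; first by case: ifP => // kn'; exact: Aw.
by have := Aw k (ltnW kn : (k < n.+1)%N); rewrite kn.
Qed.

Hypothesis prodC : forall n A, (n <= K)%N -> (forall k, C k (A k)) ->
  P (\bigcap_(k in `I_n) A k) = (\prod_(k < n) P (A k))%E.

Lemma past_indep n : (n < K)%N -> independent_pair P (past n) <<s C n >>.
Proof.
move=> nK; apply: independent_pair_gen => //; [exact: past_sets_measurable|exact: past_setsI|exact: past_setsT|].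
move=> _ B [A hA ->] CB; pose A' k := if (k < n)%N then A k else if k == n then B else setT.
have hA' k : C k (A' k) by rewrite /A'; case: ifP => // _; case: eqP => [->|].
have := prodC nK hA'; rewrite big_ord_recr /=.
have -> : (\prod_(k < n) P (A' k) = \prod_(k < n) P (A k))%E.
  by apply: eq_bigr => k _; rewrite /A' ltn_ord.
have := prodC (ltnW nK) hA => <-; rewrite {2}/A' ltnn eqxx => <-; congr (P _).
rewrite eqEsubset; split => w.
  move=> [Aw Bw] k /=; rewrite ltnS leq_eqVlt /A' => /orP[/eqP ->|kn]; first by rewrite ltnn eqxx.
  by rewrite kn; exact: Aw.
move=> Aw; split; last by have := Aw n (ltnSn n); rewrite /A' ltnn eqxx.
by move=> k kn; have := Aw k (ltnW kn : (k < n.+1)%N); rewrite /A' kn.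
Qed.

End Past.

(** * Joint independence of the increments of several Brownian motions *)

Section Levy.
Context (R : realType) (disp : measure_display) (Omega : measurableType disp)
  (P : probability Omega R).
Variables (T : R) (F : R -> set (set Omega)).
Hypothesis hF : filtration T F.
Let sM := @subalg_measurable disp Omega.
Variable m : nat.

Lemma normr_Ex (f : Omega -> R) : LG P measurable f -> `|Ex P f| <= Ex P (fun w => `|f w|).
Proof. by move=> hf; apply: le_normr_Rintegral => //; exact: (LG_integrable sM hf). Qed.

Lemma process_sigma_subalg (W : R -> Omega -> 'cV[R]_m) : adapted T F W ->
  subalg (process_sigma T W).
Proof.
move=> aW; apply: gen_subalg => A [t tT]; have [sF _] := hF.
have t0 : 0 <= t <= T by move: tT; rewrite /= in_itv.
by move=> /(aW t t0); have [_] := sF t t0; apply.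
Qed.

Section onestep.
Variables (W : R -> Omega -> 'cV[R]_m) (s t : R) (phi : 'cV[R]_m -> R) (Kphi L : R).
Hypotheses (bW : standard_brownian P T F W) (s0 : 0 <= s) (st : s < t) (tT : t <= T)
  (K0 : 0 <= Kphi) (bphi : forall x, `|phi x| <= Kphi) (L0 : 0 <= L)
  (lphi : forall x y, `|phi x - phi y| <= L * enorm (x - y)).

Let aW : adapted T F W. Proof. by case: bW. Qed.

Let cphi : continuous phi.
Proof. by apply: (@lipschitz_continuous _ _ _ _ L 0) => // x y; rewrite expr0 mulr1. Qed.

Let sub r : s <= r <= t -> subalg (F r).
Proof.
move=> /andP[sr rt]; have [sF _] := hF; apply: sF.
by rewrite (le_trans s0 sr) (le_trans rt tT).
Qed.

Let incr_msr0 r r' i : s <= r -> r <= r' -> r' <= t -> msr measurable (fun w => (W r' w - W r w) i 0).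
Proof.
move=> sr rr rt; have br' : s <= r' <= t by rewrite rt (le_trans sr).
apply: (msr_sub (sub br').2).
by apply: (incr_msr hF bW) => //; [exact: le_trans sr|exact: le_trans tT].
Qed.

Let LGphi r r' x : s <= r -> r <= r' -> r' <= t -> LG P measurable (fun w => phi (x + (W r' w - W r w))).
Proof.
move=> sr rr rt; apply: (@LG_bounded _ _ _ _ _ _ Kphi) => //.
apply: (msr_cont (g := fun y => phi (x + y))) => //; first by case: sM.
  apply: (@lipschitz_continuous _ _ _ _ L 0) => // y z; rewrite expr0 mulr1.
  by apply: le_trans (lphi _ _) _; rewrite [x + y]addrC [x + z]addrC opprD addrACA subrr addr0.
by move=> i j; rewrite ord1; exact: incr_msr0.
Qed.

(** An explicit form of the conditional expectation of phi(W_t - W_s) given F_r: the part of the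
    increment up to r is kept and the part after r is averaged. *)
Definition levy_mart r w := Ex P (fun w' => phi ((W r w - W s w) + (W t w' - W r w'))).

Let levy_mart_t w : levy_mart t w = phi (W t w - W s w).
Proof.
rewrite /levy_mart -[RHS](Ex_cst P (phi (W t w - W s w))).
by apply: eq_Ex => w'; rewrite subrr addr0.
Qed.

Let msr_levy G r : subalg G -> s <= r <= t -> (forall i, msr G (fun w => (W r w - W s w) i 0)) ->
  msr G (levy_mart r).
Proof.
move=> sG /andP[sr rt] mU.
apply: (msr_cont (g := fun x => Ex P (fun w' => phi (x + (W t w' - W r w'))))); first by case: sG.
  apply: (@lipschitz_continuous _ _ _ _ L 0) => // x y; rewrite expr0 mulr1.
  have h1 := LGphi x sr rt (lexx t); have h2 := LGphi y sr rt (lexx t).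
  rewrite -(ExB sM)//; apply: le_trans (normr_Ex (LGB sM h1 h2)) _.
  rewrite -(Ex_cst P (L * enorm (x - y))); apply: (Ex_le sM) => [||w].
  - by apply: LG_norm; exact: LGB.
  - exact: LG_cst.
  - by apply: le_trans (lphi _ _) _; rewrite opprD addrACA subrr addr0.
by move=> i j; rewrite ord1.
Qed.

Let freeze r f : s <= r <= t -> LG P (F r) f ->
  Ex P (fun w => f w * phi (W t w - W s w)) = Ex P (fun w => f w * levy_mart r w).
Proof.
move=> /andP[sr]; rewrite le_eqVlt => /orP[/eqP ->|rt] hf.
  by apply: eq_Ex => w; rewrite levy_mart_t.
have r0 : 0 <= r by exact: le_trans sr.
have T0 : T != 0 by rewrite gt_eqF// (le_lt_trans r0)// (lt_le_trans rt).
have hi := bm_incr hF bW r0 rt tT (esym (mulVKf T0 _)).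
have sH := subalg_preimage_sigma hi; have sG := incr_past hi.
have GH := incr_indep hi; have mV := VLG_preimage_sigma hi.
have br : s <= r <= t by rewrite sr ltW.
have hfM := LG_sub sG.2 hf.
have h12 w : phi (W t w - W s w) = phi ((W r w - W s w) + (W t w - W r w)).
  by congr phi; rewrite [RHS]addrC addrA subrK.
under eq_Ex do rewrite h12.
pose h (z : Omega * Omega) := f z.1 * phi ((W r z.1 - W s z.1) + (W t z.2 - W r z.2)).
have -> : (fun w => f w * phi ((W r w - W s w) + (W t w - W r w))) = (fun w => h (w, w)) by [].
have -> : Ex P (fun w => f w * levy_mart r w) = Ex P (fun w => Ex P (fun w' => h (w, w'))).
  by apply: eq_Ex => w; rewrite /h /= (ExZ sM)//; apply: LGphi => //; exact: ltW.
apply: (indep_fubini sG sH GH (h := h)).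
- apply: measurable_funM.
    have hf' : measurable_fun setT (f : g_sigma_algebraType (F r) -> R) := LG_msr hf.
    exact: (measurableT_comp hf' measurable_fst).
  apply/msr_measurable.
  apply: (@msr_cont _ (g_sigma_algebraType (F r) * g_sigma_algebraType (preimage_sigma (fun w => W t w - W r w)))%type
    _ _ _ (fun z => (W r z.1 - W s z.1) + (W t z.2 - W r z.2)) phi) => //; first exact: sigma_algebra_measurable.
  move=> i j; apply: (proj1 (msr_measurable _)).
  suff : measurable_fun setT (fun z : g_sigma_algebraType (F r) *
      g_sigma_algebraType (preimage_sigma (fun w => W t w - W r w)) =>
      (W r z.1 - W s z.1) i j + (W t z.2 - W r z.2) i j).
    by congr (measurable_fun _ _); apply/funext => z; rewrite [RHS]mxE.
  apply: measurable_funD.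
    have mU : measurable_fun setT ((fun w => (W r w - W s w) i j) : g_sigma_algebraType (F r) -> R).
      by rewrite ord1; apply: (incr_msr hF bW) => //; exact: le_trans (ltW rt) tT.
    exact: (measurableT_comp mU measurable_fst).
  have mV' : measurable_fun setT ((fun w => (W t w - W r w) i j)
     : g_sigma_algebraType (preimage_sigma (fun w => W t w - W r w)) -> R) := LG_msr (mV i j).
  exact: (measurableT_comp mV' measurable_snd).
- apply: (LG_integrable sM); rewrite /h /=; apply: (LGM sM) => //.
  have := LGphi 0 (lexx s) (ltW st) (lexx t); congr (LG P _ _).
  by apply/funext => w; rewrite add0r h12.
- move=> w; apply: (LG_integrable sM); rewrite /h /=; apply: (LGZ sM).
  by apply: LGphi => //; exact: ltW.
Qed.

Let holder r r' : s <= r -> r <= r' -> r' <= t ->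
  Ex P (fun w => (levy_mart r' w - levy_mart r w) ^+ 2) <= 4 * L ^+ 2 * (bm_cst T m 1 / T) * (r' - r).
Proof.
move=> sr; rewrite le_eqVlt => /orP[/eqP ->|rr rt].
  move=> _; under eq_Ex do rewrite subrr expr0n/=.
  by rewrite (Ex_cst P 0) subrr mulr0.
have r0 : 0 <= r by exact: le_trans sr.
have Tp : 0 < T by rewrite (le_lt_trans r0)// (lt_le_trans rr)// (le_trans rt).
have hi := bm_incr hF bW r0 rr (le_trans rt tT) (esym (mulVKf (lt0r_neq0 Tp) _)).
pose D w := W r' w - W r w.
have hD : LG P measurable (fun w => enorm (D w)).
  by apply: LG_sub (LG_enorm (incr_future hi) (incr_VLG hi)); case: (incr_future hi).
have br : s <= r <= t by rewrite sr (le_trans (ltW rr)).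
have br' : s <= r' <= t by rewrite rt (le_trans sr (ltW rr)).
have ml q : s <= q <= t -> LG P measurable (levy_mart q).
  move=> /andP[sq qt]; have bq : s <= q <= t by rewrite sq qt.
  apply: (@LG_bounded _ _ _ _ _ _ Kphi) => //.
    by apply: msr_levy => // i; exact: incr_msr0.
  move=> w; have hl := LGphi (W q w - W s w) sq qt (lexx t).
  apply: le_trans (normr_Ex hl) _; rewrite -(Ex_cst P Kphi).
  by apply: (Ex_le sM) => //; [exact: LG_norm|exact: LG_cst].
set ED := Ex P (fun w => enorm (D w)).
have EDD : ED ^+ 2 <= Ex P (fun w => enorm (D w) ^+ 2).
  have h1 : LG P measurable (cst (1 : R)) by exact: LG_cst.
  have := Ex_CS sM h1 hD; under eq_Ex do rewrite /= mul1r.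
  under [X in _ <= X * _]eq_Ex do rewrite /= expr1n.
  by rewrite (Ex_cst P 1) mul1r.
have pw w : `|levy_mart r' w - levy_mart r w| <= L * (enorm (D w) + ED).
  have h1 := LGphi (W r' w - W s w) (le_trans sr (ltW rr)) rt (lexx t).
  have h2 := LGphi (W r w - W s w) sr (le_trans (ltW rr) rt) (lexx t).
  rewrite /levy_mart -(ExB sM)//; apply: le_trans (normr_Ex (LGB sM h1 h2)) _.
  rewrite mulrDr -(ExZ sM)//.
  have hLD : LG P measurable (fun w' => L * enorm (D w')) by exact: LGZ.
  have hc : LG P measurable (cst (L * enorm (D w))) by exact: LG_cst.
  rewrite -(Ex_cst P (L * enorm (D w))) -(ExD sM)//; apply: (Ex_le sM).
  - by apply: LG_norm; exact: LGB.
  - exact: LGD.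
  - move=> w' /=; rewrite -mulrDr; apply: le_trans (lphi _ _) _; rewrite ler_wpM2l//.
    apply: le_trans (ler_enormB _ _); rewrite /D le_eqVlt; apply/orP; left; apply/eqP; congr enorm.
    by apply/matrixP => i j; rewrite !mxE; ring.
have h2 := incr_moment hi 1; rewrite muln1 expr1 in h2.
have hE : LG P measurable (fun w => enorm (D w) ^+ 2) by exact: LG_pow.
have hc2 : LG P measurable (cst (ED ^+ 2)) by exact: LG_cst.
apply: (@le_trans _ _ (Ex P (fun w => 2 * L ^+ 2 * (enorm (D w) ^+ 2 + ED ^+ 2)))).
  apply: (Ex_le sM).
  - by apply: LG_pow; apply: (LGB sM); apply: ml.
  - by apply: (LGZ sM); exact: LGD.
  - move=> w; rewrite -real_normK ?num_real//.
    have ED0 : 0 <= ED by apply: Ex_ge0 => ?; exact: enorm_ge0.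
    apply: (@le_trans _ _ ((L * (enorm (D w) + ED)) ^+ 2)).
      by rewrite lerXn2r ?nnegrE ?mulr_ge0 ?addr_ge0.
    rewrite exprMn; have := mulr_ge0 (sqr_ge0 L) (sqr_ge0 (enorm (D w) - ED)).
    by rewrite !expr2; lra.
rewrite (ExZ sM) ?(ExD sM)//; last exact: LGD.
rewrite (Ex_cst P (ED ^+ 2)).
have -> : 4 * L ^+ 2 * (bm_cst T m 1 / T) * (r' - r) = 2 * L ^+ 2 * (2 * (bm_cst T m 1 * (T^-1 * (r' - r)))) by ring.
apply: ler_wpM2l; first by rewrite mulr_ge0// sqr_ge0.
by have := le_trans EDD h2; move: h2; rewrite /D; lra.
Qed.

Lemma levy_bmart : bmart P F s t (process_sigma T W) levy_mart.
Proof.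
have T0 : 0 <= T by rewrite (le_trans s0)// (le_trans (ltW st)).
split.
- move=> r br; have /andP[sr rt] := br; apply: msr_levy => //; first exact: sub.
  by move=> i; apply: (incr_msr hF bW) => //; exact: le_trans tT.
- move=> r br; have /andP[sr rt] := br; have sW := process_sigma_subalg aW.
  apply: msr_levy => // i; under eq_fun do rewrite 2!mxE.
  have h q : s <= q <= t -> msr (process_sigma T W) (fun w => W q w i 0).
    move=> /andP[sq qt]; move: i (0 : 'I_1); apply/borel_measurable_entries; first by case: sW.
    move=> A hA; apply: sub_gen_smallest; exists q => //.
    by rewrite /= in_itv /= (le_trans s0 sq) (le_trans qt).
  by apply: measurable_funB; apply: h => //; rewrite lexx ltW.
- exists Kphi => // r w /andP[sr rt].
  have hl := LGphi (W r w - W s w) sr rt (lexx t).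
  apply: le_trans (normr_Ex hl) _; rewrite -(Ex_cst P Kphi).
  by apply: (Ex_le sM) => //; [exact: LG_norm|exact: LG_cst].
- move=> r r' f sr rr rt hf.
  have br : s <= r <= t by rewrite sr (le_trans rr).
  have br' : s <= r' <= t by rewrite rt (le_trans sr).
  rewrite -(freeze br hf) -(freeze br')//; apply: LG_sub hf; have [_] := hF; apply => //.
    exact: le_trans sr.
  exact: le_trans tT.
- exists (4 * L ^+ 2 * (bm_cst T m 1 / T)) => //.
  by rewrite !mulr_ge0 ?sqr_ge0 ?invr_ge0// bm_cst_ge0.
Qed.

End onestep.

Section family.
Variables (K : nat) (W : nat -> R -> Omega -> 'cV[R]_m).
Hypothesis bW : forall k, standard_brownian P T F (W k).
Let C k := process_sigma T (W k).
Let sC k : subalg (C k). Proof. by apply: process_sigma_subalg; case: (bW k). Qed.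
Hypothesis prodC : forall n A, (n <= K)%N -> (forall k, C k (A k)) ->
  P (\bigcap_(k in `I_n) A k) = (\prod_(k < n) P (A k))%E.

Let CM k : C k `<=` measurable. Proof. by case: (sC k). Qed.
Let CI k : setI_closed (C k).
Proof.
have E := sigma_algebra_id (proj1 (sC k)) => A B; rewrite -E.
exact: (@measurableI _ (g_sigma_algebraType (C k))).
Qed.
Let CT k : C k setT. Proof. by case: (sC k) => -[C0 CD _] _; rewrite -(setD0 setT); exact: CD. Qed.
Let sP n : subalg (past C n) := past_subalg CM n.
Let CE k : <<s C k >> = C k. Proof. by rewrite sigma_algebra_id//; case: (sC k). Qed.

Section onestep.
Variables (s t : R) (phi : nat -> 'cV[R]_m -> R) (L : R).
Hypotheses (s0 : 0 <= s) (st : s < t) (tT : t <= T)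
  (bphi : forall k x, `|phi k x| <= 1) (L0 : 0 <= L)
  (lphi : forall k x y, `|phi k x - phi k y| <= L * enorm (x - y)).

Let M k := levy_mart (W k) s t (phi k).
Let bM k := levy_bmart (bW k) s0 st tT ler01 (bphi k) L0 (lphi k).

Let bprod n : (n <= K)%N -> bmart P F s t (past C n) (fun r w => \prod_(k < n) M k r w).
Proof.
elim: n => [_|n IH nK].
  have := bmart_cst P F s t 1 (sP 0); congr bmart; apply/funext => r; apply/funext => w.
  by rewrite big_ord0.
have -> : (fun r w => \prod_(k < n.+1) M k r w) = (fun r w => (\prod_(k < n) M k r w) * M n r w).
  by apply/funext => r; apply/funext => w; rewrite big_ord_recr.
apply: (bmart_mul hF s0 tT (sP n) (sC n) _ _ _ (IH (ltnW nK)) (bM n)).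
- exact: past_sub.
- by rewrite -(CE n); exact: sub_past.
- by rewrite -(CE n); exact: (past_indep CM CI CT prodC).
Qed.

(** At time t the product of the martingales is the product of the [phi k] of the increments; at
    time s it is the constant product of their means. Hence the increments are jointly independent
    of F_s, and not only each of them. *)
Lemma levy_step (Y : Omega -> R) : LG P (F s) Y ->
  Ex P (fun w => Y w * \prod_(k < K) phi k (W k t w - W k s w)) =
  Ex P Y * \prod_(k < K) Ex P (fun w => phi k (W k t w - W k s w)).
Proof.
move=> hY; have := bmart_mart (bprod (leqnn K)) (lexx s) (ltW st) (lexx t) hY.
have -> : (fun w => Y w * \prod_(k < K) M k t w) =
    (fun w => Y w * \prod_(k < K) phi k (W k t w - W k s w)).
  apply/funext => w; congr (_ * _); apply: eq_bigr => k _.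
  rewrite /M /levy_mart -[RHS](Ex_cst P (phi k (W k t w - W k s w))).
  by apply: eq_Ex => w'; rewrite subrr addr0.
move=> ->; under eq_Ex do rewrite mulrC.
set c := \prod_(k < K) Ex P _.
have -> : (fun w => \prod_(k < K) M k s w * Y w) = (fun w => c * Y w).
  apply/funext => w; congr (_ * _); apply: eq_bigr => k _.
  by apply: eq_Ex => w'; rewrite subrr add0r.
have hYM : LG P measurable Y.
  have bs : 0 <= s <= T by rewrite s0 (le_trans (ltW st)).
  by apply: LG_sub hY; have [sF _] := hF; have [] := sF s bs.
by rewrite (ExZ sM)// mulrC.
Qed.

End onestep.
End family.
End Levy.

(** * Boxes and their Lipschitz approximation *)

Section Boxes.
Variable R : realType.

Lemma prod_lip (I : Type) (s : seq I) (a b : I -> R) :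
  (forall i, 0 <= a i <= 1) -> (forall i, 0 <= b i <= 1) ->
  `|\prod_(i <- s) a i - \prod_(i <- s) b i| <= \sum_(i <- s) `|a i - b i|.
Proof.
move=> a01 b01; elim: s => [|i s IH]; first by rewrite !big_nil subrr normr0.
rewrite !big_cons; set A := \prod_(j <- s) a j in IH *; set B := \prod_(j <- s) b j in IH *.
have -> : a i * A - b i * B = (a i - b i) * A + b i * (A - B) by ring.
have A0 : 0 <= A by apply: prodr_ge0 => j _; have /andP[] := a01 j.
have A1 : A <= 1 by apply: prodr_ile1 => j _; exact: a01.
apply: le_trans (ler_normD _ _) _; rewrite !normrM; apply: lerD.
  by rewrite ler_piMr// ger0_norm.
have /andP[b0 b1] := b01 i.
by apply: le_trans IH; rewrite (ger0_norm b0) ler_piMl.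
Qed.

Definition clamp (z : R) : R := Num.min 1 (Num.max 0 z).

Lemma clamp01 z : 0 <= clamp z <= 1.
Proof. by rewrite /clamp ge_min lexx le_min ler01 le_max lexx. Qed.

Lemma clamp_lip x y : `|clamp x - clamp y| <= `|x - y|.
Proof.
wlog xy : x y / x <= y.
  move=> h; have [/h//|/ltW /h] := leP x y.
  by rewrite distrC [X in _ -> _ <= X]distrC.
rewrite [leRHS]distrC [leRHS]ger0_norm ?subr_ge0// distrC /clamp.
rewrite !minElt !maxElt; do ?case: ifP => /=;
  move=> *; rewrite ler_norml; lra.
Qed.

Variable m : nat.
Implicit Type b : 'I_m -> option R.

(** [None] leaves a coordinate unconstrained, so the whole space is a box and boxes are closed under
    intersection. *)
Definition box b : set 'cV[R]_m := [set x | forall i, oapp (fun r => x i 0 < r) true (b i)].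

(** A Lipschitz function with values in [0, 1] that tends to the indicator of the box, since
    [levy_step] accepts only bounded Lipschitz functions. *)
Definition soft_box (n : nat) b (x : 'cV[R]_m) : R :=
  \prod_i oapp (fun r => clamp (n%:R * (r - x i 0))) 1 (b i).

Let soft01 n b (x : 'cV[R]_m) i : 0 <= oapp (fun r => clamp (n%:R * (r - x i 0))) 1 (b i) <= 1.
Proof. by case: (b i) => [r|] /=; [exact: clamp01|rewrite ler01 lexx]. Qed.

Lemma normr_soft_box n b x : `|soft_box n b x| <= 1.
Proof.
rewrite ger0_norm; first by apply: prodr_ile1 => i _; exact: soft01.
by apply: prodr_ge0 => i _; have /andP[] := soft01 n b x i.
Qed.

Lemma soft_box_lip n b x y : `|soft_box n b x - soft_box n b y| <= (m * n)%:R * enorm (x - y).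
Proof.
apply: le_trans (prod_lip _ (soft01 n b x) (soft01 n b y)) _.
apply: (@le_trans _ _ (\sum_(i < m) n%:R * enorm (x - y))); last first.
  by rewrite sumr_const card_ord natrM -mulrA [leRHS]mulr_natl.
apply: ler_sum => i _; case: (b i) => [r|] /=; last by rewrite subrr normr0 mulr_ge0.
apply: le_trans (clamp_lip _ _) _; rewrite -mulrBr normrM ger0_norm// ler_wpM2l//.
have -> : r - x i 0 - (r - y i 0) = - (x i 0 - y i 0) by ring.
by rewrite normrN; have := enorm_entry (x - y) i 0; rewrite !mxE.
Qed.

Lemma soft_box_cvg b x : soft_box n b x @[n --> \oo] --> (\1_(box b) x : R).
Proof.
have -> : \1_(box b) x = \prod_i oapp (fun r => (x i 0 < r)%R%:R) 1 (b i) :> R.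
  rewrite indicE; have [xb|xb] := pselect (box b x).
    by rewrite mem_set// big1// => i _; have := xb i; case: (b i) => //= r ->.
  rewrite memNset//; have /existsNP[i hi] := xb; rewrite (bigD1 i)//=.
  by move: hi; case: (b i) => [r|] //= /negP/negbTE ->; rewrite mul0r.
apply: cvg_big => [|i _]; first exact: mul_continuous.
case: (b i) => [r|] /=; last exact: cvg_cst.
apply: cvg_near_cst; have [xr|rx] := ltP (x i 0) r; last first.
  near=> n; rewrite /clamp; have h : n%:R * (r - x i 0) <= 0.
    by rewrite mulr_ge0_le0// subr_le0.
  by rewrite max_l// min_r.
near=> n; rewrite /clamp min_l// le_max; apply/orP; right.
rewrite -ler_pdivrMr ?subr_gt0// mul1r.
near: n; exact: nbhs_infty_ger.
Unshelve. all: by end_near. Qed.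

Lemma box_preimage (Omega : pointedType) (G : set (set Omega)) (D : Omega -> 'cV[R]_m) b :
  sigma_algebra setT G -> (forall i, msr G (fun w => D w i 0)) -> G (D @^-1` box b).
Proof.
move=> sG mD; have E := sigma_algebra_id sG; rewrite -E.
have -> : D @^-1` box b = \bigcap_(i in [set: 'I_m])
    (if b i is Some r then (fun w => D w i 0) @^-1` `]-oo, r[ else setT).
  rewrite eqEsubset; split => w /=.
    by move=> h i _; have := h i; case: (b i) => //= r; rewrite in_itv.
  by move=> h i; have := h i Logic.I; case: (b i) => //= r; rewrite in_itv.
apply: (@fin_bigcap_measurable _ (g_sigma_algebraType G)) => // i _.
case: (b i) => [r|]; last exact: measurableT.
by rewrite -[X in measurable X]setTI; apply: mD.
Qed.

Lemma boxI b b' : exists b'', box b `&` box b' = box b''.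
Proof.
exists (fun i => match b i, b' i with
  | Some r, Some r' => Some (Num.min r r') | Some r, None => Some r | None, o => o end).
rewrite eqEsubset; split => x.
  move=> [xb xb'] i; have := xb i; have := xb' i.
  by case: (b i) (b' i) => [r|] [r'|] //= h1 h2; rewrite lt_min h1 h2.
by move=> h; split => i; have := h i; case: (b i) (b' i) => [r|] [r'|] //=;
  rewrite lt_min => /andP[].
Qed.

End Boxes.

(** * Product formulas over a time grid *)

Section Independence.
Context (R : realType) (disp : measure_display) (Omega : measurableType disp)
  (P : probability Omega R).
Let sM := @subalg_measurable disp Omega.

Lemma Ex_dct (f_ : nat -> Omega -> R) (f g : Omega -> R) :
  (forall n, LG P measurable (f_ n)) -> LG P measurable f -> LG P measurable g ->
  (forall n w, `|f_ n w| <= g w) -> (forall w, f_ n w @[n --> \oo] --> f w) ->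
  Ex P (f_ n) @[n --> \oo] --> Ex P f.
Proof.
move=> hf_ hf hg fg ff.
have H : (\int[P]_w (f_ n w)%:E @[n --> \oo] --> \int[P]_w (f w)%:E)%E.
  apply: (@dominated_cvg _ _ _ P setT measurableT (fun n w => (f_ n w)%:E) _ (EFin \o g)) => //.
  - by move=> n; apply/measurable_EFinP; exact: (msr_measurable_fun sM (LG_msr (hf_ n))).
  - by move=> w _; apply: cvg_EFin; [exact: nearW|exact: ff].
  - exact: (LG_integrable sM hg).
  - by move=> n w _; rewrite lee_fin.
by rewrite (Ex_EFin sM hf) in H; exact: (fine_cvg H).
Qed.

Lemma indic_bigcap n (A : nat -> set Omega) w :
  \1_(\bigcap_(k in `I_n) A k) w = \prod_(k < n) \1_(A k) w :> R.
Proof.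
rewrite indicE; have [h|h] := pselect ((\bigcap_(k in `I_n) A k) w).
  by rewrite mem_set// big1// => k _; rewrite indicE mem_set//; apply: h => /=.
rewrite memNset//; have /existsNP[k /not_implyP[kn hk]] := h.
by rewrite (bigD1 (Ordinal kn))//= indicE memNset// mul0r.
Qed.

Lemma LG_prod G (I : Type) (s : seq I) (f : I -> Omega -> R) : subalg G ->
  (forall i, LG P G (f i)) -> LG P G (fun w => \prod_(i <- s) f i w).
Proof.
move=> sG hf; elim: s => [|i s IH].
  by under eq_fun do rewrite big_nil; exact: LG_cst.
by under eq_fun do rewrite big_cons; exact: LGM.
Qed.

Lemma EFin_Ex_indic (A : set Omega) : measurable A -> P A = (Ex P (\1_A))%:E.
Proof. by move=> mA; rewrite (Ex_indic _ sM)// fineK// fin_num_measure. Qed.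

Variables (T : R) (F : R -> set (set Omega)).
Hypothesis hF : filtration T F.
Variable m : nat.

Section family.
Variables (K : nat) (W : nat -> R -> Omega -> 'cV[R]_m).
Hypothesis bW : forall k, standard_brownian P T F (W k).
Hypothesis prodW : forall n A, (n <= K)%N -> (forall k, process_sigma T (W k) (A k)) ->
  P (\bigcap_(k in `I_n) A k) = (\prod_(k < n) P (A k))%E.

Section onestep.
Variables (s t : R).
Hypotheses (s0 : 0 <= s) (st : s < t) (tT : t <= T).

Let sFt : subalg (F t).
Proof. by have [sF _] := hF; apply: sF; rewrite tT (le_trans s0 (ltW st)). Qed.
Let sFs : subalg (F s).
Proof. by have [sF _] := hF; apply: sF; rewrite s0 (le_trans (ltW st)). Qed.

Let mD k i : msr (F t) (fun w => (W k t w - W k s w) i 0).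
Proof. by apply: (incr_msr hF (bW k)) => //; exact: ltW. Qed.

Lemma LG_box k (b : 'I_m -> option R) : LG P (F t) (fun w => \1_(box b) (W k t w - W k s w)).
Proof.
have -> : (fun w => \1_(box b) (W k t w - W k s w)) =
  (\1_((fun w => W k t w - W k s w) @^-1` box b) : Omega -> R).
  by apply/funext => w; rewrite !indicE; congr (_%:R); apply/idP/idP; rewrite !inE.
by apply: (LG_indic _ sFt); apply: box_preimage => //; case: sFt.
Qed.

Let LG_soft k n b : LG P (F t) (fun w => soft_box n b (W k t w - W k s w)).
Proof.
apply: (LG_bounded P sFt _ (K := 1)); last by move=> w; exact: normr_soft_box.
apply: (msr_cont (g := soft_box n b)); first by case: sFt.
  by apply: (@lipschitz_continuous _ _ _ _ (m * n)%:R 0) => // x y; rewrite expr0 mulr1 soft_box_lip.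
by move=> i j; rewrite ord1.
Qed.

Lemma levy_box (Y : Omega -> R) (b : nat -> 'I_m -> option R) : LG P (F s) Y ->
  Ex P (fun w => Y w * \prod_(k < K) \1_(box (b k)) (W k t w - W k s w)) =
  Ex P Y * \prod_(k < K) Ex P (fun w => \1_(box (b k)) (W k t w - W k s w)).
Proof.
move=> hY; have hYM := LG_sub sFs.2 hY.
have up f : LG P (F t) f -> LG P measurable f by apply: LG_sub; case: sFt.
have hsoft n : LG P measurable (fun w => \prod_(k < K) soft_box n (b k) (W k t w - W k s w)).
  by apply: (LG_prod _ sM) => k; exact/up/LG_soft.
have hbox : LG P measurable (fun w => \prod_(k < K) \1_(box (b k)) (W k t w - W k s w)).
  by apply: (LG_prod _ sM) => k; exact/up/LG_box.
have L1 : Ex P (fun w => Y w * \prod_(k < K) soft_box n (b k) (W k t w - W k s w)) @[n --> \oo] -->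
    Ex P (fun w => Y w * \prod_(k < K) \1_(box (b k)) (W k t w - W k s w)).
  apply: (@Ex_dct _ _ (fun w => `|Y w|)).
  - by move=> n; exact: LGM.
  - exact: LGM.
  - exact: LG_norm.
  - move=> n w; rewrite normrM ler_piMr// normr_prod.
    by apply: prodr_ile1 => k _; rewrite normr_ge0 normr_soft_box.
  - move=> w; apply: cvgM; first exact: cvg_cst.
    by apply: cvg_big => [|k _]; [exact: mul_continuous|exact: soft_box_cvg].
have L2 : Ex P Y * \prod_(k < K) Ex P (fun w => soft_box n (b k) (W k t w - W k s w)) @[n --> \oo] -->
    Ex P Y * \prod_(k < K) Ex P (fun w => \1_(box (b k)) (W k t w - W k s w)).
  apply: cvgM; first exact: cvg_cst.
  apply: cvg_big => [|k _]; first exact: mul_continuous.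
  apply: (@Ex_dct _ _ (cst 1)).
  - by move=> n; exact/up/LG_soft.
  - exact/up/LG_box.
  - exact: LG_cst.
  - by move=> n w; exact: normr_soft_box.
  - by move=> w; exact: soft_box_cvg.
have E n : Ex P (fun w => Y w * \prod_(k < K) soft_box n (b k) (W k t w - W k s w)) =
    Ex P Y * \prod_(k < K) Ex P (fun w => soft_box n (b k) (W k t w - W k s w)).
  apply: (@levy_step R disp Omega P T F hF m K W bW prodW s t (fun k => soft_box n (b k)) (m * n)%:R) => //.
  - by move=> k x; exact: normr_soft_box.
  - by move=> k x y; exact: soft_box_lip.
rewrite (eq_cvg _ _ E) in L1.
exact: (cvg_unique _ L1 L2).
Qed.

End onestep.

Variables (tau : nat -> R) (N : nat).
Hypotheses (tau0 : 0 <= tau 0%N) (tauN : tau N <= T)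
  (tauS : forall i, (i < N)%N -> tau i < tau i.+1).

Let tau_le i j : (i <= j)%N -> (j <= N)%N -> tau i <= tau j.
Proof.
elim: j => [|j IH]; first by rewrite leqn0 => /eqP ->.
rewrite leq_eqVlt => /orP[/eqP -> //|]; rewrite ltnS => ij jN.
by apply: le_trans (IH ij (ltnW jN)) _; exact/ltW/tauS.
Qed.

(** The last cell is split off: all earlier factors are measurable at its left end and join Y. *)
Lemma levy_grid (Y : Omega -> R) (b : nat -> nat -> 'I_m -> option R) : LG P (F (tau 0%N)) Y ->
  forall n, (n <= N)%N ->
  Ex P (fun w => Y w * \prod_(i < n) \prod_(k < K) \1_(box (b i k)) (W k (tau i.+1) w - W k (tau i) w)) =
  Ex P Y * \prod_(i < n) \prod_(k < K) Ex P (fun w => \1_(box (b i k)) (W k (tau i.+1) w - W k (tau i) w)).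
Proof.
move=> hY; have [sF mF] := hF.
have bt i : (i <= N)%N -> 0 <= tau i <= T.
  by move=> iN; rewrite (le_trans tau0 (tau_le _ iN))//= (le_trans _ tauN)// tau_le.
have hZ n : (n <= N)%N -> LG P (F (tau n)) (fun w => Y w *
    \prod_(i < n) \prod_(k < K) \1_(box (b i k)) (W k (tau i.+1) w - W k (tau i) w)).
  move=> nN; have /andP[t0 tT] := bt n nN; apply: (LGM (sF _ (bt n nN))).
    by apply: LG_sub hY; apply: mF => //; exact: tau_le.
  apply: (LG_prod _ (sF _ (bt n nN))) => i; apply: (LG_prod _ (sF _ (bt n nN))) => k.
  have iN : (i < N)%N by exact: leq_trans (ltn_ord i) nN.
  have /andP[i0 iT] := bt _ (ltnW iN); have /andP[i0' iT'] := bt _ iN.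
  apply: (LG_sub _ (LG_box i0 (tauS iN) iT' k (b i k))); apply: mF => //.
  by apply: tau_le => //; exact: ltn_ord.
elim=> [_|n IH nN]; first by rewrite big_ord0 mulr1; apply: eq_Ex => w; rewrite big_ord0 mulr1.
rewrite big_ord_recr /= mulrA -IH; last exact: ltnW.
under eq_Ex do rewrite big_ord_recr /= mulrA.
have /andP[t0 tT] := bt _ nN; have /andP[t0' tT'] := bt _ (ltnW nN).
exact: (levy_box t0' (tauS nN) tT (b n) (hZ n (ltnW nN))).
Qed.

End family.

Lemma box_law (W W' : R -> Omega -> 'cV[R]_m) s t b :
  standard_brownian P T F W -> standard_brownian P T F W' -> 0 <= s -> s < t -> t <= T ->
  Ex P (fun w => \1_(box b) (W t w - W s w)) = Ex P (fun w => \1_(box b) (W' t w - W' s w)).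
Proof.
move=> bW bW' s0 st tT.
pose B i : set R := if b i is Some r then `]-oo, r[%classic else setT.
have mB i : measurable (B i) by rewrite /B; case: (b i).
have key (V : R -> Omega -> 'cV[R]_m) : standard_brownian P T F V ->
    (Ex P (fun w => \1_(box b) (V t w - V s w)))%:E = (\prod_(i < m) normal_prob 0 (Num.sqrt (t - s)) (B i))%E.
  move=> bV; have [_ _ _ _ law] := bV; rewrite -(law s t s0 st tT B mB).
  have mS : F t ((fun w => V t w - V s w) @^-1` box b).
    have [sF _] := hF; have sFt : subalg (F t) by apply: sF; rewrite tT (le_trans s0 (ltW st)).
    apply: box_preimage; first by case: sFt.
    by move=> i; apply: (incr_msr hF bV) => //; exact: ltW.
  have [sF _] := hF; have sFt : subalg (F t) by apply: sF; rewrite tT (le_trans s0 (ltW st)).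
  have -> : [set w | forall i, B i ((V t w - V s w) i 0)] = (fun w => V t w - V s w) @^-1` box b.
    rewrite eqEsubset; split => w /= h i; have := h i; rewrite /B; case: (b i) => //= r;
      by rewrite in_itv.
  rewrite EFin_Ex_indic; last by case: sFt => _; apply.
  congr (_%:E); apply: eq_Ex => w; rewrite !indicE; congr (_%:R).
by apply: EFin_inj; rewrite !key.
Qed.

End Independence.

(** * Independent and identically distributed copies *)

Section Copies.
Context (R : realType) (disp : measure_display) (Omega : measurableType disp)
  (P : probability Omega R).
Variables (T : R) (F : R -> set (set Omega)).
Hypotheses (hF : filtration T F) (T0 : 0 < T).
Variables (d m N : nat).
Hypothesis N0 : (0 < N)%N.
Let sM := @subalg_measurable disp Omega.

(* The state space of one copy: the initial value and the increments over the
   grid with [N] steps. *)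
Definition copy := ('cV[R]_d * (nat -> 'cV[R]_m))%type.

Definition grid (i : nat) : R := i%:R * T / N%:R.

Definition copy_of (xi : Omega -> 'cV[R]_d) (W : R -> Omega -> 'cV[R]_m) (w : Omega) : copy :=
  (xi w, fun i => W (grid i.+1) w - W (grid i) w).

(** Only the first N increments are constrained; the remaining entries of the sequence lie beyond
    the grid and do not enter the scheme. *)
Definition copy_sets : set (set copy) := [set S | exists B b, borel_sets B /\
  S = [set e | B e.1 /\ forall i, (i < N)%N -> box (b i) (e.2 i)]].

Lemma copy_setsI : setI_closed copy_sets.
Proof.
move=> _ _ [B [b [hB ->]]] [B' [b' [hB' ->]]].
have /choice[c hc] : forall i, exists c, box (b i) `&` box (b' i) = box c by move=> i; exact: boxI.
exists (B `&` B'), c; split.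
  have := smallest_sigma_algebra setT (@open 'cV[R]_d) => sB.
  have E := sigma_algebra_id sB.
  have := @measurableI _ (g_sigma_algebraType (@borel_sets 'cV[R]_d)) B B'.
  by rewrite /measurable /= E; apply.
rewrite eqEsubset; split => e.
  move=> [[Be be] [Be' be']]; split => // i iN; rewrite -hc.
  by split; [exact: be|exact: be'].
move=> [[Be Be'] ce]; split; split => // i iN; have := ce i iN; rewrite -hc; by case.
Qed.

Lemma copy_setsT : copy_sets setT.
Proof.
exists setT, (fun _ _ => None); split; last by rewrite eqEsubset; split => // e _; split.
have [s0 sD _] := smallest_sigma_algebra setT (@open 'cV[R]_d).
by rewrite -(setD0 setT); exact: sD.
Qed.

Let Nr : 0 < N%:R :> R. Proof. by rewrite ltr0n. Qed.

Lemma grid0 : grid 0 = 0. Proof. by rewrite /grid !mul0r. Qed.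

Lemma gridN : grid N = T. Proof. by rewrite /grid mulrAC divff ?mul1r// gt_eqF. Qed.

Lemma grid_lt i j : (i < j)%N -> grid i < grid j.
Proof. by move=> ij; rewrite /grid ltr_pM2r ?invr_gt0// ltr_pM2r// ltr_nat. Qed.

Lemma grid_bounds i : (i <= N)%N -> 0 <= grid i <= T.
Proof.
move=> iN; rewrite -{1}grid0 -gridN; apply/andP; split.
  by case: i iN => // i _; exact/ltW/grid_lt.
by move: iN; rewrite leq_eqVlt => /orP[/eqP -> //|/grid_lt/ltW].
Qed.

Lemma copy_preimage xi W S :
  borel_measurable (F 0) xi -> standard_brownian P T F W ->
  copy_sets S -> measurable (copy_of xi W @^-1` S).
Proof.
move=> mxi bW [B [b [hB ->]]]; have [sF mF] := hF.
have -> : copy_of xi W @^-1` [set e | B e.1 /\ forall i, (i < N)%N -> box (b i) (e.2 i)] =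
  xi @^-1` B `&` \bigcap_(i in `I_N) ((fun w => W (grid i.+1) w - W (grid i) w) @^-1` box (b i)).
  by rewrite eqEsubset; split => w /=.
apply: measurableI.
  by have [_] := sF 0 ltac:(by rewrite lexx ltW); apply; apply: mxi; exists B.
apply: bigcap_measurableType => i iN.
have bi := grid_bounds iN; have [sFi FM] := sF _ bi; apply: FM; apply: box_preimage => // j.
have /andP[g0 _] := grid_bounds (ltnW iN); have /andP[_ gT] := bi.
by apply: (incr_msr hF bW) => //; exact/ltW/grid_lt.
Qed.

Lemma indic_copy xi W (B : set 'cV[R]_d) (b : nat -> 'I_m -> option R) w :
  \1_(copy_of xi W @^-1` [set e | B e.1 /\ forall i, (i < N)%N -> box (b i) (e.2 i)]) w =
  \1_(xi @^-1` B) w * \prod_(i < N) \1_(box (b i)) (W (grid i.+1) w - W (grid i) w) :> R.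
Proof.
have -> : copy_of xi W @^-1` [set e | B e.1 /\ forall i, (i < N)%N -> box (b i) (e.2 i)] =
  xi @^-1` B `&` \bigcap_(i in `I_N) ((fun w => W (grid i.+1) w - W (grid i) w) @^-1` box (b i)).
  by rewrite eqEsubset; split => w' /=.
rewrite indicI /= indic_bigcap; congr (_ * _); exact: eq_bigr.
Qed.

Lemma copy_prob xi W (B : set 'cV[R]_d) (b : nat -> 'I_m -> option R) :
  borel_measurable (F 0) xi -> standard_brownian P T F W -> borel_sets B ->
  Ex P (\1_(copy_of xi W @^-1` [set e | B e.1 /\ forall i, (i < N)%N -> box (b i) (e.2 i)])) =
  Ex P (\1_(xi @^-1` B)) * \prod_(i < N) Ex P (fun w => \1_(box (b i)) (W (grid i.+1) w - W (grid i) w)).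
Proof.
move=> mxi bW hB; under eq_Ex do rewrite indic_copy.
(* A family with one member satisfies the product formula trivially, so [levy_grid] applies to a
   single motion. *)
have hprod n A : (n <= 1)%N -> (forall k : nat, process_sigma T W (A k)) ->
    P (\bigcap_(k in `I_n) A k) = (\prod_(k < n) P (A k))%E.
  case: n => [|[|//]] _ hA.
    by rewrite big_ord0 (_ : \bigcap_(k in `I_0) A k = setT) ?probability_setT//
      -subTset => w _ k.
  rewrite big_ord1; congr (P _); rewrite eqEsubset; split => w; first by apply.
  by move=> Aw k /=; case: k.
have [sF mF] := hF.
have sF0 : subalg (F 0) by apply: sF; rewrite lexx ltW.
have hY : LG P (F (grid 0)) (\1_(xi @^-1` B)).
  by rewrite grid0; apply: LG_indic => //; apply: mxi; exists B.
have := @levy_grid R disp Omega P T F hF m 1 (fun _ => W) (fun _ => bW) hprod grid N _ _ _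
  _ (fun i _ => b i) hY N (leqnn N).
rewrite grid0 gridN => /(_ (lexx 0) (lexx T) (fun i _ => grid_lt (ltnSn i))).
under eq_Ex do under eq_bigr do rewrite big_ord1.
by move=> ->; congr (_ * _); apply: eq_bigr => i _; rewrite big_ord1.
Qed.

Lemma copy_law xi W xi' W' S :
  borel_measurable (F 0) xi -> standard_brownian P T F W ->
  borel_measurable (F 0) xi' -> standard_brownian P T F W' ->
  (forall B, borel_sets B -> P (xi @^-1` B) = P (xi' @^-1` B)) ->
  copy_sets S -> P (copy_of xi W @^-1` S) = P (copy_of xi' W' @^-1` S).
Proof.
move=> mxi bW mxi' bW' law hS; have mS := copy_preimage mxi bW hS.
have mS' := copy_preimage mxi' bW' hS.
rewrite !EFin_Ex_indic//; case: hS => B [b [hB ->]] in mS mS' *.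
congr (_%:E); rewrite !copy_prob//; congr (_ * _).
  have [sF mF] := hF; have [_ F0M] : subalg (F 0) by apply: sF; rewrite lexx ltW.
  have m1 : measurable (xi @^-1` B) by apply: F0M; apply: mxi; exists B.
  have m2 : measurable (xi' @^-1` B) by apply: F0M; apply: mxi'; exists B.
  by apply: EFin_inj; rewrite -!EFin_Ex_indic// law.
apply: eq_bigr => i _; have /andP[g0 _] := grid_bounds (ltnW (ltn_ord i)).
have /andP[_ gT] := grid_bounds (ltn_ord i).
by apply: (box_law hF) => //; exact: grid_lt.
Qed.

Section family.
Variables (xi : nat -> Omega -> 'cV[R]_d) (W : nat -> R -> Omega -> 'cV[R]_m).
Hypotheses (bW : forall k, standard_brownian P T F (W k))
  (mxi : forall k, borel_measurable (F 0) (xi k)).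
Hypothesis prodW : forall n A, (forall k, process_sigma T (W k) (A k)) ->
  P (\bigcap_(k in `I_n) A k) = (\prod_(k < n) P (A k))%E.
Hypothesis prodxi : forall n A, (forall k, preimage_sigma (xi k) (A k)) ->
  P (\bigcap_(k in `I_n) A k) = (\prod_(k < n) P (A k))%E.

Definition copy_sigma k : set (set Omega) :=
  [set copy_of (xi k) (W k) @^-1` S | S in copy_sets].

Lemma copy_sigma_measurable k : copy_sigma k `<=` measurable.
Proof. by move=> _ [S hS <-]; exact: copy_preimage. Qed.

Lemma copy_sigmaI k : setI_closed (copy_sigma k).
Proof.
by move=> _ _ [S hS <-] [S' hS' <-]; exists (S `&` S'); [exact: copy_setsI|rewrite preimage_setI].
Qed.

Lemma copy_sigmaT k : copy_sigma k setT.
Proof. by exists setT; [exact: copy_setsT|rewrite preimage_setT]. Qed.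

(** The initial values are F_0-measurable and can take the part of Y in [levy_grid]. What remains is
    the product formula for the initial values alone, which is given. *)
Lemma copy_sigma_prod n A : (forall k, copy_sigma k (A k)) ->
  P (\bigcap_(k in `I_n) A k) = (\prod_(k < n) P (A k))%E.
Proof.
move=> hA.
have /choice[Bb hBb] : forall k, exists Bb : set 'cV[R]_d * (nat -> 'I_m -> option R),
    borel_sets Bb.1 /\ copy_of (xi k) (W k) @^-1` [set e | Bb.1 e.1 /\
      forall i, (i < N)%N -> box (Bb.2 i) (e.2 i)] = A k.
  by move=> k; have [_ [B [b [hB ->]]] E] := hA k; exists (B, b).
have AM k : measurable (A k) by have := @copy_sigma_measurable k; apply.
have mcap : measurable (\bigcap_(k in `I_n) A k) by exact: bigcap_measurableType.
rewrite EFin_Ex_indic//; under eq_bigr do rewrite EFin_Ex_indic//.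
rewrite prodEFin; congr (_%:E).
under eq_Ex do rewrite indic_bigcap.
have EA k w : \1_(A k) w = \1_(xi k @^-1` (Bb k).1) w *
   \prod_(i < N) \1_(box ((Bb k).2 i)) (W k (grid i.+1) w - W k (grid i) w) :> R.
  by have [_ <-] := hBb k; rewrite indic_copy.
have PA k : Ex P (\1_(A k)) = Ex P (\1_(xi k @^-1` (Bb k).1)) *
   \prod_(i < N) Ex P (fun w => \1_(box ((Bb k).2 i)) (W k (grid i.+1) w - W k (grid i) w)).
  by have [hB <-] := hBb k; rewrite copy_prob.
under eq_bigr do rewrite PA; rewrite big_split /=.
under eq_Ex do under eq_bigr do rewrite EA.
under eq_Ex do rewrite big_split /= exchange_big /=.
rewrite [X in _ = _ * X]exchange_big /=.
have [sF mF] := hF.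
have sF0 : subalg (F 0) by apply: sF; rewrite lexx ltW.
have Fx k : F 0 (xi k @^-1` (Bb k).1) by apply: mxi; have [hB _] := hBb k; exists (Bb k).1.
have hY : LG P (F (grid 0)) (fun w => \prod_(k < n) \1_(xi k @^-1` (Bb k).1) w).
  by rewrite grid0; apply: LG_prod => // k; exact: LG_indic.
have := @levy_grid R disp Omega P T F hF m n W bW (fun n A _ => @prodW n A) grid N _ _ _
  _ (fun i k => (Bb k).2 i) hY N (leqnn N).
rewrite grid0 gridN => /(_ (lexx 0) (lexx T) (fun i _ => grid_lt (ltnSn i))) ->.
congr (_ * _); under eq_Ex do rewrite -(indic_bigcap R n (fun k => xi k @^-1` (Bb k).1)).
apply: EFin_inj; rewrite -EFin_Ex_indic; last first.
  by apply: bigcap_measurableType => k _; case: sF0 => _; apply.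
rewrite prodxi; last by move=> k; have [hB _] := hBb k; exists (Bb k).1.
by rewrite -prodEFin; apply: eq_bigr => k _; rewrite EFin_Ex_indic//; case: sF0 => _; apply.
Qed.

Definition copy_past n := past copy_sigma n.

Lemma copy_past_subalg n : subalg (copy_past n).
Proof. exact: (past_subalg copy_sigma_measurable). Qed.

Lemma copy_gen_subalg n : subalg <<s copy_sigma n >>.
Proof. by apply: gen_subalg; exact: copy_sigma_measurable. Qed.

Lemma copy_past_indep n : independent_pair P (copy_past n) <<s copy_sigma n >>.
Proof.
apply: (past_indep copy_sigma_measurable copy_sigmaI copy_sigmaT (K := n.+1)) => // k A _.
exact: copy_sigma_prod.
Qed.

Lemma msr_copy k (g : copy -> R) : msr copy_sets g -> msr <<s copy_sigma k >> (g \o copy_of (xi k) (W k)).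
Proof.
move=> mg _ B mB; rewrite setTI comp_preimage.
have sg := smallest_sigma_algebra setT (copy_sigma k).
rewrite /measurable /= sigma_algebra_id//.
have := mg measurableT B mB; rewrite setTI => h.
apply: (@preimage_generated _ _ <<s copy_sigma k >> copy_sets) h => // S hS.
by apply: sub_gen_smallest; exists S.
Qed.

End family.
End Copies.

(** * Continuous paths and linear interpolation *)

Section Paths.
Variables (R : realType) (T : R) (d : nat).
Hypothesis T0 : 0 < T.
Implicit Types v w : R -> 'cV[R]_d.

Lemma itv0T x : (x \in `[0, T]) = (0 <= x <= T). Proof. by rewrite in_itv. Qed.

Lemma cpath_dist v x e : {within `[0, T], continuous v} -> 0 <= x <= T -> 0 < e ->
  exists2 r, 0 < r & forall t, 0 <= t <= T -> `|x - t| < r -> enorm (v x - v t) < e.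
Proof.
move=> /subspace_continuousP cv xT e0.
have e1 : 0 < e / ((d * 1)%:R + 1) by rewrite divr_gt0// ltr_wpDl.
have Ax : `[0, T]%classic x by rewrite /= itv0T.
have /(@cvgrPdist_lt _ _ _ _ (within_filter _ (nbhs_filter x))) := cv x Ax.
move=> /(_ _ e1); rewrite near_withinE => /nbhs_ballP[r /= r0 hr]; exists r => // t tT xt.
apply: le_lt_trans (enorm_le_norm _) _.
apply: (@le_lt_trans _ _ (((d * 1)%:R + 1) * `|v x - v t|)); first by rewrite ler_wpM2r// lerDl.
rewrite mulrC -ltr_pdivlMr ?ltr_wpDl//; apply: (hr t); last by rewrite /= itv0T.
by rewrite -ball_normE.
Qed.

Lemma heine v e : {within `[0, T], continuous v} -> 0 < e ->
  exists2 r, 0 < r & forall s t, 0 <= s <= T -> 0 <= t <= T -> `|s - t| < r -> enorm (v s - v t) <= e.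
Proof.
move=> cv e0.
have cA : compact `[0, T]%classic by exact: segment_compact.
move/compact_near_coveringP : cA => nA.
pose P (r : R) (x : R) := 0 <= x <= T -> forall t, 0 <= t <= T -> `|x - t| < r -> enorm (v x - v t) <= e.
have /(nA _ _ P (at_right_proper_filter 0)) H : forall x, `[0, T]%classic x ->
    \forall x' \near x & r \near 0^'+, P r x'.
  move=> x; rewrite /= itv0T => xT.
  have [r r0 hr] := cpath_dist cv xT (divr_gt0 e0 (ltr0n R 2)).
  exists (ball x (r / 2), [set s | s < r / 2]); first split => /=.
  - by apply: nbhsx_ballx; rewrite divr_gt0.
  - by apply: nbhs_right_lt; rewrite divr_gt0.
  move=> [x' s] /= []; rewrite -ball_normE /= => xx' sr x'T t tT x't.
  have h1 : enorm (v x - v x') < e / 2 by apply: hr => //; lra.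
  have h2 : enorm (v x - v t) < e / 2.
    apply: hr => //; apply: le_lt_trans (ler_distD x' _ _) _; lra.
  have -> : v x' - v t = (v x - v t) - (v x - v x') by apply/matrixP => i j; rewrite !mxE; ring.
  by apply: le_trans (ler_enormB _ _) _; lra.
have : \forall r \near (0 : R)^'+, 0 < r /\ `[0, T]%classic `<=` P r.
  by near=> r; split; [near: r; exact: nbhs_right_gt|near: r].
move=> /filter_ex[r [r0 hr]]; exists r => // s t sT tT st; apply: hr => //.
Unshelve. all: by end_near. Qed.

Lemma cpath_bounded v : {within `[0, T], continuous v} ->
  exists2 M, 0 <= M & forall t, 0 <= t <= T -> enorm (v t) <= M.
Proof.
move=> cv; have cA : compact `[0, T]%classic by exact: segment_compact.
move/compact_near_coveringP : cA => nA.
pose P (M : R) (x : R) := 0 <= x <= T -> enorm (v x) <= M.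
have /(nA _ _ P proper_pinfty_nbhs) H : forall x, `[0, T]%classic x ->
    \forall x' \near x & M \near +oo, P M x'.
  move=> x; rewrite /= itv0T => xT.
  have [r r0 hr] := cpath_dist cv xT ltr01.
  exists (ball x r, [set s | enorm (v x) + 1 <= s]); first split => /=.
  - by apply: nbhsx_ballx.
  - by apply: nbhs_pinfty_ge; rewrite num_real.
  move=> [x' s] /= []; rewrite -ball_normE /= => xx' sr x'T.
  have h1 := hr x' x'T xx'; have := ler_enormB (v x) (v x - v x').
  by rewrite subKr; lra.
have : \forall r \near +oo, 0 <= r /\ `[0, T]%classic `<=` P r.
  by near=> r; split; [near: r; apply: nbhs_pinfty_ge; rewrite num_real|near: r].
move=> /filter_ex[r [r0 hr]]; exists r => // s sT; apply: hr => //.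
Unshelve. all: by end_near. Qed.

Lemma supnorm_le v M : (forall t, 0 <= t <= T -> enorm (v t) <= M) -> supnorm T v <= M.
Proof.
move=> H; apply: ge_sup; first by exists (enorm (v 0)), 0; rewrite //= itv0T lexx ltW.
by move=> _ [t /= tT <-]; apply: H; rewrite -itv0T.
Qed.

Lemma supnorm_ge0 v M : (forall t, 0 <= t <= T -> enorm (v t) <= M) -> 0 <= supnorm T v.
Proof.
move=> H; apply: (@le_trans _ _ (enorm (v 0))); first exact: enorm_ge0.
apply: ub_le_sup; last by exists 0; rewrite //= itv0T lexx ltW.
by exists M => _ [t /= tT <-]; apply: H; rewrite -itv0T.
Qed.

Definition interp (N : nat) (y : nat -> 'cV[R]_d) (t : R) : 'cV[R]_d :=
  let u := t * N%:R / T in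
  let n := minn (Num.truncn u) N.-1 in
  (u - n%:R) *: y n.+1 + (n.+1%:R - u) *: y n.

Section interp.
Variable N : nat.
Hypothesis N0 : (0 < N)%N.
Implicit Type y : nat -> 'cV[R]_d.

(** At a node the formulas of the two adjacent cells agree, so n may be any cell containing t and
    need not be the truncation; at t = T the truncation is N and is cut down to N - 1. *)
Lemma interpE y t n : (n < N)%N -> n%:R <= t * N%:R / T <= n.+1%:R ->
  interp N y t = (t * N%:R / T - n%:R) *: y n.+1 + (n.+1%:R - t * N%:R / T) *: y n.
Proof.
move=> nN /andP[nu un]; rewrite /interp; set u := t * N%:R / T in nu un *.
have [un'|nu'] := ltP u n.+1%:R.
  have -> : Num.truncn u = n by apply: truncn_def; rewrite nu.
  by rewrite (minn_idPl _)//; case: (N) nN.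
have -> : u = n.+1%:R by apply: le_anti; rewrite un.
have -> : Num.truncn (n.+1%:R : R) = n.+1 by apply: truncn_def; rewrite lexx ltr_nat ltnSn.
have [nN1|nN1] := leqP n.+1 N.-1.
  by rewrite !subrr !scale0r add0r addr0 -!natrB ?leqnSn// !subSnn.
by have -> : N.-1 = n by apply/eqP; rewrite eqn_leq -ltnS nN1 -ltnS (ltn_predK nN) nN.
Qed.

Lemma interp_ex t : 0 <= t <= T -> exists2 n, (n < N)%N & n%:R <= t * N%:R / T <= n.+1%:R.
Proof.
move=> /andP[t0 tT]; have Nr : 0 < N%:R :> R by rewrite ltr0n.
set u := t * N%:R / T.
have u0 : 0 <= u by rewrite divr_ge0 ?mulr_ge0// ltW.
have uN : u <= N%:R by rewrite ler_pdivrMr// mulrC ler_wpM2l.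
have /andP[h1 h2] := truncn_itv u0.
have [uN'|Nu] := ltnP (Num.truncn u) N.
  by exists (Num.truncn u) => //; rewrite h1 ltW.
exists N.-1; first by rewrite prednK.
rewrite prednK// uN andbT; apply: le_trans h1; rewrite ler_nat.
by apply: leq_trans Nu; exact: leq_pred.
Qed.

Lemma interp_conv y t : 0 <= t <= T -> exists n x, [/\ (n < N)%N, 0 <= x <= 1,
  t = (n%:R + x) * T / N%:R & forall y', interp N y' t = x *: y' n.+1 + (1 - x) *: y' n].
Proof.
move=> tT; have [n nN nu] := interp_ex tT.
exists n, (t * N%:R / T - n%:R); split => //.
- by case/andP: nu => h1 h2; rewrite subr_ge0 h1 /= lerBlDr nat1r.
- have Nr : N%:R != 0 :> R by rewrite pnatr_eq0 -lt0n.
  by rewrite addrC subrK; field; rewrite Nr gt_eqF.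
- move=> y'; rewrite (interpE _ nN nu); congr (_ + _ *: _).
  by rewrite -nat1r; ring.
Qed.

Lemma enorm_conv (x : R) (a b : 'cV[R]_d) M : 0 <= x <= 1 -> enorm a <= M -> enorm b <= M ->
  enorm (x *: a + (1 - x) *: b) <= M.
Proof.
move=> /andP[x0 x1] aM bM; apply: le_trans (ler_enormD _ _) _; rewrite !enormZ !ger0_norm ?subr_ge0//.
have : x * enorm a <= x * M by rewrite ler_wpM2l.
have : (1 - x) * enorm b <= (1 - x) * M by rewrite ler_wpM2l// subr_ge0.
by lra.
Qed.

Lemma interp_bound y M t : 0 <= t <= T -> (forall n, (n <= N)%N -> enorm (y n) <= M) ->
  enorm (interp N y t) <= M.
Proof.
move=> tT yM; have [n [x [nN x01 _ ->]]] := interp_conv y tT.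
by apply: enorm_conv => //; apply: yM => //; exact: ltnW.
Qed.

Lemma interpB y y' t : 0 <= t <= T ->
  interp N y t - interp N y' t = interp N (fun n => y n - y' n) t.
Proof.
move=> tT; have [n [x [nN x01 _ E]]] := interp_conv y tT; rewrite !E.
by rewrite !scalerBr opprD addrACA.
Qed.

Lemma interp_continuous y : {within `[0, T], continuous (interp N y)}.
Proof.
(* Interpolation as y_0 plus clamped increments: a finite sum of continuous functions, with no case
   distinction at the nodes. *)
pose g (t : R) : 'cV[R]_d := y 0%N + \sum_(i < N) clamp (t * N%:R / T - i%:R) *: (y i.+1 - y i).
apply: (@subspace_eq_continuous _ _ _ g) => [t|]; last first.
  apply: continuous_subspaceT => t; apply: cvgD; first exact: cvg_cst.
  apply: cvg_big => [|i _]; first exact: add_continuous.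
  apply: cvgZl.
  have cl : continuous (fun t : R => clamp (t * N%:R / T - i%:R)).
    move=> s; apply/(@cvgrPdist_lt _ _ _ _ (nbhs_filter s)) => e e0.
    have Nr : 0 < N%:R / T by rewrite divr_gt0// ltr0n.
    near=> r; apply: le_lt_trans (clamp_lip _ _) _.
    have -> : s * N%:R / T - i%:R - (r * N%:R / T - i%:R) = (s - r) * (N%:R / T) by ring.
    rewrite normrM (ger0_norm (ltW Nr)) -ltr_pdivlMr//.
    near: r; apply/nbhs_ballP; exists (e / (N%:R / T)); first by rewrite /= divr_gt0.
    by move=> r; rewrite -ball_normE.
  exact: cl.
rewrite inE /= itv0T => tT; have [n nN nu] := interp_ex tT.
change (g t = interp N y t).
rewrite (interpE _ nN nu) /g; move: nu => /andP[]; set u := t * N%:R / T => nu un.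
have clE (i : 'I_N) : clamp (u - i%:R) = if (i < n)%N then 1 else if i == n :> nat then u - n%:R else 0.
  rewrite /clamp; case: ltngtP => [ni|ni|->].
  - have : i.+1%:R <= n%:R :> R by rewrite ler_nat.
    by rewrite -nat1r => h; rewrite min_l// le_max; apply/orP; right; lra.
  - have : n.+1%:R <= i%:R :> R by rewrite ler_nat.
    by move=> h; rewrite max_l ?subr_le0 ?(le_trans un)// min_r.
  - by move: un; rewrite -nat1r => un; rewrite max_r ?subr_ge0// min_r//; lra.
have -> : \sum_(i < N) clamp (u - i%:R) *: (y i.+1 - y i) = (y n - y 0%N) + (u - n%:R) *: (y n.+1 - y n).
  transitivity (\sum_(0 <= i < N) (if (i < n)%N then 1 else if i == n :> nat then u - n%:R else 0) *: (y i.+1 - y i)).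
    by rewrite big_mkord; apply: eq_bigr => i _; rewrite clE.
  rewrite (big_cat_nat (n := n)) ?leq0n 1?ltnW//=; congr (_ + _).
    rewrite -(telescope_sumr y (leq0n n)); apply: eq_big_nat => i /andP[_ ->].
    by rewrite scale1r.
  rewrite big_ltn// ltnn eqxx big_nat big1 ?addr0// => i /andP[ni _].
  by rewrite ltnNge (ltnW ni) /= gtn_eqF// scale0r.
by apply/matrixP => i j; rewrite !mxE -nat1r; ring.
Unshelve. all: by end_near. Qed.

End interp.

Lemma interp_approx v e : {within `[0, T], continuous v} -> 0 < e ->
  exists N, forall n t, (N <= n)%N -> 0 <= t <= T ->
    enorm (interp n.+1 (fun k => v (k%:R * T / n.+1%:R)) t - v t) <= e.
Proof.
move=> cv e0; have [r r0 hr] := heine cv e0.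
exists (Num.truncn (T / r)) => n t nN tT.
have Nr : 0 < n.+1%:R :> R by rewrite ltr0n.
have [k [x [kN /andP[x0 x1] tE ->]]] := interp_conv (ltn0Sn n) (fun=> 0) tT.
have hT : T / n.+1%:R < r.
  rewrite ltr_pdivrMr// mulrC -ltr_pdivrMr//; apply: lt_le_trans (truncnS_gt _) _.
  by rewrite ler_nat.
have gT j : (j <= n.+1)%N -> 0 <= j%:R * T / n.+1%:R <= T.
  move=> jn; rewrite divr_ge0 ?mulr_ge0 ?(ltW T0)//= ler_pdivrMr// mulrC ler_pM2l//.
  by rewrite ler_nat.
have h0 : 0 <= T / n.+1%:R by rewrite divr_ge0 ?ltW.
have -> : x *: v (k.+1%:R * T / n.+1%:R) + (1 - x) *: v (k%:R * T / n.+1%:R) - v t =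
    x *: (v (k.+1%:R * T / n.+1%:R) - v t) + (1 - x) *: (v (k%:R * T / n.+1%:R) - v t).
  by apply/matrixP => i j; rewrite !mxE; ring.
apply: enorm_conv; rewrite ?x0 ?x1//; apply: hr => //; try exact: gT.
- rewrite tE (_ : _ - _ = (1 - x) * (T / n.+1%:R)); last by rewrite -[k.+1%:R]nat1r; ring.
  have x2 : 0 <= 1 - x by rewrite subr_ge0.
  rewrite (ger0_norm (mulr_ge0 x2 h0)); apply: (le_lt_trans _ hT).
  by rewrite ler_piMl// lerBlDr lerDl.
- by apply: gT; exact: ltnW.
- rewrite tE (_ : _ - _ = - (x * (T / n.+1%:R))); last by ring.
  rewrite normrN (ger0_norm (mulr_ge0 x0 h0)); apply: (le_lt_trans _ hT).
  by rewrite ler_piMl.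
Qed.

End Paths.

(** * The functional on path space *)

Section Functional.
Variables (R : realType) (T : R) (d : nat).
Hypothesis T0 : 0 < T.
Variables (c : R) (f : (R -> 'cV[R]_d) -> R).
Hypotheses (c0 : 0 <= c) (hf : forall v w : R -> 'cV[R]_d,
    {within `[0, T], continuous v} -> {within `[0, T], continuous w} ->
    `|f v - f w| <=
      c * (1 + supnorm T v `^ c + supnorm T w `^ c)
        * supnorm T (fun t => v t - w t)).

Let q := (Num.truncn c).+1.

(** The form in which the hypothesis on f is used: pointwise upper bounds replace suprema, and an
    integer power replaces the exponent c. *)
Definition functional_bound (K : R) := forall v w M M' D,
    {within `[0, T], continuous v} -> {within `[0, T], continuous w} ->
    (forall t, 0 <= t <= T -> enorm (v t) <= M) ->
    (forall t, 0 <= t <= T -> enorm (w t) <= M') ->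
    (forall t, 0 <= t <= T -> enorm (v t - w t) <= D) ->
    `|f v - f w| <= K * (1 + M + M') ^+ q * D.

Lemma functional_boundP : functional_bound (3 * c).
Proof.
move=> v w M M' D cv cw vM wM vwD; apply: le_trans (hf cv cw) _.
have v0 := supnorm_ge0 T0 vM; have w0 := supnorm_ge0 T0 wM.
have vM' := supnorm_le T0 vM; have wM' := supnorm_le T0 wM.
have M0 : 0 <= M by exact: le_trans vM'.
have M0' : 0 <= M' by exact: le_trans wM'.
have D0 := supnorm_ge0 T0 vwD; have D1 := supnorm_le T0 vwD.
apply: ler_pM => //; first by rewrite mulr_ge0// !addr_ge0// powR_ge0.
have pw (x : R) : 0 <= x -> x <= M + M' -> x `^ c <= (1 + M + M') ^+ q.
  move=> x0 xM; apply: le_trans (powR_le_expn c0 x0) _.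
  by rewrite lerXn2r ?nnegrE ?addr_ge0// -addrA lerD2l.
have e1 : M <= M + M' by lra.
have e2 : M' <= M + M' by lra.
have h1 := pw _ v0 (le_trans vM' e1); have h2 := pw _ w0 (le_trans wM' e2).
have h3 : 1 <= (1 + M + M') ^+ q by apply: exprn_ege1; lra.
rewrite -mulrA [3 * _]mulrC -mulrA; apply: ler_wpM2l => //; lra.
Qed.

(** Interpolation at n + 2 nodes makes f(Z) a limit of continuous functions of finitely many
    entries, so no sigma-algebra on the space of paths is required. *)
Lemma msr_functional (Omega : pointedType) (G : set (set Omega)) (Z : Omega -> R -> 'cV[R]_d) :
  sigma_algebra setT G -> (forall w, {within `[0, T], continuous (Z w)}) ->
  (forall t i, 0 <= t <= T -> msr G (fun w => Z w t i 0)) -> msr G (fun w => f (Z w)).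
Proof.
move=> sG cZ mZ.
pose h n w := f (interp T n.+1 (fun k => Z w (k%:R * T / n.+1%:R))).
apply: (@measurable_fun_cvg _ (g_sigma_algebraType G) R setT h); last first.
  move=> w _; apply/(@cvgrPdist_le _ _ _ _ _) => e e0.
  have [M M0 hM] := cpath_bounded (cZ w).
  pose L := 3 * c * (1 + M + M) ^+ q + 1.
  have L0 : 0 < L by rewrite ltr_wpDl// !mulr_ge0// exprn_ge0// !addr_ge0.
  have [n0 hn0] := interp_approx T0 (cZ w) (divr_gt0 e0 L0).
  exists n0 => // n /= nn.
  have gT j : (j <= n.+1)%N -> 0 <= j%:R * T / n.+1%:R <= T.
    move=> jn; rewrite divr_ge0 ?mulr_ge0 ?(ltW T0)//= ler_pdivrMr ?ltr0n// mulrC ler_pM2l//.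
    by rewrite ler_nat.
  have := @functional_boundP (Z w) (interp T n.+1 (fun k => Z w (k%:R * T / n.+1%:R))) M M (e / L)
     (cZ w) (@interp_continuous _ _ _ T0 n.+1 isT _) hM.
  move=> H; apply: le_trans (H _ _) _.
  - by move=> t tT; apply: interp_bound => // j jn; apply: hM; exact: gT.
  - by move=> t tT; rewrite enormB; exact: hn0.
  rewrite mulrA ler_pdivrMr// [e * L]mulrC ler_wpM2r ?(ltW e0)//.
  by rewrite /L lerDl.
move=> n; pose A w : 'M[R]_(d, n.+2) := \matrix_(i, k) Z w (k%:R * T / n.+1%:R) i 0.
pose g (B : 'M[R]_(d, n.+2)) := f (interp T n.+1 (fun k => col (inord k) B)).
have gT j : (j <= n.+1)%N -> 0 <= j%:R * T / n.+1%:R <= T.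
  move=> jn; rewrite divr_ge0 ?mulr_ge0 ?(ltW T0)//= ler_pdivrMr ?ltr0n// mulrC ler_pM2l//.
  by rewrite ler_nat.
have -> : h n = (fun w => g (A w)).
  (* The two interpolations are only known to agree on [0, T], whereas f takes functions on the
     whole line; the bound with D = 0 shows that f does not see the difference. *)
  apply/funext => w; apply/eqP; rewrite -subr_eq0 -normr_le0.
  have [M M0 hM] := cpath_bounded (cZ w).
  have E k : (k <= n.+1)%N -> col (inord k) (A w) = Z w (k%:R * T / n.+1%:R).
    by move=> kn; apply/matrixP => i j; rewrite !mxE inordK ?ltnS// ord1.
  have := @functional_boundP (interp T n.+1 (fun k => Z w (k%:R * T / n.+1%:R)))
    (interp T n.+1 (fun k => col (inord k) (A w))) M M 0 (@interp_continuous _ _ _ T0 n.+1 isT _)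
    (@interp_continuous _ _ _ T0 n.+1 isT _).
  rewrite mulr0; apply.
  - by move=> t tT; apply: interp_bound => // j jn; apply: hM; exact: gT.
  - by move=> t tT; apply: interp_bound => // j jn; rewrite E//; apply: hM; exact: gT.
  - move=> t tT; rewrite interpB//; apply: interp_bound => // j jn.
    by rewrite E// subrr enorm0.
have colB (k : 'I_n.+2) (B : 'M[R]_(d, n.+2)) : enorm (col k B) <= enorm B.
  rewrite -(ler_pXn2r (n := 2))// ?nnegrE// !sqr_enorm /mdot.
  apply: ler_sum => i _; rewrite big_ord1 mxE (bigD1 k)//= lerDl.
  by apply: sumr_ge0 => j _; rewrite -expr2 sqr_ge0.
apply: (msr_cont (g := g)) => //.
  apply: (@lipschitz_continuous _ _ _ _ (3 * c) q) => [|x y]; first by rewrite mulr_ge0.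
  apply: functional_boundP.
  - exact: interp_continuous.
  - exact: interp_continuous.
  - by move=> t tT; apply: interp_bound => // j jn; exact: colB.
  - by move=> t tT; apply: interp_bound => // j jn; exact: colB.
  - move=> t tT; rewrite interpB//; apply: interp_bound => // j jn.
    have -> : col (inord j) x - col (inord j) y = col (inord j) (x - y).
      by apply/matrixP => i k; rewrite !mxE.
    exact: colB.
move=> i k; under eq_fun do rewrite mxE.
by apply: mZ; apply: gT; rewrite -ltnS.
Qed.

End Functional.

(** * Refinement of grids, and the scheme as a function of a copy *)

Lemma OL_sub (R : realType) (disp : measure_display) (Omega : measurableType disp)
  (P : probability Omega R) (I J : Type) (eta : I -> R) (eta' : J -> R) (g : J -> I) a
  (f : I -> Omega -> R) : (forall x, 0 <= eta (g x) <= eta' x) ->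
  OL P eta a f -> OL P eta' a (fun x => f (g x)).
Proof.
move=> ee [hf H]; split => [x|q]; first exact: hf.
have [c c0 Hc] := H q; exists c => // x; apply: le_trans (Hc (g x)) _.
by rewrite ler_wpM2l//; have /andP[e0 e1] := ee x; rewrite lerXn2r ?nnegrE ?(le_trans e0).
Qed.

Section Doubling.
Variables (R : realType) (T : R) (d : nat).
Hypothesis T0 : 0 < T.

Definition refine (y : nat -> 'cV[R]_d) (j : nat) : 'cV[R]_d :=
  if odd j then 2^-1 *: (y j./2 + y j./2.+1) else y j./2.

Lemma refine_even y j : refine y j.*2 = y j.
Proof. by rewrite /refine odd_double doubleK. Qed.

Lemma refine_odd y j : refine y j.*2.+1 = 2^-1 *: (y j + y j.+1).
Proof. by rewrite /refine /= odd_double /= uphalf_double. Qed.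

Lemma interp_refine N (y : nat -> 'cV[R]_d) t : (0 < N)%N -> 0 <= t <= T ->
  interp T N y t = interp T N.*2 (refine y) t.
Proof.
move=> N0 tT; have N20 : (0 < N.*2)%N by rewrite double_gt0.
have Nr : N%:R != 0 :> R by rewrite pnatr_eq0 -lt0n.
have [n [x [nN /andP[x0 x1] tE ->]]] := interp_conv T0 N20 y tT.
have uE : t * N%:R / T = (n%:R + x) / 2.
  by rewrite tE -muln2 natrM; field; rewrite Nr gt_eqF.
have hN : (n./2 < N)%N by rewrite -ltn_double; apply: leq_ltn_trans nN; rewrite -{2}[n]odd_double_half leq_addl.
have nE := esym (odd_double_half n); set j := n./2 in hN nE.
have dj : j.*2%:R = 2 * j%:R :> R by rewrite -muln2 natrM mulrC.
have jS : j.+1%:R = 1 + j%:R :> R by rewrite nat1r.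
move: (odd n) nE => [] /=; rewrite ?add1n ?add0n => nE; rewrite {}nE in uE *.
  have dj1 : j.*2.+1%:R = 1 + 2 * j%:R :> R by rewrite -nat1r dj.
  rewrite (interpE y hN) uE dj1 jS; last by apply/andP; split; lra.
  rewrite refine_odd -doubleS refine_even.
  by apply/matrixP => a b; rewrite !mxE; field.
rewrite (interpE y hN) uE dj jS; last by apply/andP; split; lra.
rewrite refine_odd refine_even.
by apply/matrixP => a b; rewrite !mxE; field.
Qed.

End Doubling.

Section CopyPaths.
Variables (R : realType) (T : R) (d m : nat) (mu : 'cV[R]_d -> 'cV[R]_d)
  (sigma : 'cV[R]_d -> 'M[R]_(d, m)).
Variables (K : R) (k : nat).
Hypotheses (T0 : 0 < T) (K0 : 0 <= K) (hmu : drift_bounds K k mu)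
  (hsig : forall x y, enorm (sigma x - sigma y) <= K * enorm (x - y)).

(** The recursion of [tamed] along one trajectory: a deterministic function of the initial value and
    the increments, hence of a [copy]. *)
Fixpoint scheme (h : R) (x : 'cV[R]_d) (D : nat -> 'cV[R]_m) n : 'cV[R]_d :=
  if n is n'.+1 then
    let y := scheme h x D n' in y + tame mu h y + sigma y *m D n'
  else x.

Lemma tamed_scheme disp (Omega : measurableType disp) h (X : Omega -> 'cV[R]_d)
    (D : nat -> Omega -> 'cV[R]_m) n w :
  tamed mu sigma h X D n w = scheme h (X w) (D ^~ w) n.
Proof. by elim: n => //= n ->. Qed.

Lemma eq_scheme h x D D' n : D =1 D' -> scheme h x D n = scheme h x D' n.
Proof. by move=> DD; elim: n => //= n ->; rewrite DD. Qed.

Lemma msr_scheme (Omega : pointedType) (G : set (set Omega)) h (x : Omega -> 'cV[R]_d)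
    (D : Omega -> nat -> 'cV[R]_m) N : sigma_algebra setT G -> 0 <= h ->
  (forall i j, msr G (fun w => x w i j)) ->
  (forall n i j, (n < N)%N -> msr G (fun w => D w n i j)) ->
  forall n i j, (n <= N)%N -> msr G (fun w => scheme h (x w) (D w) n i j).
Proof.
move=> sG h0 mx mD; elim=> [|n IH] i j nN; first exact: mx.
have cont n' k' (g : 'cV[R]_d -> 'M[R]_(n', k')) : locally_lipschitz g ->
    forall i j, msr G (fun w => g (scheme h (x w) (D w) n) i j).
  move=> [C [q [C0 Cg]]] i' j'; apply: (msr_cont (g := fun y => g y i' j')) => //.
    apply: (lipschitz_continuous C0) => y z; apply: le_trans (Cg y z).
    by have := enorm_entry (g y - g z) i' j'; rewrite !mxE.
  by move=> a b; apply: IH; exact: ltnW.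
have mt := cont _ _ _ (lip_tame K0 hmu h0) i j; have ms := cont _ _ _ (lip_sigma K0 hsig) i.
have -> : (fun w => scheme h (x w) (D w) n.+1 i j) = (fun w => (scheme h (x w) (D w) n i j
    + tame mu h (scheme h (x w) (D w) n) i j)
    + \sum_l sigma (scheme h (x w) (D w) n) i l * D w n l j).
  by apply/funext => w; rewrite /= !mxE.
apply: measurable_funD; first by apply: measurable_funD => //; apply: IH; exact: ltnW.
elim: (index_enum _) => [|l r IHr]; first by under eq_fun do rewrite big_nil; exact: measurable_cst.
under eq_fun do rewrite big_cons; apply: measurable_funD => //.
by apply: measurable_funM; [exact: ms|exact: mD].
Qed.

Lemma copy_sets_sigma N : sigma_algebra setT <<s @copy_sets R d m N >>.
Proof. exact: smallest_sigma_algebra. Qed.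

Lemma msr_copy_init N i j : msr <<s @copy_sets R d m N >> (fun e : copy R d m => e.1 i j).
Proof.
move: i j; apply/(borel_measurable_entries _ (copy_sets_sigma N)) => _ [B hB <-].
apply: sub_gen_smallest; exists B, (fun _ _ => None); split => //.
by rewrite eqEsubset; split => e //= -[].
Qed.

Lemma msr_copy_incr N n i j : (n < N)%N ->
  msr <<s @copy_sets R d m N >> (fun e : copy R d m => e.2 n i j).
Proof.
move=> nN _ B mB; rewrite setTI.
have E : @measurable _ R = <<s @RGenInftyO.G R >> by refine (RGenInftyO.measurableE R).
rewrite E in mB; apply: (@preimage_generated _ _ _ _ _ _ _ _ mB).
  exact: smallest_sigma_algebra.
move=> _ [x ->]; apply: sub_gen_smallest; apply: sub_gen_smallest.
exists setT, (fun n' i' => if (n' == n) && (i' == i) then Some x else None).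
have [s0 sD _] := smallest_sigma_algebra setT (@open 'cV[R]_d).
split; first by rewrite -(setD0 setT); exact: sD.
rewrite eqEsubset; split => e /=.
  rewrite in_itv /= ord1 => h; split => // n' n'N i'.
  by case: eqP => [->|] //=; case: eqP => [->|].
by move=> [_ /(_ n nN i)]; rewrite !eqxx /= in_itv ord1.
Qed.

Definition copy_nodes N (e : copy R d m) := scheme (T / N%:R) e.1 e.2.

Definition copy_coarse N (e : copy R d m) :=
  scheme (T / N%:R) e.1 (fun n => e.2 n.*2 + e.2 n.*2.+1).

Lemma grid_double N n : (0 < N)%N -> grid T N.*2 n.*2 = grid T N n.
Proof.
move=> N0; rewrite /grid -!muln2 !natrM; field.
by rewrite pnatr_eq0 -lt0n.
Qed.

Variables (disp : measure_display) (Omega : measurableType disp) (xi : Omega -> 'cV[R]_d) (W : R -> Omega -> 'cV[R]_m).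

Lemma copy_nodesE N w n : copy_nodes N (copy_of T N xi W w) n =
  tamed_euler T mu sigma N (xi w) (fun t => W t w) n.
Proof. by rewrite /copy_nodes; elim: n => //= n ->. Qed.

Lemma tamed_interpE N w : interp T N (copy_nodes N (copy_of T N xi W w)) =
  tamed_interp T mu sigma N (xi w) (fun t => W t w).
Proof. by apply/funext => t; rewrite /interp /tamed_interp !copy_nodesE. Qed.

Lemma copy_coarseE N w : (0 < N)%N -> copy_coarse N (copy_of T N.*2 xi W w) =
  copy_nodes N (copy_of T N xi W w).
Proof.
move=> N0; apply/funext => n; apply: eq_scheme => {}n /=.
rewrite -(grid_double n.+1 N0) -(grid_double n N0) doubleS.
by rewrite addrC addrA subrK.
Qed.

End CopyPaths.

(** * Moments of sums of independent centred variables *)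

Section IndependentSum.
Context (R : realType) (disp : measure_display) (Omega : measurableType disp)
  (P : probability Omega R).
Let sM := @subalg_measurable disp Omega.

(** Jensen's inequality, by integrating the tangent of the power at the mean. *)
Lemma Ex_pow_le (g : Omega -> R) q : LG P measurable g -> (forall w, 0 <= g w) ->
  Ex P g ^+ q <= Ex P (fun w => g w ^+ q).
Proof.
move=> hg g0; set a := Ex P g; have a0 : 0 <= a by exact: Ex_ge0.
have hc x : LG P measurable (cst x) by exact: LG_cst.
have h1 : LG P measurable (fun w => q%:R * a ^+ q.-1 * (g w - a)) by apply: (LGZ sM); apply: LGB => //; exact: hc.
have : Ex P (fun w => a ^+ q + q%:R * a ^+ q.-1 * (g w - a)) <= Ex P (fun w => g w ^+ q).
  apply: (Ex_le sM) => [||w]; [by apply: (LGD sM) => //; exact: hc|exact: LG_pow|].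
  have := @bernoulli R a (g w - a) q a0; rewrite addrC subrK => /(_ (g0 w)); lra.
rewrite (ExD sM (hc _) h1) (ExZ sM); last by apply: LGB => //; exact: hc.
by rewrite (ExB sM hg (hc a)) (Ex_cst P a) -/a subrr mulr0 addr0 (Ex_cst P (a ^+ q)).
Qed.

Lemma OL_center (I : Type) (eta : I -> R) a (f : I -> Omega -> R) :
  (forall x, 0 <= eta x <= 1) -> OL P eta a f -> OL P eta a (fun x w => f x w - Ex P (f x)).
Proof.
move=> e01 of_; have oE : OL P eta a (fun x _ => - Ex P (f x)).
  have [hf H] := of_; split => [x|q]; first exact: LG_cst.
  have [c c0 Hc] := H q; exists c => // x; apply: le_trans (Hc x).
  rewrite (Ex_cst P ((- Ex P (f x)) ^+ (2 * q))) even_pow_norm normrN.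
  have hn := LG_norm (hf x); have n0 : 0 <= Ex P (fun w => `|f x w|) by exact: Ex_ge0.
  apply: (@le_trans _ _ (Ex P (fun w => `|f x w|) ^+ (2 * q))).
    by rewrite lerXn2r ?nnegrE//; exact: normr_Ex.
  apply: le_trans (Ex_pow_le _ hn (fun w => normr_ge0 _)) _.
  by under eq_Ex do rewrite -even_pow_norm.
exact: OL_D of_ oE.
Qed.

Variables (M : nat) (Gs Hs : nat -> set (set Omega)) (Z : nat -> Omega -> R)
  (Cn : nat -> R) (v : R).
Hypotheses (v0 : 0 < v) (Cn0 : forall q, 0 <= Cn q)
  (sG : forall n, subalg (Gs n)) (sH : forall n, subalg (Hs n))
  (GS : forall n, Gs n `<=` Gs n.+1) (HG : forall n, Hs n `<=` Gs n.+1)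
  (GH : forall n, independent_pair P (Gs n) (Hs n))
  (hZ : forall n, LG P (Hs n) (Z n)) (EZ : forall n, Ex P (Z n) = 0)
  (mZ : forall n r, Ex P (fun w => Z n w ^+ (2 * r)) <= Cn r * v ^+ r).

(** Divided by sqrt(M v) and read as vectors of dimension 1, the summands are increments over M
    steps of length 1/M, so [mart_moment] with the coefficient 1 gives an inequality of
    Marcinkiewicz-Zygmund type. *)
Lemma indep_sum_moment q : (0 < M)%N ->
  Ex P (fun w => (\sum_(n < M) Z n w) ^+ (2 * q.+1)) <=
  expR (step_cst Cn q.+1) * step_cst Cn q.+1 * (M%:R * v) ^+ q.+1.
Proof.
move=> M0; have Mr : 0 < M%:R :> R by rewrite ltr0n.
pose s := Num.sqrt (M%:R * v); have s0 : 0 < s by rewrite sqrtr_gt0 mulr_gt0.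
have s2 : s ^+ 2 = M%:R * v by rewrite sqr_sqrtr// mulr_ge0// ltW.
pose D n w : 'cV[R]_1 := const_mx (Z n w / s).
have nD (x : R) : enorm (const_mx x : 'cV[R]_1) = `|x|.
  by rewrite enormE /mdot !big_ord1 mxE -expr2 sqrtr_sqr.
have VD n G : subalg G -> LG P G (Z n) -> VLG P G (D n).
  move=> sG' h i j; under eq_fun do rewrite mxE mulrC; exact: LGZ.
have hD : chain P Cn M (fun=> M%:R^-1) Gs D.
  move=> n nM; split => //.
  - by apply: VD => //; exact: LG_sub (hZ n).
  - have mD : borel_measurable (Hs n) (D n).
      apply/borel_measurable_entries; first by case: (sH n).
      by move=> i j; exact: LG_msr (VD n _ (sH n) (hZ n) i j).
    by move=> A A' hA hA'; exact: (GH hA (mD _ hA')).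
  - move=> i; under eq_Ex do rewrite mxE mulrC.
    by rewrite (ExZ sM) ?EZ ?mulr0//; apply: LG_sub (hZ n); case: (sH n).
  - move=> r; have -> : (fun w => enorm (D n w) ^+ (2 * r)) = (fun w => (s ^+ (2 * r))^-1 * Z n w ^+ (2 * r)).
      by apply/funext => w; rewrite nD -even_pow_norm expr_div_n mulrC.
    rewrite (ExZ sM); last by apply: LG_pow; apply: LG_sub (hZ n); case: (sH n).
    rewrite exprM s2 exprMn invfM.
    apply: (@le_trans _ _ ((M%:R ^+ r)^-1 * (v ^+ r)^-1 * (Cn r * v ^+ r))).
      by rewrite ler_wpM2l// mulr_ge0// invr_ge0 exprn_ge0// ltW.
    rewrite exprVn le_eqVlt; apply/orP; left; apply/eqP; field.
    by rewrite !expf_neq0// gt_eqF.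
pose B (n : nat) (w : Omega) : 'M[R]_1 := const_mx 1.
have hB n : (n < M)%N -> VLG P (Gs n) (B n) by move=> _; exact: VLG_cst.
have := @mart_moment R disp Omega P 1 1 Cn M (fun=> M%:R^-1) Gs D B hD hB q M (leqnn M).
have e01 : 0 < M%:R^-1 :> R by rewrite invr_gt0.
have e1 : M%:R^-1 <= 1 :> R by rewrite invf_le1// ler1n.
move=> /(_ (fun _ _ => introT andP (conj e01 e1)) (fun _ => ltW e01)).
rewrite sumr_const card_ord -[X in X <= 1 -> _]mulr_natl divff ?gt_eqF//.
move=> /(_ (lexx 1) Cn0).
have -> : (fun w => enorm (mart B D M w) ^+ (2 * q.+1)) =
    (fun w => (s ^+ (2 * q.+1))^-1 * (\sum_(n < M) Z n w) ^+ (2 * q.+1)).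
  apply/funext => w; have -> : mart B D M w = const_mx ((\sum_(n < M) Z n w) / s).
    apply/matrixP => i j; rewrite /mart summxE mxE mulr_suml; apply: eq_bigr => n _.
    by rewrite !mxE big_ord1 !mxE mul1r.
  by rewrite nD -even_pow_norm expr_div_n mulrC.
have hS : LG P measurable (fun w => \sum_(n < M) Z n w).
  by apply: (LG_sum sM) => n _; apply: LG_sub (hZ n); case: (sH n).
rewrite (ExZ sM); last exact: LG_pow.
have -> : \sum_(i < M) M%:R^-1 * (step_cst Cn q.+1 * Ex P (fun w => enorm (B i w) ^+ (2 * q.+1))) = step_cst Cn q.+1.
  have EB i : Ex P (fun w => enorm (B i w) ^+ (2 * q.+1)) = 1.
    by under eq_Ex do rewrite nD normr1 expr1n; rewrite (Ex_cst P 1).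
  under eq_bigr do rewrite EB mulr1.
  by rewrite sumr_const card_ord -[LHS]mulr_natl mulrA divff ?mul1r// gt_eqF.
rewrite exprM s2 mulrC ler_pdivrMr//; exact: exprn_gt0 (mulr_gt0 Mr v0).
Qed.

End IndependentSum.

(** * Level differences and the error of the estimator *)

Section Multilevel.
Context (R : realType) (disp : measure_display) (Omega : measurableType disp)
  (P : probability Omega R).
Variables (T : R) (F : R -> set (set Omega)) (d m : nat) (K : R) (k : nat)
  (mu : 'cV[R]_d -> 'cV[R]_d) (sigma : 'cV[R]_d -> 'M[R]_(d, m)).
Hypotheses (T0 : 0 < T) (hF : filtration T F) (K0 : 0 <= K) (hmu : drift_bounds K k mu)
  (hsig : forall x y, enorm (sigma x - sigma y) <= K * enorm (x - y))
  (gmu : forall x, enorm (mu x) <= K * (1 + enorm x) ^+ k)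
  (gsig : forall x, enorm (sigma x) <= K * (1 + enorm x)).
Variables (c : R) (f : (R -> 'cV[R]_d) -> R).
Hypotheses (c0 : 0 <= c) (hf : forall v w : R -> 'cV[R]_d,
    {within `[0, T], continuous v} -> {within `[0, T], continuous w} ->
    `|f v - f w| <=
      c * (1 + supnorm T v `^ c + supnorm T w `^ c)
        * supnorm T (fun t => v t - w t)).
Variables (W : nat -> nat -> R -> Omega -> 'cV[R]_m) (xi : nat -> nat -> Omega -> 'cV[R]_d).
Variable (Cx : nat -> R).
Hypotheses (bW : forall l j, standard_brownian P T F (W l j))
  (hxi : forall l j, VLG P (F 0) (xi l j)) (Cx0 : forall r, 0 <= Cx r)
  (mxi : forall l j r, Ex P (fun w => enorm (xi l j w) ^+ (2 * r)) <= Cx r).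

Let sM := @subalg_measurable disp Omega.
Let T0' : 0 <= T := ltW T0.
Let C := bm_cst T m.
Let C0 q : 0 <= C q. Proof. exact: bm_cst_ge0. Qed.
Local Notation grid := (grid T).

Definition incs N l j n w := W l j (grid N n.+1) w - W l j (grid N n) w.

Lemma tsetup_incs N l j : (0 < N)%N ->
  tsetup P C Cx N (fun n => F (grid N n)) (incs N l j) (xi l j).
Proof.
move=> N0; split => //.
- move=> n nN; have /andP[g0 _] := grid_bounds T0 N0 (ltnW nN).
  have /andP[_ gT] := grid_bounds T0 N0 nN.
  apply: (bm_incr hF (bW l j)) => //; first exact: grid_lt.
  by rewrite /grid -mulrBl -mulrBl -natrB// subSnn mul1r.
- by have [sF _] := hF; apply: sF; exact: grid_bounds.
- by rewrite grid0.
Qed.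

Lemma tsetup_pair N l j : (0 < N)%N ->
  tsetup P C Cx N (fun n => F (grid N.*2 n.*2)) (pairsum (incs N.*2 l j)) (xi l j).
Proof.
move=> N0.
have -> : (fun n => F (grid N.*2 n.*2)) = (fun n => F (grid N n)).
  by apply/funext => n; rewrite grid_double.
have -> : pairsum (incs N.*2 l j) = incs N l j; last exact: tsetup_incs.
apply/funext => n; apply/funext => w; rewrite /pairsum /incs -(grid_double T n.+1 N0) -(grid_double T n N0).
by rewrite doubleS addrC addrA subrK.
Qed.

Let path N l j w := interp T N (copy_nodes T mu sigma N (copy_of T N (xi l j) (W l j) w)).

Let msr_interp N N' (y : copy R d m -> nat -> 'cV[R]_d) : (0 < N)%N ->
  (forall n i, (n <= N)%N -> msr <<s @copy_sets R d m N' >> (fun e => y e n i 0)) ->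
  msr <<s @copy_sets R d m N' >> (fun e => f (interp T N (y e))).
Proof.
move=> N0 mn; have sC := copy_sets_sigma R d m N'.
apply: (msr_functional T0 c0 hf) => // [e|t i tT]; first exact: interp_continuous.
pose u := t * N%:R / T; pose n := minn (Num.truncn u) N.-1.
have nN : (n < N)%N by rewrite /n gtn_min ltn_predL N0 orbT.
have -> : (fun e => interp T N (y e) t i 0) = (fun e =>
    (u - n%:R) * y e n.+1 i 0 + (n.+1%:R - u) * y e n i 0).
  by apply/funext => e; rewrite /interp !mxE.
by apply: measurable_funD; apply: measurable_funM => //; apply: mn => //; exact: ltnW.
Qed.

Lemma msr_path_functional N : (0 < N)%N ->
  msr <<s @copy_sets R d m N >> (fun e => f (interp T N (copy_nodes T mu sigma N e))).
Proof.
move=> N0; have sC := copy_sets_sigma R d m N; apply: msr_interp => // n i nN.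
apply: (msr_scheme (N := N) K0 hmu hsig) => //; first by rewrite divr_ge0.
  exact: msr_copy_init.
by move=> a b b' aN; exact: msr_copy_incr.
Qed.

Lemma msr_coarse_functional N : (0 < N)%N ->
  msr <<s @copy_sets R d m N.*2 >> (fun e => f (interp T N (copy_coarse T mu sigma N e))).
Proof.
move=> N0; have sC := copy_sets_sigma R d m N.*2; apply: msr_interp => // n i nN.
apply: (msr_scheme (N := N) K0 hmu hsig) => //; first by rewrite divr_ge0.
  exact: msr_copy_init.
move=> a b b' aN; have -> : (fun e : copy R d m => (e.2 a.*2 + e.2 a.*2.+1) b b') =
    (fun e => e.2 a.*2 b b' + e.2 a.*2.+1 b b') by apply/funext => e; rewrite mxE.
by apply: measurable_funD; apply: msr_copy_incr; rewrite ?ltn_double ?ltn_Sdouble.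
Qed.

Lemma msr_on_copy N l j (g : copy R d m -> R) : (0 < N)%N ->
  msr <<s @copy_sets R d m N >> g -> msr measurable (fun w => g (copy_of T N (xi l j) (W l j) w)).
Proof.
move=> N0 mg B0 B mB; rewrite setTI.
have mF0 : borel_measurable (F 0) (xi l j).
  have [sF _] := hF; have [sF0 _] := sF 0 ltac:(by rewrite lexx).
  by apply/(borel_measurable_entries _ sF0) => a b; exact: LG_msr (hxi l j a b).
have sC := copy_sets_sigma R d m N.
have := mg measurableT B mB; rewrite setTI /measurable /= sigma_algebra_id// => h.
rewrite sigma_algebra_id; last exact: sigma_algebra_measurable.
change (measurable (copy_of T N (xi l j) (W l j) @^-1` (g @^-1` B))).
apply: (@preimage_generated _ _ _ (@copy_sets R d m N)) h => [|S hS].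
  exact: sigma_algebra_measurable.
exact: (copy_preimage hF T0 N0 mF0 (bW l j) hS).
Qed.

Lemma nodes_tamed N l j w n : copy_nodes T mu sigma N (copy_of T N (xi l j) (W l j) w) n =
  tamed mu sigma (T / N%:R) (xi l j) (incs N l j) n w.
Proof. by rewrite tamed_scheme. Qed.

Lemma LG_path N l j : (0 < N)%N -> LG P measurable (fun w => f (path N l j w)).
Proof.
move=> N0; have hs := tsetup_incs l j N0; have [_ hD sG0 _ _] := hs.
have hn n : (n <= N)%N -> LG P measurable (fun w => enorm (tamed mu sigma (T / N%:R) (xi l j) (incs N l j) n w)).
  move=> nN; have sG := chain_subalg hD sG0 nN.
  by apply: LG_sub (LG_enorm sG (VLG_tamed T0 K0 hmu hsig hs nN)); case: sG.
have hM := LG_runmaxT hn; set M := runmax _ _ in hM.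
have hM1 : LG P measurable (fun w => 1 + M w + 0).
  by apply: (LGD sM); [apply: (LGD sM) => //|]; exact: LG_cst.
apply: (LG_dom sM (f := fun w => `|f (fun=> 0)| + 3 * c * (1 + M w + 0) ^+ (Num.truncn c).+1 * M w)).
- exact: (msr_on_copy l j N0 (msr_path_functional N0)).
- move=> w; have -> : f (path N l j w) = f (fun=> 0) + (f (path N l j w) - f (fun=> 0)) by rewrite addrC subrK.
  apply: le_trans (ler_normD _ _) _; rewrite lerD2l.
  have b t : 0 <= t <= T -> enorm (path N l j w t) <= M w.
    move=> tT; apply: interp_bound => // n nN; rewrite nodes_tamed.
    exact: (le_runmax (fun n w => enorm (tamed mu sigma (T / N%:R) (xi l j) (incs N l j) n w))).
  apply: (functional_boundP T0 c0 hf (v := path N l j w) (w := fun=> 0)) => //.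
  - exact: interp_continuous.
  - by move=> x; exact: cvg_cst.
  - by move=> t _; rewrite enorm0.
  - by move=> t tT; rewrite subr0; exact: b.
- apply: (LGD sM); first exact: LG_cst.
  by apply: (LGM sM) => //; apply: (LGZ sM); exact: LG_pow.
Qed.

Let pow_gt0 n : (0 < 2 ^ n)%N. Proof. by rewrite expn_gt0. Qed.
Let double_pow_gt0 n : (0 < (2 ^ n).*2)%N. Proof. by rewrite double_gt0 expn_gt0. Qed.

(** The pair (l, j) stands for copy j on level l + 1 of the estimator: 2^l coarse and 2^(l+1) fine
    steps, both driven by [W l.+1 j]. *)
Definition level (x : nat * nat) : lev P d m C Cx :=
  let N0 : (0 < 2 ^ x.1)%N := pow_gt0 x.1 in
  Lev (tsetup_incs x.1.+1 x.2 (double_pow_gt0 x.1)) (tsetup_pair x.1.+1 x.2 N0).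

(** The squared rate of a level difference: the relative fine step 1/2^(l+1) times the factor l + 2
    that [gauss_max] produces for 2^(l+1) increments. *)
Definition leta' (x : nat * nat) : R := x.1.+2%:R / (2 ^ x.1).*2%:R.

Lemma leta'01 x : 0 <= leta' x <= 1.
Proof.
rewrite /leta' divr_ge0//= ler_pdivrMr ?ltr0n ?double_gt0 ?expn_gt0// mul1r ler_nat.
rewrite -mul2n -expnS; elim: (x.1) => // n IH.
by rewrite expnS mul2n -addnn; apply: leq_trans (leq_add IH IH); rewrite addSn ltnS addnS -addSn leq_addr.
Qed.

Let le_eta x : 0 <= leta (level x) <= leta' x.
Proof.
rewrite /leta /leta' invr_ge0 ler0n /= ler_peMl ?invr_ge0// ler1n//.
Qed.

Definition max_incs (x : nat * nat) w :=
  runmax (fun n w => enorm (lD (level x) n w)) (2 ^ x.1).*2.-1 w.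

Let ltD (x : nat * nat) n : (n <= (2 ^ x.1).*2.-1)%N -> (n < (2 ^ x.1).*2)%N.
Proof. by move=> h; rewrite -(@prednK (2 ^ x.1).*2) ?double_gt0 ?expn_gt0. Qed.

Lemma OL_max_incs : OL P leta' 1 max_incs.
Proof.
have hD x n : (n <= (2 ^ x.1).*2.-1)%N -> LG P measurable (fun w => enorm (lD (level x) n w)).
  move=> /ltD nN; have [_ hD _ _ _] := lfine (level x); have hi := hD n nN.
  by apply: LG_sub (LG_enorm (incr_future hi) (incr_VLG hi)); case: (incr_future hi).
apply: (OL_intro) => [x|q]; first by apply: LG_runmaxT => n nN; exact: hD.
exists (gauss_cst R m q.+1 * T ^+ q.+1); first by rewrite mulr_ge0 ?exprn_ge0 ?gauss_cst_ge0.
move=> x; rewrite mul1n; set N := (2 ^ x.1).*2.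
have N0 : (0 < N)%N by rewrite double_gt0 expn_gt0.
have s0 : 0 < Num.sqrt (T / N%:R) by rewrite sqrtr_gt0 divr_gt0// ltr0n.
have H := @gauss_max R disp Omega P m x.1.+1 N.-1 q (Num.sqrt (T / N%:R)) (lD (level x)) s0.
apply: le_trans (H _ _) _ => {H}.
- by rewrite prednK// expnS mul2n.
- move=> n i /ltD nN; have /andP[g0 _] := grid_bounds T0 N0 (ltnW nN).
  have /andP[_ gT] := grid_bounds T0 N0 nN.
  have := @incr_gauss R disp Omega P T F hF m (W x.1.+1 x.2) (bW _ _) _ _ i g0 (grid_lt T0 N0 (ltnSn n)) gT.
  by rewrite (_ : grid N n.+1 - grid N n = T / N%:R)// /grid -!mulrBl -natrB// subSnn mul1r.
- rewrite sqr_sqrtr ?divr_ge0// -[leRHS]mulrA -exprMn le_eqVlt; apply/orP; left; apply/eqP.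
  by rewrite /leta' -/N; congr (_ * _ ^+ _); ring.
Qed.

Definition path_gap (x : nat * nat) w := max_err T mu sigma (level x) w +
  K * (1 + max_coarse T mu sigma (level x) w) ^+ 1 * max_incs x w.

Lemma OL_path_gap : OL P leta' 1 path_gap.
Proof.
have oE := OL_sub le_eta (OL_max_err P T0 K0 hmu hsig gmu gsig C0 Cx0).
have oCo := OL_sub le_eta (OL_max_coarse P T0 K0 hmu hsig gmu gsig C0 Cx0).
have e01 := leta'01.
have oK : OL P leta' 0 (fun x w => K * (1 + max_coarse T mu sigma (level x) w) ^+ 1) := OL_poly e01 K 1 oCo.
exact: OL_D oE (OL_M e01 oK OL_max_incs).
Qed.

Let path_coarse x w : path (2 ^ x.1) x.1.+1 x.2 w =
  interp T (2 ^ x.1) (fun n => coarseY T mu sigma (level x) n w).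
Proof.
have N0 : (0 < 2 ^ x.1)%N by rewrite expn_gt0.
congr interp; apply/funext => n; rewrite nodes_tamed /coarseY /=.
congr (tamed _ _ _ _ _ _ _); apply/funext => i; apply/funext => w'.
rewrite /pairsum /incs -(grid_double T i.+1 N0) -(grid_double T i N0).
by rewrite doubleS [RHS]addrC addrA subrK.
Qed.

Let path_fine x w : path (2 ^ x.1).*2 x.1.+1 x.2 w =
  interp T (2 ^ x.1).*2 (fun n => fineY T mu sigma (level x) n w).
Proof. by congr interp; apply/funext => n; rewrite nodes_tamed. Qed.

Let coarse_max x w n : (n <= 2 ^ x.1)%N ->
  enorm (coarseY T mu sigma (level x) n w) <= max_coarse T mu sigma (level x) w.
Proof. exact: (le_runmax (fun n w => enorm (coarseY T mu sigma (level x) n w))). Qed.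

(** On the fine grid the coarse interpolation agrees with [midY] at even nodes. At an odd node they
    differ by half of sigma(coarse) applied to the difference of the two adjacent increments, the
    noise that linear interpolation misses; this is where maxima of increments enter. *)
Lemma path_gapP x w t : 0 <= t <= T ->
  enorm (path (2 ^ x.1).*2 x.1.+1 x.2 w t - path (2 ^ x.1) x.1.+1 x.2 w t) <= path_gap x w.
Proof.
have N20 : (0 < (2 ^ x.1).*2)%N by rewrite double_gt0.
have bc n : (n <= 2 ^ x.1)%N -> enorm (coarseY T mu sigma (level x) n w) <= max_coarse T mu sigma (level x) w.
  exact: coarse_max.
move=> tT; rewrite path_fine path_coarse /path_gap.
rewrite [X in _ - X]interp_refine// interpB//; apply: interp_bound => // j jN.
have be n : (n <= (2 ^ x.1).*2)%N -> enorm (fineY T mu sigma (level x) n w - midY T mu sigma (level x) n w)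
     <= max_err T mu sigma (level x) w.
  by move=> nN; exact: (le_runmax (fun n w => enorm (err T mu sigma (level x) n w))).
have bD n : (n < (2 ^ x.1).*2)%N -> enorm (lD (level x) n w) <= max_incs x w.
  move=> nN; apply: (le_runmax (fun n w => enorm (lD (level x) n w))).
  by rewrite -ltnS prednK.
have mi0 : 0 <= max_incs x w by apply: le_trans (bD 0%N N20); exact: enorm_ge0.
have mc0 : 0 <= max_coarse T mu sigma (level x) w by apply: le_trans (bc 0%N (leq0n _)); exact: enorm_ge0.
rewrite expr1; have j2 := odd_double_half j; move: (odd j) j2 => [] /=; rewrite ?add1n ?add0n => j2.
  rewrite -{}j2 in jN *; set n := j./2 in jN *.
  have nN : (n < 2 ^ x.1)%N by rewrite -ltn_double.
  rewrite refine_odd.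
  have -> : fineY T mu sigma (level x) n.*2.+1 w - 2^-1 *: (coarseY T mu sigma (level x) n w + coarseY T mu sigma (level x) n.+1 w)
     = (fineY T mu sigma (level x) n.*2.+1 w - midY T mu sigma (level x) n.*2.+1 w) +
       2^-1 *: (sigma (coarseY T mu sigma (level x) n w) *m (lD (level x) n.*2 w - lD (level x) n.*2.+1 w)).
    have alg (u q z a b : 'cV[R]_d) : u - 2^-1 *: (q + (q + z + (a + b))) =
        (u - (q + 2^-1 *: z + a)) + 2^-1 *: (a - b).
      by apply/matrixP => i i'; rewrite !mxE; field.
    have -> : coarseY T mu sigma (level x) n.+1 w = coarseY T mu sigma (level x) n w +
        tame mu (T / (lN (level x))%:R) (coarseY T mu sigma (level x) n w) +
        (sigma (coarseY T mu sigma (level x) n w) *m lD (level x) n.*2 w +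
         sigma (coarseY T mu sigma (level x) n w) *m lD (level x) n.*2.+1 w).
      by rewrite /coarseY /= /pairsum mulmxDr.
    by rewrite [LHS]alg -midY_odd -mulmxBr.
  apply: le_trans (ler_enormD _ _) _; apply: lerD; first by apply: be.
  rewrite enormZ ger0_norm ?invr_ge0//.
  have h1 := enorm_mulmx (sigma (coarseY T mu sigma (level x) n w)) (lD (level x) n.*2 w - lD (level x) n.*2.+1 w).
  have h2 : enorm (lD (level x) n.*2 w - lD (level x) n.*2.+1 w) <= 2 * max_incs x w.
    apply: le_trans (ler_enormB _ _) _; have := bD n.*2; have := bD n.*2.+1.
    by rewrite ltn_Sdouble ltn_double nN => /(_ isT) ? /(_ isT) ?; lra.
  have h3 : enorm (sigma (coarseY T mu sigma (level x) n w)) <= K * (1 + max_coarse T mu sigma (level x) w).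
    by apply: le_trans (gsig _) _; rewrite ler_wpM2l// lerD2l; apply: bc; exact: ltnW.
  have := ler_pM (enorm_ge0 _) (enorm_ge0 _) h3 h2.
  by move: h1; lra.
rewrite -{}j2 in jN *; rewrite refine_even -midY_even.
apply: le_trans (be _ jN) _; rewrite lerDl mulr_ge0// mulr_ge0// addr_ge0//.
Qed.

Definition level_diff (x : nat * nat) w :=
  f (path (2 ^ x.1).*2 x.1.+1 x.2 w) - f (path (2 ^ x.1) x.1.+1 x.2 w).

Lemma OL_level_diff : OL P leta' 1 level_diff.
Proof.
have oFi := OL_sub le_eta (OL_max_fine P T0 K0 hmu hsig gmu gsig C0 Cx0).
have oCo := OL_sub le_eta (OL_max_coarse P T0 K0 hmu hsig gmu gsig C0 Cx0).
have e01 := leta'01.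
have oR := OL_M e01 (OL_poly e01 (3 * c) (Num.truncn c).+1 (OL_D oFi oCo)) OL_path_gap.
have N0 (x : nat * nat) : (0 < 2 ^ x.1)%N by rewrite expn_gt0.
apply: (OL_dom _ _ oR) => [x|x w].
  by apply: (LGB sM); apply: LG_path; rewrite ?double_gt0.
have N20 : (0 < (2 ^ x.1).*2)%N by rewrite double_gt0.
rewrite /= addrA; apply: (functional_boundP T0 c0 hf).
- exact: interp_continuous.
- exact: interp_continuous.
- move=> t tT; rewrite path_fine; apply: interp_bound => // n nN.
  exact: (le_runmax (fun n w => enorm (fineY T mu sigma (level x) n w))).
- by move=> t tT; rewrite path_coarse; apply: interp_bound => // n; exact: coarse_max.
- by move=> t; exact: path_gapP.
Qed.

Hypotheses (lawxi : forall l j B, borel_sets B -> P (xi l j @^-1` B) = P (xi 0%N 0%N @^-1` B))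
  (prodW : forall l n A, (forall j, process_sigma T (W l j) (A j)) ->
     P (\bigcap_(j in `I_n) A j) = (\prod_(j < n) P (A j))%E)
  (prodxi : forall l n A, (forall j, preimage_sigma (xi l j) (A j)) ->
     P (\bigcap_(j in `I_n) A j) = (\prod_(j < n) P (A j))%E).
Local Notation copyw N l j := (copy_of T N (xi l j) (W l j)).

Let bxi l j : borel_measurable (F 0) (xi l j).
Proof.
have [sF _] := hF; have [sF0 _] := sF 0 ltac:(by rewrite lexx ltW).
by apply/(borel_measurable_entries _ sF0) => a b; exact: LG_msr (hxi l j a b).
Qed.

Lemma msr_gen (E : pointedType) (S : set (set E)) (g : E -> R) : msr <<s S >> g -> msr S g.
Proof.
move=> mg B0 B mB; have := mg measurableT B mB; rewrite /measurable /= sigma_algebra_id//.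
Qed.

Section copies.
Variables (N : nat) (g : copy R d m -> R).
Hypotheses (N0 : (0 < N)%N) (mg : msr <<s @copy_sets R d m N >> g).

Lemma Ex_copy l j (h : R -> R) : continuous h ->
  Ex P (fun w => h (g (copyw N l j w))) = Ex P (fun w => h (g (copyw N 0 0 w))).
Proof.
move=> ch; have mhg : msr (@copy_sets R d m N) (h \o g).
  apply: (@measurableT_comp _ _ _ _ R R h); last exact: msr_gen.
  exact: continuous_measurable_fun.
have [] // := @law_unique R disp Omega P (copy R d m) (@copy_sets R d m N) (copyw N l j)
  (copyw N 0 0) (@copy_setsI R d m N) (@copy_setsT R d m N) _ _ _ (h \o g) mhg.
- by move=> S; exact: (copy_preimage hF T0 N0 (@bxi l j) (bW l j)).
- by move=> S; exact: (copy_preimage hF T0 N0 (@bxi 0 0) (bW 0 0)).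
- by move=> S; apply: (copy_law hF T0 N0) => // B hB; exact: lawxi.
Qed.

Lemma copy_average l (Cn : nat -> R) (v : R) (e : R) q M : (0 < M)%N -> 0 < v ->
  (forall r, 0 <= Cn r) -> (forall j, LG P measurable (fun w => g (copyw N l j w))) ->
  e = Ex P (fun w => g (copyw N 0 0 w)) ->
  (forall j r, Ex P (fun w => (g (copyw N l j w) - e) ^+ (2 * r)) <= Cn r * v ^+ r) ->
  Ex P (fun w => (M%:R^-1 * \sum_(j < M) g (copyw N l j w) - e) ^+ (2 * q.+1)) <=
  expR (step_cst Cn q.+1) * step_cst Cn q.+1 * (v / M%:R) ^+ q.+1.
Proof.
move=> M0 v0 Cn0 hg eE mom; have Mr : 0 < M%:R :> R by rewrite ltr0n.
have sH n := @copy_gen_subalg _ _ _ _ _ _ hF T0 d m N N0 (xi l) (W l) (bW l) (@bxi l) n.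
have sG n := @copy_past_subalg _ _ _ _ _ _ hF T0 d m N N0 (xi l) (W l) (bW l) (@bxi l) n.
have cT := copy_sigmaT T N (xi l) (W l).
have hZ n : LG P <<s copy_sigma T N (xi l) (W l) n >> (fun w => g (copyw N l n w) - e).
  apply: (LGB (sH n)); last exact: LG_cst.
  split; last by case: (hg n).
  exact: (msr_copy (xi := xi l) (W := W l) (k := n) (msr_gen mg)).
have EZ n : Ex P (fun w => g (copyw N l n w) - e) = 0.
  rewrite (ExB sM); [|exact: hg|exact: LG_cst].
  rewrite (Ex_cst P e) eE; have := @Ex_copy l n id (fun x => cvg_id) => /= ->.
  exact: subrr.
have HG n : <<s copy_sigma T N (xi l) (W l) n >> `<=` copy_past T N (xi l) (W l) n.+1.
  by apply: (sub_past cT); exact: ltnSn.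
have GS n : copy_past T N (xi l) (W l) n `<=` copy_past T N (xi l) (W l) n.+1.
  exact: (past_sub cT).
have GH n := @copy_past_indep _ _ _ _ _ _ hF T0 d m N N0 (xi l) (W l) (bW l) (@bxi l) (@prodW l) (@prodxi l) n.
have := @indep_sum_moment R disp Omega P M _ _ (fun n w => g (copyw N l n w) - e) Cn v
  v0 Cn0 sG sH GS HG GH hZ EZ mom q M0.
set A := expR _ * _ => H.
have Mn : M%:R != 0 :> R by rewrite gt_eqF.
have E w : (M%:R^-1 * \sum_(j < M) g (copyw N l j w) - e) ^+ (2 * q.+1) =
    (M%:R ^+ (2 * q.+1))^-1 * (\sum_(j < M) (g (copyw N l j w) - e)) ^+ (2 * q.+1).
  rewrite -exprVn -exprMn; congr (_ ^+ _).
  by rewrite big_split /= sumr_const card_ord mulrDr -[- e *+ M]mulr_natr mulrCA mulVf ?mulr1.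
under eq_Ex do rewrite E.
rewrite (ExZ sM); last first.
  apply: LG_pow; apply: (LG_sum sM) => j _; apply: (LGB sM) => //; exact: LG_cst.
rewrite ler_pdivrMl ?exprn_gt0//; apply: le_trans H _.
rewrite le_eqVlt; apply/orP; left; apply/eqP.
rewrite mulrCA; congr (_ * _); rewrite exprM -exprMn; congr (_ ^+ _).
by field.
Qed.

End copies.

Definition value N l j w := f (interp T N (copy_nodes T mu sigma N (copyw N l j w))).

(** Both paths of a level difference are functions of one copy on the fine grid, which makes
    differences of distinct copies independent and identically distributed. *)
Definition level_fun N (e : copy R d m) :=
  f (interp T N.*2 (copy_nodes T mu sigma N.*2 e)) - f (interp T N (copy_coarse T mu sigma N e)).

Lemma level_funE l j w : level_diff (l, j) w =
  level_fun (2 ^ l) (copyw (2 ^ l).*2 l.+1 j w).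
Proof. by rewrite /level_fun copy_coarseE// expn_gt0. Qed.

Let LGv N l j : (0 < N)%N -> LG P measurable (value N l j).
Proof. exact: LG_path. Qed.

Let msrv N : (0 < N)%N -> msr <<s @copy_sets R d m N >> (fun e => f (interp T N (copy_nodes T mu sigma N e))).
Proof. exact: msr_path_functional. Qed.

Let msrl N : (0 < N)%N -> msr <<s @copy_sets R d m N.*2 >> (level_fun N).
Proof.
move=> N0; apply: measurable_funB; first by apply: msrv; rewrite double_gt0.
exact: msr_coarse_functional.
Qed.

Lemma Ex_value N l j : (0 < N)%N -> Ex P (value N l j) = Ex P (value N 0 0).
Proof. by move=> N0; exact: (Ex_copy N0 (msrv N0) l j (fun x => cvg_id)). Qed.

Definition level_mean l := Ex P (value (2 ^ l).*2 0 0) - Ex P (value (2 ^ l) 0 0).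

Lemma Ex_level_diff l j : Ex P (level_diff (l, j)) = level_mean l.
Proof.
have N0 : (0 < 2 ^ l)%N by rewrite expn_gt0.
have N20 : (0 < (2 ^ l).*2)%N by rewrite double_gt0.
transitivity (Ex P (value (2 ^ l).*2 l.+1 j) - Ex P (value (2 ^ l) l.+1 j)).
  exact: (ExB sM (LGv l.+1 j N20) (LGv l.+1 j N0)).
by rewrite (Ex_value l.+1 j N0) (Ex_value l.+1 j N20).
Qed.

Definition level_avg l M w := M%:R^-1 * \sum_(j < M) level_diff (l, nat_of_ord j) w.
Definition base_avg M w := M%:R^-1 * \sum_(j < M) value 1 0 j w.

Let LGl l j : LG P measurable (level_diff (l, j)).
Proof. by have [h _] := OL_level_diff. Qed.

Lemma level_avg_moment q : exists2 C, 0 <= C & forall l M, (0 < M)%N ->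
  Ex P (fun w => (level_avg l M w - level_mean l) ^+ (2 * q.+1)) <=
  C * (leta' (l, 0%N) / M%:R) ^+ q.+1.
Proof.
have := OL_center leta'01 (OL_level_diff).
move=> [_ H]; have /choice[Cn HCn] : forall r, exists Cr : R, 0 <= Cr /\ forall x,
    Ex P (fun w => (level_diff x w - Ex P (level_diff x)) ^+ (2 * r))
    <= Cr * leta' x ^+ (1 * r).
  by move=> r; have [Cr Cr0 h] := H r; exists Cr.
have Cn0 r : 0 <= Cn r by case: (HCn r).
exists (expR (step_cst Cn q.+1) * step_cst Cn q.+1).
  by rewrite mulr_ge0 ?expR_ge0// /step_cst addr_ge0 ?mulr_ge0 ?exprn_ge0 ?addr_ge0.
move=> l M M0; have N0 : (0 < 2 ^ l)%N by rewrite expn_gt0.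
have N20 : (0 < (2 ^ l).*2)%N by rewrite double_gt0.
have v0 : 0 < leta' (l, 0%N) by rewrite divr_gt0 ?ltr0n.
have Eg j : (fun w => level_fun (2 ^ l) (copyw (2 ^ l).*2 l.+1 j w)) = level_diff (l, j).
  by apply/funext => w; rewrite level_funE.
have eE : level_mean l = Ex P (fun w => level_fun (2 ^ l) (copyw (2 ^ l).*2 0 0 w)).
  have := @Ex_copy _ _ N20 (msrl N0) l.+1 0%N id (fun x => cvg_id) => /= <-.
  by rewrite Eg Ex_level_diff.
have hg j : LG P measurable (fun w => level_fun (2 ^ l) (copyw (2 ^ l).*2 l.+1 j w)) by rewrite Eg.
have hm j r : Ex P (fun w => (level_fun (2 ^ l) (copyw (2 ^ l).*2 l.+1 j w) - level_mean l) ^+ (2 * r))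
    <= Cn r * leta' (l, 0%N) ^+ r.
  have [_ /(_ (l, j))] := HCn r; rewrite mul1n Ex_level_diff.
  by under eq_Ex do rewrite level_funE.
have H2 := @copy_average _ _ N20 (msrl N0) l.+1 Cn _ _ q M M0 v0 Cn0 hg eE hm.
apply: le_trans H2; rewrite le_eqVlt; apply/orP; left; apply/eqP; apply: eq_Ex => w.
rewrite /level_avg; congr ((_ * _ - _) ^+ _).
by apply: eq_bigr => j _; rewrite level_funE.
Qed.

Lemma base_avg_moment q : exists2 C, 0 <= C & forall M, (0 < M)%N ->
  Ex P (fun w => (base_avg M w - Ex P (value 1 0 0)) ^+ (2 * q.+1)) <= C * (1 / M%:R) ^+ q.+1.
Proof.
pose Cn r := Ex P (fun w => (value 1 0 0 w - Ex P (value 1 0 0)) ^+ (2 * r)).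
have Cn0 r : 0 <= Cn r by apply: Ex_ge0 => w; rewrite exprM exprn_ge0// sqr_ge0.
exists (expR (step_cst Cn q.+1) * step_cst Cn q.+1).
  by rewrite mulr_ge0 ?expR_ge0// /step_cst addr_ge0 ?mulr_ge0 ?exprn_ge0 ?addr_ge0.
move=> M M0; apply: (@copy_average 1 _ isT (msrv (ltn0Sn 0)) 0 Cn 1 _ q M M0 ltr01 Cn0) => //.
- by move=> j; exact: LGv.
- move=> j r; rewrite expr1n mulr1 le_eqVlt; apply/orP; left; apply/eqP.
  apply: (@Ex_copy 1 _ isT (msrv (ltn0Sn 0)) 0 j (fun x => (x - Ex P (value 1 0 0)) ^+ (2 * r))).
  move=> x; apply: (@continuous_comp _ _ _ (fun x : R => x - Ex P (value 1 0 0)) (fun y => y ^+ (2 * r))).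
    by apply: cvgB; [exact: cvg_id|exact: cvg_cst].
  exact: exprn_continuous.
Qed.

(** The estimator for N = 2^n, with copies and difference levels numbered from 0; [level_avg l]
    compares 2^l with 2^(l+1) steps. *)
Definition estimate n w := base_avg (2 ^ n) w + \sum_(l < n) level_avg l (2 ^ (n - l.+1)) w.

Lemma LG_estimate n : LG P measurable (estimate n).
Proof.
apply: (LGD sM).
  by apply: (LGZ sM); apply: (LG_sum sM) => j _; exact: LGv.
by apply: (LG_sum sM) => l _; apply: (LGZ sM); apply: (LG_sum sM) => j _; exact: LGl.
Qed.

Lemma value_telescope n : Ex P (value (2 ^ n) 0 0) = Ex P (value 1 0 0) + \sum_(l < n) level_mean l.
Proof.
elim: n => [|n IH]; first by rewrite big_ord0 addr0 expn0.
by rewrite big_ord_recr /= addrA -IH /level_mean expnS mul2n addrC subrK.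
Qed.

(** The error has n + 2 parts: the bias, the base level and n differences. On level l the squared
    rate (l+2)/2^(l+1) divided by the 2^(n-l-1) copies is (l+2)/2^n, so each part has square of
    order (n+1)/2^n. The power of a sum of n + 2 terms contributes (n+1)^2 more, hence the cube. *)
Lemma estimate_moment e b : 0 <= b ->
  (forall n, (e - Ex P (value (2 ^ n) 0 0)) ^+ 2 <= b * (n.+1%:R / 2 ^+ n)) ->
  forall q, exists2 C, 0 <= C & forall n,
    Ex P (fun w => (e - estimate n w) ^+ (2 * q.+1)) <= C * (n.+1%:R ^+ 3 / 2 ^+ n) ^+ q.+1.
Proof.
move=> b0 bias q; have [C1 C10 H1] := level_avg_moment q; have [C2 C20 H2] := base_avg_moment q.
pose Cm := b ^+ q.+1 + C2 + C1.
exists (4 ^+ q.+1 * Cm); first by rewrite mulr_ge0 ?exprn_ge0// !addr_ge0 ?exprn_ge0.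
move=> n; pose u : R := n.+1%:R / 2 ^+ n.
have p2 : 0 < 2 ^+ n :> R by exact: exprn_gt0.
have u0 : 0 <= u by rewrite divr_ge0// ltW.
pose t (i : nat) w : R := match i with
  | 0 => e - Ex P (value (2 ^ n) 0 0)
  | 1 => - (base_avg (2 ^ n) w - Ex P (value 1 0 0))
  | l.+2 => - (level_avg l (2 ^ (n - l.+1)) w - level_mean l) end.
have tE w : e - estimate n w = \sum_(i < n.+2) t i w.
  rewrite !big_ord_recl /= /t /bump /= sumrN big_split /= sumrN value_telescope /estimate.
  by ring.
have ht i : LG P measurable (t i).
  case: i => [|[|l]]; first exact: LG_cst.
    apply: (LGN sM); apply: (LGB sM); last exact: LG_cst.
    by apply: (LGZ sM); apply: (LG_sum sM) => j _; exact: LGv.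
  apply: (LGN sM); apply: (LGB sM); last exact: LG_cst.
  by apply: (LGZ sM); apply: (LG_sum sM) => j _; exact: LGl.
have mt i : (i < n.+2)%N -> Ex P (fun w => t i w ^+ (2 * q.+1)) <= Cm * u ^+ q.+1.
  have sqN (x : R) : (- x) ^+ (2 * q.+1) = x ^+ (2 * q.+1) by rewrite !exprM sqrrN.
  case: i => [|[|l]] ln /=.
  - rewrite (Ex_cst P ((e - Ex P (value (2 ^ n) 0 0)) ^+ (2 * q.+1))) exprM.
    apply: (@le_trans _ _ ((b * u) ^+ q.+1)).
      by rewrite lerXn2r ?nnegrE ?sqr_ge0 ?mulr_ge0//; exact: bias.
    by rewrite exprMn ler_wpM2r ?exprn_ge0// /Cm -addrA lerDl addr_ge0.
  - under eq_Ex do rewrite sqN.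
    apply: le_trans (H2 _ _) _; first by rewrite expn_gt0.
    have h1 : 0 <= (1 / (2 ^ n)%:R : R) ^+ q.+1 by rewrite exprn_ge0// divr_ge0.
    have h2 : C2 <= Cm by rewrite /Cm -addrA addrCA lerDl addr_ge0// exprn_ge0.
    apply: ler_pM => //; rewrite lerXn2r ?nnegrE ?divr_ge0// natrX /u ler_pM2r ?invr_gt0//.
    by rewrite ler1n.
  - under eq_Ex do rewrite sqN.
    have ln' : (l < n)%N by [].
    apply: le_trans (H1 _ _ _) _; first by rewrite expn_gt0.
    have h2 : C1 <= Cm by rewrite /Cm lerDr addr_ge0// exprn_ge0.
    have e2 : leta' (l, 0%N) / (2 ^ (n - l.+1))%:R = l.+2%:R / 2 ^+ n.
      rewrite /leta' /= -mulrA -invfM -natrM -mul2n -expnS -expnD subnKC//.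
      by rewrite natrX.
    have h1 : 0 <= (l.+2%:R / 2 ^+ n : R) by rewrite divr_ge0// ltW.
    have h3 := exprn_ge0 q.+1 h1.
    rewrite e2; apply: ler_pM => //.
    rewrite lerXn2r ?nnegrE// /u ler_pM2r ?invr_gt0// ler_nat.
    by rewrite ltnS.
have E2 : ((2 * q).+2 = 2 * q.+1)%N by rewrite mulnS.
have hsum : LG P measurable (fun w => n.+2%:R ^+ (2 * q).+1 * \sum_(i < n.+2) t i w ^+ (2 * q.+1)).
  by apply: (LGZ sM); apply: (LG_sum sM) => i _; exact: LG_pow.
apply: (@le_trans _ _ (Ex P (fun w => n.+2%:R ^+ (2 * q).+1 * \sum_(i < n.+2) t i w ^+ (2 * q.+1)))).
  apply: (Ex_le sM) => //.
    by apply: LG_pow; apply: (LGB sM); [exact: LG_cst|exact: LG_estimate].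
  move=> w; rewrite tE even_pow_norm.
  apply: (@le_trans _ _ ((\sum_(i < n.+2) `|t i w|) ^+ (2 * q.+1))).
    by rewrite lerXn2r ?nnegrE ?sumr_ge0// ler_norm_sum.
  rewrite -[X in _ ^+ X <= _]E2.
  apply: le_trans (pow_sum_le _ _ (fun i => normr_ge0 (t i w))) _.
  rewrite ler_wpM2l ?exprn_ge0//; apply: ler_sum => i _.
  by rewrite E2 -even_pow_norm.
rewrite (ExZ sM); last by apply: (LG_sum sM) => i _; exact: LG_pow.
rewrite (Ex_sum sM) => [|i _]; last exact: LG_pow.
apply: (@le_trans _ _ (n.+2%:R ^+ (2 * q).+1 * \sum_(i < n.+2) Cm * u ^+ q.+1)).
  by rewrite ler_wpM2l ?exprn_ge0//; apply: ler_sum => i _; exact: mt.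
rewrite sumr_const card_ord -[Cm * _ *+ n.+2]mulr_natl mulrA -exprSr.
have -> : n.+1%:R ^+ 3 / 2 ^+ n = n.+1%:R ^+ 2 * u :> R by rewrite /u mulrA -exprSr.
have Cm0 : 0 <= Cm by rewrite !addr_ge0 ?exprn_ge0.
have h : n.+2%:R <= 2 * n.+1%:R :> R by rewrite -natrM ler_nat mul2n -addnn addSn ltnS leq_addl.
have key : n.+2%:R ^+ (2 * q.+1) <= 4 ^+ q.+1 * (n.+1%:R ^+ 2) ^+ q.+1 :> R.
  rewrite exprM -exprMn lerXn2r ?nnegrE ?mulr_ge0 ?sqr_ge0//.
  have n0 : 0 <= n.+2%:R :> R by [].
  have := ler_pM n0 n0 h h; rewrite !expr2; lra.
have -> : 4 ^+ q.+1 * Cm * (n.+1%:R ^+ 2 * u) ^+ q.+1 = 4 ^+ q.+1 * (n.+1%:R ^+ 2) ^+ q.+1 * (Cm * u ^+ q.+1).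
  by rewrite exprMn; ring.
by rewrite E2 ler_wpM2r// mulr_ge0// exprn_ge0.
Qed.

End Multilevel.

(** * Step integrals and Lenglart's inequality *)

Lemma measurable_enorm (R : realType) d' (E : measurableType d') n k (Y : E -> 'M[R]_(n, k)) :
  (forall i j, measurable_fun setT (fun x => Y x i j)) -> measurable_fun setT (fun x => enorm (Y x)).
Proof.
move=> mY; apply/msr_measurable; apply: msr_enorm => [|i j]; first exact: subalg_measurable.
by apply: (msr_measurable _).1; exact: mY.
Qed.

Section StepIntegral.
Context (R : realType) (disp : measure_display) (Omega : measurableType disp)
  (P : probability Omega R).
Variables (T : R) (F : R -> set (set Omega)) (d m : nat) (W : R -> Omega -> 'cV[R]_m).
Hypotheses (T0 : 0 < T) (hF : filtration T F) (bW : standard_brownian P T F W).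
Let sM := @subalg_measurable disp Omega.

Variables (I : finType) (a b : I -> R) (v : I -> Omega -> 'M[R]_(d, m)).

(** Any finite index type is allowed and the intervals may overlap, so that the difference of two
    step processes is again one, indexed by a sum type. *)
Definition sproc (s : R) (w : Omega) : 'M[R]_(d, m) :=
  \sum_i \1_(`]a i, b i]) s *: v i w.

Definition sint (t : R) (w : Omega) : 'cV[R]_d :=
  \sum_i v i w *m (W (Num.min (b i) t) w - W (Num.min (a i) t) w).

Lemma sproc_measurable w k l :
  measurable_fun setT (fun s : measurableTypeR R => sproc s w k l).
Proof.
have h x : measurable_fun setT (fun s : measurableTypeR R => \1_(`]a x, b x]) s * v x w k l : R).
  by apply: measurable_funM; [exact: measurable_indic|exact: measurable_cst].
have -> : (fun s => sproc s w k l) = (fun s => \sum_x \1_(`]a x, b x]) s * v x w k l).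
  by apply/funext => s; rewrite /sproc summxE; apply: eq_bigr => x _; rewrite mxE.
apply: measurable_sum => x; exact: h.
Qed.

Hypotheses (a0 : forall i, 0 <= a i) (ab : forall i, a i <= b i) (bT : forall i, b i <= T)
  (mv : forall i j l, msr (F (a i)) (fun w => v i w j l)).

Section grid.
Variables (M : nat) (g : nat -> R).
Hypotheses (gS : forall j, (j < M)%N -> g j < g j.+1) (g0 : 0 <= g 0%N) (gT : g M <= T)
  (ga : forall i, exists2 j, (j <= M)%N & a i = g j)
  (gb : forall i, exists2 j, (j <= M)%N & b i = g j).

Lemma grid_mono i j : (i <= j)%N -> (j <= M)%N -> g i <= g j.
Proof.
elim: j => [|j IH]; first by rewrite leqn0 => /eqP ->.
rewrite leq_eqVlt => /orP[/eqP -> //|]; rewrite ltnS => ij jN.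
by apply: le_trans (IH ij (ltnW jN)) _; exact/ltW/gS.
Qed.

Let gle i j : (i <= M)%N -> (j <= M)%N -> (g i <= g j) = (i <= j)%N.
Proof.
move=> iM jM; have [ij|ji] := leqP i j; first by rewrite grid_mono.
apply/negbTE; rewrite -ltNge; apply: lt_le_trans (gS _) (grid_mono ji iM).
exact: leq_trans ji iM.
Qed.

Let glt i j : (i <= M)%N -> (j <= M)%N -> (g i < g j) = (i < j)%N.
Proof. by move=> iM jM; rewrite ltNge gle// -ltnNge. Qed.

Let in_cell i j : (j < M)%N ->
  \1_(`]a i, b i]) (g j.+1) = ((a i <= g j) && (g j.+1 <= b i))%:R :> R.
Proof.
move=> jM; rewrite indicE; congr (_%:R).
have [ja jaM ->] := ga i; have [jb jbM ->] := gb i.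
rewrite mem_setE in_itv /= glt// ltnS gle//; exact: ltnW.
Qed.

(** On a grid containing all end points the integral is a discrete martingale transform. The
    coefficient of a cell is the value at its right end, because the intervals are open on the
    left. *)
Lemma sint_grid p w : (p <= M)%N ->
  sint (g p) w = \sum_(j < p) sproc (g j.+1) w *m (W (g j.+1) w - W (g j) w).
Proof.
elim: p => [_|p IH pM].
  rewrite big_ord0 /sint big1// => i _; have [ja jaM ->] := ga i; have [jb jbM ->] := gb i.
  by rewrite !min_r ?gle// subrr mulmx0.
rewrite big_ord_recr /= -IH; last exact: ltnW.
rewrite /sint /sproc mulmx_suml -big_split; apply: eq_bigr => i _ /=.
rewrite in_cell// -scalemxAl; have [ja jaM aE] := ga i; have [jb jbM bE] := gb i.
have jab : (ja <= jb)%N by rewrite -gle// -aE -bE.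
rewrite {}aE {}bE !gle// ?(ltnW pM)//.
have [pb|bp] := ltnP p jb; have [ap|pa] := leqP ja p; rewrite /= ?scale0r ?scale1r ?addr0.
- have -> : Num.min (g jb) (g p.+1) = g p.+1 by rewrite min_r// gle.
  have -> : Num.min (g ja) (g p.+1) = g ja by rewrite min_l// gle// leqW.
  have -> : Num.min (g jb) (g p) = g p by rewrite min_r// gle// ltnW.
  have -> : Num.min (g ja) (g p) = g ja by rewrite min_l// gle// ltnW.
  by rewrite -mulmxDr [W (g p) w - _ + _]addrC addrA subrK.
- have -> : Num.min (g jb) (g p.+1) = g p.+1 by rewrite min_r// gle.
  have -> : Num.min (g ja) (g p.+1) = g p.+1 by rewrite min_r// gle.
  have -> : Num.min (g jb) (g p) = g p by rewrite min_r// gle// ltnW.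
  have -> : Num.min (g ja) (g p) = g p by rewrite min_r// gle// ltnW.
  by rewrite !subrr !mulmx0.
- have -> : Num.min (g jb) (g p.+1) = g jb by rewrite min_l// gle// leqW.
  have -> : Num.min (g ja) (g p.+1) = g ja by rewrite min_l// gle// leqW.
  have -> : Num.min (g jb) (g p) = g jb by rewrite min_l// gle// ltnW.
  by have -> : Num.min (g ja) (g p) = g ja by rewrite min_l// gle// ltnW.
- by have := leq_trans pa (leq_trans jab bp); rewrite ltnn.
Qed.

Let eta j : R := if (j < M)%N then (g j.+1 - g j) / T else 0.

Let eta_ge0 j : 0 <= eta j.
Proof. by rewrite /eta; case: ifP => // jM; rewrite divr_ge0 ?subr_ge0 ?ltW ?gS. Qed.

Let eta01 j : (j < M)%N -> 0 < eta j <= 1.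
Proof.
move=> jM; rewrite /eta jM divr_gt0 ?subr_gt0 ?gS//= ler_pdivrMr// mul1r.
by have := grid_mono jM (leqnn M); have := grid_mono (leq0n j) (ltnW jM); move: g0 gT; lra.
Qed.

Let eta_sum : \sum_(j < M) eta j <= 1.
Proof.
have -> : \sum_(j < M) eta j = (g M - g 0%N) / T.
  rewrite -(telescope_sumr g (leq0n M)) big_mkord mulr_suml; apply: eq_bigr => j _.
  by rewrite /eta ltn_ord.
by rewrite ler_pdivrMr// mul1r; move: g0 gT; lra.
Qed.

Let gb0 j : (j <= M)%N -> 0 <= g j <= T.
Proof.
move=> jM; rewrite (le_trans g0 (grid_mono (leq0n j) jM)).
exact: le_trans (grid_mono jM (leqnn M)) gT.
Qed.

Let sF j : (j <= M)%N -> subalg (F (g j)).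
Proof. by move=> jM; have [h _] := hF; apply: h; exact: gb0. Qed.

Let Kj j w := sproc (g j.+1) w.

Let mK j i l : (j < M)%N -> msr (F (g j)) (fun w => Kj j w i l).
Proof.
move=> jM; rewrite /Kj /sproc; under eq_fun do rewrite summxE.
have h x : msr (F (g j)) (fun w => (\1_(`]a x, b x]) (g j.+1) *: v x w) i l).
  under eq_fun do rewrite mxE in_cell//.
  have [ax|_] := boolP (a x <= g j); last first.
    by under eq_fun do rewrite /= mul0r; exact: measurable_cst.
  apply: measurable_funM; first exact: measurable_cst.
  have hx := @mv x i l; apply: msr_sub hx; have [_ mF] := hF.
  by have /andP[_ gjT] := gb0 (ltnW jM); apply: mF.
elim: (index_enum _) => [|x r IH]; first by under eq_fun do rewrite big_nil; exact: measurable_cst.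
by under eq_fun do rewrite big_cons; apply: measurable_funD; [exact: h|exact: IH].
Qed.

Variables (delta : R).
Hypothesis delta0 : 0 <= delta.

Let cum j w := \sum_(i < j.+1) eta i * enorm (Kj i w) ^+ 2.

Let cum_le i j w : (i <= j)%N -> cum i w <= cum j w.
Proof.
move=> ij; rewrite /cum -(big_mkord xpredT (fun i => eta i * enorm (Kj i w) ^+ 2)).
rewrite -(big_mkord xpredT (fun i => eta i * enorm (Kj i w) ^+ 2)).
rewrite [leRHS](big_cat_nat (n := i.+1)) ?ltnS//= lerDl sumr_ge0// => l _.
by rewrite mulr_ge0// sqr_ge0.
Qed.

Let mcum j : (j < M)%N -> msr (F (g j)) (cum j).
Proof.
move=> jM; rewrite /cum.
have : forall i : 'I_j.+1, msr (F (g j)) (fun w => eta i * enorm (Kj i w) ^+ 2).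
  move=> i; have ij : (i <= j)%N by rewrite -ltnS ltn_ord.
  have iM : (i < M)%N by exact: leq_ltn_trans jM.
  apply: measurable_funM; first exact: measurable_cst.
  apply: measurable_funX; apply: (msr_enorm (sF (ltnW jM))) => k l; have [_ mF] := hF.
  have /andP[gi0 _] := gb0 (ltnW iM); have /andP[_ gjT] := gb0 (ltnW jM).
  have hk := @mK i k l iM; apply: msr_sub hk; apply: mF => //; apply: grid_mono => //; exact: ltnW.
elim: (index_enum _) => [|x r IH] h; first by under eq_fun do rewrite big_nil; exact: measurable_cst.
by under eq_fun do rewrite big_cons; apply: measurable_funD; [exact: h|exact: IH].
Qed.

(** The integrand is switched off once its accumulated energy exceeds delta. The sum [cum j] already
    contains cell j, which is admissible because the coefficient there is known at the left end of
    the cell; this is what makes B bounded. *)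
Let B j w := (\1_[set w | cum j w <= delta] w : R) *: Kj j w.

Let B_bound j w : eta j * enorm (B j w) ^+ 2 <= delta.
Proof.
rewrite /B indicE; have [h|h] := pselect ([set w | cum j w <= delta] w); last first.
  by rewrite memNset// scale0r enorm0 expr0n mulr0.
rewrite mem_set// scale1r; apply: le_trans h; rewrite /cum big_ord_recr /= lerDr.
by apply: sumr_ge0 => i _; rewrite mulr_ge0// sqr_ge0.
Qed.

Let B_sum w : \sum_(j < M) eta j * enorm (B j w) ^+ 2 <= delta.
Proof.
suff H n : (n <= M)%N -> \sum_(j < n) eta j * enorm (B j w) ^+ 2 <= delta by exact: H.
elim: n => [|n IH] nM; first by rewrite big_ord0.
have [h|h] := pselect (cum n w <= delta); last first.
  rewrite big_ord_recr /= {2}/B indicE memNset// scale0r enorm0 expr0n mulr0 addr0.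
  by apply: IH; exact: ltnW.
apply: le_trans h; apply: ler_sum => j _; rewrite ler_wpM2l// /B indicE.
case: (_ \in _); rewrite ?scale1r// scale0r enorm0 expr0n.
by rewrite sqr_ge0.
Qed.

Let hB j : (j < M)%N -> VLG P (F (g j)) (B j).
Proof.
move=> jM; have sG := sF (ltnW jM); have /andP[e0 _] := eta01 jM.
apply: (VLG_dom sG (f := cst (Num.sqrt (delta / eta j)))).
- move=> i l; under eq_fun do rewrite mxE; apply: measurable_funM; last exact: mK.
  apply: (LG_msr (LG_indic P sG _)).
  have := mcum jM; move=> /(_ measurableT _ (measurable_itv `]-oo, delta])).
  rewrite setTI /measurable /= sigma_algebra_id; last by case: sG.
  by congr (F _ _); apply/seteqP; split => w /=; rewrite in_itv.
- exact: LG_cst.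
- move=> w /=; rewrite -[leLHS]ger0_norm ?enorm_ge0// -sqrtr_sqr ler_wsqrtr//.
  by rewrite ler_pdivlMr// mulrC; exact: B_bound.
Qed.

Let D j w := W (g j.+1) w - W (g j) w.

Let hD : chain P (bm_cst T m) M eta (fun j => F (g j)) D.
Proof.
move=> j jM; have /andP[gj0 _] := gb0 (ltnW jM); have /andP[_ gjT] := gb0 jM.
apply: (bm_incr hF bW) => //; first exact: gS.
by rewrite /eta jM mulrCA mulfV ?mulr1// gt_eqF.
Qed.

Definition lenglart_cst : R := 4 * expR (step_cst (bm_cst T m) 1) * step_cst (bm_cst T m) 1.

(** S is the maximum of the transform with the switched-off integrand, whose energy is at most delta
    surely. Where the energy of the given integrand stays below T delta nothing is switched off, so
    S dominates the integral at every node; the factor T undoes the normalisation of [eta]. *)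
Lemma lenglart_grid : exists S, [/\ LG P measurable S, Ex P (fun w => S w ^+ 2) <= lenglart_cst * delta &
  forall w, \sum_(j < M) (g j.+1 - g j) * enorm (sproc (g j.+1) w) ^+ 2 <= T * delta ->
    forall p, (p <= M)%N -> enorm (sint (g p) w) <= S w].
Proof.
have bc q : 0 <= bm_cst T m q by exact: bm_cst_ge0 (ltW T0).
have [S [hS S0 bS ES]] := mart_max hD (sF (leq0n M)) hB 0 eta01 eta_ge0 eta_sum bc.
have sc : 0 <= lenglart_cst.
  have s0 : 0 <= step_cst (bm_cst T m) 1.
    by rewrite /step_cst; repeat (apply: addr_ge0 || apply: mulr_ge0 || apply: exprn_ge0) => //.
  by rewrite /lenglart_cst mulr_ge0// mulr_ge0// expR_ge0.
exists S; split.
- by apply: LG_sub hS; case: (sF (leqnn M)).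
- apply: le_trans ES _; apply: ler_wpM2l => //; rewrite muln1.
  have hBM j : (j < M)%N -> LG P measurable (fun w => eta j * enorm (B j w) ^+ 2).
    move=> jM; have sG := sF (ltnW jM); apply: (LGZ sM); apply: LG_pow.
    by apply: LG_sub (LG_enorm sG (hB jM)); case: sG.
  have -> : \sum_(i < M) eta i * Ex P (fun w => enorm (B i w) ^+ 2) =
      Ex P (fun w => \sum_(i < M) eta i * enorm (B i w) ^+ 2).
    rewrite (Ex_sum sM) => [|i _]; last exact: hBM.
    apply: eq_bigr => i _; have sG := sF (ltnW (ltn_ord i)); rewrite (ExZ sM)//.
    by apply: LG_pow; apply: LG_sub (LG_enorm sG (hB (ltn_ord i))); case: sG.
  rewrite -[leRHS](Ex_cst P delta); apply: (Ex_le sM) => [||w]; last exact: B_sum.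
    by apply: (LG_sum sM) => i _; exact: hBM.
  exact: LG_cst.
- move=> w hw p pM.
  have cM j : (j < M)%N -> cum j w <= delta.
    move=> jM; rewrite -(ler_pM2l T0); apply: le_trans hw.
    apply: (@le_trans _ _ (T * cum M.-1 w)).
      by rewrite ler_pM2l//; apply: cum_le; rewrite -ltnS (ltn_predK jM).
    rewrite /cum (ltn_predK jM) mulr_sumr; apply: ler_sum => i _.
    by rewrite /eta ltn_ord mulrA [T * _]mulrC divfK// gt_eqF.
  rewrite sint_grid//; have := bS p w pM; rewrite expr1; apply: le_trans.
  rewrite /mart le_eqVlt; apply/orP; left; apply/eqP; congr enorm; apply: eq_bigr => j _.
  have jM : (j < M)%N by exact: leq_trans (ltn_ord j) pM.
  by rewrite /B indicE mem_set ?scale1r//; exact: cM.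
Qed.

(* The step process is constant on the cells of the grid. *)
Lemma sproc_cell_integral w :
  ((\sum_(j < M) (g j.+1 - g j) * enorm (sproc (g j.+1) w) ^+ 2)%:E <=
   \int[lebesgue_measure]_(s in `[0%R, T]) (enorm (sproc s w) ^+ 2)%:E)%E.
Proof.
pose h (j : 'I_M) (s : measurableTypeR R) : \bar R := (enorm (sproc (g j.+1) w) ^+ 2 * \1_(`]g j, g j.+1]) s)%:E.
have mh j : measurable_fun (`[0%R, T]%classic : set (measurableTypeR R)) (h j).
  by apply/measurable_EFinP; apply: measurable_funTS; apply: measurable_funM => //; exact: measurable_indic.
have h0 j s : (0 <= h j s)%E by rewrite lee_fin mulr_ge0 ?sqr_ge0// indicE; case: (_ \in _).
have -> : ((\sum_(j < M) (g j.+1 - g j) * enorm (sproc (g j.+1) w) ^+ 2)%:E =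
   \int[lebesgue_measure]_(s in `[0%R, T]) (\sum_(j < M) h j s)%E)%E.
  rewrite -sumEFin; apply/esym.
  apply: (etrans (@ge0_integral_sum _ _ R lebesgue_measure _ _ _ h mh (fun j s _ => h0 j s) (index_enum _))) => //.
  apply: eq_bigr => j _; apply/esym.
  have jM := ltn_ord j; have /andP[gj0 _] := gb0 (ltnW jM); have /andP[_ gjT] := gb0 jM.
  under eq_integral do rewrite /h EFinM.
  rewrite ge0_integralZl//; last 2 first.
  - by apply/measurable_EFinP; apply: measurable_funTS; exact: measurable_indic.
  - by rewrite lee_fin sqr_ge0.
  rewrite integral_indic// (_ : `]g j, g j.+1]%classic `&` `[0, T]%classic = `]g j, g j.+1]%classic).
    have L : (lebesgue_measure (`]g j, g j.+1]%classic : set R) = (g j.+1 - g j)%:E)%E.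
      by rewrite lebesgue_measure_itv /= lte_fin gS// EFinB.
    by rewrite EFinM muleC; congr (_ * _)%E; exact/esym/L.
  apply/seteqP; split => s /=; rewrite !in_itv /=; first by case.
  by move=> /andP[s1 s2]; rewrite s1 s2; split => //; apply/andP; split; lra.
have msp : measurable_fun setT (fun s : measurableTypeR R => enorm (sproc s w) ^+ 2).
  by apply: measurable_funX; apply: measurable_enorm => i l; exact: sproc_measurable.
apply: ge0_le_integral => //.
- by move=> s _; apply: sume_ge0.
- by apply: emeasurable_sum => j; exact: mh.
- by apply/measurable_EFinP; exact: measurable_funTS.
move=> s _; have [[j [jM sj]]|hN] := pselect (exists j, (j < M)%N /\ s \in `]g j, g j.+1]); last first.
  rewrite big1 ?lee_fin ?sqr_ge0// => j _; rewrite /h indicE memNset ?mulr0// => sj.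
  by apply: hN; exists j.
rewrite (bigD1 (Ordinal jM))//= big1 ?adde0.
  rewrite /h indicE mem_set// mulr1 lee_fin le_eqVlt; apply/orP; left; apply/eqP.
  congr (enorm _ ^+ 2); rewrite /sproc; apply: eq_bigr => i _; congr (_ *: _).
  rewrite in_cell// indicE; congr (_%:R); move: sj; rewrite in_itv /= => /andP[s1 s2].
  have [ja jaM aE] := ga i; have [jb jbM bE] := gb i.
  have h1 : (g ja < s) = (ja <= j)%N.
    apply/idP/idP => h1; first by rewrite -ltnS -glt//; exact: lt_le_trans s2.
    by apply: le_lt_trans s1; rewrite gle// ltnW.
  have h2 : (s <= g jb) = (j.+1 <= jb)%N.
    apply/idP/idP => h2; first by rewrite -glt ?(ltnW jM)//; exact: lt_le_trans h2.
    by apply: le_trans s2 _; rewrite gle.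
  by rewrite mem_setE in_itv /= aE bE h1 h2 !gle// ltnW.
move=> i ij; rewrite /h indicE memNset ?mulr0// /= in_itv /= => /andP[s1 s2].
move: sj; rewrite in_itv /= => /andP[s3 s4].
have iM := ltn_ord i.
have := lt_le_trans s1 s4; have := lt_le_trans s3 s2.
rewrite !glt// ?(ltnW jM) ?(ltnW iM)// !ltnS => ji ij'.
by move/eqP: ij; apply; apply/val_inj/eqP; rewrite /= eqn_leq ij' ji.
Qed.

End grid.

Lemma lenglart (ts : seq R) (delta : R) : 0 <= delta -> (forall t, t \in ts -> 0 <= t <= T) ->
  exists S, [/\ LG P measurable S, Ex P (fun w => S w ^+ 2) <= lenglart_cst * delta &
  forall w, (\int[lebesgue_measure]_(s in `[0%R, T]) (enorm (sproc s w) ^+ 2)%:E <= (T * delta)%:E)%E ->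
    forall t, t \in ts -> enorm (sint t w) <= S w].
Proof.
move=> delta0 tsT.
pose l := ts ++ [seq a i | i <- enum I] ++ [seq b i | i <- enum I].
(* All end points and all requested times; the added 0 makes the list nonempty. *)
pose s := sort <=%R (undup (0 :: l)).
have ms x : (x \in s) = (x \in 0 :: l) by rewrite mem_sort mem_undup.
have sT x : x \in s -> 0 <= x <= T.
  rewrite ms in_cons => /orP[/eqP ->|]; first by rewrite lexx ltW.
  rewrite !mem_cat => /or3P[|/mapP[i _ ->]|/mapP[i _ ->]]; first exact: tsT.
    by rewrite a0 (le_trans (ab i)).
  by rewrite (le_trans (a0 i) (ab i)) bT.
have ss : sorted <%R s by rewrite sort_lt_sorted undup_uniq.
have s0 : (0 < size s)%N by rewrite lt0n size_eq0; apply/eqP => sE; have := ms 0; rewrite sE mem_head.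
pose M := (size s).-1; have sM' : size s = M.+1 by rewrite prednK.
pose g j := nth T s j.
have gin j : (j <= M)%N -> g j \in s by move=> jM; rewrite mem_nth// sM'.
have gS j : (j < M)%N -> g j < g j.+1.
  by move=> jM; rewrite (lt_sorted_ltn_nth _ ss)// inE sM' ?ltnS// ltnW.
have gex x : x \in s -> exists2 j, (j <= M)%N & x = g j.
  move=> xs; exists (index x s); last by rewrite /g nth_index.
  by rewrite -ltnS -sM' index_mem.
have g0 : 0 <= g 0%N by have /andP[] := sT _ (gin 0%N (leq0n M)).
have gT : g M <= T by have /andP[] := sT _ (gin M (leqnn M)).
have ga i : exists2 j, (j <= M)%N & a i = g j.
  by apply: gex; rewrite ms in_cons !mem_cat map_f ?mem_enum ?orbT.
have gb i : exists2 j, (j <= M)%N & b i = g j.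
  by apply: gex; rewrite ms in_cons !mem_cat [X in _ || (_ || (_ || X))]map_f ?mem_enum ?orbT.
have [S [hS ES bS]] := lenglart_grid gS g0 gT ga gb delta0.
exists S; split => // w hw t tts.
have [p pM ->] : exists2 j, (j <= M)%N & t = g j by apply: gex; rewrite ms in_cons mem_cat tts orbT.
by apply: bS => //; rewrite -lee_fin; apply: le_trans hw; exact: sproc_cell_integral.
Qed.

End StepIntegral.

(** * Small events and moduli of continuity in probability *)

Section SmallEvents.
Context (R : realType) (disp : measure_display) (Omega : measurableType disp)
  (P : probability Omega R).
Let sM := @subalg_measurable disp Omega.

(* Outer probability at most [e]: no measurability of [A] is asked for. *)
Definition small (A : set Omega) (e : R) : Prop :=
  exists B, [/\ measurable B, A `<=` B & (P B <= e%:E)%E].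

Lemma small_sub A B e : A `<=` B -> small B e -> small A e.
Proof. by move=> AB [C [mC BC PC]]; exists C; split => //; exact: subset_trans BC. Qed.

Lemma small_le A e e' : e <= e' -> small A e -> small A e'.
Proof. by move=> ee [C [mC AC PC]]; exists C; split => //; apply: le_trans PC _; rewrite lee_fin. Qed.

Lemma smallU A B e e' : small A e -> small B e' -> small (A `|` B) (e + e').
Proof.
move=> [C [mC AC PC]] [D [mD BD PD]]; exists (C `|` D); split.
- exact: measurableU.
- exact: setUSS.
- by apply: le_trans (measureU2 _ _ _) _ => //; rewrite EFinD leeD.
Qed.

Lemma small_bigcup n (A : nat -> set Omega) e : 0 <= e -> (forall i, (i < n)%N -> small (A i) e) ->
  small [set w | exists2 i, (i < n)%N & A i w] (n%:R * e).
Proof.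
move=> e0; elim: n => [|n IH] hA.
  by exists set0; split => //; [move=> w []|rewrite measure0 mul0r].
have h := smallU (IH (fun i iN => hA i (ltnW iN))) (hA n (ltnSn n)).
rewrite -[n.+1%:R]natr1 mulrDl mul1r; apply: small_sub h => w [i].
by rewrite ltnS leq_eqVlt => /orP[/eqP ->|iN] Ai; [right|left; exists i].
Qed.

Lemma small_cvg (A : nat -> set Omega) e : (forall n, measurable (A n)) ->
  P (A n) @[n --> \oo] --> 0%E -> 0 < e -> exists N, forall n, (N <= n)%N -> small (A n) e.
Proof.
move=> mA /fine_cvgP[_ cA] e0; have /cvgrPdist_le /(_ _ e0) [N _ hN] := cA.
exists N => n nN; exists (A n); split => //; have := hN n nN; rewrite /= sub0r normrN => h.
rewrite -[leLHS]fineK ?fin_num_measure// lee_fin; exact: le_trans (ler_norm _) h.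
Qed.

Lemma small_markov1 (S : Omega -> R) t a : LG P measurable S -> (forall w, 0 <= S w) -> 0 < t ->
  Ex P S <= a -> small [set w | t <= S w] (a / t).
Proof.
move=> hS S0 t0 ES; have mA : measurable [set w | t <= S w].
  have mS := msr_measurable_fun sM (LG_msr hS).
  rewrite (_ : [set w | _] = setT `&` S @^-1` `[t, +oo[%classic); first exact: mS.
  by rewrite setTI; apply/seteqP; split => w; rewrite /= in_itv /= andbT.
exists [set w | t <= S w]; split => //; rewrite (EFin_Ex_indic P mA) lee_fin.
rewrite ler_pdivlMr// mulrC; apply: le_trans ES.
have hI := LG_indic P sM mA; rewrite -(ExZ sM _ hI); apply: (Ex_le sM) => //.
  by apply: (LGZ sM).
by move=> w; rewrite indicE; have [|_] := boolP (w \in _); rewrite ?inE /= ?mulr1 ?mulr0.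
Qed.

Lemma small_markov (S : Omega -> R) t c : LG P measurable S -> 0 < t ->
  Ex P (fun w => S w ^+ 2) <= c -> small [set w | t <= S w] (c / t ^+ 2).
Proof.
move=> hS t0 ES; have t2 : 0 < t ^+ 2 by rewrite exprn_gt0.
apply: small_sub (small_markov1 (LG_pow 2 hS) (fun w => sqr_ge0 _) t2 ES) => w /= tS.
by rewrite lerXn2r// nnegrE ?(ltW t0)// (le_trans (ltW t0)).
Qed.

Lemma small_ae (A : set Omega) : (\forall w \ae P, ~ A w) -> small A 0.
Proof.
by move=> [B [mB PB AB]]; exists B; split => //; [move=> w Aw; apply: AB => /= /(_ Aw)|rewrite PB].
Qed.

Lemma small_decr (A : nat -> set Omega) e : (forall n, measurable (A n)) ->
  (forall n, A n.+1 `<=` A n) -> (forall w, exists n, ~ A n w) -> 0 < e ->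
  exists N, forall n, (N <= n)%N -> small (A n) e.
Proof.
move=> mA dA A0 e0; apply: small_cvg => //.
have -> : 0%E = P (\bigcap_n A n).
  by rewrite (_ : \bigcap_n A n = set0) ?measure0//; apply/seteqP; split => // w h;
    have [n] := A0 w; apply; exact: h.
apply: nonincreasing_cvg_mu => //.
- by rewrite (le_lt_trans (probability_le1 _ _))// ltry.
- exact: bigcap_measurable.
- by apply/nonincreasing_seqP => n; exact/subsetPset/dA.
Qed.

Variables (T : R) (d : nat) (Z : R -> Omega -> 'cV[R]_d).
Hypotheses (T0 : 0 < T) (cZ : forall w, {within `[0, T], continuous (Z ^~ w)})
  (mZ : forall t i, 0 <= t <= T -> msr measurable (fun w => Z t w i 0)).

Let floor (n : nat) (s : R) : R := grid T n.+1 (Num.truncn (s * n.+1%:R / T)).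

Let floorP n s : 0 <= s <= T -> [/\ (Num.truncn (s * n.+1%:R / T) <= n.+1)%N,
  0 <= floor n s <= T & `|s - floor n s| <= T / n.+1%:R].
Proof.
move=> /andP[s0 sT]; have n0 : 0 < n.+1%:R :> R by rewrite ltr0n.
have x0 : 0 <= s * n.+1%:R / T by rewrite divr_ge0 ?mulr_ge0// ltW.
have /andP[h1 h2] := truncn_itv x0.
have kn : (Num.truncn (s * n.+1%:R / T) <= n.+1)%N.
  rewrite -(ler_nat R); apply: le_trans h1 _; rewrite ler_pdivrMr// mulrC ler_pM2l//.
split => //; first by apply: grid_bounds.
have le1 : floor n s <= s.
  by rewrite /floor /grid ler_pdivrMr// -ler_pdivlMr.
rewrite ger0_norm ?subr_ge0// lerBlDr /floor /grid -mulrDl ler_pdivlMr//.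
rewrite -[X in X + _]mul1r -mulrDl nat1r -ler_pdivrMr// ltW//.
Qed.

Let mlt s t e : 0 <= s <= T -> 0 <= t <= T -> measurable [set w | e < enorm (Z s w - Z t w)].
Proof.
move=> sT tT; have m : msr measurable (fun w => enorm (Z s w - Z t w)).
  apply: msr_enorm => // i j; rewrite ord1; under eq_fun do rewrite !mxE.
  by apply: measurable_funB; exact: mZ.
have := msr_measurable_fun sM m => {}m.
rewrite (_ : [set w | _] = setT `&` (fun w => enorm (Z s w - Z t w)) @^-1` `]e, +oo[%classic).
  exact: m.
by rewrite setTI; apply/seteqP; split => w; rewrite /= in_itv /= andbT.
Qed.

Definition mod_event (N : nat) (e : R) : set Omega :=
  [set w | exists s t, [/\ 0 <= s <= T, 0 <= t <= T, `|s - t| <= T / N%:R & e < enorm (Z s w - Z t w)]].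

(** The event ranges over uncountably many times, whence outer probability. It is contained in a
    countable union of events at grid points, and these unions decrease to the empty set because
    each path is uniformly continuous. *)
Lemma small_modulus e eta : 0 < e -> 0 < eta ->
  exists N0, forall N, (N0 <= N)%N -> small (mod_event N.+1 e) eta.
Proof.
move=> e0 eta0.
(* Moving s and t to the points below them on a finer grid adds at most two steps to their distance
   and loses at most e/4 at each point in space, hence the constants 3 and e/2. *)
pose c N n i j := [&& (i <= n.+1)%N, (j <= n.+1)%N &
  `|grid T n.+1 i - grid T n.+1 j| <= 3 * (T / N.+1%:R)].
pose B N := \bigcup_n \bigcup_i \bigcup_j
  [set w | c N n i j && (e / 2 < enorm (Z (grid T n.+1 i) w - Z (grid T n.+1 j) w))].
have mB N : measurable (B N).
  apply: bigcupT_measurable => n; apply: bigcupT_measurable => i; apply: bigcupT_measurable => j.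
  case cE : (c N n i j) => /=; last by rewrite (_ : [set _ | _] = set0)//; apply/seteqP; split.
  by move: cE => /and3P[iN jN _]; apply: mlt; exact: grid_bounds.
have dB N : B N.+1 `<=` B N.
  move=> w [n _ [i _ [j _ /= /andP[/and3P[iN jN h] hw]]]].
  exists n => //; exists i => //; exists j => //=; rewrite hw andbT /c iN jN /=.
  apply: le_trans h _; rewrite ler_pM2l// ler_pM2l// lef_pV2 ?posrE ?ltr0n// ler_nat//.
have B0 w : exists N, ~ B N w.
  have [r r0 hr] := heine (@cZ w) (divr_gt0 e0 (ltr0n R 2)).
  exists (Num.truncn (3 * T / r)) => -[n _ [i _ [j _ /= /andP[/and3P[iN jN h]]]]].
  rewrite ltNge => /negP; apply; apply: hr; rewrite ?grid_bounds//.
  apply: le_lt_trans h _; rewrite mulrA ltr_pdivrMr ?ltr0n// [r * _]mulrC -ltr_pdivrMr//.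
  exact: truncnS_gt.
have [N0 hN0] := small_decr mB dB B0 eta0.
exists N0 => N NN; apply: small_sub (hN0 N NN) => w [s [t [sT tT st hst]]].
have [r r0 hr] := heine (@cZ w) (divr_gt0 e0 (ltr0n R 4)).
pose n := maxn N (Num.truncn (T / r)).
have nr : T / n.+1%:R < r.
  rewrite ltr_pdivrMr ?ltr0n// mulrC -ltr_pdivrMr//; apply: lt_le_trans (truncnS_gt _) _.
  by rewrite ler_nat ltnS leq_maxr.
have nN : T / n.+1%:R <= T / N.+1%:R.
  by rewrite ler_pM2l// lef_pV2 ?posrE ?ltr0n// ler_nat ltnS leq_maxl.
have [sn fs hs] := floorP n sT; have [tn ft ht] := floorP n tT.
exists n => //; exists (Num.truncn (s * n.+1%:R / T)) => //.
exists (Num.truncn (t * n.+1%:R / T)) => //=; apply/andP; split.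
  apply/and3P; split => //; rewrite -/(floor n s) -/(floor n t).
  have -> : floor n s - floor n t = (s - t) - (s - floor n s) + (t - floor n t) by ring.
  apply: le_trans (ler_normD _ _) _; apply: le_trans (lerD (ler_normB _ _) ht) _.
  apply: le_trans (lerD (lerD st hs) (lexx _)) _; move: nN.
  by move: (T / n.+1%:R) (T / N.+1%:R) => x y; lra.
rewrite -/(floor n s) -/(floor n t); rewrite ltNge; apply/negP => hle.
have h1 : enorm (Z s w - Z (floor n s) w) <= e / 4 by apply: hr => //; exact: le_lt_trans nr.
have h2 : enorm (Z t w - Z (floor n t) w) <= e / 4 by apply: hr => //; exact: le_lt_trans nr.
move: hst; rewrite ltNge => /negP; apply.
have -> : Z s w - Z t w = (Z s w - Z (floor n s) w) + (Z (floor n s) w - Z (floor n t) w)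
   - (Z t w - Z (floor n t) w) by apply/matrixP => a b; rewrite !mxE; ring.
apply: le_trans (ler_enormB _ _) _.
by have := ler_enormD (Z s w - Z (floor n s) w) (Z (floor n s) w - Z (floor n t) w); lra.
Qed.

Lemma small_bounded eta : 0 < eta ->
  exists2 kappa, 0 <= kappa & small [set w | exists2 t, 0 <= t <= T & kappa < enorm (Z t w)] eta.
Proof.
move=> eta0.
pose B (N : nat) := \bigcup_n \bigcup_i
  [set w | (i <= n.+1)%N && (N%:R < enorm (Z (grid T n.+1 i) w))].
have mB N : measurable (B N).
  apply: bigcupT_measurable => n; apply: bigcupT_measurable => i.
  case iN : (i <= n.+1)%N => /=; last by rewrite (_ : [set _ | _] = set0)//; apply/seteqP; split.
  have m : msr measurable (fun w => enorm (Z (grid T n.+1 i) w)).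
    by apply: msr_enorm => // a b; rewrite ord1; apply: mZ; exact: grid_bounds.
  have := msr_measurable_fun sM m => {}m.
  rewrite (_ : [set w | _] = setT `&` (fun w => enorm (Z (grid T n.+1 i) w)) @^-1` `]N%:R, +oo[%classic).
    exact: m.
  by rewrite setTI; apply/seteqP; split => w; rewrite /= in_itv /= andbT.
have dB N : B N.+1 `<=` B N.
  move=> w [n _ [i _ /= /andP[iN h]]]; exists n => //; exists i => //=; rewrite iN /=.
  by apply: le_lt_trans h; rewrite ler_nat.
have B0 w : exists N, ~ B N w.
  have [M M0 hM] := cpath_bounded (@cZ w).
  exists (Num.truncn M).+1 => -[n _ [i _ /= /andP[iN]]]; rewrite ltNge => /negP; apply.
  by apply: le_trans (hM _ _) (ltW (truncnS_gt _)); exact: grid_bounds.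
have [N0 hN0] := small_decr mB dB B0 eta0.
exists (N0%:R + 1) => //; apply: small_sub (hN0 N0 (leqnn _)) => w [t tT ht].
have [r r0 hr] := heine (@cZ w) (ltr01 : 0 < 1 :> R).
have [kn ft htf] := floorP (Num.truncn (T / r)) tT.
set n := Num.truncn (T / r) in kn ft htf.
exists n => //; exists (Num.truncn (t * n.+1%:R / T)) => //=; rewrite kn /= -/(floor n t).
have : enorm (Z t w - Z (floor n t) w) <= 1.
  apply: hr => //; apply: le_lt_trans htf _; rewrite ltr_pdivrMr ?ltr0n// mulrC -ltr_pdivrMr//.
  exact: truncnS_gt.
have := ler_enormD (Z t w - Z (floor n t) w) (Z (floor n t) w); rewrite subrK; lra.
Qed.

End SmallEvents.

(** * The distance of a step process from the integrand sigma(X) *)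

Section ItoGap.
Context (R : realType) (disp : measure_display) (Omega : measurableType disp)
  (P : probability Omega R).
Variables (T K : R) (d m : nat) (X : R -> Omega -> 'cV[R]_d) (sigma : 'cV[R]_d -> 'M[R]_(d, m)).
Hypotheses (T0 : 0 < T) (cX : forall w, {within `[0, T], continuous (X ^~ w)})
  (mX : forall t i, 0 <= t <= T -> msr measurable (fun w => X t w i 0))
  (K0 : 0 <= K) (hsig : forall x y, enorm (sigma x - sigma y) <= K * enorm (x - y)).
Let sM := @subalg_measurable disp Omega.
Let TR := measurableTypeR R.

Let cell n k : set TR := `[0, T]%classic `&` `[grid T n.+1 k, grid T n.+1 k.+1[%classic.

Let cellE n k s : 0 <= s <= T -> \1_(cell n k) s = (Num.truncn (s * n.+1%:R / T) == k)%:R :> R.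
Proof.
move=> /[dup] sT /andP[s0 s1]; rewrite indicE; congr (nat_of_bool _)%:R.
have n0 : 0 < n.+1%:R :> R by rewrite ltr0n.
have x0 : 0 <= s * n.+1%:R / T by rewrite divr_ge0 ?mulr_ge0// ltW.
rewrite truncn_eq// /cell in_setI !mem_setE !in_itv /= s0 s1 /=.
by rewrite /grid ler_pdivlMr// ltr_pdivrMr// ltr_pdivlMr// ler_pdivrMr.
Qed.

(** Extended by 0 outside [0, T], so that joint measurability holds on the whole product space and
    Fubini applies there. *)
Let zX (p : Omega * TR) : 'cV[R]_d := \1_(`[0, T]%classic : set TR) p.2 *: X p.2 p.1.

Let zXE w s : 0 <= s <= T -> zX (w, s) = X s w.
Proof. by move=> sT; rewrite /zX /= indicE mem_set ?scale1r// /= in_itv. Qed.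

(** By continuity of paths, X is the limit of its values at the grid point to the left, and these
    approximations are finite sums of a function of time multiplied by a function of the outcome. *)
Lemma process_joint_measurable i :
  measurable_fun setT (fun p : Omega * TR => zX p i 0).
Proof.
pose h n (p : Omega * TR) : R :=
  \sum_(k < n.+2) \1_(cell n k) p.2 * X (grid T n.+1 k) p.1 i 0.
apply: (@measurable_fun_cvg _ _ _ _ h) => [n|[w s] _].
  have hk (k : 'I_n.+2) : measurable_fun setT
      (fun p : Omega * TR => \1_(cell n k) p.2 * X (grid T n.+1 k) p.1 i 0 : R).
    apply: measurable_funM.
      apply: (measurableT_comp (f := (\1_(cell n k) : TR -> R))); last exact: measurable_snd.
      by apply: measurable_indic; apply: measurableI.
    apply: (measurableT_comp (f := fun w => X (grid T n.+1 k) w i 0)); last exact: measurable_fst.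
    apply: (msr_measurable_fun sM); apply: mX; apply: grid_bounds => //.
    by rewrite -ltnS.
  by apply: measurable_sum => k; exact: hk.
have [sT|sT] := boolP (0 <= s <= T); last first.
  have -> : zX (w, s) i 0 = 0.
    by rewrite /zX mxE indicE memNset ?mul0r// /= in_itv /=; exact/negP.
  rewrite (_ : h ^~ (w, s) = fun=> 0); first exact: cvg_cst.
  apply/funext => n; rewrite /h big1// => k _.
  by rewrite indicE memNset ?mul0r// => -[]; rewrite /= in_itv /= (negbTE sT).
apply/cvgrPdist_lt => e e0; have [r r0 hr] := cpath_dist (@cX w) sT e0.
exists (Num.truncn (T / r)) => // n /= nr; rewrite zXE//.
set k := Num.truncn (s * n.+1%:R / T).
have /andP[s0 s1] := sT; have n0 : 0 < n.+1%:R :> R by rewrite ltr0n.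
have x0 : 0 <= s * n.+1%:R / T by rewrite divr_ge0 ?mulr_ge0// ltW.
have /andP[k1 k2] := truncn_itv x0; rewrite -/k in k1 k2.
have kn : (k <= n.+1)%N.
  rewrite -(ler_nat R); apply: le_trans k1 _; rewrite ler_pdivrMr// mulrC ler_pM2l//.
have -> : h n (w, s) = X (grid T n.+1 k) w i 0.
  have kn2 : (k < n.+2)%N by rewrite ltnS.
  rewrite /h (bigD1 (Ordinal kn2))//= big1 ?addr0; first by rewrite cellE// eqxx mul1r.
  move=> j jk; rewrite cellE// (_ : _ == _ = false) ?mul0r//; apply/negbTE.
  by apply: contra jk => /eqP jk; apply/eqP/val_inj; rewrite /= -jk.
rewrite -[_ - _](_ : (X s w - X (grid T n.+1 k) w) i 0 = _); last by rewrite !mxE.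
apply: le_lt_trans (enorm_entry _ _ _) _; apply: hr; first exact: grid_bounds.
have gs : grid T n.+1 k <= s by rewrite /grid ler_pdivrMr// -ler_pdivlMr.
rewrite ger0_norm ?subr_ge0//; apply: (@le_lt_trans _ _ (T / n.+1%:R)).
  rewrite lerBlDr /grid -mulrDl ler_pdivlMr//.
  by rewrite -[X in X + _]mul1r -mulrDl nat1r -ler_pdivrMr// ltW.
rewrite ltr_pdivrMr// mulrC -ltr_pdivrMr//; apply: lt_le_trans (truncnS_gt _) _.
by rewrite ler_nat.
Qed.

Definition joint_measurable (E : R -> Omega -> 'M[R]_(d, m)) : Prop :=
  forall i l, measurable_fun setT (fun p : Omega * TR => E p.2 p.1 i l).

Let zgap E (p : Omega * TR) : R := enorm (E p.2 p.1 - sigma (zX p)) ^+ 2.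

Let mzgap E : joint_measurable E -> measurable_fun setT (zgap E).
Proof.
move=> mE; apply: measurable_funX; apply: measurable_enorm => i l.
under eq_fun do rewrite !mxE; apply: measurable_funB; first exact: mE.
apply/(msr_measurable (fun p => sigma (zX p) i l)).
apply: (msr_cont (Y := zX) (g := fun x => sigma x i l)) => [||a b].
- exact: sigma_algebra_measurable.
- apply: (@lipschitz_continuous _ _ _ _ K 0) => // x y; rewrite expr0 mulr1.
  apply: le_trans (hsig x y); rewrite -[_ - _](_ : (sigma x - sigma y) i l = _) ?enorm_entry//.
  by rewrite !mxE.
- by rewrite ord1; apply/(msr_measurable (fun p => zX p a 0)); exact: process_joint_measurable.
Qed.

(** The quantity that [is_ito_integral] requires to tend to 0 in probability, for the integrand
    sigma(X). *)
Definition gap E w : \bar R :=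
  (\int[lebesgue_measure]_(s in `[0%R, T]) (enorm (E s w - sigma (X s w)) ^+ 2)%:E)%E.

Lemma gap_measurable E : joint_measurable E -> measurable_fun setT (gap E).
Proof.
move=> mE; pose h (p : Omega * TR) := (\1_(`[0, T]%classic : set TR) p.2 * zgap E p)%:E.
have mh : measurable_fun setT h.
  apply/measurable_EFinP; apply: measurable_funM; last exact: mzgap.
  apply: (measurableT_comp (f := (\1_(`[0, T]%classic : set TR) : TR -> R))).
    exact: measurable_indic.
  exact: measurable_snd.
have h0 p : (0 <= h p)%E.
  by rewrite lee_fin mulr_ge0 ?sqr_ge0// indicE; case: (_ \in _).
have := @measurable_fun_fubini_tonelli_F _ _ _ _ R lebesgue_measure h mh h0.
rewrite (_ : fubini_F _ _ = gap E)//; apply/funext => w; rewrite /fubini_F /gap [RHS]integral_mkcond.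
apply: eq_integral => s _; rewrite patchE /h /= indicE.
have [sT|sT] := boolP (s \in _); last by rewrite mul0r.
by rewrite mul1r /zgap zXE//; move: sT; rewrite inE /= in_itv.
Qed.

Lemma gap_section_measurable E w : joint_measurable E ->
  measurable_fun (`[0, T]%classic : set TR) (fun s : TR => enorm (E s w - sigma (X s w)) ^+ 2).
Proof.
move=> mE; have mz := mzgap mE.
have m2 : measurable_fun setT (fun s : TR => zgap E (w, s)).
  exact: (measurable_fun_pair2 w mz).
have := measurable_funTS (D := (`[0, T]%classic : set TR)) m2.
apply: eq_measurable_fun => s; rewrite inE /= in_itv /= => sT.
by rewrite /zgap zXE.
Qed.

Lemma step_joint_measurable (I : finType) (a b : I -> R) (v : I -> Omega -> 'M[R]_(d, m)) :
  (forall i k l, msr measurable (fun w => v i w k l)) -> joint_measurable (sproc a b v).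
Proof.
move=> mv k l.
have h x : measurable_fun setT (fun p : Omega * TR => \1_(`]a x, b x] : set TR) p.2 * v x p.1 k l : R).
  apply: measurable_funM.
    apply: (measurableT_comp (f := (\1_(`]a x, b x] : set TR) : TR -> R))); last exact: measurable_snd.
    exact: measurable_indic.
  apply: (measurableT_comp (f := fun w => v x w k l)); last exact: measurable_fst.
  by apply: (msr_measurable_fun sM); exact: mv.
rewrite (_ : (fun p => _) = (fun p : Omega * TR =>
   \sum_x (\1_(`]a x, b x] : set TR) p.2 * v x p.1 k l : R))).
  by apply: measurable_sum => x; exact: h.
by apply/funext => p; rewrite /sproc summxE; apply: eq_bigr => x _; rewrite mxE.
Qed.

Lemma gap_triangle E1 E2 w (c : R) : joint_measurable E1 -> joint_measurable E2 ->
  (gap E1 w <= c%:E)%E -> (gap E2 w <= c%:E)%E ->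
  (\int[lebesgue_measure]_(s in `[0%R, T]) (enorm (E1 s w - E2 s w) ^+ 2)%:E <= (4 * c)%:E)%E.
Proof.
move=> m1 m2 g1 g2.
have n1 := gap_section_measurable w m1; have n2 := gap_section_measurable w m2.
have q0 (a : R) : 0 <= a ^+ 2 by exact: sqr_ge0.
have mD : measurable_fun setT (fun s : TR => enorm (E1 s w - E2 s w) ^+ 2).
  apply: measurable_funX; apply: measurable_enorm => i l.
  under eq_fun do rewrite !mxE; apply: measurable_funB; [exact: (measurable_fun_pair2 w (m1 i l))|exact: (measurable_fun_pair2 w (m2 i l))].
pose a1 (s : TR) := (enorm (E1 s w - sigma (X s w)) ^+ 2)%:E.
pose a2 (s : TR) := (enorm (E2 s w - sigma (X s w)) ^+ 2)%:E.
have ma1 : measurable_fun (`[0, T]%classic : set TR) a1 by apply/measurable_EFinP.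
have ma2 : measurable_fun (`[0, T]%classic : set TR) a2 by apply/measurable_EFinP.
have a10 s : (0 <= a1 s)%E by rewrite lee_fin.
have a20 s : (0 <= a2 s)%E by rewrite lee_fin.
apply: (@le_trans _ _ (\int[lebesgue_measure]_(s in `[0%R, T]) (2%:E * (a1 s + a2 s)))%E).
  apply: ge0_le_integral => //.
  - by move=> s _; rewrite lee_fin.
  - by apply/measurable_EFinP; exact: measurable_funTS mD.
  - by apply: measurable_funeM; exact: emeasurable_funD.
  move=> s _; rewrite /a1 /a2 -EFinD -EFinM lee_fin.
  have -> : E1 s w - E2 s w = (E1 s w - sigma (X s w)) - (E2 s w - sigma (X s w)).
    by apply/matrixP => i j; rewrite !mxE; ring.
  have := ler_enormB (E1 s w - sigma (X s w)) (E2 s w - sigma (X s w)).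
  move: (enorm_ge0 (E1 s w - sigma (X s w) - (E2 s w - sigma (X s w)))).
  move: (enorm _) (enorm _) (enorm _) => x y z x0 h.
  apply: (@le_trans _ _ ((y + x) ^+ 2)); first by apply: lerXn2r; rewrite ?nnegrE// (le_trans x0).
  have := q0 (y - x); nra.
have ma : measurable_fun (`[0, T]%classic : set TR) (fun s => a1 s + a2 s)%E.
  exact: emeasurable_funD.
have -> : (\int[lebesgue_measure]_(s in `[0%R, T]) (2%:E * (a1 s + a2 s)) =
    2%:E * \int[lebesgue_measure]_(s in `[0%R, T]) (a1 s + a2 s))%E.
  by apply: ge0_integralZl => // s _; exact: adde_ge0.
rewrite ge0_integralD// (_ : 4 * c = 2 * (c + c)); last by ring.
have g := leeD g1 g2; rewrite EFinM EFinD; apply: (lee_wpmul2l _ g); by rewrite lee_fin.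
Qed.

End ItoGap.

(** * Riemann sums for the drift *)

Lemma within_comp (R : realType) (U V : topologicalType) (A : set R) (v : R -> U) (h : U -> V) :
  {within A, continuous v} -> continuous h -> {within A, continuous (h \o v)}.
Proof.
move=> /subspace_continuousP cv ch; apply/subspace_continuousP => x Ax.
by apply: (cvg_comp _ _ (cv x Ax)); exact: ch.
Qed.

Section DriftSum.
Variables (R : realType) (T : R) (d : nat) (v : R -> 'cV[R]_d) (N : nat) (e : R).
Hypotheses (T0 : 0 < T) (cv : {within `[0, T], continuous v})
  (hv : forall s t, 0 <= s <= T -> 0 <= t <= T -> `|s - t| <= T / N.+1%:R -> enorm (v s - v t) <= e).
Let TR := measurableTypeR R.
Let t_ := grid T N.+1.

Let tS i : t_ i.+1 - t_ i = T / N.+1%:R.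
Proof. by rewrite /t_ /grid -[i.+1%:R]natr1; ring. Qed.

Let tlt i : t_ i < t_ i.+1.
Proof. by rewrite -subr_gt0 tS divr_gt0// ltr0n. Qed.

Lemma enorm_le_card n k (A : 'M[R]_(n, k)) c : (forall i j, `|A i j| <= c) ->
  enorm A <= (n * k)%:R * c.
Proof.
move=> h; apply: le_trans (enorm_le_entries _) _.
have -> : (n * k)%:R * c = \sum_(i < n) \sum_(j < k) c.
  by rewrite !sumr_const !card_ord -mulrnA mulnC mulr_natl.
by apply: ler_sum => i _; apply: ler_sum => j _.
Qed.

Let g i (s : TR) : R := v s i 0.

Let g_integrable i (A : set TR) : measurable A -> A `<=` `[0, T]%classic ->
  lebesgue_measure.-integrable A (EFin \o g i).
Proof.
move=> mA AT; apply: (@integrableS _ _ _ lebesgue_measure (`[0, T]%classic : set TR)) => //.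
apply: continuous_compact_integrable; first exact: segment_compact.
have -> : g i = (fun A : 'cV[R]_d => A i 0) \o v by [].
by apply: within_comp cv _; exact: coord_continuous.
Qed.

(** Each cell contributes at most its length times the oscillation e. The integral is taken entry by
    entry, whence the factor d. *)
Lemma drift_sum n : (n <= N.+1)%N ->
  enorm (vintegral (t_ n) v - \sum_(i < n) (T / N.+1%:R) *: v (t_ i)) <= d%:R * (T * e).
Proof.
move=> nN; have h0 : 0 <= T / N.+1%:R by rewrite divr_ge0// ltW.
have e0 : 0 <= e.
  have T0' : 0 <= (0 : R) <= T by rewrite lexx ltW.
  by apply: le_trans (enorm_ge0 _) (hv T0' T0' _); rewrite subrr normr0.
suff H i k : (k <= N.+1)%N ->
    `|vintegral (t_ k) v i 0 - \sum_(j < k) T / N.+1%:R * v (t_ j) i 0| <= k%:R * (T / N.+1%:R * e).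
  have := @enorm_le_card _ _ (vintegral (t_ n) v - \sum_(i < n) (T / N.+1%:R) *: v (t_ i)) (T * e).
  rewrite muln1; apply.
  move=> i j; rewrite ord1.
  have -> : (vintegral (t_ n) v - \sum_(i < n) (T / N.+1%:R) *: v (t_ i)) i 0 =
      vintegral (t_ n) v i 0 - \sum_(j < n) T / N.+1%:R * v (t_ j) i 0.
    rewrite mxE; congr (_ + _); rewrite mxE summxE; congr (- _).
    by apply: eq_bigr => l _; rewrite mxE.
  apply: le_trans (H i n nN) _; rewrite mulrA ler_wpM2r//.
  by rewrite mulrA ler_pdivrMr ?ltr0n// mulrC ler_pM2l// ler_nat.
elim: k => [_|k IH kN].
  rewrite big_ord0 subr0 mxE /t_ /grid mul0r mul0r mul0r (_ : `[0, 0]%classic = [set 0]).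
    by rewrite Rintegral_set1 normr0.
  by rewrite set_itv1.
have /andP[k0 kT] := @grid_bounds R T T0 N.+1 (ltn0Sn N) k (ltnW kN).
have /andP[k0' kT'] := @grid_bounds R T T0 N.+1 (ltn0Sn N) k.+1 kN.
rewrite -/t_ in k0 kT k0' kT'.
have := @Rintegral_itvB R (g i) (BLeft 0) (BRight (t_ k.+1)) (t_ k).
rewrite !bnd_simp k0 (ltW (tlt k)) => /(_ _ isT isT) step.
have {}step : vintegral (t_ k.+1) v i 0 - vintegral (t_ k) v i 0 =
    \int[lebesgue_measure]_(x in `]t_ k, t_ k.+1]) g i x.
  rewrite !mxE; apply: step; apply: g_integrable => //.
  by move=> x; rewrite /= !in_itv /= => /andP[-> x1]; exact: le_trans x1 kT'.
have sub : `]t_ k, t_ k.+1]%classic `<=` `[0, T]%classic.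
  move=> x; rewrite /= !in_itv /= => /andP[x0 x1].
  by rewrite (le_trans k0 (ltW x0)) (le_trans x1).
have ig := g_integrable i (measurable_itv `]t_ k, t_ k.+1]) sub.
have mu1 : lebesgue_measure (`]t_ k, t_ k.+1]%classic : set R) = (T / N.+1%:R)%:E.
  by rewrite lebesgue_measure_itv /= lte_fin tlt -EFinB tS.
have cstE c : \int[lebesgue_measure]_(x in `]t_ k, t_ k.+1]) (cst c x) = T / N.+1%:R * c.
  by rewrite Rintegral_cst//; rewrite mulrC; congr (_ * _); have := congr1 fine mu1.
have icst c : lebesgue_measure.-integrable (`]t_ k, t_ k.+1]%classic : set TR) (EFin \o cst c).
  apply: (@integrableS _ _ _ lebesgue_measure (`[0, T]%classic : set TR)) => //.
  apply: continuous_compact_integrable; first exact: segment_compact.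
  by apply: continuous_subspaceT => x; exact: cst_continuous.
have close x : `]t_ k, t_ k.+1]%classic x -> `|g i x - v (t_ k) i 0| <= e.
  move=> xk; have xT := sub x xk; move: xk xT; rewrite /= !in_itv /= => /andP[x0 x1] xT.
  rewrite -[_ - _](_ : (v x - v (t_ k)) i 0 = _); last by rewrite !mxE.
  apply: le_trans (enorm_entry _ _ _) _; apply: hv => //; first by rewrite k0.
  by have x0' := ltW x0; rewrite ger0_norm ?subr_ge0// -(tS k) lerD2r.
have up : \int[lebesgue_measure]_(x in `]t_ k, t_ k.+1]) g i x <= T / N.+1%:R * (v (t_ k) i 0 + e).
  rewrite -cstE; apply: le_Rintegral => // x /close; rewrite ler_norml => /andP[_].
  by rewrite /= lerBlDl.
have lo : T / N.+1%:R * (v (t_ k) i 0 - e) <= \int[lebesgue_measure]_(x in `]t_ k, t_ k.+1]) g i x.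
  rewrite -cstE; apply: le_Rintegral => // x /close; rewrite ler_norml => /andP[+ _].
  by rewrite /= lerBrDl addrC.
rewrite big_ord_recr /=.
have -> : vintegral (t_ k.+1) v i 0 = vintegral (t_ k) v i 0 +
  \int[lebesgue_measure]_(x in `]t_ k, t_ k.+1]) g i x by rewrite -step addrC subrK.
have := IH (ltnW kN); move: up lo; rewrite -[k.+1%:R]natr1 mulrDl mul1r.
move: (vintegral _ _ _ _) (\int[_]_(_ in _) _) (\sum_(j < k) _) (v (t_ k) i 0) => V x S y.
move: (T / _) (k%:R * _) => h q up lo; rewrite !ler_norml => /andP[l1 l2]; apply/andP; split; lra.
Qed.

End DriftSum.

(** * Summability of the level rates *)

Section LevelRate.
Variable R : realType.

Definition level_rate (l : nat) : R := Num.sqrt (leta' R (l, 0%N)).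

Lemma level_rate_ge0 l : 0 <= level_rate l. Proof. exact: sqrtr_ge0. Qed.

Lemma sqr_level_rate l : level_rate l ^+ 2 = leta' R (l, 0%N).
Proof. by rewrite sqr_sqrtr//; have /andP[] := leta'01 R (l, 0%N). Qed.

(** The squared ratio is (l+3)/(2(l+2)) <= 3/4, and 3/4 < (7/8)^2. The constant 8 = 1/(1 - 7/8)
    below is the geometric sum. *)
Lemma level_rateS l : level_rate l.+1 <= 7 / 8 * level_rate l.
Proof.
rewrite -(ler_pXn2r (n := 2))// ?nnegrE ?mulr_ge0 ?level_rate_ge0//.
rewrite exprMn !sqr_level_rate /leta' /= -!mul2n expnS !natrM.
have p0 : 0 < (2 ^ l)%:R :> R by rewrite ltr0n expn_gt0.
have -> : l.+3%:R / (2 * (2 * (2 ^ l)%:R)) = l.+3%:R / 4 / (2 ^ l)%:R :> R by field; rewrite gt_eqF.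
have -> : (7 / 8) ^+ 2 * (l.+2%:R / (2 * (2 ^ l)%:R)) = (7 / 8) ^+ 2 * l.+2%:R / 2 / (2 ^ l)%:R :> R.
  by field; rewrite gt_eqF.
rewrite ler_pM2r ?invr_gt0// -[l.+3%:R]natr1.
by have : 2 <= l.+2%:R :> R; [rewrite ler_nat|lra].
Qed.

Lemma sum_level_rate n k : \sum_(n <= j < n + k) level_rate j <= 8 * level_rate n.
Proof.
suff H : \sum_(n <= j < n + k) level_rate j <= 8 * (level_rate n - level_rate (n + k)).
  by apply: le_trans H _; have := level_rate_ge0 (n + k); lra.
elim: k => [|k IH]; first by rewrite addn0 big_geq ?subrr ?mulr0.
rewrite addnS big_nat_recr /= ?leq_addr//.
by have := level_rateS (n + k); lra.
Qed.

Lemma level_rate_small e : 0 < e -> exists L, forall l, (L <= l)%N -> level_rate l <= e.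
Proof.
move=> e0; have h l : level_rate l <= level_rate 0 * (7 / 8) ^+ l.
  elim: l => [|l IH]; first by rewrite expr0 mulr1.
  by apply: le_trans (level_rateS l) _; rewrite exprS; move: IH; lra.
have q1 : `|7 / 8 : R| < 1 by rewrite ger0_norm; lra.
have := cvg_geometric (level_rate 0) q1 => /cvgrPdist_le /(_ _ e0)[L _ HL].
exists L => l Ll; apply: le_trans (h l) _; apply: le_trans (HL l Ll).
by rewrite sub0r normrN; exact: ler_norm.
Qed.

End LevelRate.

(** * The solution satisfies the Euler recursion up to a small residual *)

Section Solution.
Context (R : realType) (disp : measure_display) (Omega : measurableType disp)
  (P : probability Omega R).
Variables (T K : R) (F : R -> set (set Omega)) (d m : nat) (W : R -> Omega -> 'cV[R]_m)
  (mu : 'cV[R]_d -> 'cV[R]_d) (sigma : 'cV[R]_d -> 'M[R]_(d, m)) (xi : Omega -> 'cV[R]_d)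
  (X : R -> Omega -> 'cV[R]_d).
Hypotheses (T0 : 0 < T) (hF : filtration T F) (bW : standard_brownian P T F W)
  (K0 : 0 <= K) (hsig : forall x y, enorm (sigma x - sigma y) <= K * enorm (x - y))
  (hX : sde_solution P T F mu sigma xi W X).
Let sM := @subalg_measurable disp Omega.

Lemma solution_continuous w : {within `[0, T], continuous (X ^~ w)}.
Proof. by have [_ cX _] := hX; exact: cX. Qed.

Lemma solution_msr t i : 0 <= t <= T -> msr (F t) (fun w => X t w i 0).
Proof. by have [aX _ _] := hX; move=> tT; apply: (adapted_msr hF). Qed.

Lemma solution_measurable t i : 0 <= t <= T -> msr measurable (fun w => X t w i 0).
Proof.
move=> tT; have [sF _] := hF; have [_ sub] := sF _ tT.
exact: msr_sub sub (solution_msr i tT).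
Qed.

Lemma sigma_entry_msr G t i l : subalg G -> (forall j, msr G (fun w => X t w j 0)) ->
  msr G (fun w => sigma (X t w) i l).
Proof.
move=> sG mX; apply: (msr_cont (g := fun x => sigma x i l)) => [||a b]; first by case: sG.
- apply: (@lipschitz_continuous _ _ _ _ K 0) => // x y; rewrite expr0 mulr1.
  apply: le_trans (hsig x y); rewrite -[_ - _](_ : (sigma x - sigma y) i l = _) ?enorm_entry//.
  by rewrite !mxE.
- by rewrite ord1; exact: mX.
Qed.

Definition step_adapted (I : finType) (a b : I -> R) (v : I -> Omega -> 'M[R]_(d, m)) :=
  [/\ forall i, 0 <= a i, forall i, a i <= b i, forall i, b i <= T &
    forall i j l, msr (F (a i)) (fun w => v i w j l)].

Lemma step_adapted_joint I a b v : @step_adapted I a b v -> joint_measurable (sproc a b v).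
Proof.
move=> [a0 ab bT mv]; apply: step_joint_measurable => i k l.
have [sF _] := hF; have h : 0 <= a i <= T by rewrite a0 (le_trans (ab i)).
have [_ sub] := sF _ h; exact: msr_sub sub (mv i k l).
Qed.

Lemma elementary_step (H : elementary R Omega d m) : elementary_adapted T F H ->
  step_adapted (fun j : 'I_(elem_size H) => elem_time H j) (fun j => elem_time H j.+1)
    (fun j => elem_val H j).
Proof.
move=> [[t0 tT] tS mv _].
have mono i j : (i <= j)%N -> (j <= elem_size H)%N -> elem_time H i <= elem_time H j.
  elim: j => [|j IH]; first by rewrite leqn0 => /eqP ->.
  rewrite leq_eqVlt => /orP[/eqP -> //|]; rewrite ltnS => ij jN.
  by apply: le_trans (IH ij (ltnW jN)) _; exact: tS.
have a0 (i : 'I_(elem_size H)) : 0 <= elem_time H i.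
  by apply: le_trans t0 _; apply: mono => //; exact: ltnW.
have bT (i : 'I_(elem_size H)) : elem_time H i.+1 <= T by apply: le_trans tT; exact: mono.
split => // [i|i j l]; first exact: tS.
have [sF _] := hF; have h : 0 <= elem_time H i <= T.
  by rewrite a0 (le_trans _ (bT i))//; exact: tS.
have [sG _] := sF _ h; have := mv i (ltn_ord i).
by move/(borel_measurable_entries _ sG); apply.
Qed.

(** Two step processes close to the same integrand are close to each other, and their difference is
    a step process over the sum type; [lenglart] carries this over to the integrals at all listed
    times. The fraction 1/4 pays for [gap_triangle]. *)
Lemma small_step_diff (I1 I2 : finType) a1 b1 v1 a2 b2 v2 (ts : seq R) (delta e p1 p2 : R) :
  @step_adapted I1 a1 b1 v1 -> @step_adapted I2 a2 b2 v2 ->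
  (forall t, t \in ts -> 0 <= t <= T) -> 0 < delta -> 0 < e ->
  small P [set w | ((T * delta / 4)%:E <= gap T X sigma (sproc a1 b1 v1) w)%E] p1 ->
  small P [set w | ((T * delta / 4)%:E <= gap T X sigma (sproc a2 b2 v2) w)%E] p2 ->
  small P [set w | exists2 t, t \in ts & e <= enorm (sint W a1 b1 v1 t w - sint W a2 b2 v2 t w)]
    (p1 + p2 + lenglart_cst T m * delta / e ^+ 2).
Proof.
move=> ok1 ok2 tsT delta0 e0 s1 s2.
have j1 := step_adapted_joint ok1; have j2 := step_adapted_joint ok2.
move: ok1 ok2 => [a10 ab1 bT1 mv1] [a20 ab2 bT2 mv2].
pose a (i : I1 + I2) := match i with inl i => a1 i | inr i => a2 i end.
pose b (i : I1 + I2) := match i with inl i => b1 i | inr i => b2 i end.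
pose v (i : I1 + I2) w := match i with inl i => v1 i w | inr i => - v2 i w end.
have a0 i : 0 <= a i by case: i.
have ab i : a i <= b i by case: i.
have bT i : b i <= T by case: i.
have mv i j l : msr (F (a i)) (fun w => v i w j l).
  case: i => i /=; first exact: mv1.
  under eq_fun do rewrite mxE; apply: measurableT_comp; [exact: oppr_measurable|exact: mv2].
have vE s w : sproc a b v s w = sproc a1 b1 v1 s w - sproc a2 b2 v2 s w.
  rewrite /sproc big_sumType /=; congr (_ + _); rewrite -sumrN.
  by apply: eq_bigr => i _; rewrite scalerN.
have iE t w : sint W a b v t w = sint W a1 b1 v1 t w - sint W a2 b2 v2 t w.
  rewrite /sint big_sumType /=; congr (_ + _); rewrite -sumrN.
  by apply: eq_bigr => i _; rewrite mulNmx.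
have [S [hS ES bS]] := lenglart T0 hF bW a0 ab bT mv (ltW delta0) tsT.
have s3 := small_markov hS e0 ES.
apply: small_sub (smallU (smallU s1 s2) s3) => w [t tts ht].
have [h1|/negP] := pselect ((T * delta / 4)%:E <= gap T X sigma (sproc a1 b1 v1) w)%E; first by left; left.
rewrite -ltNge => h1; have [h2|/negP] := pselect ((T * delta / 4)%:E <= gap T X sigma (sproc a2 b2 v2) w)%E; first by left; right.
rewrite -ltNge => h2; right; apply: (le_trans ht); rewrite -iE; apply: bS => //.
under eq_integral do rewrite vE.
have := gap_triangle T0 solution_continuous solution_measurable K0 hsig j1 j2 (ltW h1) (ltW h2).
by rewrite [4 * _]mulrC divfK// pnatr_eq0.
Qed.

(** The stochastic integral as read off from the equation: one process for all times, whereas the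
    equation supplies a random variable for each time separately and only up to a null set. *)
Definition stoch_part (t : R) (w : Omega) : 'cV[R]_d :=
  X t w - xi w - vintegral t (fun s => mu (X s w)).

Lemma stoch_part_approx t e delta eta : 0 <= t <= T -> 0 < e -> 0 < delta -> 0 < eta ->
  exists H : elementary R Omega d m, [/\ elementary_adapted T F H,
    small P [set w | (delta%:E <= gap T X sigma (elementary_process H) w)%E] eta &
    small P [set w | e <= enorm (elementary_integral W H t w - stoch_part t w)] eta].
Proof.
move=> tT e0 delta0 eta0; have [aX cX hI] := hX; have [I [mI [H [aH gH iH]]] XI] := hI t tT.
have mg n : measurable [set w | (delta%:E <= gap T X sigma (elementary_process (H n)) w)%E].
  have := gap_measurable T0 solution_continuous solution_measurable K0 hsig
    (step_adapted_joint (elementary_step (aH n))).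
  move=> m'; rewrite (_ : [set w | _] =
    setT `&` gap T X sigma (elementary_process (H n)) @^-1` `[delta%:E, +oo[%classic).
    by apply: m' => //; exact: emeasurable_itv.
  by rewrite setTI; apply/seteqP; split => w; rewrite /= in_itv /= andbT.
have mi n : measurable [set w | e <= enorm (elementary_integral W (H n) t w - I w)].
  have mint i : msr measurable (fun w => (elementary_integral W (H n) t w - I w) i 0).
    have [a0 ab bT mv] := elementary_step (aH n); have [sF mF] := hF.
    rewrite (_ : (fun w => _) = (fun w => \sum_(j < elem_size (H n))
       (elem_val (H n) j w *m (W (Num.min (elem_time (H n) j.+1) t) w
                       - W (Num.min (elem_time (H n) j) t) w)) i 0 - I w i 0)); last first.
      by apply/funext => w; rewrite !mxE /elementary_integral summxE.
    have mW r l : 0 <= r <= T -> msr measurable (fun w => W r w l 0).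
      move=> rT; have [_ sub] := sF _ rT; have [aW _ _ _ _] := bW.
      have h := @adapted_msr _ _ _ _ _ hF _ _ r l aW rT; apply: msr_sub h => //.
    have hmin s : 0 <= s <= T -> 0 <= Num.min s t <= T.
      by have /andP[t0 t1] := tT; move=> /andP[s0 s1]; rewrite le_min s0 t0 ge_min s1.
    have hj (j : 'I_(elem_size (H n))) : msr measurable (fun w => (elem_val (H n) j w *m
        (W (Num.min (elem_time (H n) j.+1) t) w - W (Num.min (elem_time (H n) j) t) w)) i 0).
      have h0 : 0 <= elem_time (H n) j <= T by rewrite a0 (le_trans (ab j)).
      have h1 : 0 <= elem_time (H n) j.+1 <= T by rewrite (le_trans (a0 j) (ab j)) bT.
      have hl (l : 'I_m) : msr measurable (fun w => elem_val (H n) j w i l *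
          (W (Num.min (elem_time (H n) j.+1) t) w - W (Num.min (elem_time (H n) j) t) w) l 0).
        apply: measurable_funM.
          by have [_ sub] := sF _ h0; have h := mv j i l; apply: msr_sub h.
        under eq_fun do rewrite !mxE; apply: measurable_funB; apply: mW; exact: hmin.
      under eq_fun do rewrite mxE.
      by apply: measurable_sum => l; exact: hl.
    apply: measurable_funB; first by apply: measurable_sum => j; exact: hj.
    by have := mI; move/(borel_measurable_entries _ (@sigma_algebra_measurable _ Omega)); apply.
  have := msr_measurable_fun sM (msr_enorm sM (Y := fun w => elementary_integral W (H n) t w - I w) _).
  move=> /(_ (fun i j => _)) m'.
  rewrite (_ : [set w | _] = setT `&`
    (fun w => enorm (elementary_integral W (H n) t w - I w)) @^-1` `[e, +oo[%classic).
    by apply: m' => // i j; rewrite ord1.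
  by rewrite setTI; apply/seteqP; split => w; rewrite /= in_itv /= andbT.
have [n1 h1] := small_cvg mg (gH _ delta0) eta0.
have [n2 h2] := small_cvg mi (iH _ e0) eta0.
exists (H (maxn n1 n2)); split; [exact: aH|by apply: h1; exact: leq_maxl|].
have s3 : small P (~` [set w | X t w = xi w + vintegral t (fun s => mu (X s w)) + I w]) 0.
  by apply: small_ae; apply: filterS XI => w h; apply.
have := smallU (h2 _ (leq_maxr n1 n2)) s3; rewrite addr0; apply: small_sub => w /= hw.
have [XE|XE] := pselect (X t w = xi w + vintegral t (fun s => mu (X s w)) + I w); last by right.
left; move: hw; rewrite /= /stoch_part XE; congr (_ <= enorm (_ - _)).
by apply/matrixP => i j; rewrite !mxE; ring.
Qed.

Hypothesis cmu : continuous mu.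
Let TR := measurableTypeR R.
Let cX := solution_continuous.
Let mX := solution_measurable.

Let t_ N := grid T N.+1.
Let aN N (i : 'I_N.+1) := t_ N i.
Let bN N (i : 'I_N.+1) := t_ N i.+1.
Let vN N (i : 'I_N.+1) w := sigma (X (t_ N i) w).

Let t_lt N i j : (t_ N i < t_ N j) = (i < j)%N.
Proof. by rewrite /t_ /grid ltr_pM2r ?invr_gt0 ?ltr0n// ltr_pM2r// ltr_nat. Qed.

Let t_le N i j : (t_ N i <= t_ N j) = (i <= j)%N.
Proof. by rewrite !leNgt t_lt -leqNgt. Qed.

Let t_T N i : (i <= N.+1)%N -> 0 <= t_ N i <= T.
Proof. by move=> iN; exact: grid_bounds. Qed.

Let stepN N : step_adapted (@aN N) (@bN N) (@vN N).
Proof.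
split => [i|i|i|i j l].
- by have /andP[] := t_T (ltnW (ltn_ord i)).
- by rewrite /aN /bN t_le.
- by have /andP[] := t_T (ltn_ord i).
- have [sF _] := hF; have h := t_T (ltnW (ltn_ord i)).
  apply: (@sigma_entry_msr (F (t_ N i)) (t_ N i) j l) => [|k].
    exact: sF.
  exact: solution_msr.
Qed.

Let in_step N s w : 0 < s <= T -> exists2 j, (j < N.+1)%N /\ t_ N j < s <= t_ N j.+1 &
  sproc (@aN N) (@bN N) (@vN N) s w = sigma (X (t_ N j) w).
Proof.
move=> /andP[s0 sT].
have ex : exists j, s <= t_ N j by exists N.+1; rewrite /t_ /grid mulrAC mulfV ?mul1r// pnatr_eq0.
case: (ex_minnP ex) => [[|j] sj jmin].
  by move: sj; rewrite /t_ /grid !mul0r leNgt s0.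
have js : t_ N j < s by rewrite ltNge; apply/negP => /jmin; rewrite ltnn.
have jN : (j < N.+1)%N.
  by rewrite -(t_lt N) (lt_le_trans js)// /t_ /grid [N.+1%:R * _]mulrC mulfK// pnatr_eq0.
exists j; first by rewrite js.
rewrite /sproc (bigD1 (Ordinal jN))//= big1 ?addr0; last first.
  move=> i ij; rewrite indicE memNset ?scale0r//= in_itv /= => /andP[i1 i2].
  have := lt_le_trans i1 sj; have := lt_le_trans js i2; rewrite /aN /bN !t_lt !ltnS => h1 h2.
  by move/eqP: ij; apply; apply/val_inj/eqP; rewrite /= eqn_leq h1 h2.
by rewrite indicE mem_set ?scale1r//= in_itv /= js.
Qed.

Lemma grid_gap_small delta eta : 0 < delta -> 0 < eta -> exists N0, forall N, (N0 <= N)%N ->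
  small P [set w | (delta%:E <= gap T X sigma (sproc (@aN N) (@bN N) (@vN N)) w)%E] eta.
Proof.
(* With this e the integrand stays below (K e)^2 <= delta/(2T), so the gap is at most delta/2; the
   denominator K + 1 also covers K = 0. *)
move=> delta0 eta0; pose e := Num.sqrt (delta / (2 * T)) / (K + 1).
have K1 : 0 < K + 1 by rewrite ltr_wpDl.
have q0 : 0 < delta / (2 * T) by rewrite divr_gt0// mulr_gt0.
have e0 : 0 < e by rewrite divr_gt0// sqrtr_gt0.
have [N0 hN0] := small_modulus P T0 cX mX e0 eta0.
exists N0 => N NN; apply: small_sub (hN0 N NN) => w; rewrite /= leNgt => /negP h.
apply: contrapT => hmod; apply: h.
have mg := gap_section_measurable T0 cX mX K0 hsig w (step_adapted_joint (stepN N)).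
have mg' : measurable_fun (`]0, T]%classic : set TR)
   (fun s : TR => enorm (sproc (@aN N) (@bN N) (@vN N) s w - sigma (X s w)) ^+ 2).
  apply: measurable_funS mg => //; move=> x; rewrite /= !in_itv /= => /andP[/ltW -> ->] //.
(* The point 0 lies in none of the half-open cells, so the step process vanishes there whatever
   sigma(X) is; this null set is removed first. *)
rewrite /gap -integral_itv_obnd_cbnd; last by apply/measurable_EFinP.
apply: (@le_lt_trans _ _ (\int[lebesgue_measure]_(s in `]0%R, T]) ((delta / (2 * T))%:E))%E).
  apply: ge0_le_integral => //.
  - by move=> s _; rewrite lee_fin sqr_ge0.
  - by apply/measurable_EFinP.
  move=> s; rewrite /= in_itv /= => sT; rewrite lee_fin.
  have [j [jN /andP[js sj]] ->] := in_step N w sT.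
  have hXs : enorm (X (t_ N j) w - X s w) <= e.
    rewrite leNgt; apply/negP => he; apply: hmod; exists (t_ N j), s; split => //.
    - by apply: t_T; exact: ltnW.
    - by have /andP[/ltW -> ->] := sT.
    have js' := ltW js; rewrite distrC ger0_norm ?subr_ge0// lerBlDr; apply: le_trans sj _.
    by rewrite /t_ /grid -[j.+1%:R]nat1r mulrDl mul1r mulrDl.
  apply: (@le_trans _ _ ((K * e) ^+ 2)).
    have Ke : 0 <= K * e by rewrite mulr_ge0// (ltW e0).
    apply: lerXn2r; rewrite ?nnegrE//.
    by apply: le_trans (hsig _ _) _; rewrite ler_wpM2l.
  have q0' := ltW q0.
  have -> : (K * e) ^+ 2 = delta / (2 * T) * (K / (K + 1)) ^+ 2 by rewrite /e mulrCA exprMn sqr_sqrtr.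
  apply: ler_piMr => //.
  by rewrite exprn_ile1// ?divr_ge0 ?(ltW K1)// ler_pdivrMr// mul1r lerDl.
rewrite integral_cst//; have L : lebesgue_measure (`]0, T]%classic : set R) = T%:E.
  by rewrite lebesgue_measure_itv /= lte_fin T0 -EFinB subr0.
rewrite [X in (_ * X)%E]L -EFinM lte_fin.
have -> : delta / (2 * T) * T = delta / 2 by field; rewrite gt_eqF.
by move: delta0; lra.
Qed.

Let sintN N n w : (n <= N.+1)%N -> sint W (@aN N) (@bN N) (@vN N) (t_ N n) w =
  \sum_(i < n) sigma (X (t_ N i) w) *m (W (t_ N i.+1) w - W (t_ N i) w).
Proof.
move=> nN; rewrite /sint /aN /bN /vN.
pose G i := sigma (X (t_ N i) w) *m (W (Num.min (t_ N i.+1) (t_ N n)) w - W (Num.min (t_ N i) (t_ N n)) w).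
rewrite -(big_mkord xpredT G) (big_cat_nat (n := n)) //=.
have -> : \sum_(n <= i < N.+1) G i = 0.
  rewrite big_nat_cond; apply: big1 => i; rewrite andbT => /andP[ni _].
  by rewrite /G !min_r ?t_le ?subrr ?mulmx0// leqW.
rewrite addr0; rewrite big_mkord; apply: eq_bigr => i _; rewrite /G !min_l// t_le; [exact: ltnW|exact: ltn_ord].
Qed.

(** Each time comes with its own approximating sequence. The approximation H chosen for the final
    time is compared at every node with the one belonging to that node, which shows that H
    approximates the stochastic part at all nodes; then H is compared with the grid process at all
    nodes at once. *)
Lemma stoch_part_uniform e eta : 0 < e -> 0 < eta -> exists N0, forall N, (N0 <= N)%N ->
  small P [set w | exists2 n, (n <= N.+1)%N & 3 * e <= enorm (stoch_part (t_ N n) w -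
    \sum_(i < n) sigma (X (t_ N i) w) *m (W (t_ N i.+1) w - W (t_ N i) w))] eta.
Proof.
move=> e0 eta0; pose L := lenglart_cst T m.
have L1 : 0 < `|L| + 1 by rewrite ltr_wpDl.
(* Chosen so that the Lenglart term L * del x / e^2 is at most x. *)
pose del x := x * e ^+ 2 / (`|L| + 1).
have del0 x : 0 < x -> 0 < del x by move=> x0; rewrite divr_gt0 ?mulr_gt0 ?exprn_gt0.
have delL x : 0 < x -> L * del x / e ^+ 2 <= x.
  move=> x0; rewrite ler_pdivrMr ?exprn_gt0//; apply: (@le_trans _ _ ((`|L| + 1) * del x)).
    rewrite ler_wpM2r ?(ltW (del0 _ _))//; apply: le_trans (ler_norm _) _; by rewrite lerDl.
  by rewrite /del mulrCA mulfV ?mulr1// gt_eqF.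
have dT x : 0 < x -> 0 < T * del x / 4 by move=> x0; rewrite divr_gt0// mulr_gt0// del0.
have eta8 : 0 < eta / 8 by rewrite divr_gt0.
have [N0 hN0] := grid_gap_small (dT _ eta8) eta8.
(* At each of the N + 2 nodes four events of size eta2 occur: two gaps, one Lenglart term and one
   approximation error. Together they make eta/2. *)
exists N0 => N NN; pose eta2 := eta / (8 * N.+2%:R).
have N2 : 0 < N.+2%:R :> R by rewrite ltr0n.
have eta20 : 0 < eta2 by rewrite divr_gt0// mulr_gt0.
have eta28 : eta2 <= eta / 8.
  rewrite /eta2 ler_pM2l// lef_pV2 ?posrE ?mulr_gt0// ler_peMr// ler1n//.
have hH n : (n <= N.+1)%N -> exists H : elementary R Omega d m, [/\ elementary_adapted T F H,
    small P [set w | ((T * del eta2 / 4)%:E <= gap T X sigma (elementary_process H) w)%E] eta2 &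
    small P [set w | e <= enorm (elementary_integral W H (t_ N n) w - stoch_part (t_ N n) w)] eta2].
  by move=> nN; apply: stoch_part_approx => //; [exact: t_T|exact: dT].
have [H [aH gH _]] := hH N.+1 (leqnn _).
have tsT n : (n <= N.+1)%N -> forall t, t \in [:: t_ N n] -> 0 <= t <= T.
  by move=> nN t; rewrite inE => /eqP ->; exact: t_T.
have A n : (n < N.+2)%N -> small P [set w | 2 * e <=
    enorm (elementary_integral W H (t_ N n) w - stoch_part (t_ N n) w)] (4 * eta2).
  rewrite ltnS => nN; have [H' [aH' gH' iH']] := hH n nN.
  have sd := small_step_diff (elementary_step aH) (elementary_step aH')
    (tsT n nN) (del0 _ eta20) e0 gH gH'.
  have := smallU sd iH'.
  move=> h; apply: small_le (small_sub _ h) => [|w /= hw].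
    by have := delL _ eta20; rewrite -/L; lra.
  have [h1|/negP] := pselect (e <= enorm (elementary_integral W H' (t_ N n) w - stoch_part (t_ N n) w)).
    by right.
  rewrite -ltNge => h1; left; exists (t_ N n); first by rewrite inE.
  move: hw; rewrite -(subrKA (elementary_integral W H' (t_ N n) w)) => hw.
  have := le_trans hw (ler_enormD _ _).
  by rewrite -/(elementary_integral W H (t_ N n) w) -/(elementary_integral W H' (t_ N n) w); lra.
have B := small_bigcup (ltW (mulr_gt0 (ltr0n R 4) eta20)) A.
have [ts tsN tsin] : exists2 ts : seq R, (forall t, t \in ts -> 0 <= t <= T) &
    forall n, (n < N.+2)%N -> t_ N n \in ts.
  exists [seq t_ N n | n <- iota 0 N.+2] => [t /mapP[n]|n nN].
    by rewrite mem_iota add0n ltnS => /andP[_ nN] ->; exact: t_T.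
  by apply/mapP; exists n => //; rewrite mem_iota.
have gH8 : small P [set w | ((T * del (eta / 8) / 4)%:E <= gap T X sigma (elementary_process H) w)%E] eta2.
  apply: small_sub gH => w /=; apply: le_trans; rewrite lee_fin ler_pM2r// ler_pM2l//.
  by rewrite /del ler_pM2r ?invr_gt0// ler_pM2r ?exprn_gt0.
have sd := small_step_diff (elementary_step aH) (stepN N) tsN
  (del0 _ eta8) e0 gH8 (hN0 N NN).
apply: small_le (small_sub _ (smallU B sd)) => [|w /= [n nN hn]].
  have -> : N.+2%:R * (4 * eta2) = eta / 2.
    rewrite /eta2; move: N2; move: (N.+2%:R : R) => x x0; field; by rewrite gt_eqF.
  by have := delL _ eta8; rewrite -/L; lra.
have [h1|/negP] := pselect (2 * e <= enorm (elementary_integral W H (t_ N n) w - stoch_part (t_ N n) w)).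
  by left; exists n.
rewrite -ltNge => h1; right; exists (t_ N n); first exact: tsin.
rewrite sintN//; move: hn; set S := \sum_(i < n) _ => hn.
rewrite -/(elementary_integral W H (t_ N n) w).
have := ler_enormB (elementary_integral W H (t_ N n) w - S)
  (elementary_integral W H (t_ N n) w - stoch_part (t_ N n) w).
rewrite (_ : _ - _ - (_ - _) = stoch_part (t_ N n) w - S); last first.
  by apply/matrixP => i j; rewrite !mxE; ring.
by move=> h; lra.
Qed.

Definition euler_residual N n w : 'cV[R]_d := X (t_ N n) w - xi w -
  \sum_(i < n) ((T / N.+1%:R) *: mu (X (t_ N i) w)
    + sigma (X (t_ N i) w) *m (W (t_ N i.+1) w - W (t_ N i) w)).

Lemma residual_small e eta : 0 < e -> 0 < eta -> exists N0, forall N, (N0 <= N)%N ->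
  small P [set w | exists2 n, (n <= N.+1)%N & e <= enorm (euler_residual N n w)] eta.
Proof.
move=> e0 eta0; pose Z t w := mu (X t w).
have cZ w : {within `[0, T], continuous (Z ^~ w)}.
  have -> : Z ^~ w = mu \o (X ^~ w) by [].
  by apply: (within_comp _ cmu); exact: cX.
have mZ t i : 0 <= t <= T -> msr measurable (fun w => Z t w i 0).
  move=> tT; apply: (msr_cont (g := fun x => mu x i 0)) => [||a b].
  - exact: sigma_algebra_measurable.
  - have -> : (fun x => mu x i 0) = (fun A : 'cV[R]_d => A i 0) \o mu by [].
    by move=> x; apply: continuous_comp; [exact: cmu|exact: coord_continuous].
  - by rewrite ord1; exact: mX.
have dT : 0 <= d%:R * T by apply: mulr_ge0; [|exact: ltW].
have dT1 : 0 < d%:R * T + 1 by rewrite ltr_wpDl.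
have e2 : 0 < e / (2 * (d%:R * T + 1)) by rewrite divr_gt0// mulr_gt0.
have e6 : 0 < e / 6 by rewrite divr_gt0.
have eta2 : 0 < eta / 2 by rewrite divr_gt0.
have [N1 h1] := small_modulus P T0 cZ mZ e2 eta2.
have [N2 h2] := stoch_part_uniform e6 eta2.
exists (maxn N1 N2) => N; rewrite geq_max => /andP[NN1 NN2].
have := smallU (h1 N NN1) (h2 N NN2); rewrite -splitr; apply: small_sub => w /= [n nN hn].
have [hmod|hmod] := pselect (mod_event T Z N.+1 (e / (2 * (d%:R * T + 1))) w); [by left|right].
exists n => //; have := @drift_sum R T d (Z ^~ w) N (e / (2 * (d%:R * T + 1))) T0 (cZ w) _ n nN.
have hd : d%:R * (T * (e / (2 * (d%:R * T + 1)))) <= e / 2.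
  have -> : d%:R * (T * (e / (2 * (d%:R * T + 1)))) = e / 2 * (d%:R * T / (d%:R * T + 1)).
    by field; rewrite gt_eqF.
  apply: ler_piMr; first by rewrite divr_ge0// ltW.
  by rewrite ler_pdivrMr// mul1r lerDl.
have hv : forall s t, 0 <= s <= T -> 0 <= t <= T -> `|s - t| <= T / N.+1%:R ->
    enorm (Z s w - Z t w) <= e / (2 * (d%:R * T + 1)).
  by move=> s t sT tT st; rewrite leNgt; apply/negP => h; apply: hmod; exists s, t.
move=> /(_ hv) /le_trans /(_ hd) h3.
have := ler_enormD (stoch_part (t_ N n) w -
    \sum_(i < n) sigma (X (t_ N i) w) *m (W (t_ N i.+1) w - W (t_ N i) w))
  (vintegral (grid T N.+1 n) (Z ^~ w) - \sum_(i < n) (T / N.+1%:R) *: Z (grid T N.+1 i) w).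
rewrite (_ : _ - _ + (_ - _) = euler_residual N n w); last first.
  rewrite /euler_residual big_split /stoch_part /t_ /Z.
  by apply/matrixP => i j; rewrite !mxE; ring.
by move=> h4; lra.
Qed.

Variable k : nat.
Hypotheses (hmu : drift_bounds K k mu)
  (gmu : forall x, enorm (mu x) <= K * (1 + enorm x) ^+ k)
  (gsig : forall x, enorm (sigma x) <= K * (1 + enorm x)).
Variable (Cx : nat -> R).
Hypotheses (hxi : VLG P (F 0) xi) (Cx0 : forall r, 0 <= Cx r)
  (mxi : forall r, Ex P (fun w => enorm (xi w) ^+ (2 * r)) <= Cx r).
Let C := bm_cst T m.
Let C0 q : 0 <= C q. Proof. exact: bm_cst_ge0 (ltW T0). Qed.

Let D N n w := W (grid T N.+1 n.+1) w - W (grid T N.+1 n) w.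
Let Y N := tamed mu sigma (T / N.+1%:R) xi (D N).

Let hs N : tsetup P C Cx N.+1 (fun n => F (grid T N.+1 n)) (D N) xi.
Proof.
exact: (@tsetup_incs _ _ _ P T F d m T0 hF (fun _ _ => W) (fun _ _ => xi) Cx
  (fun _ _ => bW) (fun _ _ => hxi) (fun _ _ => mxi) N.+1 0%N 0%N (ltn0Sn N)).
Qed.

(** * Stopped comparison of the solution with the scheme *)

Section stopped.
Variables (kappa delta : R) (N : nat).
Hypotheses (kappa0 : 0 <= kappa) (delta01 : 0 < delta <= 1).
Let tau_ := grid T N.+1.
Let h := T / N.+1%:R.
Let eta : R := N.+1%:R^-1.
Let Q := euler_residual N.
Let Yn := Y N.

Let h0 : 0 <= h. Proof. by rewrite divr_ge0// ltW. Qed.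

(* The error is stopped as soon as [X] leaves the ball of radius [kappa] or the
   residual exceeds [delta]: [X] itself has no moments to work with. *)
Fixpoint in_range n w : bool :=
  (if n is n'.+1 then in_range n' w else true) &&
  ((enorm (X (tau_ n) w) <= kappa) && (enorm (Q n w) <= delta)).

Let g n w : R := (in_range n w)%:R.
Let Xs n w := g n w *: X (tau_ n) w.
Let A n w := g n w *: (h *: mu (Xs n w) - tame mu h (Yn n w)).
Let B n w := g n w *: (sigma (Xs n w) - sigma (Yn n w)).

(** While in range this is X - Y - Q. Subtracting the residual Q leaves a recursion of the form
    [A + B *m D], and the factor g keeps it constant from the first step after the range has been
    left. *)
Fixpoint stopped_err n w : 'cV[R]_d :=
  if n is n'.+1 then (stopped_err n' w + A n' w) + B n' w *m D N n' w else 0.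

Lemma in_rangeP n w : in_range n w -> enorm (X (tau_ n) w) <= kappa /\ enorm (Q n w) <= delta.
Proof. by case: n => [|n] /=; [move=> /andP[]|move=> /andP[_ /andP[]]]. Qed.

Lemma in_range_prev n w : in_range n w -> if n is n'.+1 then in_range n' w else true.
Proof. by case: n => //= n /andP[]. Qed.

Lemma stopped_errE n w : (if n is n'.+1 then in_range n' w else true) ->
  stopped_err n w = X (tau_ n) w - Yn n w - Q n w.
Proof.
elim: n => [_|n IH /= gn].
  by rewrite /= /Q /euler_residual big_ord0 subr0 /Yn /= subrr.
rewrite (IH (in_range_prev gn)) /A /B /Xs /g gn !scale1r /Q /euler_residual !big_ord_recr /=.
rewrite -/(Yn n w) -/(tau_ n) -/(tau_ n.+1) -/h mulmxBl /D -/(tau_ n) -/(tau_ n.+1).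
have -> : Yn n.+1 w = Yn n w + tame mu h (Yn n w) + sigma (Yn n w) *m (W (tau_ n.+1) w - W (tau_ n) w) by [].
move: (\sum_(i < n) _) (_ *m _) (_ *m _) => S1 S2 S3.
by apply/matrixP => i j; rewrite !mxE; ring.
Qed.

Let tT n : (n <= N.+1)%N -> 0 <= tau_ n <= T. Proof. exact: grid_bounds. Qed.

Let sG n : (n <= N.+1)%N -> subalg (F (tau_ n)).
Proof. by have [sF _] := hF; move=> nN; apply: sF; exact: tT. Qed.

Let mono i n : (i <= n)%N -> (n <= N.+1)%N -> F (tau_ i) `<=` F (tau_ n).
Proof. by have [_ hD _ _ _] := hs N; move=> iin nN; apply: (chain_sub hD); rewrite iin nN. Qed.

Let msr_X i n j : (i <= n)%N -> (n <= N.+1)%N -> msr (F (tau_ n)) (fun w => X (tau_ i) w j 0).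
Proof.
move=> iin nN; apply: msr_sub (mono iin nN) _.
by apply: solution_msr; apply: tT; exact: leq_trans nN.
Qed.

Let msr_Q n : (n <= N.+1)%N -> forall i j, msr (F (tau_ n)) (fun w => Q n w i j).
Proof.
move=> nN i j; rewrite ord1 /Q /euler_residual; have [sFn _] := sG nN.
have -> : (fun w => (X (tau_ n) w - xi w - \sum_(l < n) ((T / N.+1%:R) *: mu (X (tau_ l) w)
    + sigma (X (tau_ l) w) *m (W (tau_ l.+1) w - W (tau_ l) w))) i 0) =
  (fun w => X (tau_ n) w i 0 - xi w i 0 - \sum_(l < n) ((T / N.+1%:R) * mu (X (tau_ l) w) i 0 +
    \sum_j sigma (X (tau_ l) w) i j * (W (tau_ l.+1) w - W (tau_ l) w) j 0)).
  apply/funext => w; rewrite mxE; congr (_ + _); first by rewrite !mxE.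
  by rewrite mxE summxE; congr (- _); apply: eq_bigr => l _; rewrite !mxE.
apply: measurable_funB; first apply: measurable_funB.
- exact: msr_X.
- have [_ _ _ hx _] := hs N; apply: msr_sub (LG_msr (hx i 0)).
  exact: (mono (i := 0%N)).
apply: measurable_sum => l; have ln : (l <= n)%N by exact: ltnW.
apply: measurable_funD.
  apply: measurable_funM => //; apply: (msr_cont (g := fun x => mu x i 0)) => // [|a b].
    have -> : (fun x => mu x i 0) = (fun A : 'cV[R]_d => A i 0) \o mu by [].
    by move=> x; apply: continuous_comp; [exact: cmu|exact: coord_continuous].
  by rewrite ord1; exact: msr_X.
apply: measurable_sum => a; apply: measurable_funM.
  apply: (@sigma_entry_msr (F (tau_ n)) (tau_ l) i a (sG nN)) => b; exact: msr_X.
have lN : (l < N.+1)%N by exact: leq_trans nN.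
have /andP[l0 _] := tT (ltnW lN); have /andP[_ lT] := tT lN.
apply: msr_sub (mono (ltn_ord l) nN) _.
apply: (incr_msr hF bW) => //; exact/ltW/grid_lt.
Qed.

Let LG_range n : (n <= N.+1)%N -> LG P (F (tau_ n)) (fun w =>
  (enorm (X (tau_ n) w) <= kappa)%R%:R * (enorm (Q n w) <= delta)%R%:R).
Proof.
move=> nN; have sGn := sG nN.
apply: (LGM sGn); apply: (LG_le P _ sGn); apply: (msr_enorm sGn); last exact: msr_Q.
by move=> i j; rewrite ord1; exact: msr_X.
Qed.

Let LG_g n : (n <= N.+1)%N -> LG P (F (tau_ n)) (g n).
Proof.
elim: n => [|n IH] nN; have sGn := sG nN.
  have -> : g 0 = (fun w => (enorm (X (tau_ 0) w) <= kappa)%R%:R * (enorm (Q 0 w) <= delta)%R%:R).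
    by apply/funext => w; rewrite /g /= -natrM mulnb.
  exact: LG_range.
have -> : g n.+1 = (fun w => g n w *
    ((enorm (X (tau_ n.+1) w) <= kappa)%R%:R * (enorm (Q n.+1 w) <= delta)%R%:R)).
  by apply/funext => w; rewrite /g /= -!natrM !mulnb.
apply: (LGM sGn); last exact: LG_range.
by apply: LG_sub (mono (leqnSn n) nN) _; exact/IH/ltnW.
Qed.

Let Xs_le n w : enorm (Xs n w) <= kappa.
Proof.
rewrite /Xs /g; case E: (in_range n w); last by rewrite scale0r enorm0.
by rewrite scale1r; have [] := in_rangeP E.
Qed.

Let VLG_Xs n : (n <= N.+1)%N -> VLG P (F (tau_ n)) (Xs n).
Proof.
move=> nN; apply: (VLG_dom (sG nN) _ (LG_cst P (F (tau_ n)) kappa)) => [i j|]; last exact: Xs_le.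
under eq_fun do rewrite mxE; apply: measurable_funM; first exact: LG_msr (LG_g nN).
by rewrite ord1; exact: msr_X.
Qed.

Let VLG_Yn n : (n <= N.+1)%N -> VLG P (F (tau_ n)) (Yn n).
Proof. exact: (VLG_tamed T0 K0 hmu hsig (hs N)). Qed.

Let M : R := K * (1 + kappa) ^+ k.
Definition node_cst : R := T * (4 * K + 2 * (M + 1) + T ^+ 2 + 2 * T * (M ^+ 2 + 1)) + 2 * K ^+ 2.
Let rho n w : R := (delta + eta) * (node_cst * (1 + enorm (mu (Yn n w))) ^+ 4).

Let M0 : 0 <= M. Proof. by rewrite mulr_ge0// exprn_ge0// addr_ge0. Qed.

Let node_cst_ge0 : 0 <= node_cst.
Proof.
have T0' := ltW T0.
by rewrite addr_ge0 ?mulr_ge0 ?addr_ge0 ?mulr_ge0 ?sqr_ge0 ?addr_ge0 ?sqr_ge0.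
Qed.

Let eta0 : 0 <= eta. Proof. by rewrite invr_ge0. Qed.
Let eta1 : eta <= 1. Proof. by rewrite invf_le1 ?ltr0n// ler1n. Qed.

Let muXs n w : enorm (mu (Xs n w)) <= M.
Proof.
apply: le_trans (gmu _) _; rewrite ler_wpM2l// lerXn2r ?nnegrE ?addr_ge0//.
by rewrite lerD2l.
Qed.

Let g_stopped n w : in_range n w -> [/\ g n w = 1, Xs n w = X (tau_ n) w,
  stopped_err n w = Xs n w - Yn n w - Q n w & enorm (Q n w) <= delta].
Proof.
move=> gn; have [_ Qd] := in_rangeP gn; rewrite /Xs /g gn scale1r; split => //.
exact/stopped_errE/in_range_prev.
Qed.

Let XsY n w : in_range n w -> enorm (Xs n w - Yn n w) ^+ 2 <=
  2 * enorm (stopped_err n w) ^+ 2 + 2 * delta ^+ 2.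
Proof.
move=> /g_stopped[_ _ Ez Qd].
have -> : Xs n w - Yn n w = stopped_err n w + Q n w by rewrite Ez subrK.
rewrite sqr_enormD; have q0 := enorm_ge0 (Q n w); have := le_mdot (stopped_err n w) (Q n w).
move: (enorm (stopped_err _ _)) (enorm (Q _ _)) (mdot _ _) q0 Qd => z q p q0 qd pzq.
have := sqr_ge0 (z - q); have : q ^+ 2 <= delta ^+ 2 by rewrite lerXn2r ?nnegrE// (le_trans q0).
by lra.
Qed.

(** The one-sided condition is available for x - y, but the error is x - y - Q. The additional inner
    product with Q is at most delta times the sizes of mu at both points, where |mu x| <= M by the
    stopping and mu y has moments. *)
Let A_bound n w : enorm (stopped_err n w + A n w) ^+ 2 <=
  (1 + (T * (4 * K + 1) + 2 * K ^+ 2) * eta) * enorm (stopped_err n w) ^+ 2 + eta * rho n w.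
Proof.
have T0' := ltW T0; have /andP[d0 d1] := delta01; have d0' := ltW d0.
have r0 : 0 <= rho n w by rewrite mulr_ge0 ?addr_ge0// mulr_ge0// exprn_ge0// addr_ge0.
have K2 := sqr_ge0 K.
case E: (in_range n w); last first.
  rewrite /A /g E scale0r addr0.
  have : 0 <= (T * (4 * K + 1) + 2 * K ^+ 2) * eta * enorm (stopped_err n w) ^+ 2.
    by rewrite !mulr_ge0 ?sqr_ge0// addr_ge0 ?mulr_ge0 ?addr_ge0// mulr_ge0.
  by have := mulr_ge0 eta0 r0; lra.
have [g1 _ Ez Qd] := g_stopped E; have XY := XsY E.
rewrite /A g1 scale1r; set a := h *: mu (Xs n w) - tame mu h (Yn n w).
set e := stopped_err n w in Ez XY *; set x := Xs n w in Ez XY a *; set y := Yn n w in Ez XY a *.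
set mY := enorm (mu y); have hx : enorm (mu x) <= M := muXs n w.
have mY0 : 0 <= mY := enorm_ge0 _.
have hE : h = T * eta by [].
pose r := h *: mu y - tame mu h y.
have r_le : enorm r <= h ^+ 2 * mY ^+ 2 by rewrite enormB; exact: tame_err.
have aE : a = h *: (mu x - mu y) + r by rewrite /a /r scalerBr addrA subrK.
have a_le : enorm a <= h * (M + mY).
  apply: le_trans (ler_enormB _ _) _; rewrite mulrDr lerD//.
    by rewrite enormZ ger0_norm// ler_wpM2l.
  exact: tame_le.
have ea : mdot e a <= h * (K * enorm (x - y) ^+ 2 + delta * (M + mY)) + enorm e * (h ^+ 2 * mY ^+ 2).
  rewrite aE mdotDr mdotZr; apply: lerD; last first.
    by apply: le_trans (le_mdot _ _) _; rewrite ler_wpM2l.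
  apply: ler_wpM2l => //; rewrite Ez mdotDl mdotNl; apply: lerD.
    by rewrite -dotpE; have [] := hmu x y.
  apply: le_trans (ler_norm _) _; rewrite normrN; apply: le_trans (le_norm_mdot _ _) _.
  apply: ler_pM => //; apply: le_trans (ler_enormB _ _) _; by rewrite lerD2r.
rewrite sqr_enormD.
set E2 := enorm e ^+ 2 in XY *; set S := (1 + mY) ^+ 4.
have S1 : 1 <= S by rewrite exprn_ege1// lerDl.
have SmY : mY <= S by apply: (@le_trans _ _ (1 + mY)); [rewrite lerDr|apply: ler_eXnr => //; rewrite lerDl].
have SmY4 : mY ^+ 4 <= S by rewrite lerXn2r ?nnegrE ?addr_ge0// lerDr.
have SmY2 : mY ^+ 2 <= S.
  apply: (@le_trans _ _ ((1 + mY) ^+ 2)); first by rewrite lerXn2r ?nnegrE ?addr_ge0// lerDr.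
  by apply: ler_weXn2l => //; rewrite lerDl.
have am : enorm a ^+ 2 <= h ^+ 2 * (2 * (M ^+ 2 + mY ^+ 2)).
  apply: (@le_trans _ _ ((h * (M + mY)) ^+ 2)).
    by rewrite lerXn2r ?nnegrE ?mulr_ge0 ?addr_ge0.
  by rewrite exprMn ler_wpM2l ?sqr_ge0//; have := sqr_ge0 (M - mY); lra.
have er : 2 * (enorm e * (h ^+ 2 * mY ^+ 2)) <= h * (E2 + h ^+ 2 * mY ^+ 4).
  have -> : 2 * (enorm e * (h ^+ 2 * mY ^+ 2)) = h * (2 * enorm e * (h * mY ^+ 2)) by ring.
  rewrite ler_wpM2l//; have := sqr_ge0 (enorm e - h * mY ^+ 2); rewrite /E2.
  by rewrite -[mY ^+ 4](_ : (mY ^+ 2) ^+ 2 = _); [lra|rewrite -exprM].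
set s := delta + eta; have s0 : 0 <= s by rewrite addr_ge0.
have ds : delta <= s by rewrite lerDl.
have es : eta <= s by rewrite lerDr.
have d2 : delta ^+ 2 <= s * S.
  apply: (@le_trans _ _ (delta * 1)); first by rewrite expr2 ler_wpM2l.
  exact: ler_pM.
have b2 : delta * (M + mY) <= s * ((M + 1) * S).
  apply: ler_pM => //; first by rewrite addr_ge0.
  by rewrite mulrDl mul1r lerD// ler_peMr.
have b3 : h ^+ 2 * mY ^+ 4 <= s * (T ^+ 2 * S).
  rewrite hE (_ : _ * _ = eta ^+ 2 * (T ^+ 2 * mY ^+ 4)); last by ring.
  apply: ler_pM; rewrite ?mulr_ge0 ?sqr_ge0 ?exprn_ge0//.
    by apply: le_trans es; rewrite expr2 ler_piMl.
  by rewrite ler_wpM2l ?sqr_ge0.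
have b4 : h * (2 * (M ^+ 2 + mY ^+ 2)) <= s * (2 * T * ((M ^+ 2 + 1) * S)).
  rewrite hE (_ : _ * (_ * _) = eta * (2 * T * (M ^+ 2 + mY ^+ 2))); last by ring.
  apply: ler_pM; rewrite ?mulr_ge0 ?addr_ge0 ?sqr_ge0//.
  apply: ler_wpM2l; first by rewrite mulr_ge0.
  rewrite mulrDl mul1r lerD// ler_peMr// sqr_ge0//.
have hXY := ler_wpM2l (mulr_ge0 h0 K0) XY.
have fin : E2 + 2 * mdot e a + enorm a ^+ 2 <= E2 + h * ((4 * K + 1) * E2) +
   h * (s * ((4 * K + 2 * (M + 1) + T ^+ 2 + 2 * T * (M ^+ 2 + 1)) * S)).
  have c1 := ler_wpM2l (mulr_ge0 h0 K0) d2; have c2 := ler_wpM2l h0 b2.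
  have c3 := ler_wpM2l h0 b3; have c4 := ler_wpM2l h0 b4.
  have c5 : h ^+ 2 * (2 * (M ^+ 2 + mY ^+ 2)) = h * (h * (2 * (M ^+ 2 + mY ^+ 2))) by ring.
  rewrite c5 in am; move: ea er am hXY c1 c2 c3 c4.
  move: (enorm (x - y) ^+ 2) (mdot e a) (enorm a ^+ 2) (enorm e * _) => XX EA AA EE.
  by move=> ea er am hXY c1 c2 c3 c4; lra.
apply: le_trans fin _; rewrite /rho -/s /node_cst -/mY -/S hE.
have F1 : 0 <= eta * (2 * K ^+ 2) * E2 by rewrite !mulr_ge0 ?sqr_ge0.
have F2 : 0 <= eta * (s * ((2 * K ^+ 2) * S)).
  have S0 : 0 <= S by exact: le_trans S1.
  by apply: mulr_ge0 => //; apply: mulr_ge0 => //; apply: mulr_ge0 => //; exact: mulr_ge0.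
by lra.
Qed.

Let B_bound n w : enorm (B n w) ^+ 2 <=
  (T * (4 * K + 1) + 2 * K ^+ 2) * enorm (stopped_err n w) ^+ 2 + rho n w.
Proof.
have T0' := ltW T0; have /andP[d0 d1] := delta01; have d0' := ltW d0.
have E0 := sqr_ge0 (enorm (stopped_err n w)); have K2 := sqr_ge0 K.
have S1 : 1 <= (1 + enorm (mu (Yn n w))) ^+ 4 by rewrite exprn_ege1// lerDl.
have r0 : 0 <= rho n w by rewrite mulr_ge0 ?addr_ge0// mulr_ge0// exprn_ge0// addr_ge0.
have t0 : 0 <= T * (4 * K + 1) by rewrite mulr_ge0// addr_ge0// mulr_ge0.
case E: (in_range n w); last first.
  rewrite /B /g E scale0r enorm0 expr0n /= addr_ge0// mulr_ge0// addr_ge0// mulr_ge0//.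
have [g1 _ Ez Qd] := g_stopped E; have XY := XsY E.
rewrite /B g1 scale1r.
apply: (@le_trans _ _ ((K * enorm (Xs n w - Yn n w)) ^+ 2)).
  by rewrite lerXn2r ?nnegrE ?mulr_ge0.
have rl : 2 * K ^+ 2 * delta ^+ 2 <= rho n w.
  rewrite /rho mulrC; apply: ler_pM; rewrite ?sqr_ge0 ?mulr_ge0//.
    by apply: (@le_trans _ _ delta); [rewrite expr2 ler_piMl|rewrite lerDl].
  have nk : 2 * K ^+ 2 <= node_cst.
    by rewrite /node_cst lerDr mulr_ge0// !addr_ge0 ?mulr_ge0 ?addr_ge0 ?sqr_ge0.
  by apply: le_trans nk _; rewrite ler_peMr.
rewrite exprMn; have := ler_wpM2l K2 XY; have := mulr_ge0 t0 E0; move: rl.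
by move: (rho n w) (enorm _ ^+ 2) (enorm _ ^+ 2) => r z x; lra.
Qed.

Let VLG_A n : (n < N.+1)%N -> VLG P (F (tau_ n)) (stopped_err n) ->
  VLG P (F (tau_ n)) (fun w => stopped_err n w + A n w).
Proof.
move=> nN hZ; have nN' := ltnW nN; have sGn := sG nN'.
apply: (VLGD sGn) => //; apply: (VLGZ sGn (LG_g nN')); apply: (VLGB sGn).
  by apply: (VLGZc sGn); apply: (VLG_comp sGn (lip_mu K0 hmu)); exact: VLG_Xs.
by apply: (VLG_comp sGn (lip_tame K0 hmu h0)); exact: VLG_Yn.
Qed.

Let VLG_B n : (n < N.+1)%N -> VLG P (F (tau_ n)) (stopped_err n) -> VLG P (F (tau_ n)) (B n).
Proof.
move=> nN _; have nN' := ltnW nN; have sGn := sG nN'.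
apply: (VLGZ sGn (LG_g nN')); apply: (VLGB sGn).
  by apply: (VLG_comp sGn (lip_sigma K0 hsig)); exact: VLG_Xs.
by apply: (VLG_comp sGn (lip_sigma K0 hsig)); exact: VLG_Yn.
Qed.

Let VLG0 : VLG P (F (tau_ 0)) (stopped_err 0).
Proof. by apply: VLG_cst; exact: sG. Qed.

Lemma LG_stopped_err n : (n <= N.+1)%N -> LG P measurable (fun w => enorm (stopped_err n w)).
Proof.
move=> nN; apply: LG_sub (proj2 (sG nN)) _; apply: (LG_enorm (sG nN)).
have [_ hD sG0 _ _] := hs N.
exact: (VLG_rec hD VLG0 (fun _ _ _ => erefl) VLG_A VLG_B).
Qed.

Definition stopped_cst : R := rec_cst C (T * (4 * K + 1) + 2 * K ^+ 2) 1.

Lemma stopped_err_moment cY n : (n <= N.+1)%N ->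
  (forall i, (i < N.+1)%N -> Ex P (fun w => (1 + enorm (mu (Yn i w))) ^+ 4) <= cY) ->
  Ex P (fun w => enorm (stopped_err n w) ^+ 2) <=
  expR stopped_cst * (stopped_cst * (node_cst * cY)) * (delta + eta).
Proof.
move=> nN hcY; have [_ hD sG0 _ _] := hs N; have /andP[d0 _] := delta01.
have K2 := sqr_ge0 K; have T0' := ltW T0.
have c0 : 0 <= T * (4 * K + 1) + 2 * K ^+ 2 by rewrite !(mulr_ge0, addr_ge0).
have s0 : 0 <= step_cst C 1 by rewrite /step_cst addr_ge0 ?mulr_ge0 ?exprn_ge0 ?addr_ge0.
have st0 : 0 <= stopped_cst.
  have p0 := perturb_cst_ge0 1 c0.
  by rewrite /stopped_cst /rec_cst; have := mulr_ge0 s0 p0; lra.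
have hr i : (i < N.+1)%N -> LG P (F (tau_ i)) (rho i).
  move=> iN; have sGi := sG (ltnW iN); apply: (LGZ sGi); apply: (LGZ sGi); apply: LG_pow.
  apply: (LGD sGi); first exact: LG_cst.
  apply: (LG_enorm sGi); apply: (VLG_comp sGi (lip_mu K0 hmu)); exact/VLG_Yn/ltnW.
have rho0 i w : 0 <= rho i w.
  by rewrite mulr_ge0 ?addr_ge0 ?(ltW d0)// mulr_ge0// exprn_ge0// addr_ge0.
have := rec_moment (ltn0Sn N) C0 hD sG0 VLG0 (fun _ _ _ => erefl) VLG_A VLG_B 1 c0 hr rho0
  (fun n w _ => A_bound n w) (fun n w _ => B_bound n w) nN.
rewrite muln1 => /le_trans; apply; rewrite -!mulrA ler_wpM2l ?expR_ge0//.
under eq_Ex do rewrite /= enorm0 expr0n /=.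
rewrite (Ex_cst P 0) add0r; apply: (@sum_eta_le R N.+1 n (fun i => stopped_cst * Ex P (fun w => rho i w ^+ 1)) _ nN) => [|i iN].
  have cY0 : 0 <= cY by apply: le_trans (hcY 0%N _) => //; apply: Ex_ge0 => w; rewrite exprn_ge0// addr_ge0.
  have s1 := addr_ge0 (ltW d0) eta0.
  by apply: mulr_ge0 => //; apply: mulr_ge0 => //; exact: mulr_ge0.
rewrite -/stopped_cst ler_wpM2l//; have sGi := sG (ltnW iN).
under eq_Ex do rewrite expr1.
rewrite /rho (ExZ sGi); last first.
  apply: (LGZ sGi); apply: LG_pow; apply: (LGD sGi); first exact: LG_cst.
  apply: (LG_enorm sGi); apply: (VLG_comp sGi (lip_mu K0 hmu)); exact/VLG_Yn/ltnW.
rewrite (ExZ sGi); last first.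
  apply: LG_pow; apply: (LGD sGi); first exact: LG_cst.
  apply: (LG_enorm sGi); apply: (VLG_comp sGi (lip_mu K0 hmu)); exact/VLG_Yn/ltnW.
rewrite mulrC [leRHS]mulrA; apply: ler_wpM2r; first by rewrite addr_ge0// ltW.
by apply: ler_wpM2l => //; exact: hcY.
Qed.

End stopped.
Let nodes_moment : exists2 c, 0 <= c & forall N i, (i <= N.+1)%N ->
  Ex P (fun w => (1 + enorm (mu (Y N i w))) ^+ 4) <= c.
Proof.
have [c c0 H] := tamed_moment P T0 K0 hmu hsig gmu gsig C0 Cx0 (k * 2).
pose c1 := K ^+ (2 * 2) * (2 ^+ (2 * (k * 2)) * (1 + c)).
have c10 : 0 <= c1 by rewrite !mulr_ge0 ?exprn_ge0 ?addr_ge0.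
exists (2 ^+ 4 * (1 + c1)); first by rewrite mulr_ge0 ?exprn_ge0 ?addr_ge0.
move=> N i iN; have [_ hD sG0 _ _] := hs N; have sG := chain_subalg hD sG0 iN.
have hY := VLG_tamed T0 K0 hmu hsig (hs N) iN.
have hm : LG P (F (grid T N.+1 i)) (fun w => enorm (mu (Y N i w))).
  by apply: (LG_enorm sG); apply: (VLG_comp sG (lip_mu K0 hmu)).
have := moment_poly (f := fun y => enorm (mu y)) K0 sG hY (fun w => enorm_ge0 _) hm gmu (H _ _ _ _ (hs N) _ iN).
have h1 : LG P (F (grid T N.+1 i)) (cst (1 : R)) by exact: LG_cst.
move=> mom; apply: (@le_trans _ _ (Ex P (fun w => 2 ^+ 4 * (1 + enorm (mu (Y N i w)) ^+ 4)))).
  apply: (Ex_le sG).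
  - by apply: LG_pow; exact: (LGD sG).
  - by apply: (LGZ sG); apply: (LGD sG) => //; exact: LG_pow.
  - by move=> w; have := pow2D 4 ler01 (enorm_ge0 (mu (Y N i w))); rewrite expr1n.
rewrite (ExZ sG) ?(ExD sG) ?Ex_cst//; [|exact: LG_pow|by apply: (LGD sG) => //; exact: LG_pow].
by rewrite ler_wpM2l ?exprn_ge0// lerD2l.
Qed.

Lemma node_convergence e eta : 0 < e -> 0 < eta -> exists N0, forall N n, (N0 <= N)%N ->
  (n <= N.+1)%N -> small P [set w | e <= enorm (X (grid T N.+1 n) w - Y N n w)] eta.
Proof.
move=> e0 eta0; have eta3 : 0 < eta / 3 by rewrite divr_gt0.
have e2 : 0 < e / 2 by rewrite divr_gt0.
have [kappa kappa0 hkappa] := small_bounded P T0 cX mX eta3.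
have [cY cY0 hcY] := nodes_moment.
pose L := `|expR stopped_cst * (stopped_cst * (node_cst kappa * cY))| + 1.
have L0 : 0 < L by rewrite ltr_wpDl.
(* The moment bound becomes 2 L b, from delta <= b and 1/(N+1) <= b; Markov's inequality divides it
   by (e/2)^2, which makes eta/3. *)
pose b := eta / 6 * (e / 2) ^+ 2 / L.
have b0 : 0 < b by rewrite divr_gt0 ?mulr_gt0 ?divr_gt0 ?exprn_gt0.
pose delta := Num.min 1 (Num.min (e / 2) b).
have d0 : 0 < delta by rewrite !lt_min ltr01 e2 b0.
have d1 : delta <= 1 by rewrite ge_min lexx.
have d2 : delta <= e / 2 by rewrite !ge_min lexx orbT.
have d3 : delta <= b by rewrite !ge_min lexx !orbT.
have d01 : 0 < delta <= 1 by rewrite d0.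
have [N1 hN1] := residual_small d0 eta3.
exists (maxn N1 (Num.truncn b^-1)) => N n; rewrite geq_max => /andP[NN1 Nb] nN.
have etab : N.+1%:R^-1 <= b.
  rewrite invf_ple ?posrE ?ltr0n//; apply/ltW/(lt_le_trans (truncnS_gt _)).
  by rewrite ler_nat ltnS.
have mom := stopped_err_moment kappa0 d01 nN (fun i iN => hcY N i (ltnW iN)).
have hZ : LG P measurable (fun w => enorm (stopped_err kappa delta N n w)) by exact: LG_stopped_err.
have {}mom : Ex P (fun w => enorm (stopped_err kappa delta N n w) ^+ 2) <= 2 * (L * b).
  apply: le_trans mom _; apply: (@le_trans _ _ (L * (delta + N.+1%:R^-1))).
    apply: ler_wpM2r; first by rewrite addr_ge0 ?(ltW d0)// invr_ge0.
    by apply: le_trans (ler_norm _) _; rewrite lerDl.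
  by apply: le_trans (ler_wpM2l (ltW L0) (lerD d3 etab)) _; rewrite mulrDr [2 * _]mulr_natl mulr2n.
have hm := small_markov hZ e2 mom.
have E3 : 2 * (L * b) / (e / 2) ^+ 2 = eta / 3 by rewrite /b; field; rewrite !gt_eqF.
rewrite E3 in hm; have := smallU (smallU hkappa (hN1 N NN1)) hm.
rewrite (_ : _ + _ + _ = eta); last by field.
apply: small_sub => w /= hw.
have [hk|hk] := pselect (exists2 t, 0 <= t <= T & kappa < enorm (X t w)); first by left; left.
have [hq|hq] := pselect (exists2 n, (n <= N.+1)%N & delta <= enorm (euler_residual N n w)).
  by left; right.
right; have good i : (i <= N.+1)%N -> (enorm (X (grid T N.+1 i) w) <= kappa) &&
    (enorm (euler_residual N i w) <= delta).
  move=> iN; apply/andP; split; rewrite leNgt; apply/negP => h.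
    by apply: hk; exists (grid T N.+1 i) => //; exact: grid_bounds.
  by apply: hq; exists i => //; exact: ltW.
have rng i : (i <= N.+1)%N -> in_range kappa delta N i w.
  by elim: i => [|i IH] iN /=; rewrite good ?andbT//; exact/IH/ltnW.
have Qn : enorm (euler_residual N n w) <= delta by have /andP[] := good n nN.
rewrite stopped_errE; last by case: (n) nN => //= i iN; exact/rng/ltnW.
have := ler_enormD (X (grid T N.+1 n) w - Y N n w - euler_residual N n w)
  (euler_residual N n w).
by rewrite subrK /Y; move: hw; rewrite /Y; lra.
Qed.

(** * Convergence of whole paths and the bias *)

Variables (c : R) (f : (R -> 'cV[R]_d) -> R).
Hypotheses (c0 : 0 <= c) (hf : forall v w : R -> 'cV[R]_d,
    {within `[0, T], continuous v} -> {within `[0, T], continuous w} ->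
    `|f v - f w| <=
      c * (1 + supnorm T v `^ c + supnorm T w `^ c)
        * supnorm T (fun t => v t - w t)).
(** Constant families: all levels are driven by the same motion, so that their paths can be compared
    with each other and with X on one trajectory. *)
Let Wc (_ _ : nat) := W.
Let xc (_ _ : nat) := xi.
Let bWc (l j : nat) : standard_brownian P T F (Wc l j) := bW.
Let hxc (l j : nat) : VLG P (F 0) (xc l j) := hxi.
Let mxc (l j r : nat) : Ex P (fun w => enorm (xc l j w) ^+ (2 * r)) <= Cx r := mxi r.

Let v l w := interp T (2 ^ l) (copy_nodes T mu sigma (2 ^ l) (copy_of T (2 ^ l) xi W w)).
Let G l := path_gap K mu sigma T0 hF bWc hxc mxc (l, 0%N).
Let df l w := f (v l.+1 w) - f (v l w).

Let pow_gt0 l : (0 < 2 ^ l)%N. Proof. by rewrite expn_gt0. Qed.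

Let cv l w : {within `[0, T], continuous (v l w)}.
Proof. by apply: interp_continuous. Qed.

Let LG_fv l : LG P measurable (fun w => f (v l w)).
Proof. exact: (LG_path T0 hF K0 hmu hsig c0 hf bWc hxc mxc 0 0 (pow_gt0 l)). Qed.

Let vG l w t : 0 <= t <= T -> enorm (v l.+1 w t - v l w t) <= G l w.
Proof.
move=> tT; have := path_gapP mu T0 hF K0 gsig bWc hxc mxc (l, 0%N) w tT.
by rewrite /v expnS mul2n.
Qed.

Let G_ge0 l w : 0 <= G l w.
Proof. by apply: le_trans (enorm_ge0 _) (@vG l w 0 _); rewrite lexx ltW. Qed.

Lemma Ex_norm_le (g : Omega -> R) s : LG P measurable g -> 0 <= s ->
  Ex P (fun w => g w ^+ 2) <= s ^+ 2 -> Ex P (fun w => `|g w|) <= s.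
Proof.
move=> hg s0 gs; have h1 : LG P measurable (cst (1 : R)) by exact: LG_cst.
rewrite -(ler_pXn2r (n := 2))// ?nnegrE//; last exact: Ex_ge0.
apply: le_trans gs; have := Ex_CS sM h1 (LG_norm hg).
under eq_Ex do rewrite mul1r.
under [X in _ <= X * _]eq_Ex do rewrite expr1n.
rewrite (Ex_cst P 1) mul1r; under [X in _ <= X]eq_Ex do rewrite real_normK ?num_real//.
by [].
Qed.

Let OL_rate (g : nat * nat -> Omega -> R) : OL P (leta' R) 1 g ->
  exists2 b, 0 <= b & forall l, Ex P (fun w => `|g (l, 0%N) w|) <= b * level_rate R l.
Proof.
move=> [hg /(_ 1%N)[b b0 H]]; exists (Num.sqrt b); first exact: sqrtr_ge0.
move=> l; apply: Ex_norm_le; rewrite ?mulr_ge0 ?sqrtr_ge0//.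
by rewrite exprMn sqr_sqrtr// sqr_level_rate; have := H (l, 0%N); rewrite muln1 mul1n expr1.
Qed.

Let G_rate : exists2 b, 0 <= b & forall l, Ex P (G l) <= b * level_rate R l.
Proof.
have [b b0 H] := OL_rate (OL_path_gap T0 hF K0 hmu hsig gmu gsig bWc hxc Cx0 mxc).
exists b => // l; apply: le_trans (H l); rewrite le_eqVlt; apply/orP; left; apply/eqP.
by apply: eq_Ex => w; rewrite ger0_norm// G_ge0.
Qed.

Let LG_G l : LG P measurable (G l).
Proof. by have [h _] := OL_path_gap T0 hF K0 hmu hsig gmu gsig bWc hxc Cx0 mxc; exact: h. Qed.

Let D_rate : exists2 b, 0 <= b & forall l, Ex P (fun w => `|df l w|) <= b * level_rate R l.
Proof.
have [b b0 H] := OL_rate (OL_level_diff T0 hF K0 hmu hsig gmu gsig c0 hf bWc hxc Cx0 mxc).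
exists b => // l; apply: le_trans (H l); rewrite le_eqVlt; apply/orP; left; apply/eqP.
by apply: eq_Ex => w; rewrite /df /level_diff /v expnS mul2n.
Qed.

Let vG_sum l n w t : 0 <= t <= T ->
  enorm (v l w t - v (l + n) w t) <= \sum_(l <= j < l + n) G j w.
Proof.
move=> tT; elim: n => [|n IH]; first by rewrite addn0 subrr enorm0 big_geq.
rewrite addnS big_nat_recr /= ?leq_addr// -(subrKA (v (l + n) w t)).
by apply: le_trans (ler_enormD _ _) _; apply: lerD => //; rewrite enormB; exact: vG.
Qed.

Let msr_v l t i : 0 <= t <= T -> msr measurable (fun w => v l w t i 0).
Proof.
move=> tT; have [n [x [nN _ _ E]]] := interp_conv T0 (pow_gt0 l) (fun=> 0 : 'cV[R]_d) tT.
have ht := tsetup_incs T0 hF bWc hxc mxc 0 0 (pow_gt0 l).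
have hn n' : (n' <= 2 ^ l)%N ->
    msr measurable (fun w => copy_nodes T mu sigma (2 ^ l) (copy_of T (2 ^ l) xi W w) n' i 0).
  move=> n'N; have [_ hD sG0 _ _] := ht; have [_ sub] := chain_subalg hD sG0 n'N.
  have h := LG_msr (VLG_tamed T0 K0 hmu hsig ht n'N i 0).
  apply: msr_sub sub _; move: h; congr (msr _ _).
  by apply/funext => w; rewrite -(nodes_tamed T mu sigma Wc xc (2 ^ l) 0 0).
have mE (y z : R) (A B : 'cV[R]_d) : (y *: A + z *: B) i 0 = y * A i 0 + z * B i 0 by rewrite !mxE.
under eq_fun do rewrite /v E mE.
apply: measurable_funD; apply: measurable_funM => //; apply: hn => //.
exact: ltnW.
Qed.

Let interp_node l n w : (n <= 2 ^ l)%N ->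
  v l w (grid T (2 ^ l) n) = copy_nodes T mu sigma (2 ^ l) (copy_of T (2 ^ l) xi W w) n.
Proof.
have Nr : (2 ^ l)%:R != 0 :> R by rewrite pnatr_eq0 -lt0n.
have E : grid T (2 ^ l) n * (2 ^ l)%:R / T = n%:R by rewrite /grid divfK// mulfK// gt_eqF.
rewrite leq_eqVlt => /orP[/eqP nE|nN].
  case: n nE E => [nE|n nE E]; first by have := pow_gt0 l; rewrite -nE.
  rewrite /v (interpE _ (n := n)) ?E; [|by rewrite -nE|by rewrite lexx ler_nat leqnSn].
  by rewrite subrr scale0r addr0 -natr1 addrC addKr scale1r.
rewrite /v (interpE _ nN) ?E; last by rewrite lexx ler_nat leqnSn.
by rewrite subrr scale0r add0r -natr1 addrC addKr scale1r.
Qed.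

(** Convergence at nodes comes without a rate and may be summed only over a fixed number of nodes.
    The moduli of X and of the path of level l fix a grid with 2^a steps; at its nodes a much finer
    level l' is close to X, and the summed gaps G lead from l to l', with a bound that depends on l
    alone. *)
Lemma path_convergence e eta : 0 < e -> 0 < eta -> exists L, forall l, (L <= l)%N ->
  small P [set w | exists2 t, 0 <= t <= T & 4 * e <= enorm (v l w t - X t w)] eta.
Proof.
move=> e0 eta0; have eta4 : 0 < eta / 4 by rewrite divr_gt0.
have [b b0 hb] := G_rate.
have b1 : 0 < 8 * b + 1 by rewrite ltr_wpDl// mulr_ge0.
have [L hL] := level_rate_small (divr_gt0 (mulr_gt0 eta4 e0) b1).
exists L => l Ll.
have [N1 hN1] := small_modulus P T0 cX mX e0 eta4.
have [N2 hN2] := small_modulus P (Z := fun t w => v l w t) T0 (@cv l) (@msr_v l) e0 eta4.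
pose a := maxn N1 N2.
(* The convergence lemmas speak of grids with N + 1 steps, so powers of 2 are written as
   successors. *)
have aE : ((2 ^ a).-1.+1 = 2 ^ a)%N by rewrite prednK.
have ageq n : (n <= a)%N -> (n <= (2 ^ a).-1)%N.
  by move=> na; rewrite -ltnS aE; apply: leq_ltn_trans na _; exact: ltn_expl.
have {hN1} := hN1 _ (ageq _ (leq_maxl _ _)); have {hN2} := hN2 _ (ageq _ (leq_maxr _ _)).
rewrite aE => h2 h1.
pose eta2 := eta / (4 * (2 ^ a).+1%:R).
have eta20 : 0 < eta2 by rewrite divr_gt0// mulr_gt0// ltr0n.
have [N3 hN3] := node_convergence e0 eta20.
(* Beyond a, so that the nodes of the grid 2^a are nodes of the grid 2^l'; beyond N3, so that
   [node_convergence] is in force. *)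
pose l' := (l + maxn a N3)%N.
have l'E : ((2 ^ l').-1.+1 = 2 ^ l')%N by rewrite prednK.
have N3l : (N3 <= (2 ^ l').-1)%N.
  rewrite -ltnS l'E; apply: (@leq_ltn_trans l'); last exact: ltn_expl.
  by apply: leq_trans (leq_maxr a N3) _; exact: leq_addl.
have al : (a <= l')%N by apply: leq_trans (leq_maxl a N3) _; exact: leq_addl.
have hnode i : (i < (2 ^ a).+1)%N -> small P [set w | e <= enorm (X (grid T (2 ^ a) i) w - v l' w (grid T (2 ^ a) i))] eta2.
  rewrite ltnS => ia; pose i' := (i * 2 ^ (l' - a))%N.
  have E : grid T (2 ^ a) i = grid T (2 ^ l') i'.
    rewrite /grid /i' -{2}(subnKC al) expnD !natrM; field.
    by rewrite !pnatr_eq0 -!lt0n !pow_gt0.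
  have i'N : (i' <= 2 ^ l')%N by rewrite -(subnKC al) expnD /i' leq_mul2r ia orbT.
  rewrite E; have := hN3 _ i' N3l; rewrite /Y /D l'E => /(_ i'N); apply: small_sub => w /=.
  by rewrite interp_node// (nodes_tamed T mu sigma Wc xc (2 ^ l') 0 0 w i').
have h3 := small_bigcup (ltW eta20) hnode.
pose S w := \sum_(l <= j < l + maxn a N3) G j w.
have hS : LG P measurable S by apply: (LG_sum sM) => j _; exact: LG_G.
have ES : Ex P S <= eta / 4 * e.
  rewrite (Ex_sum sM) => [|j _]; last exact: LG_G.
  apply: (@le_trans _ _ (b * \sum_(l <= j < l + maxn a N3) level_rate R j)).
    by rewrite mulr_sumr; apply: ler_sum => j _; exact: hb.
  apply: (@le_trans _ _ (b * (8 * level_rate R l))); first by rewrite ler_wpM2l// sum_level_rate.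
  have := hL l Ll; rewrite ler_pdivlMr// => h; apply: le_trans h.
  by have := level_rate_ge0 R l; lra.
have S0 w : 0 <= S w by apply: sumr_ge0.
have := small_markov1 hS S0 e0 ES; rewrite mulfK ?gt_eqF// => h4.
have := smallU (smallU (smallU h1 h2) h3) h4.
have -> : eta / 4 + eta / 4 + (2 ^ a).+1%:R * eta2 + eta / 4 = eta.
  rewrite /eta2; have : (2 ^ a).+1%:R != 0 :> R by rewrite pnatr_eq0.
  by move: ((2 ^ a).+1%:R : R) => x x0; field.
apply: small_sub => w /= [s sT hv].
have [g1|g1] := pselect (mod_event T X (2 ^ a) e w); first by do 3!left.
have [g2|g2] := pselect (mod_event T (fun t w => v l w t) (2 ^ a) e w); first by do 2!left; right.
have [g3|g3] := pselect (exists2 i, (i < (2 ^ a).+1)%N &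
  e <= enorm (X (grid T (2 ^ a) i) w - v l' w (grid T (2 ^ a) i))); first by left; right.
right; have [n nN /andP[n1 n2]] := interp_ex T0 (pow_gt0 a) sT.
pose t := grid T (2 ^ a) n; have tT : 0 <= t <= T by apply: grid_bounds => //; exact: ltnW.
have Nr : 0 < (2 ^ a)%:R :> R by rewrite ltr0n.
have st : `|s - t| <= T / (2 ^ a)%:R.
  have E : s = s * (2 ^ a)%:R / T * T / (2 ^ a)%:R by field; rewrite !gt_eqF.
  have ts : t <= s by rewrite E /t /grid !ler_pM2r ?invr_gt0.
  rewrite ger0_norm ?subr_ge0// lerBlDl (_ : t + _ = n.+1%:R * T / (2 ^ a)%:R).
    by rewrite E !ler_pM2r ?invr_gt0.
  by rewrite /t /grid -natr1; ring.
have {}g1 : enorm (X s w - X t w) <= e by rewrite leNgt; apply/negP => h; apply: g1; exists s, t.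
have {}g2 : enorm (v l w s - v l w t) <= e by rewrite leNgt; apply/negP => h; apply: g2; exists s, t.
have {}g3 : enorm (X t w - v l' w t) <= e.
  by rewrite leNgt; apply/negP => h; apply: g3; exists n; [exact: leqW|exact: ltW].
have g4 : enorm (v l w t - v l' w t) <= S w by exact: vG_sum.
move: hv g1 g2 g3 g4; rewrite (enormB (X s w) (X t w)) (enormB (X t w) (v l' w t)).
move: (v l w s) (v l w t) (v l' w t) (X t w) (X s w) => a1 a2 a3 a4 a5.
have := ler_enormD (a1 - a2 + (a2 - a3)) (a3 - a4 + (a4 - a5)).
have := ler_enormD (a1 - a2) (a2 - a3); have := ler_enormD (a3 - a4) (a4 - a5).
by rewrite !subrKA => *; lra.
Qed.

Let msr_fX : msr measurable (fun w => f (X ^~ w)).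
Proof.
apply: (msr_functional T0 c0 hf (Z := fun w t => X t w)) => //; exact: sigma_algebra_measurable.
Qed.

Let fv_dist n k' w : `|f (v (n + k') w) - f (v n w)| <= \sum_(n <= j < n + k') `|df j w|.
Proof.
elim: k' => [|k' IH]; first by rewrite addn0 subrr normr0 big_geq.
rewrite addnS big_nat_recr /= ?leq_addr// -(subrKA (f (v (n + k') w))) addrC.
by apply: le_trans (ler_normD _ _) _; exact: lerD.
Qed.

(** Borel-Cantelli: along levels chosen with exceptional probabilities 2^-(i+1), the paths converge
    uniformly almost surely, and f is continuous along them. *)
Let subsequence : exists L : nat -> nat, (forall i, (i <= L i)%N) /\
  \forall w \ae P, f (v (L i) w) @[i --> \oo] --> f (X ^~ w).
Proof.
have e0 (i : nat) : 0 < 2^-1 ^+ i.+1 :> R by rewrite exprn_gt0.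
have /choice[L HL] : forall i : nat, exists l : nat, (i <= l)%N /\
    small P [set w | exists2 t, 0 <= t <= T & 4 * 2^-1 ^+ i.+1 <= enorm (v l w t - X t w)] (2^-1 ^+ i.+1).
  move=> i; have [L HL] := path_convergence (e0 i) (e0 i).
  by exists (maxn i L); split; [exact: leq_maxl|apply: HL; exact: leq_maxr].
exists L; split=> [i|]; first by have [] := HL i.
have /choice[B HB] : forall i, exists B, [/\ measurable B,
    [set w | exists2 t, 0 <= t <= T & 4 * 2^-1 ^+ i.+1 <= enorm (v (L i) w t - X t w)] `<=` B &
    (P B <= (2^-1 ^+ i.+1)%:E)%E] by move=> i; have [] := HL i.
have null : P (lim_sup_set B) = 0%E.
  apply: lim_sup_set_cvg0 => [i|]; first by have [] := HB i.
  apply: (@le_lt_trans _ _ 1%E); last exact: ltry.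
  apply: (@le_trans _ _ (\sum_(i <oo) (1 / (2 ^ i.+1)%:R)%:E)%E); last exact: epsilon_trick0.
  apply: lee_nneseries => [i _|i _]; first by move=> *; exact: measure_ge0.
  by have [_ _] := HB i; rewrite div1r natrX exprVn.
have mB : measurable (lim_sup_set B).
  by apply: bigcapT_measurable => i; apply: bigcup_measurable => j _; have [] := HB j.
exists (lim_sup_set B); split => // w /= nf n _; apply: contrapT => hn; apply: nf.
have far i : (n <= i)%N -> forall t, 0 <= t <= T -> enorm (v (L i) w t - X t w) <= 4 * 2^-1 ^+ i.+1.
  move=> ni t tT; rewrite leNgt; apply/negP => h; apply: hn; exists i => //.
  by have [_ sub _] := HB i; apply: sub; exists t => //; exact: ltW.
have [M M0 hM] := cpath_bounded (@cX w).
apply/cvgrPdist_le => e e1.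
pose q := 3 * c * (1 + (M + 4) + M) ^+ (Num.truncn c).+1 * 4 + 1.
have q0 : 0 < q by rewrite ltr_wpDl// !mulr_ge0 ?exprn_ge0 ?addr_ge0.
have h1 : `|2^-1 : R| < 1 by rewrite ger0_norm ?invr_ge0//; lra.
have := cvg_geometric 1 h1 => /cvgrPdist_le /(_ _ (divr_gt0 e1 q0))[N0 _ HN].
exists (maxn n N0) => // i /=; rewrite geq_max => /andP[ni Ni].
have x1 : 2^-1 ^+ i.+1 <= 1 :> R by rewrite exprn_ile1// invf_le1// ler1n.
have := HN i.+1 (leqW Ni); rewrite /geometric /= sub0r normrN mul1r ger0_norm ?exprn_ge0// => hx.
rewrite distrC; apply: (@le_trans _ _ (q * 2^-1 ^+ i.+1)); last first.
  by rewrite mulrC -ler_pdivlMr.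
apply: (@le_trans _ _ (3 * c * (1 + (M + 4) + M) ^+ (Num.truncn c).+1 * (4 * 2^-1 ^+ i.+1))).
  apply: (functional_boundP T0 c0 hf); [exact: cv|exact: cX| |exact: hM|exact: far].
  move=> t tT; have := ler_enormD (v (L i) w t - X t w) (X t w); rewrite subrK.
  by have := far i ni t tT; have := hM t tT; lra.
by rewrite mulrA ler_wpM2r ?exprn_ge0// lerDl.
Qed.

(** |f(v_0)| plus the sum of all |df j| is integrable by summability of the level rates and
    dominates every f(v_l). Dominated convergence along the subsequence gives finiteness of E f(X)
    and its value as a limit; the bias at n is then at most a tail of the series. *)
Lemma bias_bound : exists e b : R, [/\ 0 <= b,
  (\int[P]_w (f (X ^~ w))%:E = e%:E)%E &
  forall n, (e - Ex P (fun w => f (v n w))) ^+ 2 <= b * (n.+1%:R / 2 ^+ n)].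
Proof.
have [b b0 hb] := D_rate; have [L [Li cL]] := subsequence.
have hD l : LG P measurable (fun w => `|df l w|) by apply: LG_norm; exact: (LGB sM).
pose g w : \bar R := (`|f (v 0 w)|%:E + \sum_(j <oo) `|df j w|%:E)%E.
have mD l : measurable_fun setT (fun w => `|df l w|%:E).
  by apply/measurable_EFinP; exact: msr_measurable_fun sM (LG_msr (hD l)).
have ig : P.-integrable setT g.
  apply: integrableD => //; first exact: (LG_integrable sM (LG_norm (LG_fv 0))).
  apply/integrableP; split.
    by apply: ge0_emeasurable_sum.
  under eq_integral do rewrite gee0_abs ?nneseries_ge0//.
  rewrite integral_nneseries//.
  apply: (@le_lt_trans _ _ (b * (8 * level_rate R 0))%:E); last exact: ltry.
  apply: lime_le; first by apply: is_cvg_nneseries => j _ _; exact: integral_ge0.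
  apply: nearW => n; under eq_bigr do rewrite (Ex_EFin sM (hD _)).
  rewrite sumEFin lee_fin; apply: (@le_trans _ _ (b * \sum_(0 <= j < n) level_rate R j)).
    by rewrite mulr_sumr; apply: ler_sum.
  by rewrite ler_wpM2l//; exact: (sum_level_rate R 0 n).
have fg l w : (`|(f (v l w))%:E| <= g w)%E.
  apply: (@le_trans _ _ (`|f (v 0 w)| + \sum_(0 <= j < l) `|df j w|)%:E).
    rewrite lee_fin -(subrK (f (v 0 w)) (f (v l w))) addrC.
    by apply: le_trans (ler_normD _ _) _; rewrite lerD2l; exact: (fv_dist 0 l w).
  by rewrite EFinD -sumEFin leeD2l//; exact: nneseries_lim_ge.
have mf l : measurable_fun setT (fun w => (f (v l w))%:E).
  by apply/measurable_EFinP; exact: msr_measurable_fun sM (LG_msr (LG_fv l)).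
have mfX : measurable_fun setT (fun w => (f (X ^~ w))%:E).
  by apply/measurable_EFinP; exact: msr_measurable_fun sM msr_fX.
have [] := @dominated_convergence _ _ _ P setT measurableT (fun i w => (f (v (L i) w))%:E)
  (fun w => (f (X ^~ w))%:E) g (fun i => mf (L i)) mfX _ ig _.
- by apply: filterS cL => w h _; apply: cvg_EFin => //; exact: nearW.
- by apply: nearW => w i _; exact: fg.
move=> iX _ cI; pose e := fine (\int[P]_w (f (X ^~ w))%:E)%E.
have fin : (\int[P]_w (f (X ^~ w))%:E)%E \is a fin_num by exact: integrable_fin_num.
have {}cI : Ex P (fun w => f (v (L i) w)) @[i --> \oo] --> e.
  by apply: fine_cvg; rewrite fineK.
(* 64 = 8^2, with the constant 8 of [sum_level_rate]. *)
exists e, (64 * b ^+ 2); split; [by rewrite mulr_ge0 ?sqr_ge0|by rewrite fineK|move=> n].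
have key : `|e - Ex P (fun w => f (v n w))| <= b * (8 * level_rate R n).
  have {}cI : `|Ex P (fun w => f (v (L i) w)) - Ex P (fun w => f (v n w))| @[i --> \oo] -->
      `|e - Ex P (fun w => f (v n w))|.
    by apply: cvg_norm; apply: cvgB => //; exact: cvg_cst.
  rewrite -(cvg_lim (@Rhausdorff R) cI); apply: limr_le; first exact: cvgP cI.
  exists n => // i /= ni; have nL : (n <= L i)%N := leq_trans ni (Li i).
  rewrite -(subnKC nL) -(ExB sM (LG_fv _) (LG_fv n)).
  have hB : LG P measurable (fun w => f (v (n + (L i - n)) w) - f (v n w)) by exact: (LGB sM).
  have hS : LG P measurable (fun w => \sum_(n <= j < n + (L i - n)) `|df j w|) by exact: (LG_sum sM).
  apply: (@le_trans _ _ (Ex P (fun w => `|f (v (n + (L i - n)) w) - f (v n w)|))).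
    rewrite ler_norml -mulN1r -(ExZ sM _ (LG_norm hB)); apply/andP; split; apply: (Ex_le sM) => //.
    - by apply: (LGZ sM); exact: LG_norm.
    - by move=> w; rewrite mulN1r lerNl; apply: le_trans (ler_norm _) _; rewrite normrN.
    - exact: LG_norm.
    - by move=> w; exact: ler_norm.
  apply: (@le_trans _ _ (Ex P (fun w => \sum_(n <= j < n + (L i - n)) `|df j w|))).
    by apply: (Ex_le sM) => //; exact: LG_norm.
  rewrite (Ex_sum sM) => [|j _]; last exact: hD.
  apply: (@le_trans _ _ (b * \sum_(n <= j < n + (L i - n)) level_rate R j)).
    by rewrite mulr_sumr; apply: ler_sum.
  by rewrite ler_wpM2l// sum_level_rate.
rewrite -real_normK ?num_real//; apply: (@le_trans _ _ ((b * (8 * level_rate R n)) ^+ 2)).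
  by rewrite lerXn2r ?nnegrE ?mulr_ge0 ?level_rate_ge0.
rewrite !exprMn sqr_level_rate mulrA -[8 ^+ 2](_ : 64 = _); last by ring.
rewrite [_ ^+ 2 * 64]mulrC ler_wpM2l ?mulr_ge0 ?sqr_ge0//.
rewrite /leta' /= -mul2n natrM natrX invfM mulrA ler_pM2r ?invr_gt0 ?exprn_gt0//.
by rewrite ler_pdivrMr// -natrM ler_nat muln2 -addnn addSn ltnS leq_addl.
Qed.

End Solution.

(** * From the hypotheses on families to sequences of copies *)

Lemma independent_sequence (R : realType) disp (Omega : measurableType disp)
    (P : probability Omega R) (I : choiceType) (J : set I) (G : I -> set (set Omega))
    (h : nat -> I) (g : I -> nat) : cancel h g -> (forall j, J (h j)) ->
  independent_family P J G -> forall n A, (forall j, G (h j) (A j)) ->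
  P (\bigcap_(j in `I_n) A j) = (\prod_(j < n) P (A j))%E.
Proof.
move=> hK hJ ind n A hA; pose s := [seq h j | j <- iota 0 n].
have sP i : i \in seq_fset tt s -> exists2 j, (j < n)%N & i = h j.
  by rewrite seq_fsetE => /mapP[j]; rewrite mem_iota => jn ->; exists j.
transitivity (P (\bigcap_(i in [set` seq_fset tt s]) (A \o g) i)).
  congr (P _); apply/seteqP; split => w hw i /=.
    by move=> /sP[j jn ->]; rewrite /= hK; exact: hw.
  move=> ni; rewrite -(hK i); apply: (hw (h i)).
  suff : h i \in seq_fset tt s by [].
  by rewrite seq_fsetE; apply/mapP; exists i; rewrite ?mem_iota.
rewrite ind => [|i /= /sP[j _ ->] //|i /sP[j _ ->]]; last by rewrite /= hK.
rewrite (perm_big _ (seq_fset_perm tt s)) undup_id; last first.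
  by rewrite map_inj_uniq ?iota_uniq//; exact: can_inj hK.
rewrite big_map (_ : iota 0 n = index_iota 0 n) ?big_mkord; last by rewrite /index_iota subn0.
by apply: eq_bigr => j _; rewrite /= hK.
Qed.

Section IdenticalMoments.
Context (R : realType) (disp : measure_display) (Omega : measurableType disp)
  (P : probability Omega R).
Variables (d : nat) (x0 : Omega -> 'cV[R]_d).
Hypotheses (m0 : borel_measurable measurable x0)
  (p0 : forall p : R, 1 <= p -> ('E_P[fun w => (enorm (x0 w) `^ p)%R] < +oo)%E).
Let sM := @subalg_measurable disp Omega.

Let entries (G : set (set Omega)) (x : Omega -> 'cV[R]_d) : subalg G -> borel_measurable G x ->
  msr G (fun w => enorm (x w)).
Proof. by move=> sG mx; apply: (msr_enorm sG); apply/borel_measurable_entries => //; case: sG. Qed.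

Let integrable0 n : P.-integrable setT (EFin \o (fun w => `|enorm (x0 w)| ^+ n)).
Proof.
have me n' : measurable_fun setT (fun w => (`|enorm (x0 w)| ^+ n')%:E).
  apply/measurable_EFinP; apply: measurable_funX; apply: measurableT_comp => //.
  exact: msr_measurable_fun sM (entries sM m0).
case: n => [|n]; first exact: (LG_integrable sM (LG_cst P measurable 1)).
apply/integrableP; split; first exact: me.
have := p0 (_ : 1 <= n.+1%:R); rewrite unlock ler1n => /(_ isT); apply: le_lt_trans.
apply: ge0_le_integral => //; first by apply: measurableT_comp => //; exact: me.
  have := me n.+1; congr (measurable_fun _ _); apply/funext => w.
  by rewrite powR_mulrn// ger0_norm.
by move=> w _; rewrite /= normrX normr_id powR_mulrn// ger0_norm.
Qed.

Variables (G : set (set Omega)) (x : Omega -> 'cV[R]_d).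
Hypotheses (sG : subalg G) (mx : borel_measurable G x)
  (lx : forall B, borel_sets B -> P (x @^-1` B) = P (x0 @^-1` B)).

(** Moments are given for one initial value only; equality of laws on Borel sets transports
    integrability along with the expectations. *)
Let law n : Ex P (fun w => `|enorm (x0 w)| ^+ n) = Ex P (fun w => `|enorm (x w)| ^+ n) /\
  P.-integrable setT (EFin \o (fun w => `|enorm (x w)| ^+ n)).
Proof.
have sB : sigma_algebra setT (@borel_sets 'cV[R]_d) by exact: smallest_sigma_algebra.
have [] := @law_unique R disp Omega P 'cV[R]_d (@borel_sets 'cV[R]_d) x0 x _ _ _ _ _
  (fun y => `|enorm y| ^+ n) _.
- by have /sigma_algebraP[] := sB.
- by have /sigma_algebraP[] := sB.
- by move=> B hB; apply: m0; exists B.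
- by move=> B hB; apply: (proj2 sG); apply: mx; exists B.
- by move=> B hB; rewrite lx.
- apply: (msr_cont (Y := id) (g := fun y : 'cV[R]_d => `|enorm y| ^+ n)) => // [y|].
    apply: (@continuous_comp _ _ _ (fun y : 'cV[R]_d => `|enorm y|) (fun z => z ^+ n)); last exact: exprn_continuous.
    by apply: (@continuous_comp _ _ _ (@enorm R d 1) Num.norm); [exact: enorm_continuous|exact: norm_continuous].
  by apply/borel_measurable_entries => // _ [B hB <-].
- by move=> E hI; split => //; apply: hI; exact: integrable0.
Qed.

Lemma identical_VLG : VLG P G x.
Proof.
apply: (VLG_dom (f := fun w => enorm (x w)) sG) => // [i j|].
  by move: i j; apply/borel_measurable_entries => //; case: sG.
by split => [|n]; [exact: entries|have [] := law n].
Qed.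

Lemma identical_moment r : Ex P (fun w => enorm (x w) ^+ (2 * r)) = Ex P (fun w => enorm (x0 w) ^+ (2 * r)).
Proof.
have absE y : Ex P (fun w => enorm (y w) ^+ (2 * r)) = Ex P (fun w => `|enorm (y w : 'cV[R]_d)| ^+ (2 * r)).
  by apply: eq_Ex => w; rewrite ger0_norm.
by rewrite !absE; have [->] := law (2 * r).
Qed.

End IdenticalMoments.

(** * From even moments to L^p and pathwise rates *)

Section Rates.
Context (R : realType) (disp : measure_display) (Omega : measurableType disp)
  (P : probability Omega R).
Variable Z : nat -> Omega -> R.
Hypotheses (hZ : forall n, LG P measurable (Z n)) (mom : forall q, exists2 C, 0 <= C & forall n,
    Ex P (fun w => Z n w ^+ (2 * q.+1)) <= C * (n.+1%:R ^+ 3 / 2 ^+ n) ^+ q.+1).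
Let sM := @subalg_measurable disp Omega.
Let mZ n : measurable_fun setT (Z n) := msr_measurable_fun sM (LG_msr (hZ n)).

Let rate n : R := (1 + n%:R) `^ (3 / 2) / Num.sqrt (2 ^ n)%:R.

Let rate_gt0 n : 0 < rate n.
Proof. by rewrite divr_gt0 ?powR_gt0 ?sqrtr_gt0 ?ltr0n ?expn_gt0// ltr_wpDr. Qed.

Let sqr_rate n : rate n ^+ 2 = n.+1%:R ^+ 3 / 2 ^+ n.
Proof.
rewrite expr_div_n sqr_sqrtr// natrX; congr (_ / _).
by rewrite -powR_mulrn ?powR_ge0// -powRrM divfK// nat1r powR_mulrn.
Qed.

(** For z = |Z|/rate and q = truncn p one has z^p <= 1 + z^(2(q+1)), so real exponents follow from
    even ones. The root of order p may be dropped from 1 + C, which is at least 1, since 1/p <=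
    1. *)
Lemma moment_rate : exists C : R -> R, (forall p, 1 <= p -> 0 <= C p) /\
  forall n p, 1 <= p -> ((\int[P]_w (`|(Z n w)%:E| `^ p)) `^ p^-1 <=
    (C p * ((1 + n%:R) `^ (3 / 2) / Num.sqrt (2 ^ n)%:R))%:E)%E.
Proof.
have /choice[C HC] : forall q : nat, exists C : R, 0 <= C /\ forall n,
    Ex P (fun w => Z n w ^+ (2 * q.+1)) <= C * (rate n ^+ (2 * q.+1)).
  move=> q; have [C C0 H] := mom q; exists C; split => // n.
  by rewrite exprM sqr_rate.
have C1 q : 1 <= 1 + C q by rewrite lerDl; have [] := HC q.
exists (fun p => 1 + C (Num.truncn p)); split=> [p _|n p p1]; first exact: le_trans (C1 _).
have p0 : 0 < p by exact: lt_le_trans p1.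
rewrite -/(rate n); set q := Num.truncn p; set s := rate n; have s0 : 0 < s := rate_gt0 n.
have pq : p <= (2 * q.+1)%:R.
  by apply/ltW/(lt_le_trans (truncnS_gt p)); rewrite ler_nat leq_pmull.
have sq0 : 0 < s ^+ (2 * q.+1) by exact: exprn_gt0.
pose b w := s `^ p * (1 + (s ^+ (2 * q.+1))^-1 * Z n w ^+ (2 * q.+1)).
have hb : LG P measurable b.
  apply: (LGZ sM); apply: (LGD sM); first exact: LG_cst.
  by apply: (LGZ sM); exact: LG_pow.
have Zb w : `|Z n w| `^ p <= b w.
  rewrite -{1}(divfK (lt0r_neq0 s0) `|Z n w|) mulrC powRM ?divr_ge0 ?(ltW s0)// ler_wpM2l ?powR_ge0//.
  rewrite (even_pow_norm (Z n w)) [_^-1 * _]mulrC -expr_div_n; set x := `|Z n w| / s.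
  have x0 : 0 <= x by rewrite divr_ge0// ltW.
  have [x1|x1] := leP x 1.
    apply: (@le_trans _ _ 1); last by rewrite lerDl exprn_ge0.
    have : x `^ p <= 1 `^ p by rewrite ge0_ler_powR ?nnegrE// ltW.
    by rewrite powR1.
  by apply: le_trans (ler_powR (ltW x1) pq) _; rewrite powR_mulrn// lerDr.
have Ib : (\int[P]_w (`|(Z n w)%:E| `^ p) <= (s `^ p * (1 + C q))%:E)%E.
  apply: (@le_trans _ _ (\int[P]_w (b w)%:E)%E).
    apply: ge0_le_integral => //.
    - by move=> w _; exact: poweR_ge0.
    - have m : measurable_fun setT (fun w => `|Z n w| `^ p).
        apply: (@measurableT_comp _ _ _ _ R R (fun x => x `^ p)); first exact: measurable_powR.
        exact: measurableT_comp (mZ n).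
      exact/measurable_EFinP.
    - by apply/measurable_EFinP; exact: msr_measurable_fun sM (LG_msr hb).
    - by move=> w _; rewrite lee_fin.
  rewrite (Ex_EFin sM hb) lee_fin /b (ExZ sM); last first.
    by apply: (LGD sM); [exact: LG_cst|apply: (LGZ sM); exact: LG_pow].
  rewrite ler_wpM2l ?powR_ge0// (ExD sM); [|exact: LG_cst|by apply: (LGZ sM); exact: LG_pow].
  rewrite (Ex_cst P 1) lerD2l (ExZ sM); last exact: LG_pow.
  by rewrite ler_pdivrMl// mulrC; have [_] := HC q.
have I0 : (0 <= \int[P]_w (`|(Z n w)%:E| `^ p))%E by apply: integral_ge0 => w _; exact: poweR_ge0.
have := @gt0_ler_poweR R p^-1 _ _ _ _ _ Ib.
rewrite invr_ge0 (ltW p0) !in_itv /= !leey !andbT I0.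
have sC : 0 <= s `^ p * (1 + C q) by rewrite mulr_ge0 ?powR_ge0// (le_trans _ (C1 q)).
rewrite lee_fin sC => /(_ isT isT isT) /le_trans; apply.
rewrite lee_fin powRM ?powR_ge0//; last exact: le_trans (C1 q).
rewrite -powRrM mulfV ?gt_eqF// powRr1 ?(ltW s0)// mulrC ler_wpM2r ?(ltW s0)//.
rewrite -[leRHS]powRr1; last exact: le_trans (C1 q).
by apply: ler_powR => //; rewrite invf_le1.
Qed.

(** A series rather than a supremum: it dominates each of its terms, and its expectation is computed
    term by term. *)
Let S eps w : \bar R := (\sum_(n <oo) ((2 ^ n)%:R `^ (2^-1 - eps) * `|Z n w|)%:E)%E.

Let S_term_ge0 eps n w : (0 <= ((2 ^ n)%:R `^ (2^-1 - eps) * `|Z n w|)%:E)%E.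
Proof. by rewrite lee_fin mulr_ge0// powR_ge0. Qed.

Let m_term eps n : measurable_fun setT (fun w => ((2 ^ n)%:R `^ (2^-1 - eps) * `|Z n w|)%:E).
Proof. by apply/measurable_EFinP; apply: measurable_funM => //; exact: measurableT_comp (mZ n). Qed.

Let mS eps : measurable_fun setT (S eps).
Proof. by apply: ge0_emeasurable_sum. Qed.

Let S_fin eps : 0 < eps -> \forall w \ae P, S eps w \is a fin_num.
Proof.
move=> eps0; suff : P.-integrable setT (S eps).
  by move=> /(integrable_ae measurableT); apply: filterS => w; apply.
have [C C0 HC] := mom 0; pose B := Num.sqrt C.
have EZ n : Ex P (fun w => `|Z n w|) <= B * rate n.
  apply: Ex_norm_le => //; first by rewrite mulr_ge0 ?sqrtr_ge0// ltW.
  by rewrite exprMn sqr_sqrtr// sqr_rate; exact: HC.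
(* Powers of n cost an arbitrarily small geometric factor: n + 1 <= (1 + del)^n / del. The choice
   del = (1 - rho)/3 keeps the ratio (1 + del)^2 rho below 1. *)
pose rho : R := 2 `^ (- eps); pose del := (1 - rho) / 3.
have rho0 : 0 < rho by rewrite powR_gt0.
have rho1 : rho < 1.
  rewrite /rho powRN invf_lt1 ?powR_gt0// -[ltLHS](powRr0 2) /powR !gt_eqF// ltr_expR mul0r.
  by rewrite mulr_gt0// ln_gt0// ltr1n.
have d0 : 0 < del by rewrite divr_gt0// subr_gt0.
have d1 : del <= 1 by rewrite ler_pdivrMr//; lra.
pose r := (1 + del) ^+ 2 * rho.
have r1 : `|r| < 1.
  rewrite ger0_norm; last by apply: mulr_ge0; [exact: sqr_ge0|exact: ltW].
  have -> : r = 1 - del * (1 + 5 * del + 3 * del ^+ 2) by rewrite /r /del; field.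
  by rewrite ltrBlDr ltrDl mulr_gt0// !addr_gt0// mulr_gt0// exprn_gt0.
have term n : (2 ^ n)%:R `^ (2^-1 - eps) * (B * rate n) <= geometric (B / del ^+ 2) r n.
  clearbody del; have N0 : 0 < (2 ^ n)%:R :> R by rewrite ltr0n expn_gt0.
  have n1 : (n.+1%:R : R) <= (1 + del) ^+ n / del.
    have := @bernoulli R 1 del n ler01 (addr_ge0 ler01 (ltW d0)).
    rewrite !expr1n mulr1 ler_pdivlMr// => h; apply: le_trans h.
    by rewrite -natr1 mulrDl mul1r addrC lerD2r.
  have rn : rate n <= n.+1%:R ^+ 2 / Num.sqrt (2 ^ n)%:R.
    rewrite /rate ler_pM2r ?invr_gt0 ?sqrtr_gt0// nat1r -powR_mulrn//.
    by apply: ler_powR; rewrite ?ler1n//; lra.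
  have pw : (2 ^ n)%:R `^ (2^-1 - eps) = Num.sqrt (2 ^ n)%:R * rho ^+ n :> R.
    rewrite powRD; last by rewrite (gt_eqF N0) implybT.
    rewrite powR12_sqrt//; congr (_ * _).
    by rewrite natrX -powR_mulrn// powRAC powR_mulrn// powR_ge0.
  have sN : 0 < Num.sqrt (2 ^ n)%:R :> R by rewrite sqrtr_gt0.
  rewrite pw /geometric /= /r [(_ * rho) ^+ n]exprMn.
  rewrite (_ : _ * (B * _) = B * rho ^+ n * (Num.sqrt (2 ^ n)%:R * rate n)); last by ring.
  rewrite (_ : B / _ * _ = B * rho ^+ n * (((1 + del) ^+ 2) ^+ n / del ^+ 2)); last by ring.
  rewrite ler_wpM2l ?mulr_ge0 ?sqrtr_ge0 ?exprn_ge0 ?(ltW rho0)//.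
  apply: (@le_trans _ _ (n.+1%:R ^+ 2)); first by rewrite mulrC -ler_pdivlMr.
  rewrite exprAC -expr_div_n lerXn2r ?nnegrE//.
  by rewrite divr_ge0 ?exprn_ge0 ?addr_ge0 ?(ltW d0).
apply/integrableP; split; first exact: mS.
under eq_integral do rewrite gee0_abs ?nneseries_ge0//.
rewrite integral_nneseries//.
apply: (@le_lt_trans _ _ (\sum_(n <oo) (geometric (B / del ^+ 2) r n)%:E)%E).
  apply: lee_nneseries => [|n _]; first by move=> *; exact: integral_ge0.
  have h : LG P measurable (fun w => (2 ^ n)%:R `^ (2^-1 - eps) * `|Z n w|).
    by apply: (LGZ sM); exact: LG_norm.
  rewrite (Ex_EFin sM h) lee_fin (ExZ sM); last exact: LG_norm.
  by apply: le_trans (term n); rewrite ler_wpM2l ?powR_ge0.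
have cg : (\sum_(0 <= i < n) (geometric (B / del ^+ 2) r i)%:E @[n --> \oo] -->
    (B / del ^+ 2 * (1 - r)^-1)%:E)%E.
  apply: cvg_EFin; first by apply: nearW => n; rewrite sumEFin.
  rewrite (_ : fine \o _ = series (geometric (B / del ^+ 2) r)); first exact: cvg_geometric_series.
  by apply/funext => n /=; rewrite sumEFin.
by rewrite (cvg_lim _ cg)// ltry.
Qed.

(** Uncountably many eps share one null set: finiteness is required only for eps = 1/(k+1), and S
    decreases as eps grows. *)
Lemma pathwise_rate : exists Ct : R -> Omega -> R,
  (forall eps, measurable_fun setT (Ct eps) /\ forall w, 0 <= Ct eps w) /\
  \forall w \ae P, forall n eps, 0 < eps < 2^-1 ->
    `|Z n w| <= Ct eps w / (2 ^ n)%:R `^ (2^-1 - eps).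
Proof.
exists (fun eps w => fine (S eps w)); split=> [eps|].
  split=> [|w]; first exact: measurableT_comp (mS eps).
  by apply: fine_ge0; apply: nneseries_ge0.
have H (k : nat) : \forall w \ae P, S k.+1%:R^-1 w \is a fin_num by apply: S_fin; rewrite invr_gt0.
apply: filterS (ae_foralln H) => w fin n eps /andP[eps0 _].
pose k := Num.truncn eps^-1.
have keps : k.+1%:R^-1 <= eps.
  by rewrite invf_ple ?posrE//; exact/ltW/truncnS_gt.
have N1 i : 1 <= (2 ^ i)%:R :> R by rewrite ler1n expn_gt0.
have fe : S eps w \is a fin_num.
  rewrite ge0_fin_numE ?nneseries_ge0//; apply: (@le_lt_trans _ _ (S k.+1%:R^-1 w)).
    apply: lee_nneseries => // i _; rewrite lee_fin ler_wpM2r//.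
    by apply: ler_powR => //; rewrite lerD2l lerN2.
  by have := fin k; rewrite ge0_fin_numE// nneseries_ge0.
rewrite ler_pdivlMr ?powR_gt0 ?(lt_le_trans _ (N1 n))// mulrC -lee_fin fineK//.
apply: le_trans (nneseries_lim_ge n.+1 _) => //.
by rewrite big_nat_recr //= leeDr// sume_ge0.
Qed.

End Rates.

Theorem proposition6p2 (R : realType) (T : R) (disp : measure_display)
  (Omega : measurableType disp) (P : probability Omega R)
  (F : R -> set (set Omega)) (d m : nat)
  (W : nat -> nat -> R -> Omega -> 'cV[R]_m)
  (xi : nat -> nat -> Omega -> 'cV[R]_d)
  (mu : 'cV[R]_d -> 'cV[R]_d) (sigma : 'cV[R]_d -> 'M[R]_(d, m))
  (X : R -> Omega -> 'cV[R]_d)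
  (c : R) (f : (R -> 'cV[R]_d) -> R) :
  0 < T -> (0 < d)%N -> (0 < m)%N ->
  normal_filtration P T F ->
  (* the Brownian motions, l >= 0, k >= 1 *)
  (forall l k, (0 < k)%N -> standard_brownian P T F (W l k)) ->
  independent_family P [set lk : nat * nat | (0 < lk.2)%N]
    (fun lk => process_sigma T (W lk.1 lk.2)) ->
  (* the initial values, l >= 0, k >= 1 *)
  (forall l k, (0 < k)%N -> borel_measurable (F 0) (xi l k)) ->
  independent_family P [set lk : nat * nat | (0 < lk.2)%N]
    (fun lk => preimage_sigma (xi lk.1 lk.2)) ->
  (forall l k, (0 < k)%N -> forall B, borel_sets B ->
    P (xi l k @^-1` B) = P (xi 0%N 1%N @^-1` B)) ->
  (forall p : R, 1 <= p ->
    ('E_P[fun w => (enorm (xi 0%N 1%N w) `^ p)%R] < +oo)%E) ->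
  (* the coefficients *)
  cont_differentiable mu ->
  (exists2 c0 : R, 0 <= c0 & forall x y,
    [/\ dotp (x - y) (mu x - mu y) <= c0 * enorm (x - y) ^+ 2,
        opnorm ('d mu x) <= c0 * (1 + enorm x `^ c0)
      & opnorm (fun v => (sigma x - sigma y) *m v) <= c0 * enorm (x - y)]) ->
  (* the solution process *)
  sde_solution P T F mu sigma (xi 0%N 1%N) (W 0%N 1%N) X ->
  (* the functional *)
  0 <= c ->
  (forall v w : R -> 'cV[R]_d,
    {within `[0, T], continuous v} -> {within `[0, T], continuous w} ->
    `|f v - f w| <=
      c * (1 + supnorm T v `^ c + supnorm T w `^ c)
        * supnorm T (fun t => v t - w t)) ->
  let Ybar (N l k : nat) (w : Omega) : R -> 'cV[R]_d :=
    tamed_interp T mu sigma N (xi l k w) (fun t => W l k t w) in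
  let error (N : nat) (w : Omega) : \bar R :=
    ('E_P[fun w' => f (X ^~ w')] - (mlmc f Ybar N w)%:E)%E in
  (exists C : R -> R,
    (forall p, 1 <= p -> 0 <= C p) /\
    (forall (N : nat) (p : R),
      (exists2 n, (0 < n)%N & N = (2 ^ n)%N) -> 1 <= p ->
      ((\int[P]_w (`|error N w| `^ p)) `^ p^-1 <=
       (C p * ((1 + (trunc_log 2 N)%:R) `^ (3 / 2) / Num.sqrt N%:R))%:E)%E))
  /\
  (exists Ct : R -> Omega -> R,
    (forall eps, 0 < eps < 2^-1 ->
      measurable_fun setT (Ct eps) /\ forall w, 0 <= Ct eps w) /\
    \forall w \ae P, forall (N : nat) (eps : R),
      (exists2 n, (0 < n)%N & N = (2 ^ n)%N) -> 0 < eps < 2^-1 ->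
      (`|error N w| <= (Ct eps w / N%:R `^ (2^-1 - eps))%:E)%E).

Proof.
move=> T0 d0 m0 nF bW iW bxi ixi lxi pxi cmu' [c0' c00 hc] hX c0 hf Ybar error.
have hF : filtration T F by case: nF => sF mF _ _; split => // t tT; exact: sF.
have [K [k [K0 hmu hsig gmu gsig]]] := coefficient_bounds cmu' c00 hc.
have cmu : continuous mu by case: cmu' => dmu _ x; exact: differentiable_continuous.
have sF0 : subalg (F 0) by have [sF _] := hF; apply: sF; rewrite lexx ltW.
(* Copies are numbered from 1 in the statement and from 0 in the lemmas. *)
pose V l j := W l j.+1; pose x l j := xi l j.+1.
have bV l j : standard_brownian P T F (V l j) by exact: bW.
have m1 : borel_measurable measurable (xi 0%N 1%N).
  by move=> A /(bxi 0%N 1%N isT); have [_] := sF0; apply.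
have lx l j B : borel_sets B -> P (x l j @^-1` B) = P (xi 0%N 1%N @^-1` B) by exact: lxi.
have hx l j : VLG P (F 0) (x l j).
  exact: (identical_VLG m1 pxi sF0 (bxi l j.+1 isT) (lx l j)).
pose Cx r := Ex P (fun w => enorm (xi 0%N 1%N w) ^+ (2 * r)).
have Cx0 r : 0 <= Cx r by apply: Ex_ge0 => w; rewrite exprn_ge0.
have mx l j r : Ex P (fun w => enorm (x l j w) ^+ (2 * r)) <= Cx r.
  by rewrite (identical_moment m1 pxi sF0 (bxi l j.+1 isT) (lx l j)).
have succK l : cancel (fun j => (l, j.+1)) (fun i : nat * nat => i.2.-1) by [].
have prodV l := independent_sequence (succK l) (fun j => ltn0Sn j) iW.
have prodx l := independent_sequence (succK l) (fun j => ltn0Sn j) ixi.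
have [e [b [b0 Ee bias]]] := bias_bound T0 hF (bV 0%N 0%N) K0 hsig hX cmu hmu gmu gsig
  (hx 0%N 0%N) Cx0 (mx 0%N 0%N) c0 hf.
have mom := estimate_moment T0 hF K0 hmu hsig gmu gsig c0 hf bV hx Cx0 mx lx prodV prodx b0 bias.
pose Z n w := e - estimate T mu sigma f V x n w.
have hZ n : LG P measurable (Z n).
  apply: (LGB (@subalg_measurable disp Omega)); first exact: LG_cst.
  exact: (LG_estimate T0 hF K0 hmu hsig gmu gsig c0 hf bV hx Cx0 mx).
have errorE n w : error (2 ^ n)%N w = (Z n w)%:E.
  rewrite /error unlock Ee -EFinB; congr (_ - _)%:E.
  rewrite /mlmc /estimate /base_avg /level_avg /value /level_diff trunc_expnK//; congr (_ + _).
    by rewrite big_add1 /= big_mkord; congr (_ * _).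
  (* Level l + 1 of [mlmc] is index l of [estimate]; its weight 2^(l+1)/2^n is the inverse of the
     number 2^(n-l-1) of copies. *)
  rewrite big_add1 /= big_mkord; apply: eq_bigr => l _; have ln := ltn_ord l.
  rewrite -expnB// big_add1 /= big_mkord; congr (_ * _).
    have -> : (2 ^ n)%:R = (2 ^ (n - l.+1))%:R * 2 ^+ l.+1 :> R.
      by rewrite -natrX -natrM -expnD subnK.
    by rewrite invfM mulrCA mulfV ?mulr1// expf_neq0.
  by apply: eq_bigr => j _; rewrite !tamed_interpE /= -mul2n -expnS.
have [C [C0 HC]] := moment_rate hZ mom; have [Ct [Ct0 HCt]] := pathwise_rate hZ mom.
split; [exists C|exists Ct]; split => //.
  by move=> N p [n _ ->] p1; under eq_integral do rewrite errorE; rewrite trunc_expnK//; exact: HC.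
by apply: filterS HCt => w hw N eps [n _ ->] he; rewrite errorE lee_fin; exact: hw.
Qed.
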